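(* Let $\mathfrak g$ be a quasi-reductive Lie superalgebra with an $\mathfrak{sl}(2)$-triple $\langle e,h,f\rangle\subseteq\mathfrak g_{\bar0}$, $e$ principal nilpotent in $\mathfrak g_{\bar0}$, such that the $\mathrm{ad}\,h$-grading is even, $\mathfrak g=\bigoplus_{k\in2\mathbb Z}\mathfrak g(k)$. Let $\mathfrak m=\bigoplus_{k\le-2}\mathfrak g(k)$, let $(\cdot|\cdot)_0$ be a non-degenerate invariant symmetric bilinear form on $\mathfrak g_{\bar0}$, and suppose the non-singular character $x\mapsto(x|e)_0$ of $\mathfrak m_{\bar0}$ extends to a character $\zeta$ of $\mathfrak m$. Let $0\le m'\le m$ and let $u_1,\dots,u_{m'}\in\mathfrak m_{\bar0}$, $u_{m'+1},\dots,u_m\in\mathfrak m_{\bar1}$, $x_1,\dots,x_{m'}\in\mathfrak g_{\bar0}$, $x_{m'+1},\dots,x_m\in\mathfrak g_{\bar1}$ be elements homogeneous with respect to both the $\mathbb Z_2$- and $\mathbb Z$-gradings, with $x_s\in\mathfrak g(-2+d_s)$, $d_s>0$, for all $1\le s\le m$. Suppose: (1) $\{u_i\mid1\le i\le m\}$ is a basis for $\mathfrak m$; (2) for every $i$, $[u_i,x_i]\in\mathfrak g(-2)\cap\mathfrak g_{\bar0}$ and $\zeta([u_i,x_i])=1$; (3) for all $i\ne j$, if $[u_i,x_j]\in\mathfrak g(-2)$ then $\zeta([u_i,x_j])=0$. Then for any finitely generated $\mathfrak g$-module $M$, any $v\in\mathrm{Wh}_\zeta(M)$ and $\mathbf a,\mathbf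 b\in X$: $$u^{\mathbf a}x^{\mathbf a}v=cv\ \text{ for some non-zero scalar }c,\qquad u^{\mathbf a}x^{\mathbf b}v=0\ \text{ when }\mathbf a>\mathbf b.$$ In addition, $\{x^{\mathbf a}1_\zeta\mid\mathbf a\in X\}$ forms a basis for $Q_\zeta$ as a free right $W_\zeta$-module, where $1_\zeta$ is the image of $1\in U(\mathfrak g)$ in $Q_\zeta$. In this case, the Whittaker functor $\mathrm{Wh}_\zeta(-)$ is an equivalence from $\mathfrak g\text{-Wmod}^\zeta$ to $W_\zeta\text{-Mod}$ with inverse $Q_\zeta\otimes_{W_\zeta}(-)$. The target category of $\mathcal N(\zeta)$ under $\mathrm{Wh}_\zeta(-)$ is $W_\zeta\text{-fdmod}$.
   Context: Everything is over $\mathbb C$ and $\mathfrak g$ is finite-dimensional. Quasi-reductive: $\mathfrak g_{\bar0}$ is a reductive Lie algebra and $\mathfrak g_{\bar1}$ is a semisimple $\mathrm{ad}\,\mathfrak g_{\bar0}$-module. $\mathfrak g(k)=\{x\mid[h,x]=kx\}$. A nilpotent $e\in\mathfrak g_{\bar 0}$ is principal if the kernel of $\mathrm{ad}\,e$ on $\mathfrak g_{\bar0}$ has minimal dimension. $I_\zeta$ is the left ideal of $U(\mathfrak g)$ generated by $x-\zeta(x)$, $x\in\mathfrak m$; $Q_\zeta=U(\mathfrak g)/I_\zeta$; $W_\zeta=\mathrm{End}_{U(\mathfrak g)}(Q_\zeta)^{\mathrm{op}}$. $\mathfrak g\text{-Wmod}^\zeta$ is the category of all $\mathfrak g$-modules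 on which $x-\zeta(x)$ acts locally nilpotently for all $x\in\mathfrak m$. $W_\zeta\text{-Mod}$ and $W_\zeta\text{-fdmod}$ are the categories of all, respectively finite-dimensional, $W_\zeta$-modules. $\mathrm{Wh}_\zeta(M)=\{v\in M\mid xv=\zeta(x)v\ \forall x\in\mathfrak m\}$. $\mathcal N(\zeta)$: $\mathfrak m_{\bar0}$ is the nilradical of the underlying even subalgebra of a Borel subalgebra $\mathfrak b=\mathfrak h+\mathfrak n$ of $\mathfrak g$, so $\mathfrak n_{\bar 0}=\mathfrak m_{\bar 0}$; $\mathcal N(\zeta)$ is the category of finitely generated $\mathfrak g$-modules locally finite over $Z(\mathfrak g_{\bar0})$ and $U(\mathfrak n)$ on which $x-\zeta(x)$ acts locally nilpotently for all $x\in\mathfrak m_{\bar0}$. $X=\mathbb Z_{\ge0}^{m'}\times\{0,1\}^{m-m'}$. For $\mathbf a=(a_1,\dots,a_m)\in X$: $|\mathbf a|=\sum_sa_s$, $\mathrm{wt}\,\mathbf a=\sum_sd_sa_s$, $x^{\mathbf a}=x_1^{a_1}\cdots x_m^{a_m}$, $u^{\mathbf a}=(u_1-\zeta(u_1))^{a_1}\cdots(u_{m'}-\zeta(u_{m'}))^{a_{m'}}u_{m'+1}^{a_{m'+1}}\cdots u_m^{a_m}$ (products in $U(\mathfrak g)$). The order $<$ is any linear ordering on $X$ such that $\mathbf a<\mathbf b$ whenever either $\mathrm{wt}\,\mathbf a<\mathrm{wt}\,\mathbf b$, or $\mathrm{wt}\,\mathbf a=\mathrm{wt}\,\mathbf b$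 and $|\mathbf a|>|\mathbf b|$. *)

(* Defs.v *)
From HB Require Import structures.
From mathcomp Require Import all_boot all_order all_algebra.
From mathcomp Require Import boolp reals complex.

Set Implicit Arguments.
Unset Strict Implicit.
Unset Printing Implicit Defensive.

Import Order.TTheory GRing.Theory Num.Theory.
Local Open Scope ring_scope.

Section SpanOf.
Variables (F : fieldType) (V : vectType F).

Definition is_span (S : V -> Prop) (W : {vspace V}) : Prop :=
  (forall x, S x -> x \in W) /\
  (forall W' : {vspace V}, (forall x, S x -> x \in W') -> (W <= W')%VS).

Lemma is_span_ex (S : V -> Prop) : exists W, is_span S W.
Proof.
pose P n := `[< exists2 s : seq V, (forall x, x \in s -> S x) & \dim <<s>>%VS = n >].
have exP : exists n, P n.
  by exists 0%N; apply/asboolP; exists [::] => //; rewrite span_nil dimv0.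
have ubP n : P n -> (n <= \dim (fullv : {vspace V}))%N.
  by case/asboolP=> s _ <-; apply/dimvS/subvf.
case: (ex_maxnP exP ubP) => n /asboolP[s sS <-] maxs.
exists <<s>>%VS; split=> [x Sx|W' sW']; last first.
  by apply/span_subvP => x /sS /sW'.
have /maxs : P (\dim <<x :: s>>%VS).
  by apply/asboolP; exists (x :: s) => // y; rewrite inE => /predU1P[->|/sS].
have sub : (<<s>> <= <<x :: s>>)%VS by rewrite span_cons addvSr.
move=> dle; have /eqP -> : <<s>>%VS == <<x :: s>>%VS by rewrite eqEdim sub.
by rewrite memv_span ?mem_head.
Qed.

Definition spanof (S : V -> Prop) : {vspace V} := projT1 (cid (is_span_ex S)).

Lemma spanofP S : is_span S (spanof S).
Proof. exact: projT2 (cid (is_span_ex S)). Qed.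

End SpanOf.

(* [lpart false] is the even part and [lpart true] the odd part; [Koszul i j]
   is the sign (-1)^(ij). The axioms are those used in characteristic 0. *)
Definition Koszul {R : pzRingType} (i j : bool) : R := (-1) ^+ (i && j).

Structure lieSuper (F : fieldType) := LieSuper {
  lie_vect :> vectType F;
  lbr : lie_vect -> lie_vect -> lie_vect;
  lpart : bool -> {vspace lie_vect};
  lbr_linearr : forall x, linear (lbr x);
  lbr_linearl : forall y, linear (lbr^~ y);
  lpart_full : (lpart false + lpart true)%VS = fullv;
  lpart_direct : (lpart false :&: lpart true)%VS = 0%VS;
  lbr_part : forall i j x y,
    x \in lpart i -> y \in lpart j -> lbr x y \in lpart (i (+) j);
  lbr_skew : forall i j x y, x \in lpart i -> y \in lpart j ->
    lbr x y = - (Koszul i j *: lbr y x);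
  lbr_jacobi : forall i j x y z, x \in lpart i -> y \in lpart j ->
    lbr x (lbr y z) = lbr (lbr x y) z + Koszul i j *: lbr y (lbr x z)
}.

Notation "[ 'lie' x , y ]" := (lbr x y)
  (at level 0, x, y at level 99, format "[ 'lie'  x ,  y ]").

Notation even_part g := (@lpart _ g false).
Notation odd_part g := (@lpart _ g true).

HB.instance Definition _ (F : fieldType) (g : lieSuper F) (x : g) :=
  GRing.isLinear.Build F g g *:%R (@lbr F g x) (lbr_linearr x).

Section LieNotions.
Variables (F : fieldType) (g : lieSuper F).
Implicit Types (A B W : {vspace g}) (x y h : g).

Definition ad x : 'End(g) := linfun (lbr x).

Definition grade h (k : int) : {vspace g} := lker (ad h - k%:~R *: \1%VF)%R.

Definition lbrv A B : {vspace g} :=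
  spanof (fun z => exists x y, [/\ x \in A, y \in B & z = [lie x, y]]).

Definition ad_stable A W : Prop :=
  forall x w, x \in A -> w \in W -> [lie x, w] \in W.

Definition ad_simple A W : Prop :=
  [/\ W != 0%VS, ad_stable A W &
      forall W', (W' <= W)%VS -> ad_stable A W' -> W' = 0%VS \/ W' = W].

Definition ad_semisimple A W : Prop :=
  exists n (S : 'I_n -> {vspace g}),
    [/\ forall i, ad_simple A (S i), directv (\sum_i S i) & (\sum_i S i)%VS = W].

(* A Lie algebra is reductive when its adjoint representation is semisimple. *)
Definition reductive_even : Prop := ad_semisimple (even_part g) (even_part g).

Definition quasi_reductive : Prop :=
  reductive_even /\ ad_semisimple (even_part g) (odd_part g).

Definition sl2_triple e h f : Prop :=
  [/\ e != 0, [lie h, e] = 2%:R *: e, [lie h, f] = - (2%:R *: f) &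
      [lie e, f] = h].

(* Nilpotent elements of a reductive Lie algebra lie in the derived algebra. *)
Definition nilpotent_even e : Prop :=
  e \in lbrv (even_part g) (even_part g) /\
  exists n, forall x, x \in even_part g -> iter n (lbr e) x = 0.

Definition principal_nilpotent e : Prop :=
  nilpotent_even e /\
  forall e', nilpotent_even e' ->
    (\dim (lker (ad e) :&: even_part g) <= \dim (lker (ad e') :&: even_part g))%N.

Definition even_grading h : Prop :=
  spanof (fun x => exists k : int, x \in grade h (2 * k)) = fullv.

Definition neg_part h : {vspace g} :=
  spanof (fun x => exists2 k : int, k <= -2 & x \in grade h k).

(* A form on the even part; values of [B] elsewhere are irrelevant. *)
Definition invariant_form (B : g -> g -> F) : Prop :=
  let g0 := even_part g in
  [/\ forall a x y z, x \in g0 -> y \in g0 -> z \in g0 ->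
        B (a *: x + y) z = a * B x z + B y z,
      {in g0 &, forall x y, B x y = B y x},
      forall x y z, x \in g0 -> y \in g0 -> z \in g0 ->
        B [lie x, y] z = B x [lie y, z] &
      forall x, x \in g0 -> (forall y, y \in g0 -> B x y = 0) -> x = 0].

(* A character of [A] is a homomorphism of Lie superalgebras from [A] to the
   purely even line, here extended linearly (and irrelevantly) to all of [g]. *)
Definition character A (zeta : {scalar g}) : Prop :=
  {in A & , forall x y, zeta [lie x, y] = 0} /\
  (forall x, x \in (A :&: odd_part g)%VS -> zeta x = 0).

Fixpoint lower_central A n : {vspace g} :=
  if n is n'.+1 then lbrv A (lower_central A n') else A.

Definition cartan_even A : Prop :=
  [/\ (A <= even_part g)%VS, ad_stable A A,
      exists n, lower_central A n = 0%VS &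
      forall x, x \in even_part g ->
        (forall y, y \in A -> [lie x, y] \in A) -> x \in A].

Definition weight_vector A (al : {scalar g}) x : Prop :=
  forall y, y \in A -> [lie y, x] = al y *: x.

End LieNotions.

(* Borel subalgebra b = h + n attached to a Cartan subalgebra [A] of the even
   part and to [H] in [A] on which no root has zero real part: [hh] is the
   centralizer of [A] and [n] the sum of the root spaces with Re al(H) > 0. *)
Definition is_borel (F : numClosedFieldType) (g : lieSuper F)
    (b hh n : {vspace g}) : Prop :=
  exists (A : {vspace g}) (H : g),
    [/\ cartan_even A, H \in A,
        (forall (al : {scalar g}) x, x != 0 -> weight_vector A al x ->
          (exists2 y, y \in A & al y != 0) -> 'Re (al H) != 0),
        hh = spanof (fun x => forall y, y \in A -> [lie y, x] = 0) &
        n = spanof (fun x => exists2 al : {scalar g},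
              weight_vector A al x & 0 < 'Re (al H))
        /\ b = (hh + n)%VS].

(* The unital associative algebra with generators the elements of [g] and
   relations: linearity, and x y - (-1)^(ij) y x = [x, y] for [x], [y]
   homogeneous of parities [i], [j]. *)
Section Enveloping.
Variables (F : fieldType) (g : lieSuper F).

Inductive uterm : Type :=
| UGen of g | UZero | UOne | UOpp of uterm | UAdd of uterm & uterm
| UMul of uterm & uterm | UScale of F & uterm.

Inductive ueq : uterm -> uterm -> Prop :=
| ueq_refl t : ueq t t
| ueq_sym s t : ueq s t -> ueq t s
| ueq_trans s t u : ueq s t -> ueq t u -> ueq s u
| ueq_opp s t : ueq s t -> ueq (UOpp s) (UOpp t)
| ueq_add s t s' t' : ueq s t -> ueq s' t' -> ueq (UAdd s s') (UAdd t t')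
| ueq_mul s t s' t' : ueq s t -> ueq s' t' -> ueq (UMul s s') (UMul t t')
| ueq_scale a s t : ueq s t -> ueq (UScale a s) (UScale a t)
| ueq_addA s t u : ueq (UAdd s (UAdd t u)) (UAdd (UAdd s t) u)
| ueq_addC s t : ueq (UAdd s t) (UAdd t s)
| ueq_add0 s : ueq (UAdd UZero s) s
| ueq_addN s : ueq (UAdd (UOpp s) s) UZero
| ueq_mulA s t u : ueq (UMul s (UMul t u)) (UMul (UMul s t) u)
| ueq_mul1l s : ueq (UMul UOne s) s
| ueq_mul1r s : ueq (UMul s UOne) s
| ueq_mulDl s t u : ueq (UMul (UAdd s t) u) (UAdd (UMul s u) (UMul t u))
| ueq_mulDr s t u : ueq (UMul s (UAdd t u)) (UAdd (UMul s t) (UMul s u))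
| ueq_scaleA a b s : ueq (UScale a (UScale b s)) (UScale (a * b) s)
| ueq_scale1 s : ueq (UScale 1 s) s
| ueq_scaleDr a s t : ueq (UScale a (UAdd s t)) (UAdd (UScale a s) (UScale a t))
| ueq_scaleDl a b s : ueq (UScale (a + b) s) (UAdd (UScale a s) (UScale b s))
| ueq_scaleAl a s t : ueq (UScale a (UMul s t)) (UMul (UScale a s) t)
| ueq_scaleAr a s t : ueq (UScale a (UMul s t)) (UMul s (UScale a t))
| ueq_lin a x y : ueq (UGen (a *: x + y)) (UAdd (UScale a (UGen x)) (UGen y))
| ueq_lie i j x y : x \in lpart g i -> y \in lpart g j ->
    ueq (UAdd (UMul (UGen x) (UGen y))
              (UOpp (UScale (Koszul i j) (UMul (UGen y) (UGen x)))))
        (UGen [lie x, y]).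

HB.instance Definition _ := gen_eqMixin uterm.
HB.instance Definition _ := gen_choiceMixin uterm.

Definition ueqb (s t : uterm) := `[< ueq s t >].

Lemma ueqb_equiv : equiv_class_of ueqb.
Proof.
split=> [t|s t|t s u]; first by apply/asboolP; exact: ueq_refl.
  by apply/asboolP/asboolP; exact: ueq_sym.
by move=> /asboolP st /asboolP tu; apply/asboolP; exact: ueq_trans tu.
Qed.
Canonical ueqb_equivRel := EquivRelPack ueqb_equiv.

Definition uea : Type := {eq_quot ueqb}%qT.
HB.instance Definition _ := Choice.on uea.

Definition ucl (t : uterm) : uea := (\pi_({eq_quot ueqb}) t)%qT.
Definition urep (u : uea) : uterm := repr (u : {eq_quot ueqb}%qT).

Lemma ureprK u : ucl (urep u) = u.
Proof. exact: reprK. Qed.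

Lemma uclP s t : ucl s = ucl t <-> ueq s t.
Proof.
split=> [/eqP|st]; last by apply/eqP; rewrite /ucl eqmodE; exact/asboolP.
by rewrite /ucl eqmodE => /asboolP.
Qed.

Lemma urepE t : ueq (urep (ucl t)) t.
Proof. by apply/uclP; rewrite ureprK. Qed.

Definition uzero := ucl UZero.
Definition uone := ucl UOne.
Definition uopp u := ucl (UOpp (urep u)).
Definition uadd u v := ucl (UAdd (urep u) (urep v)).
Definition umul u v := ucl (UMul (urep u) (urep v)).
Definition uscale a u := ucl (UScale a (urep u)).

Lemma uclN t : uopp (ucl t) = ucl (UOpp t).
Proof. by apply/uclP; apply: ueq_opp (urepE t). Qed.
Lemma uclD s t : uadd (ucl s) (ucl t) = ucl (UAdd s t).
Proof. by apply/uclP; apply: ueq_add; apply: urepE. Qed.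
Lemma uclM s t : umul (ucl s) (ucl t) = ucl (UMul s t).
Proof. by apply/uclP; apply: ueq_mul; apply: urepE. Qed.
Lemma uclZ a t : uscale a (ucl t) = ucl (UScale a t).
Proof. by apply/uclP; apply: ueq_scale (urepE t). Qed.

Let uE := (uclN, uclD, uclM, uclZ).
Local Ltac uax := 
  repeat (let u := fresh "u" in move=> u; try rewrite -(ureprK u));
  rewrite /uzero /uone ?uE; apply/uclP; by constructor.

Lemma uaddA : associative uadd. Proof. uax. Qed.
Lemma uaddC : commutative uadd. Proof. uax. Qed.
Lemma uadd0 : left_id uzero uadd. Proof. uax. Qed.
Lemma uaddN : left_inverse uzero uopp uadd. Proof. uax. Qed.
HB.instance Definition _ := GRing.isZmodule.Build uea uaddA uaddC uadd0 uaddN.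

Lemma umulA : associative umul. Proof. uax. Qed.
Lemma umul1l : left_id uone umul. Proof. uax. Qed.
Lemma umul1r : right_id uone umul. Proof. uax. Qed.
Lemma umulDl : left_distributive umul uadd. Proof. uax. Qed.
Lemma umulDr : right_distributive umul uadd. Proof. uax. Qed.

(* The counit, which shows that the algebra is not zero. *)
Fixpoint ucounit (t : uterm) : F :=
  match t with
  | UGen _ | UZero => 0
  | UOne => 1
  | UOpp s => - ucounit s
  | UAdd s t => ucounit s + ucounit t
  | UMul s t => ucounit s * ucounit t
  | UScale a t => a * ucounit t
  end.

Lemma ucounitP s t : ueq s t -> ucounit s = ucounit t.
Proof.
elim=> //=.
- by move=> s1 t1 u1 _ -> _ ->.
- by move=> s1 t1 _ ->.
- by move=> s1 t1 s2 t2 _ -> _ ->.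
- by move=> s1 t1 s2 t2 _ -> _ ->.
- by move=> a s1 t1 _ ->.
- by move=> *; rewrite addrA.
- by move=> *; rewrite addrC.
- by move=> *; rewrite add0r.
- by move=> *; rewrite addNr.
- by move=> *; rewrite mulrA.
- by move=> *; rewrite mul1r.
- by move=> *; rewrite mulr1.
- by move=> *; rewrite mulrDl.
- by move=> *; rewrite mulrDr.
- by move=> *; rewrite mulrA.
- by move=> *; rewrite mul1r.
- by move=> *; rewrite mulrDr.
- by move=> *; rewrite mulrDl.
- by move=> *; rewrite mulrA.
- by move=> a s1 t1; rewrite mulrCA.
- by move=> *; rewrite mulr0 addr0.
- by move=> *; rewrite mulr0 mulr0 oppr0 addr0.
Qed.

Lemma uone_neq0 : uone != 0.
Proof.
by apply/eqP => /uclP /ucounitP /= /eqP; rewrite oner_eq0.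
Qed.
HB.instance Definition _ := GRing.Zmodule_isNzRing.Build uea
  umulA umul1l umul1r umulDl umulDr uone_neq0.

Lemma uscaleA a b u : uscale a (uscale b u) = uscale (a * b) u.
Proof. move: u; uax. Qed.
Lemma uscale1 : left_id 1 uscale. Proof. uax. Qed.
Lemma uscaleDr : right_distributive uscale +%R.
Proof. rewrite /GRing.add /=; uax. Qed.
Lemma uscaleDl u : {morph uscale^~ u : a b / a + b}.
Proof. by move=> a b; rewrite -(ureprK u) /GRing.add /= ?uE; apply/uclP; constructor. Qed.
HB.instance Definition _ := GRing.Zmodule_isLmodule.Build F uea
  uscaleA uscale1 uscaleDr uscaleDl.

Lemma uscaleAl a (u v : uea) : a *: (u * v) = (a *: u) * v.
Proof.
rewrite /GRing.scale /GRing.mul /= -(ureprK u) -(ureprK v) ?uE.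
by apply/uclP; constructor.
Qed.
HB.instance Definition _ := GRing.Lmodule_isLalgebra.Build F uea uscaleAl.
Lemma uscaleAr a (u v : uea) : a *: (u * v) = u * (a *: v).
Proof.
rewrite /GRing.scale /GRing.mul /= -(ureprK u) -(ureprK v) ?uE.
by apply/uclP; constructor.
Qed.
HB.instance Definition _ := GRing.Lalgebra_isAlgebra.Build F uea uscaleAr.

Definition ugen (x : g) : uea := ucl (UGen x).

End Enveloping.

Definition in_lspan (A : pzRingType) (M : lmodType A) (S : M -> Prop) (v : M) : Prop :=
  exists n (a : 'I_n -> A) (s : 'I_n -> M),
    (forall i, S (s i)) /\ v = \sum_i a i *: s i.

Definition fin_gen (A : pzRingType) (M : lmodType A) : Prop :=
  exists n (b : 'I_n -> M), forall v, exists a : 'I_n -> A, v = \sum_i a i *: b i.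

(* [phi] is the action of the ground field through the ring [A]. *)
Definition fin_dim (F A : pzRingType) (phi : F -> A) (M : lmodType A) : Prop :=
  exists n (b : 'I_n -> M), forall v, exists c : 'I_n -> F, v = \sum_i phi (c i) *: b i.

Section LinearExt.
Variables (A : pzRingType) (M N : lmodType A).

Lemma linear_ext (f f' : {linear M -> N}) : f =1 f' -> f = f'.
Proof.
case: f f' => f [[[f0 fD]] [fZ]] [f' [[[f'0 f'D]] [f'Z]]] /= /funext eff'.
subst f'; rewrite (Prop_irrelevance f0 f'0) (Prop_irrelevance fD f'D).
by rewrite (Prop_irrelevance fZ f'Z).
Qed.
End LinearExt.

(* End_A(M)^op, with product [f * f' = f' \o f]; it acts on [M] from the right
   by [q . f = f q]. *)
Definition endop (A : pzRingType) (M : lmodType A) : Type := {linear M -> M}.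

Section EndOp.
Variables (A : pzRingType) (M : lmodType A).
Local Notation E := (endop M).

HB.instance Definition _ := gen_eqMixin E.
HB.instance Definition _ := gen_choiceMixin E.

Definition endact (q : M) (f : E) : M := (f : {linear M -> M}) q.

Lemma endop_ext (f f' : E) : (forall q, endact q f = endact q f') -> f = f'.
Proof. exact: linear_ext. Qed.

Lemma endadd_linear (f f' : E) : linear (fun q => endact q f + endact q f').
Proof. by move=> a x y; rewrite /endact !linearP scalerDr addrACA. Qed.
Lemma endopp_linear (f : E) : linear (fun q => - endact q f).
Proof. by move=> a x y; rewrite /endact linearP opprD scalerN. Qed.
Lemma endzero_linear : linear (fun _ : M => 0 : M).
Proof. by move=> a x y; rewrite scaler0 addr0. Qed.
Lemma endone_linear : linear (fun q : M => q).
Proof. by []. Qed.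
Lemma endmul_linear (f f' : E) : linear (fun q => endact (endact q f) f').
Proof. by move=> a x y; rewrite /endact !linearP. Qed.

Definition mkend (f : M -> M) (lf : linear f) : E :=
  HB.pack_for {linear M -> M} f (GRing.isLinear.Build A M M *:%R f lf).

Definition endadd f f' := mkend (endadd_linear f f').
Definition endopp f := mkend (endopp_linear f).
Definition endzero := mkend endzero_linear.
Definition endone := mkend endone_linear.
Definition endmul f f' := mkend (endmul_linear f f').

Lemma endaddA : associative endadd.
Proof. by move=> f g h; apply: endop_ext => q; apply: addrA. Qed.
Lemma endaddC : commutative endadd.
Proof. by move=> f g; apply: endop_ext => q; apply: addrC. Qed.
Lemma endadd0 : left_id endzero endadd.
Proof. by move=> f; apply: endop_ext => q; apply: add0r. Qed.
Lemma endaddN : left_inverse endzero endopp endadd.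
Proof. by move=> f; apply: endop_ext => q; apply: addNr. Qed.
HB.instance Definition _ :=
  GRing.isZmodule.Build E endaddA endaddC endadd0 endaddN.

Lemma endmulA : associative endmul.
Proof. by move=> f g h; apply: endop_ext. Qed.
Lemma endmul1l : left_id endone endmul.
Proof. by move=> f; apply: endop_ext. Qed.
Lemma endmul1r : right_id endone endmul.
Proof. by move=> f; apply: endop_ext. Qed.
Lemma endmulDl : left_distributive endmul +%R.
Proof. by move=> f g h; apply: endop_ext => q; apply: linearD. Qed.
Lemma endmulDr : right_distributive endmul +%R.
Proof. by move=> f g h; apply: endop_ext. Qed.
HB.instance Definition _ :=
  GRing.Zmodule_isPzRing.Build E endmulA endmul1l endmul1r endmulDl endmulDr.

Lemma endactDl (f : E) : {morph endact^~ f : q q' / q + q'}.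
Proof. exact: (linearD (f : {linear M -> M})). Qed.
Lemma endactZl a q (f : E) : endact (a *: q) f = a *: endact q f.
Proof. exact: (linearZ_LR (f : {linear M -> M})). Qed.
Lemma endactDr q : {morph endact q : f f' / f + f'}. Proof. by []. Qed.
Lemma endactM q (f f' : E) : endact q (f * f') = endact (endact q f) f'.
Proof. by []. Qed.
Lemma endact1 q : endact q 1 = q. Proof. by []. Qed.

End EndOp.

Section EndScalars.
Variables (F : fieldType) (A : algType F) (M : lmodType A).

Lemma endscal_linear (c : F) : linear (fun q : M => c%:A *: q).
Proof.
move=> a x y; rewrite scalerDr !scalerA.
by rewrite mulr_algl mulr_algr.
Qed.

Definition endscal (c : F) : endop M := mkend (endscal_linear c).
End EndScalars.

(* M (x)_E V for E = End_A(M)^op and a left E-module V, with A acting on M. *)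
Section Tensor.
Variables (A : pzRingType) (M : lmodType A) (V : lmodType (endop M)).

Inductive tterm : Type :=
| TGen of M & V | TZero | TOpp of tterm | TAdd of tterm & tterm.

Inductive teq : tterm -> tterm -> Prop :=
| teq_refl t : teq t t
| teq_sym s t : teq s t -> teq t s
| teq_trans s t u : teq s t -> teq t u -> teq s u
| teq_opp s t : teq s t -> teq (TOpp s) (TOpp t)
| teq_add s t s' t' : teq s t -> teq s' t' -> teq (TAdd s s') (TAdd t t')
| teq_addA s t u : teq (TAdd s (TAdd t u)) (TAdd (TAdd s t) u)
| teq_addC s t : teq (TAdd s t) (TAdd t s)
| teq_add0 s : teq (TAdd TZero s) s
| teq_addN s : teq (TAdd (TOpp s) s) TZero
| teq_Dl q q' v : teq (TGen (q + q') v) (TAdd (TGen q v) (TGen q' v))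
| teq_Dr q v v' : teq (TGen q (v + v')) (TAdd (TGen q v) (TGen q v'))
| teq_bal q w v : teq (TGen (endact q w) v) (TGen q (w *: v)).

HB.instance Definition _ := gen_eqMixin tterm.
HB.instance Definition _ := gen_choiceMixin tterm.

Definition teqb (s t : tterm) := `[< teq s t >].

Lemma teqb_equiv : equiv_class_of teqb.
Proof.
split=> [t|s t|t s u]; first by apply/asboolP; exact: teq_refl.
  by apply/asboolP/asboolP; exact: teq_sym.
by move=> /asboolP st /asboolP tu; apply/asboolP; exact: teq_trans tu.
Qed.
Canonical teqb_equivRel := EquivRelPack teqb_equiv.

Definition tensor : Type := {eq_quot teqb}%qT.
HB.instance Definition _ := Choice.on tensor.

Definition tcl (t : tterm) : tensor := (\pi_({eq_quot teqb}) t)%qT.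
Definition trep (u : tensor) : tterm := repr (u : {eq_quot teqb}%qT).

Lemma trepK u : tcl (trep u) = u.
Proof. exact: reprK. Qed.

Lemma tclP s t : tcl s = tcl t <-> teq s t.
Proof.
split=> [/eqP|st]; last by apply/eqP; rewrite /tcl eqmodE; exact/asboolP.
by rewrite /tcl eqmodE => /asboolP.
Qed.

Lemma trepE t : teq (trep (tcl t)) t.
Proof. by apply/tclP; rewrite trepK. Qed.

Definition tzero := tcl TZero.
Definition topp u := tcl (TOpp (trep u)).
Definition tadd u v := tcl (TAdd (trep u) (trep v)).

Lemma tclN t : topp (tcl t) = tcl (TOpp t).
Proof. by apply/tclP; apply: teq_opp (trepE t). Qed.
Lemma tclD s t : tadd (tcl s) (tcl t) = tcl (TAdd s t).
Proof. by apply/tclP; apply: teq_add; apply: trepE. Qed.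

Local Ltac tax :=
  repeat (let u := fresh "u" in move=> u; try rewrite -(trepK u));
  rewrite /tzero ?tclN ?tclD; apply/tclP; by constructor.

Lemma taddA : associative tadd.
Proof. by move=> u v w; rewrite -(trepK u) -(trepK v) -(trepK w) !tclD; apply/tclP; constructor. Qed.
Lemma taddC : commutative tadd. Proof. tax. Qed.
Lemma tadd0 : left_id tzero tadd. Proof. tax. Qed.
Lemma taddN : left_inverse tzero topp tadd. Proof. tax. Qed.
HB.instance Definition _ :=
  GRing.isZmodule.Build tensor taddA taddC tadd0 taddN.

Lemma taddE (u v : tensor) : u + v = tadd u v. Proof. by []. Qed.

Fixpoint tterm_scale (a : A) (t : tterm) : tterm :=
  match t with
  | TGen q v => TGen (a *: q) v
  | TZero => TZero
  | TOpp s => TOpp (tterm_scale a s)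
  | TAdd s s' => TAdd (tterm_scale a s) (tterm_scale a s')
  end.

Lemma tterm_scaleP a s t : teq s t -> teq (tterm_scale a s) (tterm_scale a t).
Proof.
elim=> /=; try by constructor.
- by move=> s1 t1 u1 _ st _ tu; exact: teq_trans tu.
- by move=> q q' v; rewrite scalerDr; constructor.
- by move=> q w v; rewrite -endactZl; constructor.
Qed.

Definition tscale a u := tcl (tterm_scale a (trep u)).

Lemma tclZ a t : tscale a (tcl t) = tcl (tterm_scale a t).
Proof. by apply/tclP; apply: tterm_scaleP (trepE t). Qed.

Lemma tscaleA a b u : tscale a (tscale b u) = tscale (a * b) u.
Proof.
rewrite -(trepK u) !tclZ; congr tcl.
by elim: (trep u) => //= [q v|s ->|s -> t ->] //; rewrite scalerA.
Qed.
Lemma tscale1 : left_id 1 tscale.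
Proof.
move=> u; rewrite -{2}(trepK u) -(trepK u) tclZ trepK; congr tcl.
by elim: (trep u) => //= [q v|s ->|s -> t ->] //; rewrite scale1r.
Qed.
Lemma tscaleDr : right_distributive tscale +%R.
Proof.
move=> a u v; rewrite !taddE -(trepK u) -(trepK v).
by rewrite !(tclD, tclZ).
Qed.
Lemma tscaleDl u : {morph tscale^~ u : a b / a + b}.
Proof.
move=> a b; rewrite taddE -(trepK u) !(tclZ, tclD).
elim: (trep u) => [q v||s IHs|s IHs t IHt] /=.
- by rewrite scalerDl; apply/tclP; constructor.
- by rewrite -tclD; exact/esym/tadd0.
- rewrite -!tclN IHs -!tclD -!tclN.
  exact: (opprD (tcl (tterm_scale a s) : tensor)).
- rewrite -!tclD IHs IHt -!tclD.
  exact: (addrACA (tcl (tterm_scale a s) : tensor)).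
Qed.
HB.instance Definition _ := GRing.Zmodule_isLmodule.Build A tensor
  tscaleA tscale1 tscaleDr tscaleDl.

Lemma tscaleE a (u : tensor) : a *: u = tscale a u. Proof. by []. Qed.

Definition tens (q : M) (v : V) : tensor := tcl (TGen q v).

End Tensor.

Section TensorMap.
Variables (A : pzRingType) (M : lmodType A) (V V' : lmodType (endop M)).
Variable phi : {linear V -> V'}.

Fixpoint tterm_map (t : tterm V) : tterm V' :=
  match t with
  | TGen q v => TGen q (phi v)
  | TZero => TZero V'
  | TOpp s => TOpp (tterm_map s)
  | TAdd s s' => TAdd (tterm_map s) (tterm_map s')
  end.

Lemma tterm_mapP s t : teq s t -> teq (tterm_map s) (tterm_map t).
Proof.
elim=> /=; try by constructor.
- by move=> s1 t1 u1 _ st _ tu; exact: teq_trans tu.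
- by move=> q v v'; rewrite linearD; constructor.
- by move=> q w v; rewrite linearZ; constructor.
Qed.

Definition tensor_map (u : tensor V) : tensor V' := tcl (tterm_map (trep u)).

Lemma tensor_map_cl t : tensor_map (tcl t) = tcl (tterm_map t).
Proof. by apply/tclP; apply: tterm_mapP (trepE t). Qed.

Lemma tensor_map_linear : linear tensor_map.
Proof.
move=> a u v; rewrite -(trepK u) -(trepK v).
rewrite !taddE !tscaleE !(tensor_map_cl, tclZ, tclD) /=.
by congr (tcl (TAdd _ _)); elim: (trep u) => //= [s ->|s -> t ->].
Qed.
HB.instance Definition _ := GRing.isLinear.Build A (tensor V) (tensor V') *:%R
  tensor_map tensor_map_linear.

End TensorMap.

Lemma tensor_map_id (A : pzRingType) (M : lmodType A) (V : lmodType (endop M))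
  (u : tensor V) : tensor_map idfun u = u.
Proof.
rewrite -{2}(trepK u) -(trepK u) tensor_map_cl trepK; congr tcl.
by elim: (trep u) => //= [s ->|s -> t ->].
Qed.

Lemma tensor_map_comp (A : pzRingType) (M : lmodType A)
    (V V' V'' : lmodType (endop M)) (phi : {linear V -> V'})
    (psi : {linear V' -> V''}) (u : tensor V) :
  tensor_map (psi \o phi) u = tensor_map psi (tensor_map phi u).
Proof.
rewrite -(trepK u) !tensor_map_cl; congr tcl.
by elim: (trep u) => //= [s ->|s -> t ->].
Qed.

Section Whittaker.
Variables (F : fieldType) (g : lieSuper F) (m : {vspace g}) (zeta : {scalar g}).
Local Notation U := (uea g).

Definition ushift (x : g) : U := ugen x - (zeta x)%:A.

(* The left ideal I_zeta; [U^o] is the left regular module. *)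
Definition in_ideal (y : U^o) : Prop :=
  in_lspan (fun z : U^o => exists2 x, x \in m & z = ushift x) y.

Definition ideal : {pred U^o} := fun y => `[< in_ideal y >].

Lemma idealP y : reflect (in_ideal y) (y \in ideal).
Proof. exact: asboolP. Qed.

Lemma ideal_submod : submod_closed ideal.
Proof.
split=> [|a y z /idealP[n [c [s [sS ->]]]] /idealP[p [d [t [tS ->]]]]].
  apply/idealP; exists 0%N, (fun=> 0), (fun=> 0).
  by split=> [[]|]; rewrite ?big_ord0.
apply/idealP; exists (n + p)%N.
exists (fun i => match split i with inl j => a * c j | inr j => d j end).
exists (fun i => match split i with inl j => s j | inr j => t j end).
split=> [i|]; first by case: split.
rewrite big_split_ord /= scaler_sumr; congr (_ + _); apply: eq_bigr => i _.
  by rewrite -[lshift p i]/(unsplit (inl i)) unsplitK scalerA.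
by rewrite -[rshift n i]/(unsplit (inr i)) unsplitK.
Qed.
HB.instance Definition _ := GRing.isSubmodClosed.Build U U^o ideal ideal_submod.

Definition Qz : Type := Quotient.quot ideal.
HB.instance Definition _ := GRing.Zmodule.on Qz.

Definition qcl (y : U) : Qz := (\pi_(Quotient.quot ideal) (y : U^o))%qT.
Definition qrep (q : Qz) : U := repr (q : Quotient.quot ideal).

Lemma qrepK q : qcl (qrep q) = q. Proof. exact: reprK. Qed.

Lemma qclP y z : qcl y = qcl z <-> (y : U^o) - z \in ideal.
Proof. by rewrite Quotient.idealrBE; split=> /eqP. Qed.

Lemma qclD y z : qcl (y + z) = qcl y + qcl z.
Proof. exact: (raddfD (\pi_(Quotient.quot ideal))%qT). Qed.

Definition qscale (a : U) (q : Qz) : Qz := qcl (a * qrep q).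

Lemma qclZ a y : qscale a (qcl y) = qcl (a * y).
Proof.
apply/qclP; rewrite -mulrBr; apply: (@rpredZ _ _ ideal a); apply/qclP.
exact: qrepK.
Qed.

Lemma qscaleA a b q : qscale a (qscale b q) = qscale (a * b) q.
Proof. by rewrite -(qrepK q) !qclZ mulrA. Qed.
Lemma qscale1 : left_id 1 qscale.
Proof. by move=> q; rewrite -(qrepK q) qclZ mul1r. Qed.
Lemma qscaleDr : right_distributive qscale +%R.
Proof.
by move=> a q r; rewrite -(qrepK q) -(qrepK r) -qclD !qclZ mulrDr qclD.
Qed.
Lemma qscaleDl q : {morph qscale^~ q : a b / a + b}.
Proof. by move=> a b; rewrite -(qrepK q) !qclZ mulrDl qclD. Qed.
HB.instance Definition _ := GRing.Zmodule_isLmodule.Build U Qz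
  qscaleA qscale1 qscaleDr qscaleDl.

Lemma qcl_scale a y : a *: qcl y = qcl (a * y).
Proof. exact: qclZ. Qed.

Definition one_z : Qz := qcl 1.

Lemma qclE y : qcl y = y *: one_z.
Proof. by rewrite qcl_scale mulr1. Qed.

Local Notation Wz := (endop Qz).

Section WhModule.
Variable M : lmodType U.

Definition is_wh (v : M) : Prop :=
  forall x, x \in m -> ugen x *: v = (zeta x)%:A *: v.

Definition wh_pred : {pred M} := fun v => `[< is_wh v >].

Lemma wh_predP v : reflect (is_wh v) (v \in wh_pred).
Proof. exact: asboolP. Qed.

Lemma wh_zmod : zmod_closed wh_pred.
Proof.
split=> [|u v /wh_predP wu /wh_predP wv]; apply/wh_predP => x xm.
  by rewrite !scaler0.
by rewrite !scalerBr wu ?wv.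
Qed.
HB.instance Definition _ := GRing.isZmodClosed.Build M wh_pred wh_zmod.

Record wh : Type := MkWh { wh_val : M; _ : wh_val \in wh_pred }.
HB.instance Definition _ := [isSub for wh_val].
HB.instance Definition _ := [Choice of wh by <:].
HB.instance Definition _ := [SubChoice_isSubZmodule of wh by <:].

Lemma whP (v : wh) x : x \in m -> ugen x *: val v = (zeta x)%:A *: val v.
Proof. by case: v => v0 /= /wh_predP; apply. Qed.

Lemma ideal_wh (y : U) (v : wh) : (y : U^o) \in ideal -> y *: val v = 0.
Proof.
case/idealP=> n [c [s [sS ->]]]; rewrite scaler_suml big1 // => i _.
have [x xm ->] := sS i.
by rewrite -scalerA scalerBl whP // subrr scaler0.
Qed.

(* The homomorphism Q_zeta -> M sending 1_zeta to a Whittaker vector. *)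
Definition wh_hom (v : wh) (q : Qz) : M := qrep q *: val v.

Lemma wh_hom_cl v y : wh_hom v (qcl y) = y *: val v.
Proof.
apply/eqP; rewrite -subr_eq0 -scalerBl; apply/eqP/ideal_wh/qclP.
exact: qrepK.
Qed.

Lemma wh_hom_linear v : linear (wh_hom v).
Proof.
move=> a q r; rewrite -(qrepK q) -(qrepK r) qcl_scale -qclD !wh_hom_cl.
by rewrite scalerDl scalerA.
Qed.
HB.instance Definition _ v :=
  GRing.isLinear.Build U Qz M *:%R (wh_hom v) (wh_hom_linear v).

Lemma wh_homZ v a q : wh_hom v (a *: q) = a *: wh_hom v q.
Proof. exact: linearZ_LR. Qed.

Lemma one_z_wh x : x \in m -> ugen x *: one_z = (zeta x)%:A *: one_z.
Proof.
move=> xm; apply/eqP; rewrite -subr_eq0 -scalerBl -/(ushift x) -qclE.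
have -> : 0 = qcl 0 by rewrite qclE scale0r.
apply/eqP/qclP; rewrite subr0; apply/idealP.
exists 1%N, (fun=> 1), (fun=> ushift x); split; first by move=> _; exists x.
by rewrite big_ord1 scale1r.
Qed.

Lemma wh_act_in (w : Wz) (v : wh) : wh_hom v (endact one_z w) \in wh_pred.
Proof.
apply/wh_predP => x xm.
by rewrite -!wh_homZ -!endactZl one_z_wh.
Qed.

(* [w *: v = y *: v] for any [y] in U(g) with [one_z . w = y *: one_z]; this is
   the action of W_zeta on Wh(M) = Hom(Q_zeta, M). *)
Definition wh_act (w : Wz) (v : wh) : wh := MkWh (wh_act_in w v).

Lemma wh_hom_act w v q : wh_hom (wh_act w v) q = wh_hom v (endact q w).
Proof.
by rewrite -(qrepK q) wh_hom_cl /= -wh_homZ -endactZl -qclE.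
Qed.

Lemma wh_hom1 v : wh_hom v one_z = val v.
Proof. by rewrite wh_hom_cl scale1r. Qed.

Lemma wh_actA w w' v : wh_act w (wh_act w' v) = wh_act (w * w') v.
Proof. by apply: val_inj; rewrite !/= wh_hom_act -endactM. Qed.
Lemma wh_act1 : left_id 1 wh_act.
Proof. by move=> v; apply: val_inj; rewrite /= wh_hom1. Qed.
Lemma wh_actDr : right_distributive wh_act +%R.
Proof. by move=> w v v'; apply: val_inj; apply: scalerDr. Qed.
Lemma wh_actDl v : {morph wh_act^~ v : w w' / w + w'}.
Proof.
by move=> w w'; apply: val_inj; exact: (linearD (wh_hom v : {linear Qz -> M})).
Qed.
HB.instance Definition _ := GRing.Zmodule_isLmodule.Build Wz wh
  wh_actA wh_act1 wh_actDr wh_actDl.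

End WhModule.

Section WhMap.
Variables (M N : lmodType U) (f : {linear M -> N}).

Lemma wh_map_in (v : wh M) : f (val v) \in @wh_pred N.
Proof. by apply/wh_predP => x xm; rewrite -!linearZ whP. Qed.

Definition wh_map (v : wh M) : wh N := MkWh (wh_map_in v).

Lemma wh_map_linear : linear wh_map.
Proof.
move=> w v v'; apply: val_inj; rewrite /= [LHS]linearD; congr (_ + _).
exact: (linearZ_LR f).
Qed.
HB.instance Definition _ := GRing.isLinear.Build Wz (wh M) (wh N) *:%R
  wh_map wh_map_linear.
End WhMap.

End Whittaker.

Notation Wz m zeta := (endop (Qz m zeta)).

Record category := Category {
  obj :> Type;
  hom : obj -> obj -> Type;
  idm : forall a, hom a a;
  comp : forall a b c, hom b c -> hom a b -> hom a c;
  comp1l : forall a b (f : hom a b), comp (idm b) f = f;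
  comp1r : forall a b (f : hom a b), comp f (idm a) = f;
  compA : forall a b c d (f : hom a b) (f' : hom b c) (f'' : hom c d),
    comp f'' (comp f' f) = comp (comp f'' f') f
}.
Arguments hom {c0} a b : rename.
Arguments idm {c0} a : rename.
Arguments comp {c0 a b c} f' f : rename.

Record functor (C D : category) := Functor {
  fobj :> C -> D;
  fmap : forall a b, hom a b -> hom (fobj a) (fobj b);
  fmap1 : forall a, fmap (idm a) = idm (fobj a);
  fmapM : forall a b c (f : hom a b) (f' : hom b c),
    fmap (comp f' f) = comp (fmap f') (fmap f)
}.
Arguments fmap {C D} f0 {a b} f : rename.

Program Definition idF (C : category) : functor C C :=
  @Functor C C (fun a => a) (fun a b f => f) _ _.

Program Definition compF (C D E : category) (G : functor D E) (H : functor C D) :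
    functor C E :=
  @Functor C E (fun a => G (H a)) (fun a b f => fmap G (fmap H f)) _ _.
Next Obligation. by move=> *; rewrite !fmap1. Qed.
Next Obligation. by move=> *; rewrite !fmapM. Qed.

Definition is_iso (C : category) (a b : C) (f : hom a b) : Prop :=
  exists f' : hom b a, comp f' f = idm a /\ comp f f' = idm b.

Definition nat_iso (C D : category) (G H : functor C D) : Prop :=
  exists eta : forall a, hom (G a) (H a),
    (forall a, is_iso (eta a)) /\
    (forall a b (f : hom a b), comp (eta b) (fmap G f) = comp (fmap H f) (eta a)).

Definition quasi_inverse (C D : category) (G : functor C D) (H : functor D C) : Prop :=
  nat_iso (compF H G) (idF C) /\ nat_iso (compF G H) (idF D).

Section ModCat.
Variables (A : pzRingType) (P : lmodType A -> Prop).

Program Definition modCat : category :=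
  @Category {M : lmodType A | P M} (fun M N => {linear sval M -> sval N})
    (fun M => idfun) (fun M N K f' f => f' \o f) _ _ _.
Next Obligation. by move=> *; apply: linear_ext. Qed.
Next Obligation. by move=> *; apply: linear_ext. Qed.
Next Obligation. by move=> *; apply: linear_ext. Qed.
End ModCat.

Section SuperMod.
Variables (A : pzRingType) (Apart : bool -> A -> Prop).

Definition super_grading (M : lmodType A) (Mpart : bool -> M -> Prop) : Prop :=
  [/\ forall i, Mpart i 0 /\
        (forall u v, Mpart i u -> Mpart i v -> Mpart i (u + v)),
      forall i j a v, Apart i a -> Mpart j v -> Mpart (i (+) j) (a *: v),
      forall v, exists v0 v1, [/\ Mpart false v0, Mpart true v1 & v = v0 + v1] &
      forall v, Mpart false v -> Mpart true v -> v = 0].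

Record supermod := Supermod {
  smod :> lmodType A;
  smpart : bool -> smod -> Prop;
  smodP : super_grading smpart
}.

Definition preserves_parity (M N : supermod) (f : {linear M -> N}) : Prop :=
  forall i v, smpart i v -> smpart i (f v).
Definition even_hom (M N : supermod) : Type :=
  {f : {linear M -> N} | preserves_parity f}.

Lemma even_hom_ext (M N : supermod) (f f' : even_hom M N) :
  sval f =1 sval f' -> f = f'.
Proof.
case: f f' => f fP [f' f'P] /= /linear_ext ff'; subst f'.
by rewrite (Prop_irrelevance fP f'P).
Qed.

Definition even_id (M : supermod) : even_hom M M :=
  exist (@preserves_parity M M) idfun (fun i v vi => vi).

Definition even_comp (M N K : supermod) (f' : even_hom N K) (f : even_hom M N) :
    even_hom M K :=
  exist (@preserves_parity M K) (sval f' \o sval f)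
    (fun i v vi => svalP f' i _ (svalP f i v vi)).

Program Definition smodCat (P : lmodType A -> Prop) : category :=
  @Category {M : supermod | P M} (fun M N => even_hom (sval M) (sval N))
    (fun M => even_id (sval M)) (fun M N K f' f => even_comp f' f) _ _ _.
Next Obligation. by move=> *; apply: even_hom_ext. Qed.
Next Obligation. by move=> *; apply: even_hom_ext. Qed.
Next Obligation. by move=> *; apply: even_hom_ext. Qed.
End SuperMod.
Arguments smpart {A Apart} s i v.

Section UPart.
Variables (F : fieldType) (g : lieSuper F).
Local Notation U := (uea g).

Inductive upart : bool -> U -> Prop :=
| upart_gen i x : x \in lpart g i -> upart i (ugen x)
| upart0 i : upart i 0
| upart1 : upart false 1
| upartD i u v : upart i u -> upart i v -> upart i (u + v)
| upartZ i c u : upart i u -> upart i (c *: u)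
| upartM i j u v : upart i u -> upart j v -> upart (i (+) j) (u * v).

(* The unital subalgebra generated by a subspace; for a subalgebra [A] of [g]
   it is identified with U(A) by the Poincare-Birkhoff-Witt theorem. *)
Inductive usub (A : {vspace g}) : U -> Prop :=
| usub_gen x : x \in A -> usub A (ugen x)
| usub1 : usub A 1
| usubD u v : usub A u -> usub A v -> usub A (u + v)
| usubZ c u : usub A u -> usub A (c *: u)
| usubM u v : usub A u -> usub A v -> usub A (u * v).

Definition ucenter_even (z : U) : Prop :=
  usub (even_part g) z /\ forall y, usub (even_part g) y -> z * y = y * z.

Definition locally_finite (S : U -> Prop) (M : lmodType U) : Prop :=
  forall v : M, exists n (b : 'I_n -> M), forall s, S s ->
    exists c : 'I_n -> F, s *: v = \sum_i (c i)%:A *: b i.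

End UPart.

Section WhittakerCat.
Variables (F : fieldType) (g : lieSuper F) (m : {vspace g}) (zeta : {scalar g}).
Local Notation U := (uea g).
Local Notation Q := (Qz m zeta).
Local Notation W := (Wz m zeta).
Local Notation Wh := (wh m zeta).

Definition loc_nilpotent (A : {vspace g}) (M : lmodType U) : Prop :=
  forall x, x \in A -> forall v : M, exists n, ushift zeta x ^+ n *: v = 0.

Definition in_Wmod (M : lmodType U) : Prop := loc_nilpotent m M.

(* [n] comes from a Borel subalgebra h + n whose even part has nilradical m_0. *)
Definition in_N (n : {vspace g}) (M : lmodType U) : Prop :=
  [/\ fin_gen M, locally_finite (@ucenter_even F g) M, locally_finite (usub n) M &
      loc_nilpotent (m :&: even_part g)%VS M].

Definition W_fdmod (V : lmodType W) : Prop := fin_dim (@endscal F U Q) V.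

Definition qpart i (q : Q) : Prop := exists2 u, upart i u & q = qcl m zeta u.

Definition wpart i (w : W) : Prop :=
  forall j q, qpart j q -> qpart (i (+) j) (endact q w).

Definition whpart (M : supermod (@upart F g)) i (v : Wh M) : Prop :=
  smpart M i (val v).

Inductive tpart (V : supermod wpart) : bool -> @tensor U Q V -> Prop :=
| tpart_gen i j q v : qpart i q -> smpart V j v -> tpart (i (+) j) (tens q v)
| tpart0 i : tpart i 0
| tpartD i u v : tpart i u -> tpart i v -> tpart i (u + v).

Section Functors.
Variables (P : lmodType U -> Prop) (P' : lmodType W -> Prop).

Section Restricted.
Hypothesis HWh : forall M, P M -> P' (Wh M).
Hypothesis HQ : forall V, P' V -> P (@tensor U Q V).

Program Definition Wh_functor : functor (modCat P) (modCat P') :=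
  @Functor _ (modCat P') (fun M => exist _ (Wh (sval M) : lmodType W) (HWh (svalP M)))
    (fun M N f => @wh_map F g m zeta _ _ f : {linear Wh _ -> Wh _}) _ _.
Next Obligation. by move=> *; apply: linear_ext => v; apply: val_inj. Qed.
Next Obligation. by move=> *; apply: linear_ext => v; apply: val_inj. Qed.

Program Definition Q_functor : functor (modCat P') (modCat P) :=
  @Functor _ (modCat P)
    (fun V => exist _ (@tensor U Q (sval V) : lmodType U) (HQ (svalP V)))
    (fun V V' f => tensor_map f : {linear tensor _ -> tensor _}) _ _.
Next Obligation. by move=> *; apply: linear_ext => v; apply: tensor_map_id. Qed.
Next Obligation. by move=> *; apply: linear_ext => v; apply: tensor_map_comp. Qed.

Hypothesis gWh : forall M, super_grading wpart (whpart (M := M)).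
Hypothesis gQ : forall V, super_grading (@upart F g) (tpart (V := V)).

Definition sWh_obj (M : smodCat (@upart F g) P) : smodCat wpart P' :=
  exist _ (Supermod (gWh (sval M))) (HWh (svalP M)).

Definition sWh_map M N (f : hom M N) : hom (sWh_obj M) (sWh_obj N) :=
  exist (@preserves_parity _ _ (sval (sWh_obj M)) (sval (sWh_obj N)))
    (@wh_map F g m zeta _ _ (sval f))
    (fun i v vi => svalP f i _ vi).

Program Definition sWh_functor : functor (smodCat (@upart F g) P) (smodCat wpart P') :=
  @Functor _ _ sWh_obj sWh_map _ _.
Next Obligation. by move=> *; apply: even_hom_ext => v; apply: val_inj. Qed.
Next Obligation. by move=> *; apply: even_hom_ext => v; apply: val_inj. Qed.

Definition sQ_obj (V : smodCat wpart P') : smodCat (@upart F g) P :=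
  exist _ (Supermod (gQ (sval V))) (HQ (svalP V)).

Lemma tensor_map_even (V V' : supermod wpart) (f : even_hom V V') i u :
  tpart i u -> tpart i (tensor_map (sval f) u).
Proof.
elim=> [k j q v qk vj|k|k s t _ IHs _ IHt].
- rewrite tensor_map_cl; apply: (@tpart_gen V' k j q (sval f v)) => //.
  exact: (svalP f).
- by rewrite raddf0; apply: tpart0.
- by rewrite raddfD; apply: tpartD.
Qed.

Definition sQ_map V V' (f : hom V V') : hom (sQ_obj V) (sQ_obj V') :=
  exist (@preserves_parity _ _ (sval (sQ_obj V)) (sval (sQ_obj V')))
    (tensor_map (sval f))
    (fun i u ui => tensor_map_even f ui).

Program Definition sQ_functor : functor (smodCat wpart P') (smodCat (@upart F g) P) :=
  @Functor _ _ sQ_obj sQ_map _ _.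
Next Obligation. by move=> *; apply: even_hom_ext => v; apply: tensor_map_id. Qed.
Next Obligation. by move=> *; apply: even_hom_ext => v; apply: tensor_map_comp. Qed.
End Restricted.

(* [HWh] and [HQ] say that the two functors restrict to the full subcategories
   defined by [P] and [P']. *)
Definition Wh_equivalence : Prop :=
  exists HWh HQ, quasi_inverse (Wh_functor HWh) (Q_functor HQ).

(* The version for Z/2-graded modules; [gWh] and [gQ] say that Wh_zeta(M) and
   the tensor product inherit gradings. *)
Definition sWh_equivalence : Prop :=
  exists HWh HQ gWh gQ,
    quasi_inverse (sWh_functor HWh gWh) (sQ_functor HQ gQ).

End Functors.
End WhittakerCat.

Arguments W_fdmod {F g} m zeta V.
Arguments Wh_equivalence {F g} m zeta P P'.
Arguments sWh_equivalence {F g} m zeta P P'.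

(* Indices are counted from 0: those below [r'] are the even ones. *)
Definition in_X (r' r : nat) (a : {ffun 'I_r -> nat}) : bool :=
  [forall s : 'I_r, (r' <= s)%N ==> (a s <= 1)%N].

Definition multi_index (r' r : nat) : Type := {a : {ffun 'I_r -> nat} | in_X r' a}.

Definition mi_abs r' r (a : multi_index r' r) : nat := (\sum_s sval a s)%N.
Definition mi_wt r' r (d : 'I_r -> nat) (a : multi_index r' r) : nat :=
  (\sum_s d s * sval a s)%N.

Definition strict_linear_order (T : eqType) (lt : rel T) : Prop :=
  [/\ irreflexive lt, transitive lt & forall a b, a != b -> lt a b || lt b a].

Definition wt_compatible r' r (d : 'I_r -> nat) (lt : rel (multi_index r' r)) : Prop :=
  forall a b, (mi_wt d a < mi_wt d b)%N ||
    ((mi_wt d a == mi_wt d b) && (mi_abs b < mi_abs a)%N) -> lt a b.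

Definition xmon (F : fieldType) (g : lieSuper F) r' r (x : 'I_r -> g)
    (a : multi_index r' r) : uea g :=
  \prod_(s < r) ugen (x s) ^+ sval a s.

Definition umon (F : fieldType) (g : lieSuper F) (zeta : {scalar g}) r' r
    (u : 'I_r -> g) (a : multi_index r' r) : uea g :=
  \prod_(s < r)
    (if (s < r')%N then ushift zeta (u s) else ugen (u s)) ^+ sval a s.

(* [uniq s] makes [s] a finite set of indices. *)
Definition right_basis (A : pzRingType) (M : lmodType A) (I : eqType)
    (b : I -> M) : Prop :=
  (forall q, exists (s : seq I) (w : I -> endop M),
     q = \sum_(i <- s) endact (b i) (w i)) /\
  (forall (s : seq I) (w : I -> endop M), uniq s ->
     \sum_(i <- s) endact (b i) (w i) = 0 -> {in s, forall i, w i = 0}).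

(* Main.v *)
(** Give an element of g(j) the Kazhdan degree j + 2. On words applied to a
    Whittaker vector v, the operator u_i - zeta(u_i) lowers the Kazhdan degree by
    d_i, and by the duality of the two families it acts on x^b v like a partial
    derivative, up to terms of lower Kazhdan degree or with fewer letters. So the
    u^a are triangularly dual to the x^a: sums of x^a v_a with v_a Whittaker are
    direct, and when the u_i - zeta(u_i) are locally nilpotent they exhaust the
    module, by induction on the weight. Applied to Q_zeta and to the tensor product
    with Q_zeta this gives the basis and the bijectivity of unit and counit.

    The restriction to N(zeta) amounts to finiteness. If V is finite-dimensional,
    then the vectors of Q_zeta (x) V that are Whittaker for m_0 form a
    finite-dimensional space, stable under Z(g_0). Conversely, for M in N(zeta)
    write M as the union of the spaces U_n(g_0) E with E finite-dimensional and
    m_0-stable. Let b_c, b'_c be dual bases of g_0 made of weight vectors for the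
    Cartan subalgebra. The traces of the powers of the matrix with entries
    [b_c, b'_d] are central in U(g_0), hence locally finite, and modulo lower
    filtration degree this matrix is triangular. By Newton's identities its
    diagonal entries act nilpotently on the associated graded module, as does the
    center of g_0; together they span the Cartan subalgebra, so dim U_n(g_0) E
    grows at most like n^(dim m_0). On the other hand independent Whittaker
    vectors w yield the independent vectors x^a w with dim m_0 free exponents,
    which bounds the number of the w. *)

Require Import Defs.
From HB Require Import structures.
From mathcomp Require Import all_boot all_order all_algebra.
From mathcomp Require Import boolp reals complex.
From mathcomp Require Import zify.

Set Implicit Arguments.
Unset Strict Implicit.
Unset Printing Implicit Defensive.

Import Order.TTheory GRing.Theory Num.Theory.
Local Open Scope ring_scope.

(** * Spans and straightening *)

(** Only the spanning half of the Poincare-Birkhoff-Witt theorem is proved, by straightening words.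
    Every independence statement comes from the dual operators u^a instead: a vanishing sum of terms
    x^a v_a is tested on its largest exponent. At the top Kazhdan degree the terms that disturb the
    derivative rule keep all their letters while the derivative loses one; this is why, among
    exponents of equal weight, the one with more letters counts as smaller.

    For N(zeta) neither the Harish-Chandra isomorphism nor a classification of roots enters. The
    invariant form supplies what is needed: m_0 and the nonpositive part of g_0 are each other's
    orthogonal space, some h + w with w in m_0 lies in the Cartan subalgebra, and the opposite root
    vectors are obtained as duals of those in m_0. About Z(g_0) only the local finiteness of
    finitely many explicit central elements on a finite set E is used. *)

Notation "c *:: v" := ((c%:A) *: v) (at level 40, format "c  *::  v").

Section FieldAction.
Variables (F : fieldType) (A : algType F) (M : lmodType A).
Implicit Types (c : F) (a : A) (v w : M) (S T : M -> Prop).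

Lemma algZ c a v : (c *: a) *: v = c%:A *: (a *: v).
Proof. by rewrite scalerA mulr_algl. Qed.

Lemma algAC c a v : a *: (c%:A *: v) = c%:A *: (a *: v).
Proof. by rewrite !scalerA mulr_algl mulr_algr. Qed.

Lemma algA c c' v : (c%:A : A) *: ((c'%:A : A) *: v) = (c * c')%:A *: v.
Proof. by rewrite -algZ scalerA. Qed.

Lemma alg1 v : ((1 : F)%:A : A) *: v = v.
Proof. by rewrite scale1r scale1r. Qed.

Lemma alg0 v : ((0 : F)%:A : A) *: v = 0.
Proof. by rewrite scale0r scale0r. Qed.

Lemma algDl c c' v : ((c + c')%:A : A) *: v = c%:A *: v + c'%:A *: v.
Proof. by rewrite scalerDl scalerDl. Qed.

Lemma algK c v : c != 0 -> ((c^-1)%:A : A) *: (c%:A *: v) = v.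
Proof. by move=> c0; rewrite algA mulVf // alg1. Qed.

Lemma alg_eq0 c v : c != 0 -> (c%:A : A) *: v = 0 -> v = 0.
Proof. by move=> c0 /(congr1 ( *:%R (c^-1)%:A)); rewrite algK // scaler0. Qed.

Lemma alg_suml (I : Type) (s : seq I) (P : pred I) (f : I -> F) v :
  ((\sum_(i <- s | P i) f i)%:A : A) *: v = \sum_(i <- s | P i) ((f i)%:A : A) *: v.
Proof. by rewrite scaler_suml scaler_suml. Qed.

(** [M] is a module over [A] only, so the field acts through [c%:A] and the span over [F] is built
    by hand, one term at a time. *)
Inductive fspan S : M -> Prop :=
| fspan0 : fspan S 0
| fspan_cons c v w : S v -> fspan S w -> fspan S (c%:A *: v + w).

Lemma fspan_gen S v : S v -> fspan S v.
Proof. by move=> Sv; rewrite -[v]addr0 -[v in v + 0]alg1; apply: fspan_cons => //;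
  apply: fspan0. Qed.

Lemma fspanD S v w : fspan S v -> fspan S w -> fspan S (v + w).
Proof.
move=> Sv Sw; elim: Sv => [|c u t Su _ IH]; first by rewrite add0r.
by rewrite -addrA; apply: fspan_cons.
Qed.

Lemma fspanZ S c v : fspan S v -> fspan S (c%:A *: v).
Proof.
elim=> [|c' u t Su _ IH]; first by rewrite scaler0; apply: fspan0.
by rewrite scalerDr algA; apply: fspan_cons.
Qed.

Lemma fspan_sum S (I : Type) (s : seq I) (P : pred I) (f : I -> M) :
  (forall i, P i -> fspan S (f i)) -> fspan S (\sum_(i <- s | P i) f i).
Proof. by move=> Sf; elim/big_ind: _ => //; [apply: fspan0 | apply: fspanD]. Qed.

Lemma fspan_ind2 S (P : M -> Prop) :
  P 0 -> (forall v w, P v -> P w -> P (v + w)) ->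
  (forall c v, P v -> P (c%:A *: v)) -> (forall v, S v -> P v) ->
  forall v, fspan S v -> P v.
Proof. by move=> P0 PD PZ SP v; elim=> // c u w Su _ Pw; apply: PD => //; apply/PZ/SP. Qed.

Lemma fspan_map S T a :
  (forall v, S v -> fspan T (a *: v)) -> forall v, fspan S v -> fspan T (a *: v).
Proof.
move=> ST; apply: fspan_ind2 => [|v w|c v|v] //.
- by rewrite scaler0; apply: fspan0.
- by rewrite scalerDr; apply: fspanD.
- by rewrite algAC; apply: fspanZ.
- exact: ST.
Qed.

Lemma fspan_sub S T : (forall v, S v -> fspan T v) -> forall v, fspan S v -> fspan T v.
Proof. by move=> ST; apply: fspan_ind2 => //; [apply: fspan0|apply: fspanD|apply: fspanZ]. Qed.

Lemma fspan_mono S T : (forall v, S v -> T v) -> forall v, fspan S v -> fspan T v.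
Proof. by move=> ST; apply: fspan_sub => v /ST; apply: fspan_gen. Qed.

Lemma fspan_false S v : (forall w, S w -> w = 0) -> fspan S v -> v = 0.
Proof.
move=> S0; move: v; apply: fspan_ind2 => // [v w -> ->|c v ->].
  by rewrite addr0.
by rewrite scaler0.
Qed.

Lemma fspan_fin n (b : 'I_n -> M) v :
  fspan (fun w => exists i, w = b i) v -> exists c : 'I_n -> F, v = \sum_i (c i)%:A *: b i.
Proof.
move: v; apply: fspan_ind2 => [|v w [c ->] [c' ->]|k v [c ->]|v [i ->]].
- by exists (fun=> 0); rewrite big1 // => i _; rewrite alg0.
- exists (fun i => c i + c' i); rewrite -big_split; apply: eq_bigr => i _.
  by rewrite /= algDl.
- exists (fun i => k * c i); rewrite scaler_sumr; apply: eq_bigr => i _.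
  by rewrite algA.
- exists (fun j => (i == j)%:R); rewrite (bigD1 i) //= eqxx alg1 big1 ?addr0 // => j.
  by rewrite eq_sym => /negPf ->; rewrite alg0.
Qed.

(** [M] carries no dimension, so the dependence is read off the coefficient matrix: with more rows
    than columns it has a nonzero left kernel vector. *)
Lemma fspan_dep m n (b : 'I_m -> M) (s : seq M) :
  (forall i, fspan (fun w => w \in s) (b i)) -> size s = n -> (n < m)%N ->
  exists2 c : 'I_m -> F, exists i, c i != 0 & \sum_i (c i)%:A *: b i = 0.
Proof.
move=> bs sn nm.
have bc i : exists c : 'I_n -> F, b i = \sum_j (c j)%:A *: nth 0 s j.
  apply: (@fspan_fin n (fun j => nth 0 s j)).
  apply: fspan_mono (bs i) => w /(nthP 0)[j js <-].
  by rewrite sn in js; exists (Ordinal js).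
pose C i := projT1 (cid (bc i)); have CE i := projT2 (cid (bc i)).
pose X := \matrix_(i < m, j < n) C i j.
have : kermx X != 0.
  rewrite -mxrank_eq0 mxrank_ker -lt0n subn_gt0.
  exact: leq_ltn_trans (rank_leq_col X) nm.
case/rowV0Pn=> c /sub_kermxP cX c0.
exists (c 0).
  apply/not_existsP => c0'; case/eqP: c0; apply/rowP => i; rewrite mxE.
  by apply: contra_notP (c0' i) => /eqP.
under eq_bigr => i _ do rewrite CE scaler_sumr.
rewrite exchange_big big1 // => j _.
under eq_bigr => i _ do rewrite algA.
rewrite -alg_suml.
have /rowP/(_ j) := cX; rewrite !mxE => cX0.
rewrite (_ : \sum_i _ = 0) ?alg0 // -[RHS]cX0.
by apply: eq_bigr => i _; rewrite /X mxE.
Qed.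

End FieldAction.

Section Straightening.
Variables (F : fieldType) (A : algType F) (M : lmodType A) (n : nat).
Variables (s : 'I_n -> A) (par : 'I_n -> bool) (om : 'I_n -> nat).
Variables (eps : 'I_n -> 'I_n -> F) (br : 'I_n -> 'I_n -> 'I_n -> F).
Hypothesis swap : forall i j,
  s i * s j = eps i j *: (s j * s i) + \sum_k br i j k *: s k.
Hypothesis square : forall i, par i -> exists c : F, s i * s i = c *: (\sum_k br i i k *: s k).
Hypothesis br_om : forall i j k, br i j k != 0 -> om k = (om i + om j)%N.

Definition lword (l : seq 'I_n) : A := \prod_(i <- l) s i.
Definition lom (l : seq 'I_n) : nat := \sum_(i <- l) om i.
Definition smono (a : {ffun 'I_n -> nat}) : A := \prod_i s i ^+ a i.

Lemma lword_cons i l : lword (i :: l) = s i * lword l.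
Proof. by rewrite /lword big_cons. Qed.
Lemma lword_cat l l' : lword (l ++ l') = lword l * lword l'.
Proof. by rewrite /lword big_cat. Qed.
Lemma lom_cons i l : lom (i :: l) = (om i + lom l)%N.
Proof. by rewrite /lom big_cons. Qed.

Lemma lom_perm l l' : perm_eq l l' -> lom l = lom l'.
Proof. by move=> ll'; apply: perm_big. Qed.

Definition lexpand (a : {ffun 'I_n -> nat}) : seq 'I_n :=
  flatten [seq nseq (a i) i | i <- index_enum 'I_n].

Lemma lword_expand a : lword (lexpand a) = smono a.
Proof.
rewrite /lword /lexpand /smono; elim: (index_enum _) => [|i l IH] /=.
  by rewrite !big_nil.
rewrite big_cat big_cons /= IH; congr (_ * _).
by elim: (a i) => [|k IHk] /=; rewrite ?big_nil ?big_cons // exprS IHk.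
Qed.

Lemma sum_expand (f : 'I_n -> nat) a : (\sum_(i <- lexpand a) f i = \sum_i f i * a i)%N.
Proof.
rewrite /lexpand; elim: (index_enum _) => [|i l IH] /=.
  by rewrite !big_nil.
rewrite big_cat big_cons /= IH; congr (_ + _)%N.
by elim: (a i) => [|k IHk] /=; rewrite ?big_nil ?muln0 // big_cons IHk mulnS.
Qed.

Lemma lom_expand a : lom (lexpand a) = (\sum_i om i * a i)%N.
Proof. exact: sum_expand. Qed.

Lemma size_expand a : size (lexpand a) = (\sum_i a i)%N.
Proof.
by rewrite -sum1_size sum_expand; apply: eq_bigr => i _; rewrite mul1n.
Qed.

Lemma count_expand a i : count_mem i (lexpand a) = a i.
Proof.
rewrite /lexpand.
suff H l : uniq l -> count_mem i (flatten [seq nseq (a j) j | j <- l]) = ((i \in l) * a i)%N.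
  by rewrite (H _ (index_enum_uniq _)) mem_index_enum mul1n.
elim: l => [|j l IH] //= /andP[jl ul]; rewrite count_cat IH // count_nseq in_cons /= eq_sym.
by case: (eqVneq j i) jl => [->|ji] jl //=; rewrite (negPf jl) addn0.
Qed.

Lemma expand_perm l : perm_eq (lexpand [ffun i => count_mem i l]) l.
Proof. by apply/allP => i _; rewrite /= count_expand ffunE. Qed.

Variable v : M.

(** Brackets shorten a word but preserve its weight, so the weight of the error terms is recorded
    exactly and only the length is bounded. *)
Definition shorter p w (x : M) :=
  fspan (fun y => exists l, [/\ (size l < p)%N, lom l = w & y = lword l *: v]) x.

Lemma shorterM i p w x : shorter p w x -> shorter p.+1 (om i + w) (s i *: x).
Proof.
apply: fspan_map => y [l [lp lw ->]]; apply: fspan_gen; exists (i :: l).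
by rewrite lom_cons lw lword_cons scalerA.
Qed.

Lemma shorter_br i j l :
  shorter (size l).+2 (om i + (om j + lom l))
    ((\sum_k br i j k *: s k) *: (lword l *: v)).
Proof.
rewrite scaler_suml; apply: fspan_sum => k _; rewrite algZ.
case: (eqVneq (br i j k) 0) => [->|brk]; first by rewrite alg0; apply: fspan0.
apply/fspanZ/fspan_gen; exists (k :: l).
by rewrite lom_cons (br_om brk) addnA lword_cons scalerA.
Qed.

(** The scalar [e] is left unspecified: only spans are wanted, so the product of the coefficients
    [eps] never has to be computed. *)
Definition lequiv l l' := exists e : F,
  shorter (size l) (lom l) (lword l *: v - e%:A *: (lword l' *: v)).

Lemma lequiv_trans l1 l2 l3 : size l2 = size l1 -> lom l2 = lom l1 ->
  lequiv l1 l2 -> lequiv l2 l3 -> lequiv l1 l3.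
Proof.
move=> s12 w12 [e H] [e' H']; exists (e * e').
rewrite s12 w12 in H'.
have := fspanD H (fspanZ e H'); rewrite scalerBr algA.
by rewrite addrA subrK.
Qed.

Lemma lequiv_cons i l l' : lequiv l l' -> lequiv (i :: l) (i :: l').
Proof.
move=> [e H]; exists e; have := shorterM i H.
by rewrite scalerBr algAC !lword_cons lom_cons /= -!scalerA.
Qed.

Lemma lequiv_insert i l1 l2 : lequiv (i :: l1 ++ l2) (l1 ++ i :: l2).
Proof.
elim: l1 => [|j l1 IH] /=.
  by exists 1; rewrite alg1 subrr; apply: fspan0.
apply: (@lequiv_trans _ (j :: i :: l1 ++ l2)) => //; last exact: lequiv_cons.
  by rewrite !lom_cons addnCA.
exists (eps i j); rewrite !lom_cons /=.
have -> : lword [:: i, j & l1 ++ l2] *: v - (eps i j)%:A *: (lword [:: j, i & l1 ++ l2] *: v)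
   = (\sum_k br i j k *: s k) *: (lword (l1 ++ l2) *: v).
  by rewrite !lword_cons !mulrA swap mulrDl -!scalerA scalerDl -scalerAl algZ -!scalerA addrAC
    subrr add0r.
exact: shorter_br.
Qed.

Lemma lequiv_perm l l' : perm_eq l l' -> lequiv l l'.
Proof.
elim: l l' => [|i l IH] l'.
  by rewrite perm_sym => /perm_nilP ->; exists 1; rewrite alg1 subrr; apply: fspan0.
move=> pl; have : i \in l' by rewrite -(perm_mem pl) mem_head.
move=> /splitPr il; case: il pl => l1 l2.
rewrite perm_sym (perm_catCA l1 [:: i] l2) /= perm_cons perm_sym => pl.
have s12 := perm_size pl; have w12 := lom_perm pl.
apply: (@lequiv_trans _ (i :: l1 ++ l2)); last exact: lequiv_insert.
- by rewrite /= s12.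
- by rewrite !lom_cons w12.
- exact/lequiv_cons/IH.
Qed.

(** Induction on the length. Sorting a word costs a scalar and shorter words of the same weight; a
    repeated letter that must not repeat is brought to the front, where [square] replaces the pair
    by single letters. *)
Theorem straighten l :
  fspan (fun y => exists a : {ffun 'I_n -> nat},
    [/\ forall i, par i -> (a i <= 1)%N, (\sum_i om i * a i)%N = lom l,
        (\sum_i a i <= size l)%N & y = smono a *: v]) (lword l *: v).
Proof.
have [p] := ubnP (size l); elim: p l => // p IH l; rewrite ltnS => lp.
pose T w q (y : M) := exists a : {ffun 'I_n -> nat},
    [/\ forall i, par i -> (a i <= 1)%N, (\sum_i om i * a i)%N = w,
        (\sum_i a i <= q)%N & y = smono a *: v].
have sh y : shorter (size l) (lom l) y -> fspan (T (lom l) (size l)) y.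
  apply: fspan_sub => _ [l' [l'l <- ->]].
  apply: fspan_mono (IH l' (leq_trans l'l lp)) => z [a [a1 a2 a3 ->]].
  by exists a; split=> //; apply: leq_trans a3 (ltnW l'l).
case: (pselect (forall i, par i -> (count_mem i l <= 1)%N)) =>
  [ok|/existsNP[i /not_implyP[pi /negP]]].
  have pe := expand_perm l; rewrite perm_sym in pe.
  have [e H] := lequiv_perm pe.
  have := fspanD (sh _ H) (fspanZ e (fspan_gen (_ : T (lom l) (size l) (lword (lexpand [ffun i
    => count_mem i l]) *: v)))).
  rewrite subrK; apply; exists [ffun i => count_mem i l]; split=> //.
  - by move=> i /ok; rewrite ffunE.
  - by rewrite -lom_expand; apply/esym/lom_perm.
  - by rewrite -size_expand (perm_size pe).
  - by rewrite lword_expand.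
rewrite -ltnNge => i2.
have [l' pl] : exists l', perm_eq l (i :: i :: l').
  have il : i \in l by rewrite -has_pred1 has_count (ltn_trans _ i2).
  have pl := perm_to_rem il; have il' : i \in rem i l.
    move/permP: pl => /(_ (pred1 i)) /= h.
    by rewrite -has_pred1 has_count; move: i2; rewrite h eqxx.
  exists (rem i (rem i l)); apply: (perm_trans pl).
  by rewrite perm_cons perm_to_rem.
have [e H] := lequiv_perm pl.
have := fspanD (sh _ H) (fspanZ e (sh (lword [:: i, i & l'] *: v) _)).
rewrite subrK; apply.
have [c E] := square pi.
rewrite !lword_cons mulrA E -scalerAl algZ -scalerA; apply: fspanZ.
by rewrite (perm_size pl) (lom_perm pl) !lom_cons; apply: shorter_br.
Qed.

End Straightening.

Section SpanLemmas.
Variables (F : fieldType) (V : vectType F).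
Implicit Type (P S : V -> Prop).

(** A finite family inside [P] whose span has maximal dimension spans everything, as a further
    vector of [P] cannot enlarge it. *)
Lemma vspace_of_pred P :
  P 0 -> (forall c u v, P u -> P v -> P (c *: u + v)) ->
  exists W : {vspace V}, forall x, x \in W <-> P x.
Proof.
move=> P0 PL.
pose D n := `[< exists2 s : seq V, (forall x, x \in s -> P x) & \dim <<s>>%VS = n >].
have exD : exists n, D n.
  by exists 0%N; apply/asboolP; exists [::] => //; rewrite span_nil dimv0.
have ubD n : D n -> (n <= \dim (fullv : {vspace V}))%N.
  by case/asboolP=> s _ <-; apply/dimvS/subvf.
case: (ex_maxnP exD ubD) => n /asboolP[s sP <-] maxs.
exists <<s>>%VS => x; split=> [|Px].
  move=> xs; rewrite (@coord_span _ _ _ (in_tuple s) _ xs).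
  elim/big_ind: _ => // [u v Pu Pv|i _].
    by rewrite -[u]scale1r; apply: PL.
  by rewrite -[_ *: _]addr0; apply: PL => //; apply/sP/mem_nth/(ltn_ord i).
have /maxs : D (\dim <<x :: s>>%VS).
  by apply/asboolP; exists (x :: s) => // y; rewrite inE => /predU1P[->|/sP].
have sub : (<<s>> <= <<x :: s>>)%VS by rewrite span_cons addvSr.
move=> dle; have /eqP -> : <<s>>%VS == <<x :: s>>%VS by rewrite eqEdim sub.
by rewrite memv_span ?mem_head.
Qed.

Lemma spanof_ind S P : P 0 -> (forall c u v, P u -> P v -> P (c *: u + v)) ->
  (forall x, S x -> P x) -> forall x, x \in spanof S -> P x.
Proof.
move=> P0 PL SP x; have [W WP] := vspace_of_pred P0 PL.
have [_ /(_ W)] := spanofP S => /(_ _)/subvP sub /sub h; apply/WP/h.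
by move=> y /SP /WP.
Qed.

Lemma mem_spanof S x : S x -> x \in spanof S.
Proof. by have [H _] := spanofP S; apply: H. Qed.

Lemma spanof_sub S (W : {vspace V}) : (forall x, S x -> x \in W) -> (spanof S <= W)%VS.
Proof. by have [_ H] := spanofP S; apply: H. Qed.

End SpanLemmas.

Section LieBasics.
Variables (F : fieldType) (g : lieSuper F).
Implicit Types (x y z h : g).

Lemma lbrDr x y z : [lie x, y + z] = [lie x, y] + [lie x, z].
Proof. exact: linearD. Qed.
Lemma lbrZr c x y : [lie x, c *: y] = c *: [lie x, y].
Proof. exact: linearZ. Qed.
Lemma lbrNr x y : [lie x, - y] = - [lie x, y].
Proof. exact: linearN. Qed.
Lemma lbr0r x : [lie x, 0] = 0.
Proof. exact: linear0. Qed.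
Lemma lbrDl x y z : [lie x + y, z] = [lie x, z] + [lie y, z].
Proof. by have := lbr_linearl z 1 x y; rewrite /= !scale1r. Qed.
Lemma lbr0l x : [lie 0, x] = 0.
Proof. by have := lbr_linearl x 1 0 0;
  rewrite /= !scale1r addr0 => /(congr1 (+%R^~ (- [lie 0, x]))); rewrite addrK subrr. Qed.
Lemma lbrZl c x y : [lie c *: x, y] = c *: [lie x, y].
Proof. by have := lbr_linearl y c x 0; rewrite /= lbr0l !addr0. Qed.
Lemma lbrNl x y : [lie - x, y] = - [lie x, y].
Proof. by rewrite -scaleN1r lbrZl scaleN1r. Qed.
Lemma lbrBr x y z : [lie x, y - z] = [lie x, y] - [lie x, z].
Proof. by rewrite lbrDr lbrNr. Qed.
Lemma lbr_suml (I : Type) (s : seq I) (P : pred I) (f : I -> g) y :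
  [lie \sum_(i <- s | P i) f i, y] = \sum_(i <- s | P i) [lie f i, y].
Proof. by elim/big_rec2: _ => [|i u v _ <-]; rewrite ?lbr0l ?lbrDl. Qed.
Lemma lbr_sumr (I : Type) (s : seq I) (P : pred I) (f : I -> g) y :
  [lie y, \sum_(i <- s | P i) f i] = \sum_(i <- s | P i) [lie y, f i].
Proof. exact: linear_sum. Qed.

Lemma part_decomp x : exists x0 x1,
  [/\ x0 \in even_part g, x1 \in odd_part g & x = x0 + x1].
Proof.
have : x \in (even_part g + odd_part g)%VS by rewrite lpart_full memvf.
by case/memv_addP=> x0 p0 [x1 p1 ->]; exists x0, x1.
Qed.

Lemma KoszulF i : Koszul (R := F) false i = 1. Proof. by []. Qed.
Lemma KoszulF' i : Koszul (R := F) i false = 1. Proof. by rewrite /Koszul andbF. Qed.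

(** An even first argument produces no sign, so the Jacobi identity extends to an arbitrary [x] by
    splitting it into its parts. *)
Lemma lbr_evenJ h x y : h \in even_part g ->
  [lie h, [lie x, y]] = [lie [lie h, x], y] + [lie x, [lie h, y]].
Proof.
move=> h0; have [x0 [x1 [p0 p1 ->]]] := part_decomp x.
rewrite !lbrDl lbrDr (lbr_jacobi _ h0 p0) (lbr_jacobi _ h0 p1).
by rewrite !KoszulF !scale1r lbrDr lbrDl addrACA.
Qed.

Lemma lbr_evenC x y : x \in even_part g -> [lie x, y] = - [lie y, x].
Proof.
move=> x0; have [y0 [y1 [p0 p1 ->]]] := part_decomp y.
rewrite lbrDr lbrDl (lbr_skew x0 p0) (lbr_skew x0 p1) !KoszulF !scale1r.
by rewrite -opprD.
Qed.

Lemma gradeP h k x : reflect ([lie h, x] = k%:~R *: x) (x \in grade h k).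
Proof.
rewrite memv_ker /ad add_lfunE opp_lfunE scale_lfunE id_lfunE lfunE /=.
by rewrite subr_eq0; apply: eqP.
Qed.

Lemma grade_lbr h i j x y : h \in even_part g ->
  x \in grade h i -> y \in grade h j -> [lie x, y] \in grade h (i + j).
Proof.
move=> h0 /gradeP hx /gradeP hy; apply/gradeP.
by rewrite lbr_evenJ // hx hy lbrZl lbrZr -scalerDl intrD.
Qed.

Lemma grade_neg h k x : k <= -2 -> x \in grade h k -> x \in neg_part h.
Proof. by move=> k2 xk; apply: mem_spanof; exists k. Qed.

Lemma ugen_linear : linear (@ugen F g).
Proof. by move=> c x y; rewrite /ugen; have /uclP -> := ueq_lin c x y; rewrite -uclD -uclZ. Qed.
HB.instance Definition _ := GRing.isLinear.Build F g (uea g) *:%R (@ugen F g) ugen_linear.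

Lemma ushift_linear zeta : linear (@ushift F g zeta).
Proof.
by move=> c x y; rewrite /ushift !linearP /= scalerDl -scalerA scalerBr opprD addrACA.
Qed.
HB.instance Definition _ zeta := GRing.isLinear.Build F g (uea g) *:%R
  (@ushift F g zeta) (ushift_linear zeta).

Lemma ugenC i j x y : x \in lpart g i -> y \in lpart g j ->
  ugen x * ugen y = Koszul i j *: (ugen y * ugen x) + ugen [lie x, y].
Proof.
move=> xi yj; have /uclP := ueq_lie xi yj.
rewrite -uclD -uclN -uclZ -!uclM => E; rewrite addrC.
by apply/eqP; rewrite -subr_eq; apply/eqP.
Qed.

(** The scalar zeta(x) commutes without a sign whereas an odd [x] may pick one up; hence the
    condition that zeta(x) vanish for odd [x]. *)
Lemma ushiftC (zeta : {scalar g}) i j x y : x \in lpart g i -> y \in lpart g j ->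
  (i -> zeta x = 0) ->
  ushift zeta x * ugen y = Koszul i j *: (ugen y * ushift zeta x) + ugen [lie x, y].
Proof.
move=> xi yj zx; rewrite /ushift mulrBl mulrBr (ugenC xi yj) scalerBr.
rewrite -!addrA; congr (_ + _); rewrite addrC; congr (_ + _); congr (- _).
rewrite mulr_algl mulr_algr; case: i xi zx => [|] xi zx; last by rewrite KoszulF scale1r.
by rewrite zx // !scale0r scaler0.
Qed.

End LieBasics.

(** * Whittaker vectors and the Kazhdan filtration *)

(* For [K] the whole of [g] this is the situation of the theorem; the same
   arguments apply to the even parts of the two families, with [K] the even
   part of [g]. *)
Record dual_families (F : numFieldType) (g : lieSuper F) (h : g)
    (zeta : {scalar g}) (K : {vspace g}) (r' r : nat) (u x : 'I_r -> g)
    (d : 'I_r -> nat) : Prop := DualFamilies {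
  df_even : h \in even_part g;
  df_lie : forall y z, y \in K -> z \in K -> [lie y, z] \in K;
  df_span : K = spanof (fun y => [/\ y \in K, exists i, y \in lpart g i &
                                 exists k : int, y \in grade h (2 * k)]);
  df_zlie : {in (neg_part h :&: K)%VS &, forall y z, zeta [lie y, z] = 0};
  df_zodd : forall y, y \in (neg_part h :&: K)%VS -> y \in odd_part g -> zeta y = 0;
  df_zlow : forall y k, y \in (neg_part h :&: K)%VS -> y \in grade h k -> k < -2 ->
    zeta y = 0;
  df_uK : forall s, u s \in K;
  df_xK : forall s, x s \in K;
  df_upar : forall s : 'I_r, u s \in lpart g (r' <= s)%N;
  df_xpar : forall s : 'I_r, x s \in lpart g (r' <= s)%N;
  df_d : forall s, (0 < d s)%N;
  df_ugr : forall s, u s \in grade h (- (d s)%:Z);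
  df_xgr : forall s, x s \in grade h (-2 + (d s)%:Z);
  df_basis : basis_of (neg_part h :&: K)%VS (codom u);
  df_eq : forall i, [lie u i, x i] \in grade h (-2) /\ zeta [lie u i, x i] = 1;
  df_ne : forall i j, i != j -> [lie u i, x j] \in grade h (-2) ->
    zeta [lie u i, x j] = 0
}.

Section Kazhdan.
Variables (F : numFieldType) (g : lieSuper F) (h : g) (zeta : {scalar g}).
Variables (K : {vspace g}) (r' r : nat) (u x : 'I_r -> g) (d : 'I_r -> nat).
Hypothesis df : dual_families h zeta K r' u x d.
Variable M : lmodType (uea g).
Implicit Types (v w : M) (y z : g) (ys : seq (g * nat)).

Local Notation mK := (neg_part h :&: K)%VS.
Local Notation S := (ushift zeta).

(** With [fullv] for [K] these are the Whittaker vectors; with the even part for [K], the vectors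
    that are Whittaker for m_0 alone. *)
Definition Kwh v := forall y, y \in mK -> S y *: v = 0.

(* [p.2] is the Kazhdan degree of the letter [p.1]. *)
Definition letter (p : g * nat) := [/\ p.1 \in K, exists i, p.1 \in lpart g i,
  p.1 \in grade h (-2 + p.2%:Z) & (0 < p.2)%N].

Definition gword ys v : M := foldr (fun p w => ugen p.1 *: w) v ys.

(* Spanned by the words whose Kazhdan degree is less than [N - c], or is equal
   to it with at least [l] letters. *)
Definition kfil v c N l : M -> Prop := fspan (fun w => exists ys,
  [/\ forall p, p \in ys -> letter p,
      (sumn (unzip2 ys) + c < N)%N || ((sumn (unzip2 ys) + c == N)%N && (l <= size ys)%N) &
      w = gword ys v]).

Lemma kfil_sub v c N l c' N' l' :
  (forall s p, (s + c < N)%N || ((s + c == N)%N && (l <= p)%N) ->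
    (s + c' < N')%N || ((s + c' == N')%N && (l' <= p)%N)) ->
  forall w, kfil v c N l w -> kfil v c' N' l' w.
Proof. by move=> H; apply: fspan_mono => w [ys [ys1 ys2 ->]]; exists ys; split=> //; apply: H. Qed.

Lemma kfil_letter v c N l p w : letter p -> kfil v c N l w ->
  kfil v c (N + p.2) l.+1 (ugen p.1 *: w).
Proof.
move=> lp; apply: fspan_map => _ [ys [ys1 ys2 ->]]; apply: fspan_gen.
exists (p :: ys); split=> //= [q|]; first by rewrite inE => /predU1P[->|/ys1].
by move: ys2; rewrite ltnS (addnC p.2) addnAC ltn_add2r eqn_add2r.
Qed.

(** Letters have positive degree, so no word satisfies the bounds, the empty one included. *)
Lemma kfil_low v c N l w : (N < c)%N || ((N == c) && (0 < l)%N) -> kfil v c N l w -> w = 0.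
Proof.
move=> Nc; apply: fspan_false => w' [ys [ys1 ys2 _]]; exfalso.
case: ys ys1 ys2 => [|p ys] /= ys1 ys2; first by move: Nc ys2; lia.
have [_ _ _ p0] := ys1 _ (mem_head _ _); move: Nc ys2; lia.
Qed.

Lemma grade_eq k k' y : k = k' -> y \in grade h k -> y \in grade h k'.
Proof. by move->. Qed.

Lemma mK_grade k y : y \in K -> y \in grade h k -> k <= -2 -> y \in mK.
Proof. by move=> yK yk k2; rewrite memv_cap yK (grade_neg k2 yk). Qed.

Variable v : M.
Hypothesis vwh : Kwh v.

(** The crux of the filtration: an element of degree -k lowers the Kazhdan degree by k and, where it
    lowers it no further, loses at most one letter. A letter is lost only when a bracket falls into
    degree -2 and is evaluated by zeta. *)
Lemma S_gword ys (k : nat) i y : (forall p, p \in ys -> letter p) ->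
  y \in mK -> y \in lpart g i -> y \in grade h (- k%:Z) ->
  kfil v k (sumn (unzip2 ys)) (size ys).-1 (S y *: gword ys v).
Proof.
elim: ys i k y => [|[y1 n1] ys IH] i k y yl ym yi yk /=.
  by rewrite vwh //; apply: fspan0.
have [y1K [j y1j] y1n n10] := yl _ (mem_head _ _).
have {}yl p : p \in ys -> letter p by move=> pys; apply: yl; rewrite inE pys orbT.
have yK : y \in K by move: ym; rewrite memv_cap => /andP[].
have zy : i -> zeta y = 0 by case: i yi => // yi _; apply: df_zodd df _ ym yi.
rewrite scalerA (ushiftC yi y1j zy) scalerDl.
apply: fspanD.
  rewrite algZ -scalerA; apply: fspanZ.
  have := kfil_letter (p := (y1, n1)) (And4 y1K (ex_intro _ j y1j) y1n n10) (IH i k y yl ym yi yk).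
  by apply: kfil_sub => s p /=; clear; lia.
have zK : [lie y, y1] \in K by apply: df_lie df _ _ yK y1K.
have zp : [lie y, y1] \in lpart g (i (+) j) by apply: lbr_part.
have := grade_lbr (df_even df) yk y1n.
set z := [lie y, y1] in zK zp *; simpl in * => zk.
have gw : kfil v 0 (sumn (unzip2 ys)) (size ys) (gword ys v).
  by apply: fspan_gen; exists ys; split=> //; rewrite addn0 eqxx leqnn orbT.
(* The bracket has Kazhdan degree n1 - k. If positive, it is a new letter; otherwise it lies in [mK]
   and splits as [S z] plus its value under zeta, which is zero unless k = n1. *)
case: (ltnP k n1) => kn.
  have zl : letter (z, (n1 - k)%N).
    split=> //=; [by exists (i (+) j)|apply: grade_eq zk|]; move: kn; clear; lia.
  by apply: kfil_sub (kfil_letter zl gw) => s p /=; move: kn; clear; lia.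
have zk' : z \in grade h (- (2 + (k - n1))%:Z).
  by apply: grade_eq zk; move: kn; clear; lia.
have zm : z \in mK by apply: mK_grade zK zk' _; clear; lia.
have -> : ugen z = S z + (zeta z)%:A by rewrite /ushift subrK.
rewrite scalerDl; apply: fspanD.
  by apply: kfil_sub (IH _ _ z yl zm zp zk') => s p; move: n10 kn; clear; lia.
case: (eqVneq k n1) => [e|kn1].
  by apply: fspanZ; apply: kfil_sub gw => s p; move: e; clear; lia.
suff -> : zeta z = 0 by rewrite !scale0r; apply: fspan0.
by apply: (df_zlow df zm zk'); move: kn kn1; clear; lia.
Qed.

Lemma kfil_S c N l k i y w : y \in mK -> y \in lpart g i -> y \in grade h (- k%:Z) ->
  kfil v c N l w -> kfil v (c + k) N l.-1 (S y *: w).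
Proof.
move=> ym yi yk; apply: fspan_map => _ [ys [ys1 ys2 ->]].
by apply: kfil_sub (S_gword ys1 ym yi yk) => s p; move: ys2; clear; lia.
Qed.

Lemma kfil_nil : kfil v 0 0 0 v.
Proof. by apply: fspan_gen; exists [::]. Qed.

Lemma x_letter j : letter (x j, d j).
Proof.
split=> /=; [exact: df_xK df j|by exists (r' <= j)%N; apply: df_xpar df j| |exact: df_d df j].
exact: df_xgr df j.
Qed.

Lemma u_mK i : u i \in mK.
Proof. by apply: (basis_mem (df_basis df)); apply: codom_f. Qed.

(** For distinct indices the duality condition kills the only term that could lose a letter, so at
    the top degree all [p.+1] letters survive. *)
Lemma br_ne i j N p w : i != j -> kfil v 0 N p w ->
  kfil v (d i) (N + d j) p.+1 (ugen [lie u i, x j] *: w).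
Proof.
move=> ij wN; have um := u_mK i; have [xK _ xg _] := x_letter j.
have zK : [lie u i, x j] \in K by apply: df_lie df _ _ (df_uK df i) xK.
have zp : [lie u i, x j] \in lpart g ((r' <= i)%N (+) (r' <= j)%N).
  by apply: lbr_part; [apply: df_upar df i|apply: df_xpar df j].
have zk := grade_lbr (df_even df) (df_ugr df i) xg.
have z0 := df_ne df ij.
set z := [lie u i, x j] in zK zp zk z0 *; simpl in zk.
case: (ltnP (d i) (d j)) => dij.
  have zl : letter (z, (d j - d i)%N).
    split=> //=; [by exists ((r' <= i)%N (+) (r' <= j)%N)|apply: grade_eq zk|]; move: dij;
      clear; lia.
  by apply: kfil_sub (kfil_letter zl wN) => s q /=; move: dij; clear; lia.
have zk' : z \in grade h (- (2 + (d i - d j))%:Z).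
  by apply: grade_eq zk; move: dij; clear; lia.
have zm : z \in mK by apply: mK_grade zK zk' _; clear; lia.
have -> : ugen z = S z + (zeta z)%:A by rewrite /ushift subrK.
rewrite scalerDl; apply: fspanD.
  apply: kfil_sub (kfil_S zm zp zk' wN) => s q.
  by move: (df_d df j) dij; clear; lia.
suff -> : zeta z = 0 by rewrite alg0; apply: fspan0.
case: (eqVneq (d i) (d j)) => [e|ne].
  by apply/z0; apply: grade_eq zk; move: e; clear; lia.
by apply: (df_zlow df zm zk'); move: ne dij; clear; lia.
Qed.

Lemma step_ne i j c N p w w' : i != j -> kfil v 0 N p w ->
  kfil v (d i) N p (S (u i) *: w - c%:A *: w') ->
  kfil v (d i) (N + d j) p.+1
    (S (u i) *: (ugen (x j) *: w) - (Koszul (r' <= i)%N (r' <= j)%N * c)%:A *: (ugen (x j) *: w')).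
Proof.
move=> ij wN H; have um := u_mK i.
have zu : (r' <= i)%N -> zeta (u i) = 0.
  by move=> ri; apply: df_zodd df _ um _; have := df_upar df i; rewrite ri.
rewrite scalerA (ushiftC (df_upar df i) (df_xpar df j) zu) scalerDl algZ -(scalerA (ugen _)).
rewrite -algA -(algAC c) addrAC -scalerBr -scalerBr.
apply: fspanD (br_ne ij wN); apply: fspanZ.
exact: kfil_letter (x_letter j) H.
Qed.

(** Compared with [step_ne], the bracket now contributes zeta([u_i, x_i]) = 1, which is the extra
    term [w] of the product rule. *)
Lemma step_eq i c N p w w' : kfil v 0 N p w ->
  kfil v (d i) N p (S (u i) *: w - c%:A *: w') ->
  kfil v (d i) (N + d i) p.+1
    (S (u i) *: (ugen (x i) *: w) - (Koszul (r' <= i)%N (r' <= i)%N * c)%:A *: (ugen (x i) *: w')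
     - w).
Proof.
move=> wN H; have um := u_mK i.
have zu : (r' <= i)%N -> zeta (u i) = 0.
  by move=> ri; apply: df_zodd df _ um _; have := df_upar df i; rewrite ri.
rewrite scalerA (ushiftC (df_upar df i) (df_xpar df i) zu) scalerDl algZ -(scalerA (ugen _)).
rewrite -algA -(algAC c) [X in X - w]addrAC -scalerBr -scalerBr -addrA.
apply: fspanD; first exact/fspanZ/(kfil_letter (x_letter i) H).
have [zk z1] := df_eq df i.
have zK : [lie u i, x i] \in K by apply: df_lie df _ _ (df_uK df i) (df_xK df i).
have zp := lbr_part (df_upar df i) (df_xpar df i).
have zm : [lie u i, x i] \in mK by apply: mK_grade zK zk _.
have -> : ugen [lie u i, x i] = S [lie u i, x i] + 1 by rewrite /ushift z1 scale1r subrK.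
rewrite scalerDl scale1r addrK.
apply: kfil_sub (kfil_S (k := 2) zm zp zk wN) => s q.
by move: (df_d df i); clear; lia.
Qed.

Definition xm (b : {ffun 'I_r -> nat}) (L : seq 'I_r) := \prod_(s <- L) ugen (x s) ^+ b s.

Lemma xm_fil (b : {ffun 'I_r -> nat}) L :
  kfil v 0 (\sum_(s <- L) d s * b s) (\sum_(s <- L) b s) (xm b L *: v).
Proof.
rewrite /xm; elim: L => [|j L IH]; first by rewrite !big_nil scale1r; apply: kfil_nil.
rewrite !big_cons -scalerA; elim: (b j) => [|k IHk].
  by rewrite expr0 scale1r muln0.
rewrite exprS -scalerA mulnS.
by apply: kfil_sub (kfil_letter (x_letter j) IHk) => s p /=; clear; lia.
Qed.

Lemma xm_pow_ne i j k c N p w w' : i != j -> kfil v 0 N p w ->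
  kfil v (d i) N p (S (u i) *: w - c%:A *: w') ->
  exists2 e : F, e != 0 & kfil v (d i) (d j * k + N) (k + p)
    (S (u i) *: (ugen (x j) ^+ k *: w) - (e * c)%:A *: (ugen (x j) ^+ k *: w')).
Proof.
move=> ij wN H; elim: k => [|k [e e0 IH]].
  by exists 1; rewrite ?oner_eq0 // mul1r expr0 !scale1r muln0.
exists (Koszul (r' <= i)%N (r' <= j)%N * e).
  by rewrite mulf_neq0 // signr_eq0.
rewrite exprS -!(scalerA (ugen (x j))) -mulrA mulnS.
have wk : kfil v 0 (d j * k + N) (k + p) (ugen (x j) ^+ k *: w).
  elim: (k) => [|q IHq]; first by rewrite expr0 scale1r muln0.
  rewrite exprS -scalerA mulnS.
  by apply: kfil_sub (kfil_letter (x_letter j) IHq) => s t /=; clear; lia.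
by apply: kfil_sub (step_ne ij wk IH) => s q; clear; lia.
Qed.

(** The power rule. Even letters give the exponent as coefficient, nonzero in characteristic 0; for
    an odd letter the signs would alternate, but only the exponents 0 and 1 occur. *)
Lemma xm_pow_eq (i : 'I_r) k N p w : ((r' <= i)%N -> (k <= 1)%N) -> kfil v 0 N p w ->
  kfil v (d i) N p (S (u i) *: w) ->
  exists2 c : F, (c != 0) = (0 < k)%N & kfil v (d i) (d i * k + N) (k + p)
    (S (u i) *: (ugen (x i) ^+ k *: w) - c%:A *: (ugen (x i) ^+ k.-1 *: w)).
Proof.
move=> k1 wN H; case: k k1 => [|k] k1.
  by exists 0; rewrite ?eqxx // alg0 subr0 expr0 scale1r muln0.
have wk q : kfil v 0 (d i * q + N) (q + p) (ugen (x i) ^+ q *: w).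
  elim: q => [|q IHq]; first by rewrite expr0 scale1r muln0.
  rewrite exprS -scalerA mulnS.
  by apply: kfil_sub (kfil_letter (x_letter i) IHq) => s t /=; clear; lia.
case: (leqP r' i) k1 => [ri|ri] k1.
  case: k k1 => [|k] // /(_ isT) // _.
  exists 1; first by rewrite oner_eq0.
  rewrite expr0 expr1 alg1 scale1r muln1.
  have := step_eq (i := i) (c := 0) (w' := w) wN; rewrite alg0 subr0 mulr0 alg0 subr0 => /(_ H).
  by apply: kfil_sub => s q; clear; lia.
have addalg (c : F) (y : M) : c%:A *: y + y = (c + 1)%:A *: y by rewrite algDl alg1.
exists (k.+1)%:R; first by rewrite pnatr_eq0.
elim: {k1} k => [|k IH].
  rewrite expr0 expr1 alg1 scale1r muln1.
  have := step_eq (i := i) (c := 0) (w' := w) wN; rewrite alg0 subr0 mulr0 alg0 subr0 => /(_ H).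
  by apply: kfil_sub => s q; clear; lia.
have := step_eq (wk k.+1) IH.
rewrite leqNgt ri KoszulF mul1r [ugen (x i) *: (_ *: _)]scalerA -exprS [ugen (x i) *: (_ *:
  _)]scalerA -exprS /=.
rewrite -addrA -opprD addalg natr1.
by apply: kfil_sub => s q; rewrite !mulnS; clear; lia.
Qed.

Definition decr (b : {ffun 'I_r -> nat}) i : {ffun 'I_r -> nat} :=
  [ffun s => if s == i then (b s).-1 else b s].

Lemma xm_decr_notin (b : {ffun 'I_r -> nat}) i L : i \notin L -> xm (decr b i) L = xm b L.
Proof.
move=> iL; apply: eq_big_seq => s sL; rewrite ffunE.
by case: eqP sL iL => // -> ->.
Qed.

(** The partial derivative of an ordered monomial. As [L] has no repetition, only one factor is
    differentiated and the others are crossed up to a sign. At the top degree the error terms have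
    at least as many letters as the monomial, one more than the leading term. *)
Lemma xm_lead (b : {ffun 'I_r -> nat}) i L : uniq L -> in_X r' b ->
  exists2 c : F, (c != 0) = (i \in L) && (0 < b i)%N &
    kfil v (d i) (\sum_(s <- L) d s * b s) (\sum_(s <- L) b s)
      (S (u i) *: (xm b L *: v) - c%:A *: (xm (decr b i) L *: v)).
Proof.
move=> uL /forallP bX; elim: L uL => [|j L IH] /=.
  move=> _; exists 0; first by rewrite eqxx.
  by rewrite /xm !big_nil scale1r alg0 subr0 vwh ?u_mK //; apply: fspan0.
case/andP=> jL uL; have [c c0 H] := IH uL.
rewrite !big_cons /xm !big_cons -!/(xm _ _) -!scalerA.
have xf := xm_fil b L.
case: (eqVneq i j) => [e|ij].
  subst j; rewrite (negPf jL) /= in c0.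
  move/negbFE: c0 => /eqP c0; rewrite c0 alg0 subr0 in H.
  have [] := xm_pow_eq (k := b i) _ xf H; first by move=> ri; have /implyP := bX i; apply.
  move=> e e0 H'; exists e; first by rewrite e0 inE eqxx.
  by rewrite xm_decr_notin // ffunE eqxx.
have [e e0 H'] := xm_pow_ne (b j) ij xf H.
exists (e * c); first by rewrite mulf_eq0 negb_or e0 c0 inE (negPf ij).
by rewrite [decr b i j]ffunE (negPf (_ : j != i)) // eq_sym.
Qed.

End Kazhdan.

Section CodomBasis.
Variables (F : fieldType) (V : vectType F) (r : nat) (u : 'I_r -> V).
Variable W : {vspace V}.
Hypothesis uW : basis_of W (codom u).

Lemma codom_mktuple : codom u = [tuple u i | i < r] :> seq V.
Proof. by rewrite codomE. Qed.

Lemma codom_coords y : y \in W -> exists c : 'I_r -> F, y = \sum_i c i *: u i.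
Proof.
move=> yW; have uW' := uW; rewrite codom_mktuple in uW'.
exists (fun i => coord [tuple u i | i < r] i y).
rewrite {1}(coord_basis uW' yW); apply: eq_bigr => i _.
by rewrite (nth_map i) ?size_enum_ord // nth_ord_enum.
Qed.

Lemma codom_free (c : 'I_r -> F) : \sum_i c i *: u i = 0 -> forall i, c i = 0.
Proof.
have := basis_free uW; rewrite codom_mktuple => /freeP uf c0; apply: uf.
rewrite -[RHS]c0; apply: eq_bigr => i _.
by rewrite (nth_map i) ?size_enum_ord // nth_ord_enum.
Qed.

Lemma codom_mem i : u i \in W.
Proof. by apply: (basis_mem uW); apply: codom_f. Qed.

End CodomBasis.

Section DualBasis.
Variables (F : numFieldType) (g : lieSuper F) (h : g) (zeta : {scalar g}).
Variables (K : {vspace g}) (r' r : nat) (u x : 'I_r -> g) (d : 'I_r -> nat).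
Hypothesis df : dual_families h zeta K r' u x d.

Local Notation mK := (neg_part h :&: K)%VS.
Local Notation S := (ushift zeta).
Local Notation idx := {ffun 'I_r -> nat}.

Definition wt (a : idx) : nat := \sum_s d s * a s.
Definition deg (a : idx) : nat := \sum_s a s.
Definition xmon' (a : idx) : uea g := smono (fun s => ugen (x s)) a.
Definition umon' (a : idx) : uea g := smono (fun s => S (u s)) a.
(* Compatible with the order by weight, then by decreasing degree. *)
Definition key (a : idx) : nat := wt a ^ 2 + (wt a - deg a).

Lemma deg_le_wt a : (deg a <= wt a)%N.
Proof. by apply: leq_sum => s _; rewrite leq_pmull // (df_d df). Qed.

Lemma xmon'E a : xmon' a = xm x a (index_enum 'I_r). Proof. by []. Qed.

Lemma um_odd0 (i : 'I_r) : (r' <= i)%N -> zeta (u i) = 0.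
Proof.
move=> ri; apply: df_zodd df _ (u_mK df i) _.
by have := df_upar df i; rewrite ri.
Qed.

(** zeta vanishes on brackets, so the y - zeta(y) satisfy on [mK] the same commutation rules as the
    y; its vanishing on odd elements reconciles the signs. *)
Lemma S_mul y z i j : y \in mK -> z \in mK -> y \in lpart g i -> z \in lpart g j ->
  S y * S z = Koszul i j *: (S z * S y) + S [lie y, z].
Proof.
move=> ym zm yi zj; rewrite {2}/ushift mulrBr (ushiftC yi zj); last first.
  by case: i yi => // yi _; apply: df_zodd df _ ym yi.
rewrite [S [lie y, z]]/ushift (df_zlie df ym zm) scale0r subr0 addrAC; congr (_ + _).
have -> : S z * S y = ugen z * S y - (zeta z)%:A * S y by rewrite -mulrBl.
rewrite scalerBr; congr (_ - _).
rewrite mulr_algl mulr_algr; case: j zj => zj; last by rewrite KoszulF' scale1r.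
by rewrite (df_zodd df zm) // !scale0r scaler0.
Qed.

Lemma u_lie_coords (i j : 'I_r) : exists c : 'I_r -> F, [lie u i, u j] = \sum_k c k *: u k.
Proof.
apply: codom_coords (df_basis df) _ _.
apply: (mK_grade _ (grade_lbr (df_even df) (df_ugr df i) (df_ugr df j))).
  by apply: df_lie df _ _ (df_uK df i) (df_uK df j).
by move: (df_d df i) (df_d df j); clear; lia.
Qed.

Definition ubr (i j : 'I_r) : 'I_r -> F := projT1 (cid (u_lie_coords i j)).

Lemma ubrE i j : [lie u i, u j] = \sum_k ubr i j k *: u k.
Proof. by rewrite /ubr; case: cid. Qed.

Lemma u_swap i j : S (u i) * S (u j) =
  Koszul (r' <= i)%N (r' <= j)%N *: (S (u j) * S (u i)) + \sum_k ubr i j k *: S (u k).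
Proof.
rewrite (S_mul (u_mK df i) (u_mK df j) (df_upar df i) (df_upar df j)); congr (_ + _).
by rewrite ubrE linear_sum; apply: eq_bigr => k _; rewrite linearZ.
Qed.

Lemma u_square (i : 'I_r) : (r' <= i)%N -> exists c : F,
  S (u i) * S (u i) = c *: (\sum_k ubr i i k *: S (u k)).
Proof.
move=> ri; exists (2%:R^-1); have := u_swap i i.
rewrite /Koszul ri /= expr1 scaleN1r => /(congr1 (+%R (S (u i) * S (u i)))).
rewrite addrA subrr add0r => <-.
by rewrite -mulr2n -scaler_nat scalerA mulVf ?pnatr_eq0 // scale1r.
Qed.

(** The bracket and each [u k] are eigenvectors of ad h; independence of the [u k] leaves only those
    with the right eigenvalue. *)
Lemma ubr_d i j k : ubr i j k != 0 -> d k = (d i + d j)%N.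
Proof.
move=> bk; have := grade_lbr (df_even df) (df_ugr df i) (df_ugr df j).
move/gradeP; rewrite ubrE lbr_sumr scaler_sumr => /eqP; rewrite -subr_eq0 -sumrB => /eqP E.
have E' : \sum_l (ubr i j l * (- (d l)%:Z - (- (d i)%:Z + - (d j)%:Z))%:~R) *: u l = 0.
  rewrite -[RHS]E; apply: eq_bigr => l _; rewrite lbrZr.
  have /gradeP -> := df_ugr df l.
  by rewrite !scalerA -scalerBl rmorphB /= mulrBr [_%:~R * ubr _ _ _]mulrC.
have /eqP := codom_free (df_basis df) E' k.
rewrite mulf_eq0 (negPf bk) /= intr_eq0 => /eqP; clear; lia.
Qed.

Variable M : lmodType (uea g).
Implicit Types v w : M.

Definition isX (a : idx) : bool := in_X r' a.

Lemma KwhP v : Kwh h zeta K v <-> forall i, S (u i) *: v = 0.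
Proof.
split=> [vK i|vu y ym]; first exact/vK/(u_mK df).
have [c ->] := codom_coords (df_basis df) ym.
rewrite linear_sum scaler_suml big1 // => i _.
by rewrite linearZ /= algZ vu scaler0.
Qed.

Lemma Sword_kfil v c N l w t : Kwh h zeta K v -> kfil h K v c N l w ->
  kfil h K v (c + \sum_(i <- t) d i) N (l - size t) (lword (fun i => S (u i)) t *: w).
Proof.
move=> vK wN; elim: t => [|i t IH].
  by rewrite /lword !big_nil scale1r addn0 subn0.
rewrite lword_cons -scalerA big_cons.
apply: kfil_sub (kfil_S df vK (u_mK df i) (df_upar df i) (df_ugr df i) IH) => s p /=.
by clear; lia.
Qed.

Lemma decr_X (b : idx) i : isX b -> isX (decr b i).
Proof.
move=> /forallP bX; apply/forallP => s; apply/implyP => rs.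
have /implyP/(_ rs) := bX s; rewrite ffunE; case: eqP => _ //.
by clear; lia.
Qed.

Lemma sum_decr (f : 'I_r -> nat) (b : idx) i : (0 < b i)%N ->
  (\sum_s f s * b s = f i + \sum_s f s * decr b i s)%N.
Proof.
move=> bi; rewrite [in LHS](bigD1 i) //= [in RHS](bigD1 i) //= addnA; congr (_ + _)%N.
  by rewrite ffunE eqxx -mulnS prednK.
by apply: eq_bigr => s si; rewrite ffunE (negPf si).
Qed.

(** The weight of [t] equals that of [b], so the whole Kazhdan degree is used up and the approximate
    derivative rule becomes exact: equal lengths force every error term to retain a letter, which
    [kfil_low] forbids. *)
Lemma Sword_xmon v (t : seq 'I_r) (b : idx) : Kwh h zeta K v -> isX b ->
  (\sum_(i <- t) d i)%N = wt b -> size t = deg b ->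
  exists2 c : F, (c != 0) = [forall i, count_mem i t == b i] &
    lword (fun i => S (u i)) t *: (xmon' b *: v) = c%:A *: v.
Proof.
move=> vK; elim/last_ind: t b => [|t i IH] b bX.
  rewrite big_nil => _ /esym/eqP; rewrite sum_nat_eq0 => /forallP b0.
  exists 1; rewrite ?alg1.
    by rewrite oner_eq0; apply/esym/forallP => i; rewrite eq_sym; apply: b0.
  rewrite /lword big_nil scale1r xmon'E /xm big1 ?scale1r // => i _.
  by rewrite (eqP (b0 i)) expr0.
rewrite -cats1 big_cat big_seq1 size_cat /= addn1 => tw ts.
have [c c0 H] := xm_lead df vK i (index_enum_uniq 'I_r) bX.
rewrite mem_index_enum /= in c0.
rewrite lword_cat -scalerA /lword big_seq1 -!/(lword _ _).
have := Sword_kfil t vK H; rewrite -/(wt b) -/(deg b) scalerBr => /kfil_low.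
rewrite -ts subSnn addnC tw eqxx orbT => /(_ isT) /eqP; rewrite subr_eq0 => /eqP {H}.
rewrite -!xmon'E => ->.
case: (posnP (b i)) c0 => [bi0|bi] /=.
  move=> /negbFE/eqP ->; exists 0; last by rewrite !alg0 scaler0.
  rewrite eqxx; apply/esym/negbTE/forallPn; exists i.
  by rewrite count_cat /= eqxx bi0 addn0 addn1.
move=> c0; have [||e e0 E] := IH (decr b i) (decr_X i bX).
- by move: tw; rewrite [wt b](sum_decr d bi) addnC => /addnI.
- move: ts; rewrite [deg b](_ : _ = \sum_s 1 * b s)%N; last by apply: eq_bigr => s _; rewrite mul1n.
  rewrite (sum_decr _ bi) add1n => -[->].
  by apply: eq_bigr => s _; rewrite mul1n.
exists (c * e); last by rewrite algAC E algA.
rewrite mulf_eq0 negb_or c0 e0 /=; apply: eq_forallb => j.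
rewrite ffunE count_cat /= addn0 eq_sym [in RHS]eq_sym.
by case: (eqVneq j i) => [->|ji]; rewrite ?addn1 ?addn0 //; case: (b i) bi.
Qed.

Lemma umon_xmon_eq v (a : idx) : Kwh h zeta K v -> isX a ->
  exists2 c : F, c != 0 & umon' a *: (xmon' a *: v) = c%:A *: v.
Proof.
move=> vK aX.
have [||c c0 E] := Sword_xmon (t := lexpand a) vK aX; first exact: lom_expand.
  exact: size_expand.
exists c; first by rewrite c0; apply/forallP => i; rewrite count_expand.
by rewrite -E lword_expand.
Qed.

Lemma umon_xmon_eq0 v (a b : idx) : Kwh h zeta K v -> isX b -> a != b ->
  (wt b < wt a)%N || ((wt b == wt a) && (deg a <= deg b)%N) ->
  umon' a *: (xmon' b *: v) = 0.
Proof.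
move=> vK bX ab; rewrite /umon' -lword_expand.
have := xm_fil df v b (index_enum 'I_r).
rewrite -xmon'E -/(wt b) -/(deg b) => H.
have := Sword_kfil (lexpand a) vK H; rewrite sum_expand size_expand -/(wt a) -/(deg a) add0n.
case: ltngtP => //= wab; first by move=> H1 *; apply: kfil_low H1; rewrite wab.
rewrite leq_eqVlt => H1 /orP[/eqP dab|dab]; last first.
  by apply: kfil_low H1; rewrite wab eqxx subn_gt0 dab orbT.
have [||c c0 ->] := Sword_xmon (t := lexpand a) vK bX.
- by rewrite sum_expand.
- by rewrite size_expand.
have nf : [forall i, count_mem i (lexpand a) == b i] = false.
  apply/negbTE/forallPn/not_existsP => H'; case/eqP: ab; apply/ffunP => i.
  by have /negP := H' i; rewrite negbK count_expand => /eqP.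
by move: c0; rewrite nf => /negbFE/eqP ->; rewrite alg0.
Qed.

(** As [deg] is at most [wt], the key lies between wt^2 and wt^2 + wt < (wt + 1)^2; comparing keys
    therefore compares weights first. *)
Lemma umon_xmon_key v (a b : idx) : Kwh h zeta K v -> isX b -> a != b ->
  (key b <= key a)%N -> umon' a *: (xmon' b *: v) = 0.
Proof.
move=> vK bX ab kab; apply: umon_xmon_eq0 => //.
move: kab (deg_le_wt a) (deg_le_wt b); rewrite /key; clear; nia.
Qed.

End DualBasis.

Section NilpotentBox.
Variables (F : fieldType) (A : algType F) (M : lmodType A) (n : nat) (s : 'I_n -> A).

(** The operators need not commute. The bound is built from the innermost factor outwards: below the
    bound already found there are finitely many inner vectors, each with its own nilpotency
    index. *)
Lemma nilp_box (v : M) : (forall i (w : M), exists k, s i ^+ k *: w = 0) ->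
  exists N, forall a : {ffun 'I_n -> nat}, smono s a *: v != 0 -> forall i, (a i < N)%N.
Proof.
move=> nil.
suff [N HN] : exists N, forall a : {ffun 'I_n -> nat},
    (\prod_(i <- index_enum 'I_n) s i ^+ a i) *: v != 0 ->
    forall i, i \in index_enum 'I_n -> (a i < N)%N.
  by exists N => a H i; apply: (HN a H i); rewrite mem_index_enum.
elim: (index_enum 'I_n) => [|j l [N IH]]; first by exists 0%N.
pose w (f : {ffun 'I_n -> 'I_N.+1}) := (\prod_(i <- l) s i ^+ f i) *: v.
pose k f := projT1 (cid (nil j (w f))).
have kP f : s j ^+ k f *: w f = 0 by rewrite /k; case: cid.
exists (maxn N (\max_f k f)) => a; rewrite big_cons -scalerA => H.
have lN : forall i, i \in l -> (a i < N)%N.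
  by apply: IH; apply: contraNneq H => ->; rewrite scaler0.
move=> i; rewrite inE leq_max => /predU1P[->|/lN ->//].
rewrite orbC; apply/orP; left; rewrite ltnNge; apply: contraNN H => ka.
pose f : {ffun 'I_n -> 'I_N.+1} := [ffun i => inord (a i)].
have -> : \prod_(i <- l) s i ^+ a i = \prod_(i <- l) s i ^+ f i.
  by apply: eq_big_seq => t /lN tN; rewrite ffunE inordK // ltnW.
have kfa : (k f <= a j)%N by apply: leq_trans ka; apply: leq_bigmax.
by rewrite -/(w f) -(subnK kfa) exprD -scalerA kP scaler0.
Qed.

End NilpotentBox.

Lemma seq_argmax (T : eqType) (k : T -> nat) (s : seq T) : s != [::] ->
  exists2 a, a \in s & forall b, b \in s -> (k b <= k a)%N.
Proof.
elim: s => // a s IH _; case: (eqVneq s [::]) => [->|/IH[b bs bm]].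
  by exists a; rewrite ?mem_head // => b; rewrite inE => /eqP ->.
case: (leqP (k a) (k b)) => ab.
  exists b; first by rewrite inE bs orbT.
  by move=> c; rewrite inE => /predU1P[->//|/bm].
exists a; first exact: mem_head.
move=> c; rewrite inE => /predU1P[->//|/bm cb].
exact: leq_trans cb (ltnW ab).
Qed.

(** * Freeness and spanning of the x^a over Whittaker vectors *)

Section Structure.
Variables (F : numFieldType) (g : lieSuper F) (h : g) (zeta : {scalar g}).
Variables (K : {vspace g}) (r' r : nat) (u x : 'I_r -> g) (d : 'I_r -> nat).
Hypothesis df : dual_families h zeta K r' u x d.
Variable M : lmodType (uea g).
Implicit Types v w : M.

Local Notation mK := (neg_part h :&: K)%VS.
Local Notation S := (ushift zeta).
Local Notation idx := {ffun 'I_r -> nat}.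
Local Notation wt := (wt d).
Local Notation deg := (@deg r).
Local Notation key := (key d).
Local Notation xmon := (xmon' x).
Local Notation umon := (umon' zeta u).
Local Notation isX := (@isX r' r).
Local Notation Kwh := (@Kwh F g h zeta K M).

Lemma Kwh0 : Kwh 0.
Proof. by move=> y _; rewrite scaler0. Qed.
Lemma KwhD v w : Kwh v -> Kwh w -> Kwh (v + w).
Proof. by move=> vK wK y ym; rewrite scalerDr vK // wK // addr0. Qed.
Lemma KwhZ c v : Kwh v -> Kwh (c%:A *: v).
Proof. by move=> vK y ym; rewrite algAC vK // scaler0. Qed.
Lemma KwhN v : Kwh v -> Kwh (- v).
Proof. by move=> vK y ym; rewrite scalerN vK // oppr0. Qed.

(* A vanishing sum has no term of maximal key, since [umon a] isolates it. *)
Lemma xmon_free_key (s : seq idx) (va : idx -> M) : uniq s ->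
  (forall a, a \in s -> isX a) -> (forall a, Kwh (va a)) ->
  forall a, a \in s -> va a != 0 ->
  (forall b, b \in s -> va b != 0 -> (key b <= key a)%N) ->
  exists2 c : F, c != 0 & umon a *: (\sum_(b <- s) xmon b *: va b) = c%:A *: va a.
Proof.
move=> us sX vK a as' va0 amax.
have [c c0 E] := umon_xmon_eq df (vK a) (sX _ as').
exists c => //; rewrite (bigD1_seq a) //= scalerDr E scaler_sumr big1_seq ?addr0 // => b.
case/andP=> ba bs; case: (eqVneq (va b) 0) => [->|vb0]; first by rewrite !scaler0.
by rewrite (umon_xmon_key df (vK b)) ?sX // 1?eq_sym // amax.
Qed.

Lemma xmon_free (s : seq idx) (va : idx -> M) : uniq s ->
  (forall a, a \in s -> isX a) -> (forall a, Kwh (va a)) ->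
  \sum_(a <- s) xmon a *: va a = 0 -> forall a, a \in s -> va a = 0.
Proof.
move=> us sX vK E a as'; apply: contraTeq isT => va0.
have : [seq a <- s | va a != 0] != [::].
  by apply/negP => /eqP E'; have : a \in [::] by rewrite -E' mem_filter va0.
case/(seq_argmax key)=> b; rewrite mem_filter => /andP[vb0 bs] bmax.
have [|c c0] := xmon_free_key us sX vK bs vb0.
  by move=> t ts t0; apply: bmax; rewrite mem_filter t0.
by rewrite E scaler0 => /esym /(alg_eq0 c0) /eqP; rewrite (negPf vb0).
Qed.

Lemma u_straighten v l : fspan (fun y => exists a : idx,
    [/\ isX a, wt a = lom d l, (deg a <= size l)%N & y = umon a *: v])
  (lword (fun i => S (u i)) l *: v).
Proof.
have sq (i : 'I_r) : (r' <= i)%N -> exists c : F,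
  S (u i) * S (u i) = c *: (\sum_k ubr df i i k *: S (u k)).
  exact: u_square.
apply: fspan_mono (straighten (u_swap df) sq (@ubr_d _ _ _ _ _ _ _ _ _ _ df) v l) =>
  y [a [a1 a2 a3 ->]].
by exists a; split=> //; apply/forallP => i; apply/implyP => /a1.
Qed.

(** Straightening u_i u^a gives monomials of weight exactly wt a + d_i, which all kill [v]. *)
Lemma umon_Kwh v (a : idx) : (forall b, isX b -> (wt a < wt b)%N -> umon b *: v = 0) ->
  Kwh (umon a *: v).
Proof.
move=> H; apply/(KwhP df) => i.
rewrite /umon' -lword_expand scalerA -(lword_cons (fun i => S (u i))).
apply: fspan_false (u_straighten v (i :: lexpand a)) => y [b [bX bw _ ->]].
by apply: H bX _; rewrite bw lom_cons lom_expand -/(wt a) -[X in (X < _)%N]add0n ltn_add2r (df_d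
  df).
Qed.

(** The largest key is peeled off first: outside the list every u^b kills [v], so u^a v is Whittaker
    for the head [a]. Subtracting a multiple of x^a u^a v makes u^a kill as well and does not
    disturb the u^b outside the list. *)
Lemma xmon_span_list (L : seq idx) v : uniq L -> (forall a, a \in L -> isX a) ->
  sorted (fun a b => (key b <= key a)%N) L ->
  (forall b, isX b -> b \notin L -> umon b *: v = 0) ->
  (forall a b, a \in L -> isX b -> b \notin L -> (key a <= key b)%N) ->
  exists2 va : idx -> M, forall a, Kwh (va a) & v = \sum_(a <- L) xmon a *: va a.
Proof.
elim: L v => [|a L IH] v.
  move=> _ _ _ H _; exists (fun=> 0) => [b|]; first exact: Kwh0.
  (* With an empty list u^0 = 1 also kills [v], so [v] is zero. *)
  rewrite big_nil -(H [ffun=> 0%N]) //.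
    rewrite /umon' /smono big1 ?scale1r // => i _; by rewrite ffunE expr0.
  by apply/forallP => i; rewrite ffunE implybT.
move=> /= /andP[aL uL] LX pL H1 H2.
have aX := LX _ (mem_head _ _).
have max b : b \in L -> (key b <= key a)%N.
  have tr : transitive (fun a b : idx => (key b <= key a)%N) by move=> p q t qp tp;
    apply: leq_trans tp qp.
  by move: pL => /(order_path_min tr) /allP; apply.
have wK : Kwh (umon a *: v).
  apply: umon_Kwh => b bX wab; apply: H1 => //; apply: contraTN wab.
  rewrite inE -leqNgt => /predU1P[->//|/max].
  by move: (deg_le_wt df a) (deg_le_wt df b); rewrite /key; clear; nia.
have [c c0 E] := umon_xmon_eq df wK aX.
pose w := (c^-1)%:A *: (xmon a *: (umon a *: v)).
have wb b : isX b -> b \notin L -> umon b *: (v - w) = 0.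
  move=> bX bL; rewrite scalerBr /w algAC.
  case: (eqVneq b a) => [->|ba]; first by rewrite E algK // subrr.
  have bL' : b \notin a :: L by rewrite inE negb_or ba.
  by rewrite (umon_xmon_key df wK) // ?scaler0 ?subr0 ?H1 // H2 ?mem_head.
have [||va vaK Ev] := IH (v - w) uL _ (path_sorted pL) wb.
- by move=> b bL; apply: LX; rewrite inE bL orbT.
- move=> b b' bL b'X b'L; case: (eqVneq b' a) => [->|ba]; first exact: max.
  by apply: H2; rewrite ?inE ?bL ?orbT // negb_or ba.
exists (fun b => if b == a then (c^-1)%:A *: (umon a *: v) else va b).
  by move=> b; case: ifP => _; [apply: KwhZ|apply: vaK].
rewrite big_cons eqxx algAC -/w -[LHS](subrK w) addrC Ev; congr (_ + _).
by apply: eq_big_seq => b bL; case: eqP => // ba; rewrite ba (negPf aL) in bL.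
Qed.

Lemma wt_ge (a : idx) i : (a i <= wt a)%N.
Proof.
by rewrite /wt (bigD1 i) //=; move: (df_d df i); clear; nia.
Qed.

Lemma xmon_span v : (forall i w, exists k, S (u i) ^+ k *: w = 0) ->
  exists (s : seq idx) (va : idx -> M), [/\ uniq s, forall a, a \in s -> isX a,
    forall a, Kwh (va a) & v = \sum_(a <- s) xmon a *: va a].
Proof.
move=> nil; have [N HN] := nilp_box v nil.
(* [w0] is the weight of the far corner of the box, and [k0] bounds every key of weight at most
   [w0]. *)
pose w0 := (\sum_s d s * N)%N; pose k0 := (w0 ^ 2 + w0)%N.
have box a : umon a *: v != 0 -> (key a <= k0)%N.
  move=> /HN aN; have : (wt a <= w0)%N.
    by apply: leq_sum => s _; rewrite leq_mul2l ltnW ?orbT.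
  by move: (deg_le_wt df a); rewrite /key /k0; clear; nia.
have kw a : (wt a <= key a)%N by rewrite /key; clear; nia.
pose emb (f : {ffun 'I_r -> 'I_k0.+1}) : idx := [ffun i => val (f i)].
have emb_inj : injective emb.
  by move=> f f' /ffunP E; apply/ffunP => i; apply: val_inj; have := E i; rewrite !ffunE.
(* Each exponent is at most the weight and hence the key, so all exponents with key at most [k0]
   occur here. *)
pose L0 := [seq a <- map emb (enum {ffun 'I_r -> 'I_k0.+1}) | isX a & (key a <= k0)%N].
have L0P a : (a \in L0) = isX a && (key a <= k0)%N.
  rewrite mem_filter; case: (boolP (isX a && (key a <= k0)%N)) => //= /andP[aX ak].
  apply/mapP; exists [ffun i => inord (a i)]; first by rewrite mem_enum.
  apply/ffunP => i; rewrite !ffunE /= inordK // ltnS.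
  exact: leq_trans (wt_ge a i) (leq_trans (kw a) ak).
pose L := sort (fun a b => (key b <= key a)%N) L0.
have LP a : (a \in L) = isX a && (key a <= k0)%N by rewrite mem_sort L0P.
have uL : uniq L by rewrite sort_uniq filter_uniq // map_inj_uniq // enum_uniq.
have [|||| va vaK E] := xmon_span_list (v := v) uL.
- by move=> a; rewrite LP => /andP[].
- by apply: sort_sorted => a b; apply: leq_total.
- by move=> b bX; rewrite LP bX /= => bk; apply: contraNeq bk => /box.
- by move=> a b; rewrite !LP => /andP[_ ak] -> /=; rewrite -ltnNge => /ltnW; apply: leq_trans.
by exists L, va; split=> // a; rewrite LP => /andP[].
Qed.

(* [kfil v 0 N 0] is stable under [K], so it exhausts the module generated by [v]. *)
Lemma kfil_gen v y c N l w : Kwh v -> y \in K -> kfil h K v c N l w ->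
  exists N' l', kfil h K v c N' l' (ugen y *: w).
Proof.
move=> vK yK wN; move: yK; rewrite {1}(df_span df).
have join N1 N2 l1 l2 w1 w2 : kfil h K v c N1 l1 w1 -> kfil h K v c N2 l2 w2 ->
    exists N' l', kfil h K v c N' l' (w1 + w2).
  move=> H1 H2; exists (N1 + N2).+1, 0%N; apply: fspanD.
    by apply: kfil_sub H1 => s p; clear; lia.
  by apply: kfil_sub H2 => s p; clear; lia.
move: y; apply: spanof_ind => [|k y z [N1 [l1 H1]] [N2 [l2 H2]]|y [yK [i yi] [k yk]]].
- by exists 0%N, 0%N; rewrite linear0 scale0r; apply: fspan0.
- rewrite linearP /= scalerDl algZ; apply: join H2.
  exact: fspanZ H1.
case: (lerP (2 * k) (-2)) => k2.
  have ym : y \in mK by apply: mK_grade yK yk k2.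
  have -> : ugen y = S y + (zeta y)%:A by rewrite /ushift subrK.
  rewrite scalerDl; apply: (join (N + c)%N N 0%N l); last exact: fspanZ.
  have yk' : y \in grade h (- `|(2 * k)%R|%N%:Z) by apply: grade_eq yk; move: k2; clear; lia.
  by apply: kfil_sub (kfil_S df vK ym yi yk' wN) => s p; move: k2; clear; lia.
have yl : letter h K (y, `|(2 + 2 * k)%R|%N).
  by split=> //=; [by exists i|apply: grade_eq yk|]; move: k2; clear; lia.
by exists (N + `|(2 + 2 * k)%R|%N)%N, l.+1; apply: (kfil_letter yl wN).
Qed.

End Structure.

(** * The Whittaker functor and its inverse *)

Section Expansion.
Variables (F : numFieldType) (g : lieSuper F) (h : g) (zeta : {scalar g}).
Variables (K : {vspace g}) (r' r : nat) (u x : 'I_r -> g) (d : 'I_r -> nat).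
Hypothesis df : dual_families h zeta K r' u x d.
Local Notation idx := {ffun 'I_r -> nat}.
Local Notation Kwh := (@Kwh F g h zeta K _).

(** The coefficients form a total function, zero outside a finite list, so that uniqueness can be
    stated pointwise. *)
Definition xexp (M : lmodType (uea g)) (v : M) (va : idx -> M) : Prop :=
  (forall a, Kwh (va a)) /\ exists s : seq idx,
    [/\ uniq s, forall a, a \in s -> isX r' a, forall a, a \notin s -> va a = 0 &
        v = \sum_(a <- s) xmon' x a *: va a].

Lemma xsum_ext (M : lmodType (uea g)) (s t : seq idx) (va : idx -> M) : uniq s -> uniq t ->
  {subset s <= t} -> (forall a, a \notin s -> va a = 0) ->
  \sum_(a <- s) xmon' x a *: va a = \sum_(a <- t) xmon' x a *: va a.
Proof.
move=> us ut st s0; rewrite [RHS](bigID (mem s)) /= [X in _ + X]big1 ?addr0; last first.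
  by move=> a /s0 ->; rewrite scaler0.
rewrite -[RHS]big_filter; apply: perm_big; apply: uniq_perm => //; first exact: filter_uniq.
by move=> a; rewrite mem_filter; case: (boolP (a \in s)) => //= /st ->.
Qed.

Lemma xexpD (M : lmodType (uea g)) (v w : M) va wa :
  xexp v va -> xexp w wa -> xexp (v + w) (fun a => va a + wa a).
Proof.
move=> [vK [s [us sX s0 ->]]] [wK [t [ut tX t0 ->]]].
split=> [a|]; first exact: KwhD.
exists (undup (s ++ t)); split; first exact: undup_uniq.
- by move=> a; rewrite mem_undup mem_cat => /orP[/sX|/tX].
- by move=> a; rewrite mem_undup mem_cat negb_or => /andP[/s0 -> /t0 ->]; rewrite addr0.
under [RHS]eq_bigr => a _ do rewrite scalerDr.
rewrite big_split /=; congr (_ + _); apply: xsum_ext => //; try exact: undup_uniq.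
  by move=> a; rewrite mem_undup mem_cat => ->.
by move=> a; rewrite mem_undup mem_cat => ->; rewrite orbT.
Qed.

Lemma xexp_map (M N : lmodType (uea g)) (f : {linear M -> N}) v va :
  xexp v va -> xexp (f v) (fun a => f (va a)).
Proof.
move=> [vK [s [us sX s0 ->]]]; split=> [a y ym|].
  by rewrite -linearZ vK // linear0.
exists s; split=> // [a /s0 ->|]; first by rewrite linear0.
by rewrite linear_sum; apply: eq_bigr => a _; rewrite linearZ.
Qed.

Lemma xexp_uniq (M : lmodType (uea g)) (v : M) va va' :
  xexp v va -> xexp v va' -> forall a, va a = va' a.
Proof.
move=> H [vK' [s' [us' sX' s0' E']]].
have H' : xexp (- v) (fun a => - va' a).
  split=> [a|]; first exact: KwhN.
  exists s'; split=> // [a /s0' ->|]; first by rewrite oppr0.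
  by rewrite E' -sumrN; apply: eq_bigr => a _; rewrite scalerN.
have [vK [s [us sX s0]]] := xexpD H H'; rewrite subrr => /esym E a.
apply/eqP; rewrite -subr_eq0; apply/eqP.
case: (boolP (a \in s)) => [as'|/s0//].
exact: (xmon_free df us sX vK E).
Qed.

Lemma xexp_wh (M : lmodType (uea g)) (v : M) : Kwh v ->
  xexp v (fun a => if a == [ffun=> 0%N] then v else 0).
Proof.
move=> vK; split=> [a|]; first by case: ifP => // _; apply: Kwh0.
exists [:: [ffun=> 0%N]]; split=> // [a|a|].
- by rewrite inE => /eqP ->; apply/forallP => i; rewrite ffunE implybT.
- by rewrite inE => /negPf ->.
rewrite big_seq1 eqxx /xmon' /smono big1 ?scale1r // => i _.
by rewrite ffunE expr0.
Qed.

Lemma xexp_ex (M : lmodType (uea g)) (v : M) :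
  (forall i (w : M), exists k, ushift zeta (u i) ^+ k *: w = 0) -> exists va, xexp v va.
Proof.
move=> /(xmon_span df v) [s [va [us sX vK E]]].
exists (fun a => if a \in s then va a else 0); split=> [a|].
  by case: ifP => // _; apply: Kwh0.
exists s; split=> // [a /negPf ->//|]; rewrite E.
by apply: eq_big_seq => a ->.
Qed.

(** Each application raises the shift by at least 1 while [N] stays fixed, so [N.+1] applications
    leave nothing. *)
Lemma S_nilp (M : lmodType (uea g)) (v : M) c N l y w : Kwh v ->
  y \in (neg_part h :&: K)%VS -> kfil h K v c N l w ->
  exists k, ushift zeta y ^+ k *: w = 0.
Proof.
move=> vK ym wN.
suff H k : kfil h K v (c + k) N 0 (ushift zeta y ^+ k *: w).
  by exists N.+1; apply: kfil_low (H _); rewrite addnS ltnS leq_addl.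
elim: k => [|k IH].
  by rewrite expr0 scale1r; apply: kfil_sub wN => s p; clear; lia.
rewrite exprS -scalerA; move: (_ ^+ k *: w) IH => w' IH.
have [e ->] := codom_coords (df_basis df) ym.
rewrite linear_sum scaler_suml; apply: fspan_sum => i _.
rewrite linearZ /= algZ; apply: fspanZ.
apply: kfil_sub (kfil_S df vK (u_mK df i) (df_upar df i) (df_ugr df i) IH) => s p.
by move: (df_d df i); clear; lia.
Qed.

End Expansion.

Section UeaInduction.
Variables (F : fieldType) (g : lieSuper F).

Lemma uea_ind (P : uea g -> Prop) : P 1 -> (forall x, P (ugen x)) ->
  (forall c y, P y -> P (c *: y)) -> (forall y z, P y -> P z -> P (y + z)) ->
  (forall y z, P y -> P z -> P (y * z)) -> forall y, P y.
Proof.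
move=> P1 PG PZ PD PM y; rewrite -(ureprK y).
elim: (urep y) => [x||| t|s IHs t|s IHs t|c t] //.
- exact: PG.
- have -> : ucl (UZero g) = 0 *: 1 by rewrite scale0r.
  exact: PZ.
- move=> IHt; rewrite (_ : ucl _ = (-1) *: ucl t); first exact: PZ.
  by rewrite scaleN1r; apply/esym; apply: uclN.
- by move=> IHt; rewrite -uclD; apply: PD.
- by move=> IHt; rewrite -uclM; apply: PM.
- by move=> IHt; rewrite -uclZ; apply: PZ.
Qed.

Lemma uea_act (M : lmodType (uea g)) (P : M -> Prop) :
  (forall v w, P v -> P w -> P (v + w)) -> (forall (c : F) v, P v -> P (c%:A *: v)) ->
  (forall y v, P v -> P (ugen y *: v)) -> forall y v, P v -> P (y *: v).
Proof.
move=> PD PZ PG; apply: uea_ind => [v|y v|c y IH v|y z IHy IHz v|y z IHy IHz v] Pv.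
- by rewrite scale1r.
- exact: PG.
- by rewrite algZ; apply/PZ/IH.
- by rewrite scalerDl; apply: PD; [apply: IHy|apply: IHz].
- by rewrite -scalerA; apply/IHy/IHz.
Qed.

End UeaInduction.

Section TensorLift.
Variables (A : pzRingType) (M : lmodType A) (V : lmodType (endop M)).
Local Notation T := (tensor V).

Lemma tensDl q q' (v : V) : tens (q + q') v = tens q v + tens q' v.
Proof. by rewrite taddE /tens tclD; apply/tclP; constructor. Qed.
Lemma tensDr q (v v' : V) : tens q (v + v') = tens q v + tens q v'.
Proof. by rewrite taddE /tens tclD; apply/tclP; constructor. Qed.
Lemma tens_bal q w (v : V) : tens (endact q w) v = tens q (w *: v).
Proof. by apply/tclP; constructor. Qed.
Lemma tensZ a q (v : V) : a *: tens q v = tens (a *: q) v.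
Proof. by rewrite tscaleE tclZ. Qed.
Lemma tens0l (v : V) : tens 0 v = 0.
Proof. by have := tensDl 0 0 v; rewrite addr0 => /(congr1 (+%R (- tens 0 v)));
  rewrite addNr addKr. Qed.
Lemma tens0r q : tens q (0 : V) = 0.
Proof. by have := tensDr q (0 : V) 0; rewrite addr0 => /(congr1 (+%R (- tens q 0)));
  rewrite addNr addKr. Qed.
Lemma tensNl q (v : V) : tens (- q) v = - tens q v.
Proof. by apply/eqP; rewrite -addr_eq0 -tensDl addNr tens0l. Qed.
Lemma tens_suml (I : Type) (s : seq I) (f : I -> M) (v : V) :
  tens (\sum_(i <- s) f i) v = \sum_(i <- s) tens (f i) v.
Proof. by elim/big_rec2: _ => [|i y1 y2 _ <-]; rewrite ?tens0l ?tensDl. Qed.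
Lemma tens_sumr (I : Type) (s : seq I) (f : I -> V) q :
  tens q (\sum_(i <- s) f i) = \sum_(i <- s) tens q (f i).
Proof. by elim/big_rec2: _ => [|i y1 y2 _ <-]; rewrite ?tens0r ?tensDr. Qed.

(** Negation and zero are absorbed by pure tensors, since -(q (x) v) = (-q) (x) v; the proof carries
    [P t] and [P (- t)] together. *)
Lemma tens_ind (P : T -> Prop) : (forall q v, P (tens q v)) ->
  (forall t t', P t -> P t' -> P (t + t')) -> forall t, P t.
Proof.
move=> PG PD t; rewrite -(trepK t).
suff [//] : P (tcl (trep t)) /\ P (- tcl (trep t)).
elim: (trep t) => [q v||s|s [IHs IHs'] s' [IHt IHt']].
- by split; [apply: PG|rewrite -tensNl; apply: PG].
- have P0 : P 0 by rewrite -(tens0l 0); apply: PG.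
  have -> : tcl (TZero V) = 0 by [].
  by rewrite oppr0.
- rewrite (_ : tcl (TOpp s) = - tcl s) ?opprK; first by case.
  by apply/esym; apply: tclN.
- by rewrite -tclD -taddE opprD; split; apply: PD.
Qed.

Variables (N : zmodType) (f : M -> V -> N).
Hypothesis fDl : forall q q' v, f (q + q') v = f q v + f q' v.
Hypothesis fDr : forall q v v', f q (v + v') = f q v + f q v'.
Hypothesis fbal : forall q w v, f (endact q w) v = f q (w *: v).

Fixpoint tlift_term (t : tterm V) : N :=
  match t with
  | TGen q v => f q v
  | TZero => 0
  | TOpp s => - tlift_term s
  | TAdd s s' => tlift_term s + tlift_term s'
  end.

Definition tlift (t : T) : N := tlift_term (trep t).

Lemma tlift_termP s t : teq s t -> tlift_term s = tlift_term t.
Proof.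
elim=> //=.
- by move=> a b c _ -> _ ->.
- by move=> a b _ ->.
- by move=> a b c e _ -> _ ->.
- by move=> a b c; rewrite addrA.
- by move=> a b; rewrite addrC.
- by move=> a; rewrite add0r.
- by move=> a; rewrite addNr.
Qed.

Lemma tlift_cl t : tlift (tcl t) = tlift_term t.
Proof. exact/tlift_termP/trepE. Qed.

Lemma tlift_tens q v : tlift (tens q v) = f q v.
Proof. exact: tlift_cl. Qed.

Lemma tliftD : {morph tlift : t t' / t + t'}.
Proof.
by move=> t t'; rewrite -(trepK t) -(trepK t') taddE tclD !tlift_cl.
Qed.

End TensorLift.

Section BijectiveLinear.
Variables (A : pzRingType) (M N : lmodType A) (f : {linear M -> N}).
Hypothesis fB : (forall v, f v = 0 -> v = 0) /\ (forall w, exists v, f v = w).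

Lemma linear_inverse : exists f' : {linear N -> M}, cancel f f' /\ cancel f' f.
Proof.
pose k w := projT1 (cid (fB.2 w)).
have fk w : f (k w) = w by rewrite /k; case: cid.
have inj v w : f v = f w -> v = w.
  by move=> E; apply/eqP; rewrite -subr_eq0; apply/eqP/fB.1; rewrite linearB E subrr.
have kf v : k (f v) = v by apply: inj; rewrite fk.
have kl : linear k by move=> a v w; apply: inj; rewrite linearP !fk.
exists (HB.pack_for {linear N -> M} k (GRing.isLinear.Build A N M *:%R k kl)).
by split.
Qed.

End BijectiveLinear.

Section WhittakerTheory.
Variables (F : numFieldType) (g : lieSuper F) (h : g) (zeta : {scalar g}).
Variables (r' r : nat) (u x : 'I_r -> g) (d : 'I_r -> nat).
Hypothesis df : dual_families h zeta fullv r' u x d.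
Local Notation idx := {ffun 'I_r -> nat}.
Local Notation m := (neg_part h).
Local Notation U := (uea g).
Local Notation Q := (Qz m zeta).
Local Notation W := (Wz m zeta).
Local Notation Wh := (wh m zeta).
Local Notation q1 := (one_z m zeta).

Lemma is_whP (M : lmodType U) (v : M) : is_wh m zeta v <-> Kwh h zeta fullv v.
Proof.
split=> H y; first rewrite capvf => /H E.
  by rewrite scalerBl E subrr.
by move=> ym; apply/eqP; rewrite -subr_eq0 -scalerBl; apply/eqP/H; rewrite capvf.
Qed.

Lemma wh_Kwh (M : lmodType U) (v : Wh M) : Kwh h zeta fullv (val v).
Proof. by apply/is_whP => y; apply: whP. Qed.

Definition mkwh (M : lmodType U) (v : M) (vK : Kwh h zeta fullv v) : Wh M :=
  MkWh (introT (wh_predP m zeta v) ((is_whP v).2 vK)).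

(** Evaluation at 1_zeta identifies W_zeta with the Whittaker vectors of Q_zeta; this is the map
    back. *)
Definition wend (v : Wh Q) : W := mkend (@wh_hom_linear _ _ _ _ _ v).

Lemma wendE (v : Wh Q) y : endact (y *: q1) (wend v) = y *: val v.
Proof. by rewrite endactZl; congr (_ *: _); apply: wh_hom1. Qed.

Lemma wend1 (v : Wh Q) : endact q1 (wend v) = val v.
Proof. exact: wh_hom1. Qed.

Lemma qgen (q : Q) : q = qrep q *: q1.
Proof. by rewrite -[LHS]qrepK qclE. Qed.

Lemma W_ext (w w' : W) : endact q1 w = endact q1 w' -> w = w'.
Proof. by move=> E; apply: endop_ext => q; rewrite (qgen q) !endactZl E. Qed.

Lemma q1_Kwh : Kwh h zeta fullv q1.
Proof. by apply/is_whP => y; apply: one_z_wh. Qed.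

Lemma W_Kwh (w : W) : Kwh h zeta fullv (endact q1 w).
Proof. by move=> y ym; rewrite -endactZl q1_Kwh //; apply: (linear0 (w : {linear Q -> Q})). Qed.

(** The premise says, as an induction principle, that Whittaker vectors generate [M]. In the module
    generated by one of them every vector lies in some [kfil], where elements of m act
    nilpotently. *)
Lemma gen_Wmod (M : lmodType U) :
  (forall P : M -> Prop, (forall v w, P v -> P w -> P (v + w)) ->
     (forall y v, Kwh h zeta fullv v -> P (y *: v)) -> forall v, P v) ->
  in_Wmod m zeta M.
Proof.
move=> gen y ym; apply: gen => [v w [k Ek] [l El]|z v vK].
  exists (k + l)%N; rewrite scalerDr {1}addnC !exprD -!scalerA Ek El !scaler0.
  by rewrite addr0.
suff [N [l H]] : exists N l, kfil h fullv v 0 N l (z *: v).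
  by apply: (S_nilp df vK _ H); rewrite capvf.
move: z v vK => z v vK; apply: (uea_act (P := fun w => exists N l, kfil h fullv v 0 N l w)).
- move=> w1 w2 [N1 [l1 H1]] [N2 [l2 H2]]; exists (N1 + N2).+1, 0%N; apply: fspanD.
    by apply: kfil_sub H1 => s p; clear; lia.
  by apply: kfil_sub H2 => s p; clear; lia.
- by move=> c w [N [l H]]; exists N, l; apply: fspanZ.
- by move=> y' w [N [l H]]; exact: (kfil_gen df vK (memvf y') H).
- by exists 0%N, 0%N; apply: kfil_nil.
Qed.

Lemma Q_Wmod : in_Wmod m zeta Q.
Proof.
apply: gen_Wmod => P PD PG q; rewrite (qgen q); apply: PG; exact: q1_Kwh.
Qed.

Lemma tens1_Kwh (V : lmodType W) (v : V) : Kwh h zeta fullv (tens q1 v).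
Proof. by move=> y ym; rewrite tensZ q1_Kwh // tens0l. Qed.

Lemma tensE (V : lmodType W) q (v : V) : tens q v = qrep q *: tens q1 v.
Proof. by rewrite tensZ -qgen. Qed.

Lemma tensor_Wmod (V : lmodType W) : in_Wmod m zeta (@tensor U Q V).
Proof.
apply: gen_Wmod => P PD PG; apply: tens_ind => // q v.
rewrite tensE; apply: PG; exact: tens1_Kwh.
Qed.

Lemma Wmod_nil (M : lmodType U) : in_Wmod m zeta M ->
  forall i (w : M), exists k, ushift zeta (u i) ^+ k *: w = 0.
Proof. by move=> MW i w; apply: MW; have := u_mK df i; rewrite capvf. Qed.

Lemma Wmod_xexp (M : lmodType U) (v : M) : in_Wmod m zeta M ->
  exists va, xexp h zeta fullv r' x v va.
Proof. by move=> MW; apply: (xexp_ex df); apply: Wmod_nil. Qed.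

Section Counit.
Variable M : lmodType U.

Definition counit_fun (q : Q) (v : Wh M) : M := wh_hom v q.

Lemma counit_Dl q q' v : counit_fun (q + q') v = counit_fun q v + counit_fun q' v.
Proof. exact: (linearD (wh_hom v : {linear Q -> M})). Qed.
Lemma counit_Dr q v v' : counit_fun q (v + v') = counit_fun q v + counit_fun q v'.
Proof. exact: scalerDr. Qed.
Lemma counit_bal q w v : counit_fun (endact q w) v = counit_fun q (w *: v).
Proof. by rewrite /counit_fun [in RHS]wh_hom_act. Qed.

Definition counit : @tensor U Q (Wh M) -> M := tlift counit_fun.

Lemma counit_tens q v : counit (tens q v) = qrep q *: val v.
Proof. exact: (tlift_tens counit_Dl counit_Dr counit_bal). Qed.

Lemma counit_linear : linear counit.
Proof.
move=> a t t'; rewrite /counit (tliftD counit_Dl counit_Dr counit_bal); congr (_ + _).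
move: t; apply: tens_ind => [q v|s s' Es Es'].
  rewrite tensZ !(tlift_tens counit_Dl counit_Dr counit_bal).
  exact: wh_homZ.
by rewrite scalerDr !(tliftD counit_Dl counit_Dr counit_bal) scalerDr Es Es'.
Qed.
HB.instance Definition _ :=
  GRing.isLinear.Build U (@tensor U Q (Wh M)) M *:%R counit counit_linear.

End Counit.

Section Unit.
Variable V : lmodType W.

Definition whunit (v : V) : Wh (@tensor U Q V) := mkwh (tens1_Kwh v).

Lemma whunit_linear : linear whunit.
Proof.
move=> w v v'; apply: val_inj; rewrite /= tensDr; congr (_ + _).
by rewrite -tens_bal /wh_hom /= tensE.
Qed.
HB.instance Definition _ :=
  GRing.isLinear.Build W V (Wh (@tensor U Q V)) *:%R whunit whunit_linear.

End Unit.

(** The coefficients of an element of Q_zeta have the form 1_zeta w_a, and w_a moves across the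
    tensor sign. *)
Lemma tens_xexp (V : lmodType W) (t : @tensor U Q V) :
  exists va : idx -> V, xexp h zeta fullv r' x t (fun a => tens q1 (va a)).
Proof.
move: t; apply: tens_ind => [q v|t t' [va Ha] [va' Ha']].
  have [qa [qK [s [us sX s0 E]]]] := Wmod_xexp q Q_Wmod.
  exists (fun a => wend (mkwh (qK a)) *: v).
  have Ea a : tens q1 (wend (mkwh (qK a)) *: v) = tens (qa a) v.
    by rewrite -tens_bal wend1.
  split=> [a|]; first exact: tens1_Kwh.
  exists s; split=> // [a /s0 E0|]; first by rewrite Ea E0 tens0l.
  rewrite E tens_suml; apply: eq_bigr => a _.
  by rewrite Ea tensZ.
exists (fun a => va a + va' a).
have := xexpD Ha Ha'; congr (xexp _ _ _ _ _ _ _).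
by apply/funext => a; rewrite tensDr.
Qed.

(** Both halves compare expansions in the x^a: existence in [M] gives surjectivity, and uniqueness
    makes every coefficient of a kernel element vanish. *)
Lemma counit_bij (M : lmodType U) : in_Wmod m zeta M ->
  (forall t, counit t = 0 :> M -> t = 0) /\ (forall v : M, exists t, counit t = v).
Proof.
move=> MW; split=> [t t0|v].
  have [va Ha] := tens_xexp t.
  have Hc := xexp_map (counit (M := M) : {linear _ -> _}) Ha.
  have H0 := xexp_wh r' x (@Kwh0 _ _ h zeta fullv M).
  rewrite /= t0 in Hc.
  have va0 a : va a = 0.
    apply: val_inj; have := xexp_uniq df Hc H0 a; rewrite if_same counit_tens => E0.
    exact: etrans (esym (wh_hom1 (va a))) E0.
  case: Ha => _ [s [_ _ _ ->]]; rewrite big1 // => a _.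
  by rewrite va0 tens0r scaler0.
have [va [vK [s [us sX s0 ->]]]] := Wmod_xexp v MW.
exists (\sum_(a <- s) xmon' x a *: tens q1 (mkwh (vK a))).
rewrite (linear_sum (counit (M := M) : {linear _ -> _})); apply: eq_bigr => a _.
rewrite (linearZ_LR (counit (M := M) : {linear _ -> _})) /= counit_tens; congr (_ *: _).
exact: (wh_hom1 (mkwh (vK a))).
Qed.

(** The coefficient at exponent 0, a retraction of Q_zeta onto its Whittaker vectors that respects
    the right action. *)
Definition wcoef (q : Q) : Q := projT1 (cid (Wmod_xexp q Q_Wmod)) [ffun=> 0%N].

Lemma wcoefE q qa : xexp h zeta fullv r' x q qa -> wcoef q = qa [ffun=> 0%N].
Proof. by rewrite /wcoef; case: cid => qa' H' /= H; exact: (xexp_uniq df H' H). Qed.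

Lemma wcoef_Kwh q : Kwh h zeta fullv (wcoef q).
Proof. by rewrite /wcoef; case: cid => qa [qK H]. Qed.

Lemma wcoefD q q' : wcoef (q + q') = wcoef q + wcoef q'.
Proof.
have [qa H] := Wmod_xexp q Q_Wmod; have [qa' H'] := Wmod_xexp q' Q_Wmod.
by rewrite (wcoefE H) (wcoefE H') (wcoefE (xexpD H H')).
Qed.

Lemma wcoef_act q w : wcoef (endact q w) = endact (wcoef q) w.
Proof.
have [qa H] := Wmod_xexp q Q_Wmod.
by rewrite (wcoefE H) (wcoefE (xexp_map (w : {linear Q -> Q}) H)).
Qed.

Lemma wcoef_1 : wcoef q1 = q1.
Proof. by rewrite (wcoefE (xexp_wh r' x q1_Kwh)) eqxx. Qed.

Definition coefW (q : Q) : W := wend (mkwh (wcoef_Kwh q)).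

Lemma coefWE q : endact q1 (coefW q) = wcoef q.
Proof. exact: wend1. Qed.

(** A Whittaker tensor is its own expansion, concentrated at exponent 0, and [tens_xexp] gives that
    coefficient as 1_zeta (x) v. Injectivity comes from the retraction [coefW], which recovers v
    from 1_zeta (x) v. *)
Lemma whunit_bij (V : lmodType W) :
  (forall v : V, whunit v = 0 -> v = 0) /\
  (forall t : Wh (@tensor U Q V), exists v, whunit v = t).
Proof.
split=> [v v0|t].
  pose f q (v : V) := coefW q *: v.
  have fDl q q' v' : f (q + q') v' = f q v' + f q' v'.
    rewrite /f -scalerDl; congr (_ *: _); apply: W_ext.
    by rewrite endactDr !coefWE wcoefD.
  have fDr q v' v'' : f q (v' + v'') = f q v' + f q v'' by apply: scalerDr.
  have fb q w v' : f (endact q w) v' = f q (w *: v').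
    rewrite /f scalerA; congr (_ *: _); apply: W_ext.
    by rewrite endactM !coefWE wcoef_act.
  have := tlift_tens fDl fDr fb q1 v; rewrite -[tens q1 v]/(val (whunit v)) v0 /=.
  have -> : tlift f 0 = 0 by rewrite -(tens0l 0) (tlift_tens fDl fDr fb) /f scaler0.
  move=> ->; rewrite /f (_ : coefW q1 = 1) ?scale1r //.
  by apply: W_ext; rewrite coefWE wcoef_1 endact1.
have [va Ha] := tens_xexp (val t).
exists (va [ffun=> 0%N]); apply: val_inj => /=.
have := xexp_uniq df Ha (xexp_wh r' x (wh_Kwh t)) [ffun=> 0%N].
by rewrite eqxx.
Qed.

Lemma right_basis_xmon :
  right_basis (fun a : multi_index r' r => xmon x a *: q1).
Proof.
have wa (w : multi_index r' r -> W) a :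
    endact (xmon x a *: q1) (w a) = xmon' x (val a) *: endact q1 (w a).
  by rewrite endactZl.
split=> [q|s w us].
  have [qa [qK [s [us sX s0 E]]]] := Wmod_xexp q Q_Wmod.
  exists (pmap insub s), (fun a => wend (mkwh (qK (val a)))).
  rewrite (eq_bigr _ (fun a _ => wa (fun a => wend (mkwh (qK (val a)))) a)).
  under eq_bigr => a _ do rewrite wend1 /=.
  rewrite E -(big_map val xpredT (fun a : idx => xmon' x a *: qa a)) /=.
  congr (\sum_(a <- _) _); rewrite pmap_filter; last by move=> a; rewrite insubK.
  apply/esym/all_filterP/allP => a /sX aX /=.
  by rewrite insubT.
rewrite (eq_bigr _ (fun a _ => wa w a)) => E a as'.
(* Exponents outside X get the coefficient 0, so that freeness over plain exponent functions
   applies. *)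
pose qa (b : idx) : Q := if insub b is Some b' then endact q1 (w b') else 0.
have qE b : endact q1 (w b) = qa (val b) by rewrite /qa valK.
rewrite (eq_bigr (fun b => xmon' x (val b) *: qa (val b))) in E; last by move=> b _; rewrite qE.
rewrite -(big_map val xpredT (fun b : idx => xmon' x b *: qa b)) in E.
apply: W_ext; rewrite qE (_ : endact q1 0 = 0) //.
apply: (xmon_free df _ _ _ E); last exact: map_f.
- by rewrite map_inj_uniq //; apply: val_inj.
- by move=> _ /mapP[b _ ->]; apply: (valP b).
- by move=> b; rewrite /qa; case: insub => [b'|]; [apply: W_Kwh|apply: Kwh0].
Qed.

End WhittakerTheory.

(** * Gradings and equivalences *)

Section SuperGeneric.
Variables (A : pzRingType) (Apart : bool -> A -> Prop).
Hypothesis ApartN1 : Apart false (-1).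
Implicit Type M : supermod Apart.

Lemma sm0 M i : smpart M i 0. Proof. by have [/(_ i)[]] := smodP M. Qed.
Lemma smD M i v w : smpart M i v -> smpart M i w -> smpart M i (v + w).
Proof. by have [/(_ i)[_ +] _ _ _] := smodP M; apply. Qed.
Lemma smA M i j a v : Apart i a -> smpart M j v -> smpart M (i (+) j) (a *: v).
Proof. by have [_ + _ _] := smodP M; apply. Qed.
Lemma smN M i v : smpart M i v -> smpart M i (- v).
Proof. by move=> vi; rewrite -scaleN1r; apply: (smA ApartN1 vi). Qed.
Lemma sm_dec M (v : M) : exists v0 v1, [/\ smpart M false v0, smpart M true v1 & v = v0 + v1].
Proof. by have [_ _ + _] := smodP M; apply. Qed.
Lemma sm_dir M (v : M) : smpart M false v -> smpart M true v -> v = 0.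
Proof. by have [_ _ _ +] := smodP M; apply. Qed.

Lemma sm_sum0 M i (v w : M) : smpart M i v -> smpart M (~~ i) w -> v + w = 0 ->
  v = 0 /\ w = 0.
Proof.
move=> vi wi E; have v0 : v = 0.
  have vw : v = - w by apply/eqP; rewrite -addr_eq0 E.
  by case: i vi wi => vi wi; apply: sm_dir => //; rewrite vw; apply: smN.
by split=> //; move: E; rewrite v0 add0r.
Qed.

Definition sgn (M : zmodType) (i : bool) (v : M) : M := if i then - v else v.

Lemma sgnD (M : zmodType) i : {morph @sgn M i : v w / v + w}.
Proof. by case: i => v w //=; rewrite opprD. Qed.

Lemma smsig_ex M (v : M) : exists w, exists v0 v1,
  [/\ smpart M false v0, smpart M true v1, v = v0 + v1 & w = v0 - v1].
Proof. by have [v0 [v1 [p0 p1 E]]] := sm_dec v; exists (v0 - v1), v0, v1. Qed.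

(** The parity involution. On gradings given only by generators, the parts are shown to meet
    trivially because they are eigenspaces of such an involution for 1 and -1. *)
Definition smsig M (v : M) : M := projT1 (cid (smsig_ex v)).

Lemma smsigE M (v0 v1 : M) : smpart M false v0 -> smpart M true v1 ->
  smsig (v0 + v1) = v0 - v1.
Proof.
move=> p0 p1; rewrite /smsig; case: cid => w /= [w0 [w1 [q0 q1 E ->]]].
have [] := @sm_sum0 M false (v0 - w0) (v1 - w1); try by apply: smD => //; apply: smN.
  by rewrite addrACA -opprD E subrr.
by move=> /eqP; rewrite subr_eq0 => /eqP -> /eqP; rewrite subr_eq0 => /eqP ->.
Qed.

Lemma smsig_part M i (v : M) : smpart M i v -> smsig v = sgn i v.
Proof.
case: i => vi.
  by have := smsigE (sm0 M false) vi; rewrite add0r sub0r.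
by have := smsigE vi (sm0 M true); rewrite addr0 subr0.
Qed.

Lemma smsigD M : {morph @smsig M : v w / v + w}.
Proof.
move=> v w; have [v0 [v1 [p0 p1 ->]]] := sm_dec v.
have [w0 [w1 [q0 q1 ->]]] := sm_dec w.
rewrite addrACA !smsigE //; first by rewrite opprD addrACA.
  exact: smD.
exact: smD.
Qed.

(** [f] sends the component of f'(w) of the wrong parity into both parts at once, hence to zero, and
    [f] is injective. *)
Lemma inverse_parity (M N : supermod Apart) (f : {linear M -> N}) (f' : {linear N -> M}) :
  preserves_parity f -> cancel f f' -> cancel f' f -> preserves_parity f'.
Proof.
move=> fp fK f'K i w wi; have [v0 [v1 [p0 p1 E]]] := sm_dec (f' w).
have Ew : f v0 + f v1 = w by rewrite -linearD -E f'K.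
rewrite E; case: i wi => wi.
  have [|f0 _] := @sm_sum0 N false (f v0) (f v1 - w) (fp _ _ p0) (smD (fp _ _ p1) (smN wi)).
    by rewrite addrA Ew subrr.
  by rewrite -(fK v0) f0 linear0 add0r.
have [|f0 _] := @sm_sum0 N true (f v1) (f v0 - w) (fp _ _ p1) (smD (fp _ _ p0) (smN wi)).
  by rewrite addrCA addrA Ew subrr.
by rewrite -(fK v1) f0 linear0 addr0.
Qed.

End SuperGeneric.

Section Parity.
Variables (F : numFieldType) (g : lieSuper F).
Local Notation U := (uea g).

Definition gsig : 'End(g) :=
  (daddv_pi (even_part g) (odd_part g) - daddv_pi (odd_part g) (even_part g))%R.

Lemma gsig_part i x : x \in lpart g i -> gsig x = sgn i x.
Proof.
have dir : (even_part g :&: odd_part g)%VS = 0%VS by exact: lpart_direct.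
have dir' : (odd_part g :&: even_part g)%VS = 0%VS by rewrite capvC.
rewrite /gsig add_lfunE opp_lfunE; case: i => xi /=.
  have /= := daddv_pi_add dir' (_ : x \in odd_part g + even_part g)%VS.
  rewrite (daddv_pi_id dir' xi) memvE => /(_ (subv_trans xi (addvSl _ _))) /eqP.
  by rewrite -subr_eq0 addrC addrA addNr add0r => /eqP ->; rewrite sub0r.
have /= := daddv_pi_add dir (_ : x \in even_part g + odd_part g)%VS.
rewrite (daddv_pi_id dir xi) memvE => /(_ (subv_trans xi (addvSl _ _))) /eqP.
by rewrite -subr_eq0 addrC addrA addNr add0r => /eqP ->; rewrite subr0.
Qed.

Lemma gsig_mem i x : x \in lpart g i -> gsig x \in lpart g i.
Proof. by move=> xi; rewrite (gsig_part xi); case: i xi => //= xi; rewrite memvN. Qed.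

Fixpoint usig_term (t : uterm g) : uterm g :=
  match t with
  | UGen x => UGen (gsig x)
  | UZero => UZero g
  | UOne => UOne g
  | UOpp s => UOpp (usig_term s)
  | UAdd s s' => UAdd (usig_term s) (usig_term s')
  | UMul s s' => UMul (usig_term s) (usig_term s')
  | UScale a s => UScale a (usig_term s)
  end.

Lemma usig_termP s t : ueq s t -> ueq (usig_term s) (usig_term t).
Proof.
elim=> /=; try by constructor.
- by move=> s1 t1 u1 _ st _ tu; apply: ueq_trans tu.
- by move=> a x y; rewrite linearP; constructor.
move=> i j x y xi yj; rewrite (_ : gsig [lie x, y] = [lie gsig x, gsig y]).
  by apply: ueq_lie; apply: gsig_mem.
rewrite (gsig_part xi) (gsig_part yj) (gsig_part (lbr_part xi yj)).
by case: i {xi} => /=; case: j {yj} => /=; rewrite ?lbrNl ?lbrNr ?opprK.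
Qed.

Lemma ucl_add s t : ucl s + ucl t = ucl (UAdd s t) :> U. Proof. exact: uclD. Qed.
Lemma ucl_mul s t : ucl s * ucl t = ucl (UMul s t) :> U. Proof. exact: uclM. Qed.
Lemma ucl_scale c t : c *: ucl t = ucl (UScale c t) :> U. Proof. exact: uclZ. Qed.

(** The automorphism of U(g) that changes the sign of odd generators; it detects parity without a
    basis of U(g). *)
Definition usig (u : U) : U := ucl (usig_term (urep u)).

Lemma usig_cl t : usig (ucl t) = ucl (usig_term t).
Proof. by apply/uclP; apply: usig_termP (urepE t). Qed.
Lemma usigD : {morph usig : u v / u + v}.
Proof. by move=> u v; rewrite -(ureprK u) -(ureprK v) ucl_add !usig_cl ucl_add. Qed.
Lemma usigM : {morph usig : u v / u * v}.
Proof. by move=> u v; rewrite -(ureprK u) -(ureprK v) ucl_mul !usig_cl ucl_mul. Qed.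
Lemma usigZ c : {morph usig : u / c *: u}.
Proof. by move=> u; rewrite -(ureprK u) ucl_scale !usig_cl ucl_scale. Qed.
Lemma usig0 : usig 0 = 0. Proof. exact: usig_cl. Qed.
Lemma usig1 : usig 1 = 1. Proof. exact: usig_cl. Qed.
Lemma usigN u : usig (- u) = - usig u.
Proof. by rewrite -scaleN1r usigZ scaleN1r. Qed.

Lemma usig_part i u : upart i u -> usig u = sgn i u.
Proof.
elim=> [j x xj|j||j v w _ IHv _ IHw|j c v _ IH|j k v w _ IHv _ IHw].
- rewrite [LHS]usig_cl /= (gsig_part xj); case: j {xj} => //=.
  exact: (linearN (@ugen F g)).
- by rewrite usig0; case: j => //=; rewrite oppr0.
- by rewrite usig1.
- by rewrite usigD IHv IHw sgnD.
- by rewrite usigZ IH; case: (j) => //=; rewrite scalerN.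
- by rewrite usigM IHv IHw; case: (j); case: (k) => //=; rewrite ?mulNr ?mulrN ?opprK.
Qed.

Lemma upart_dec (u : U) : exists u0 u1, [/\ upart false u0, upart true u1 & u = u0 + u1].
Proof.
move: u; apply: uea_ind => [|x|c u [u0 [u1 [p0 p1 ->]]]|u v|u v].
- by exists 1, 0; split; [constructor|constructor|rewrite addr0].
- have [x0 [x1 [p0 p1 ->]]] := part_decomp x.
  by exists (ugen x0), (ugen x1); split; [constructor|constructor|rewrite linearD].
- by exists (c *: u0), (c *: u1); split; [constructor|constructor|rewrite scalerDr].
- move=> [u0 [u1 [p0 p1 ->]]] [v0 [v1 [q0 q1 ->]]].
  by exists (u0 + v0), (u1 + v1); split; [constructor|constructor|rewrite addrACA].
move=> [u0 [u1 [p0 p1 ->]]] [v0 [v1 [q0 q1 ->]]].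
exists (u0 * v0 + u1 * v1), (u0 * v1 + u1 * v0); split.
- apply: upartD; first exact: (upartM p0 q0).
  exact: (upartM p1 q1).
- apply: upartD; first exact: (upartM p0 q1).
  exact: (upartM p1 q0).
by rewrite mulrDl !mulrDr -!addrA; congr (_ + _); rewrite addrCA addrA [RHS]addrC; congr (_ + _);
   rewrite addrC.
Qed.

Lemma upart_alg (c : F) : upart false (c%:A : U).
Proof. by apply: upartZ; apply: upart1. Qed.

Lemma upartN1 : upart false (-1 : U).
Proof. by rewrite -scaleN1r; apply: upart_alg. Qed.

End Parity.

Section WhittakerGrading.
Variables (F : numFieldType) (g : lieSuper F) (h : g) (zeta : {scalar g}).
Variables (r' r : nat) (u x : 'I_r -> g) (d : 'I_r -> nat).
Hypothesis df : dual_families h zeta fullv r' u x d.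
Local Notation m := (neg_part h).
Local Notation U := (uea g).
Local Notation Q := (Qz m zeta).
Local Notation W := (Wz m zeta).
Local Notation Wh := (wh m zeta).
Local Notation q1 := (one_z m zeta).
Local Notation upart := (@upart F g).
Local Notation qpart := (@qpart F g m zeta).
Local Notation wpart := (@wpart F g m zeta).

Lemma S_upart (i : 'I_r) : upart (r' <= i)%N (ushift zeta (u i)).
Proof.
rewrite /ushift; case: (boolP (r' <= i)%N) => ri.
  rewrite (um_odd0 df ri) scale0r subr0; apply: upart_gen.
  by have := df_upar df i; rewrite ri.
apply: upartD; first by apply: upart_gen; have := df_upar df i; rewrite (negPf ri).
by rewrite -scaleNr; apply: upart_alg.
Qed.

(** zeta vanishes on the odd [u i], so each [ushift zeta (u i)] is homogeneous and must kill both
    components separately. *)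
Lemma wh_components (M : supermod upart) (v0 v1 : M) :
  smpart M false v0 -> smpart M true v1 -> Kwh h zeta fullv (v0 + v1) ->
  Kwh h zeta fullv v0 /\ Kwh h zeta fullv v1.
Proof.
move=> p0 p1 /(KwhP df) vK.
have H (i : 'I_r) : ushift zeta (u i) *: v0 = 0 /\ ushift zeta (u i) *: v1 = 0.
  have /= := S_upart i; set b := (r' <= i)%N => Sp.
  have := vK i; rewrite scalerDr; apply: (sm_sum0 (upartN1 g) (i := b)).
    by have := smA Sp p0; rewrite addbF.
  by have := smA Sp p1; rewrite addbT.
by split; apply/(KwhP df) => i; case: (H i).
Qed.

Lemma qpartZ i j a q : upart i a -> qpart j q -> qpart (i (+) j) (a *: q).
Proof. by move=> ai [y yj ->]; exists (a * y); rewrite ?qcl_scale //; apply: upartM. Qed.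
Lemma qpart0 i : qpart i 0.
Proof. by exists 0; [apply: upart0|rewrite qclE scale0r]. Qed.
Lemma qpartD i q q' : qpart i q -> qpart i q' -> qpart i (q + q').
Proof. by move=> [y yi ->] [y' yi' ->]; exists (y + y'); [apply: upartD|rewrite qclD]. Qed.
Lemma qpartN i q : qpart i q -> qpart i (- q).
Proof. by move=> qi; rewrite -scaleN1r; apply: (qpartZ (upartN1 g) qi). Qed.
Lemma qpart_1 : qpart false q1.
Proof. by exists 1 => //; apply: upart1. Qed.

Lemma qcl_S i : qcl m zeta (ushift zeta (u i)) = 0.
Proof. by rewrite qclE; apply: (@q1_Kwh F g h zeta); apply: (u_mK df). Qed.

(** The left ideal is generated by the homogeneous elements [ushift zeta (u i)], hence is stable
    under the sign automorphism. *)
Lemma qcl_usig y y' : qcl m zeta y = qcl m zeta y' ->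
  qcl m zeta (usig y) = qcl m zeta (usig y').
Proof.
move/qclP/idealP=> [n [a [s [sS E]]]].
apply/eqP; rewrite -subr_eq0; apply/eqP.
have -> : qcl m zeta (usig y) - qcl m zeta (usig y') = qcl m zeta (usig (y - y')).
  by rewrite usigD usigN !qclE scalerBl.
rewrite (_ : y - y' = \sum_i (a i : U) * (s i : U)); last exact: E.
rewrite (big_morph _ (@usigD F g) (@usig0 F g)) qclE scaler_suml big1 // => i _.
rewrite usigM -scalerA -qclE; have [z zm ->] := sS i.
have zm' : z \in (m :&: fullv)%VS by rewrite capvf.
have [c ->] := codom_coords (df_basis df) zm'.
rewrite linear_sum (big_morph _ (@usigD F g) (@usig0 F g)) qclE scaler_suml.
rewrite big1 ?scaler0 // => k _; rewrite linearZ usigZ (usig_part (S_upart k)).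
rewrite algZ -qclE; case: (r' <= k)%N => /=; last by rewrite qcl_S scaler0.
by rewrite qclE scaleNr -qclE qcl_S oppr0 scaler0.
Qed.

Definition qsig (q : Q) : Q := qcl m zeta (usig (qrep q)).

Lemma qsig_cl y : qsig (qcl m zeta y) = qcl m zeta (usig y).
Proof. by apply: qcl_usig; rewrite qrepK. Qed.

Lemma qsigD : {morph qsig : q q' / q + q'}.
Proof. by move=> q q'; rewrite -(qrepK q) -(qrepK q') -qclD !qsig_cl usigD qclD. Qed.

Lemma qsig_part i q : qpart i q -> qsig q = sgn i q.
Proof.
move=> [y yi ->]; rewrite qsig_cl (usig_part yi); case: i {yi} => //=.
by rewrite qclE scaleNr -qclE.
Qed.

Lemma double_eq0 (M : lmodType U) (v : M) : v = - v -> v = 0.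
Proof.
move/eqP; rewrite -addr_eq0 => /eqP E; apply: (@alg_eq0 F U M 2%:R); first by rewrite pnatr_eq0.
by rewrite -[2%:R]/(1 + 1) algDl alg1.
Qed.

Lemma Q_grading : super_grading upart qpart.
Proof.
split=> [i|i j a v|q|q q0 q1'].
- by split; [apply: qpart0|apply: qpartD].
- exact: qpartZ.
- have [y0 [y1 [p0 p1 E]]] := upart_dec (qrep q).
  exists (qcl m zeta y0), (qcl m zeta y1); split; [by exists y0|by exists y1|].
  by rewrite -qclD -E qrepK.
by apply: double_eq0; exact: etrans (esym (qsig_part q0)) (qsig_part q1').
Qed.

Definition Qs : supermod upart := Supermod Q_grading.

Lemma wpartN1 : wpart false (-1).
Proof. by move=> j q qj /=; exact: qpartN. Qed.

Lemma wend_part i (v : Wh Q) : qpart i (val v) -> wpart i (wend v).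
Proof.
move=> vi j q [y yj ->]; rewrite qclE wendE addbC.
exact: qpartZ.
Qed.

Lemma W_dec (w : W) : exists w0 w1, [/\ wpart false w0, wpart true w1 & w = w0 + w1].
Proof.
have [q0 [q1' [p0 p1 E]]] := sm_dec (endact q1 w : Qs).
have := W_Kwh w; rewrite E => /(@wh_components Qs _ _ p0 p1)[K0 K1].
exists (wend (mkwh K0)), (wend (mkwh K1)); split; try exact: wend_part.
by apply: W_ext; rewrite endactDr !wend1.
Qed.

Lemma wh_grading (M : supermod upart) : super_grading wpart (@whpart F g m zeta M).
Proof.
split=> [i|i j w v wi vj|v|v v0 v1].
- by split=> [|v w]; [apply: sm0|apply: smD].
- have [y yi E] := wi false q1 qpart_1; rewrite addbF in yi.
  by rewrite /whpart /= E wh_hom_cl; apply: smA.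
- have [v0 [v1 [p0 p1 E]]] := sm_dec (val v).
  have := wh_Kwh v; rewrite E => /(wh_components p0 p1)[K0 K1].
  by exists (mkwh K0), (mkwh K1); split=> //; apply: val_inj.
by apply: val_inj; apply: sm_dir v0 v1.
Qed.

Section TensorGrading.
Variable V : supermod wpart.
Local Notation T := (@tensor U Q V).
Local Notation tpart := (tpart (V := V)).

Definition tsig_fun (q : Q) (v : V) : T := tens (qsig q) (smsig v).

Lemma tsig_Dl q q' v : tsig_fun (q + q') v = tsig_fun q v + tsig_fun q' v.
Proof. by rewrite /tsig_fun qsigD tensDl. Qed.
Lemma tsig_Dr q v v' : tsig_fun q (v + v') = tsig_fun q v + tsig_fun q v'.
Proof. by rewrite /tsig_fun (smsigD wpartN1) tensDr. Qed.

Lemma tens_sgn i j q (v : V) : tens (sgn i q) (sgn j v) = sgn (i (+) j) (tens q v) :> T.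
Proof.
have N q' v' : tens q' (- v') = - tens q' v' :> T.
  by apply/eqP; rewrite -addr_eq0 -tensDr addNr tens0r.
by case: i; case: j => //=; rewrite ?tensNl ?N ?opprK.
Qed.

(** Both sides are additive in the three arguments, so it suffices to compare signs on homogeneous
    ones. *)
Lemma tsig_bal q w v : tsig_fun (endact q w) v = tsig_fun q (w *: v).
Proof.
have [q0 [q1' [p0 p1 E]]] := sm_dec (q : Qs).
have [v0 [v1 [o0 o1 E']]] := sm_dec v; have [w0 [w1 [n0 n1 E'']]] := W_dec w.
have hom i j k q2 w2 v2 : qpart i q2 -> wpart j w2 -> smpart V k v2 ->
    tsig_fun (endact q2 w2) v2 = tsig_fun q2 (w2 *: v2).
  move=> qi wj vk; rewrite /tsig_fun (qsig_part qi) (qsig_part (wj _ _ qi)).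
  rewrite (smsig_part wpartN1 vk) (smsig_part wpartN1 (smA wj vk)) !tens_sgn tens_bal.
  by rewrite addbA [j (+) i]addbC.
rewrite (E : q = q0 + q1') E' E'' endactDl !endactDr !tsig_Dl !tsig_Dr.
rewrite !scalerDl !scalerDr !tsig_Dr.
rewrite (hom _ _ _ _ _ _ p0 n0 o0) (hom _ _ _ _ _ _ p0 n0 o1).
rewrite (hom _ _ _ _ _ _ p0 n1 o0) (hom _ _ _ _ _ _ p0 n1 o1).
rewrite (hom _ _ _ _ _ _ p1 n0 o0) (hom _ _ _ _ _ _ p1 n0 o1).
by rewrite (hom _ _ _ _ _ _ p1 n1 o0) (hom _ _ _ _ _ _ p1 n1 o1).
Qed.

Definition tsig : T -> T := tlift tsig_fun.

Lemma tsig_part i t : tpart i t -> tsig t = sgn i t.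
Proof.
elim=> [j k q v qj vk|j|j s s' _ IH _ IH'].
- rewrite /tsig (tlift_tens tsig_Dl tsig_Dr tsig_bal) /tsig_fun.
  by rewrite (qsig_part qj) (smsig_part wpartN1 vk) tens_sgn.
- have -> : tsig 0 = 0.
    rewrite -[in LHS](tens0l 0) /tsig (tlift_tens tsig_Dl tsig_Dr tsig_bal) /tsig_fun.
    by rewrite (qsig_part (qpart0 false)) tens0l.
  by case: j => //=; rewrite oppr0.
by rewrite /tsig (tliftD tsig_Dl tsig_Dr tsig_bal) -!/(tsig _) IH IH' sgnD.
Qed.

Lemma tensor_grading : super_grading upart tpart.
Proof.
split=> [i|i j a t ai|t|t t0 t1].
- by split; [apply: tpart0|apply: tpartD].
- elim=> [k l q v qk vl|k|k s s' _ IH _ IH'].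
  + by rewrite tensZ addbA; apply: tpart_gen vl; apply: qpartZ.
  + by rewrite scaler0; apply: tpart0.
  + by rewrite scalerDr; apply: tpartD.
- move: t; apply: tens_ind => [q v|t t' [t0 [t1 [p0 p1 ->]]] [t0' [t1' [p0' p1' ->]]]].
    have [q0 [q1' [p0 p1 E]]] := sm_dec (q : Qs); have [v0 [v1 [o0 o1 E']]] := sm_dec v.
    exists (tens q0 v0 + tens q1' v1), (tens q0 v1 + tens q1' v0); split.
    * by apply: tpartD; [apply: (tpart_gen p0 o0)|apply: (tpart_gen p1 o1)].
    * by apply: tpartD; [apply: (tpart_gen p0 o1)|apply: (tpart_gen p1 o0)].
    rewrite (E : q = q0 + q1') E' tensDl !tensDr -!addrA; congr (_ + _).
    by rewrite addrCA addrA [RHS]addrC; congr (_ + _); rewrite addrC.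
  by exists (t0 + t0'), (t1 + t1'); split; [apply: tpartD|apply: tpartD|rewrite addrACA].
by apply: double_eq0; exact: etrans (esym (tsig_part t0)) (tsig_part t1).
Qed.

End TensorGrading.

Lemma counit_parity (M : supermod upart) i t :
  tpart (V := Supermod (wh_grading M)) i t -> smpart M i (counit (h := h) (zeta := zeta) (M :=
    M) t).
Proof.
elim=> [j k q v [y yj ->] vk|j|j s s' _ IH _ IH'].
- rewrite counit_tens; have := wh_hom_cl v y; rewrite /wh_hom => ->.
  exact: smA.
- by rewrite (linear0 (counit (h := h) (zeta := zeta) (M := M) : {linear _ -> _})); apply: sm0.
by rewrite (linearD (counit (h := h) (zeta := zeta) (M := M) : {linear _ -> _})); apply: smD.
Qed.

Lemma whunit_parity (V : supermod wpart) i (v : V) : smpart V i v ->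
  whpart (M := Supermod (tensor_grading V)) i (whunit v).
Proof. by move=> vi; apply: (tpart_gen qpart_1 vi). Qed.

Section Equivalences.
Variables (P : lmodType U -> Prop) (P' : lmodType W -> Prop).
Hypothesis HWh : forall M, P M -> P' (Wh M).
Hypothesis HQ : forall V, P' V -> P (@tensor U Q V).
Hypothesis HPW : forall M, P M -> in_Wmod m zeta M.

Lemma counit_natural (M N : lmodType U) (f : {linear M -> N}) t :
  counit (h := h) (zeta := zeta) (tensor_map (@wh_map F g m zeta _ _ f) t) = f (counit (h := h)
    (zeta := zeta) t).
Proof.
move: t; apply: tens_ind => [q v|t t' E E'].
  rewrite tensor_map_cl /= -/(tens _ _) !counit_tens /=.
  by rewrite (linearZ_LR f).
pose c L := counit (h := h) (zeta := zeta) (M := L) : {linear _ -> _}.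
transitivity (c N (tensor_map (@wh_map F g m zeta _ _ f) t) + c N (tensor_map (@wh_map F g m
  zeta _ _ f) t')).
  rewrite -(linearD (c N)); congr (counit _).
  exact: (linearD (tensor_map (@wh_map F g m zeta _ _ f : {linear _ -> _}))).
transitivity (f (c M t) + f (c M t')); first by congr (_ + _).
by rewrite -(linearD f) -(linearD (c M)).
Qed.

Lemma whunit_natural (V V' : lmodType W) (f : {linear V -> V'}) v :
  @wh_map F g m zeta _ _ (tensor_map f) (whunit v) = whunit (f v).
Proof. by apply: val_inj; rewrite /= tensor_map_cl. Qed.

Definition counitL (M : lmodType U) : {linear @tensor U Q (Wh M) -> M} :=
  counit (h := h) (zeta := zeta) (M := M).
Definition whunitL (V : lmodType W) : {linear V -> Wh (@tensor U Q V)} :=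
  whunit (V := V).

(** [nat_iso] asks for a map from Wh(Q (x) V) to V, whereas the unit goes the other way. *)
Definition whunit_inv (V : lmodType W) : {linear Wh (@tensor U Q V) -> V} :=
  projT1 (cid (linear_inverse (whunit_bij df V))).

Lemma whunit_invP (V : lmodType W) :
  cancel (whunit (V := V)) (whunit_inv V) /\ cancel (whunit_inv V) (whunit (V := V)).
Proof. exact: projT2 (cid (linear_inverse (whunit_bij df V))). Qed.

Lemma Wh_equiv : Wh_equivalence m zeta P P'.
Proof.
exists HWh, HQ; split.
  exists (fun M => counit (h := h) (zeta := zeta) (M := sval M) : {linear _ -> _});
    split=> [M|M N f].
    have [f' [K1 K2]] := linear_inverse (counit_bij df (HPW (svalP M))).
    exists f'; split; apply: linear_ext => t /=; first exact: K1.
    exact: K2.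
  by apply: linear_ext => t; apply: counit_natural.
exists (fun V => whunit_inv (sval V)); split=> [V|V V' f].
  exists (whunit (V := sval V) : {linear _ -> _}).
  split; apply: linear_ext => t; first exact: (whunit_invP (sval V)).2.
  exact: (whunit_invP (sval V)).1.
apply: linear_ext => t /=; apply: (can_inj (whunit_invP _).1).
rewrite (whunit_invP _).2 -whunit_natural; congr (wh_map _ _).
by rewrite (whunit_invP _).2.
Qed.

Lemma sWh_equiv : sWh_equivalence m zeta P P'.
Proof.
exists HWh, HQ, wh_grading, tensor_grading; split.
  have ep (M : smodCat upart P) := @counit_parity (sval M).
  exists (fun M : smodCat upart P => exist
     (@preserves_parity _ _ (sval (sQ_obj HQ tensor_grading (sWh_obj HWh wh_grading M))) (sval M))
     (counitL (sval M)) (ep M)); split=> [M|M N f].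
    have [f' [K1 K2]] := linear_inverse (counit_bij df (HPW (svalP M))).
    have f'p := inverse_parity (upartN1 g) (M := sval (sQ_obj HQ tensor_grading (sWh_obj HWh
      wh_grading M)))
       (N := sval M) (ep M) K1 K2.
    exists (exist _ f' f'p).
    split; apply: even_hom_ext => t; first exact: K1.
    exact: K2.
  by apply: even_hom_ext => t; apply: counit_natural.
have ip (V : smodCat wpart P') :
    preserves_parity (M := sval (sWh_obj HWh wh_grading (sQ_obj HQ tensor_grading V)))
      (N := sval V) (whunit_inv (sval V)).
  have [K1 K2] := whunit_invP (sval V).
  exact: (inverse_parity wpartN1 (M := sval V)
    (N := sval (sWh_obj HWh wh_grading (sQ_obj HQ tensor_grading V)))
    (f := whunitL (sval V)) (@whunit_parity (sval V)) K1 K2).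
exists (fun V : smodCat wpart P' => exist
     (@preserves_parity _ _ (sval (sWh_obj HWh wh_grading (sQ_obj HQ tensor_grading V))) (sval V))
     (whunit_inv (sval V)) (ip V)); split=> [V|V V' f].
  exists (exist (@preserves_parity _ _ (sval V)
      (sval (sWh_obj HWh wh_grading (sQ_obj HQ tensor_grading V))))
    (whunitL (sval V)) (@whunit_parity (sval V))).
  split; apply: even_hom_ext => t; first exact: (whunit_invP (sval V)).2.
  exact: (whunit_invP (sval V)).1.
apply: even_hom_ext => t /=; apply: (can_inj (whunit_invP _).1).
rewrite (whunit_invP _).2 -whunit_natural; congr (wh_map _ _).
by rewrite (whunit_invP _).2.
Qed.

End Equivalences.
End WhittakerGrading.

(** * Local finiteness *)

Section FiniteSpans.
Variables (F : fieldType) (g : lieSuper F) (M : lmodType (uea g)).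
Implicit Types (L : seq M).

Definition lspan L : M -> Prop := fspan (fun w => w \in L).

Lemma lspan_coef L v : lspan L v -> exists c : 'I_(size L) -> F, v = \sum_i (c i)%:A *: L`_i.
Proof.
move=> H; apply: (@fspan_fin _ _ _ _ (fun i : 'I_(size L) => L`_i)).
by apply: fspan_mono H => w /(nthP 0)[i iL <-]; exists (Ordinal iL).
Qed.

Lemma locally_finiteI (S : uea g -> Prop) :
  (forall v, exists L, forall s, S s -> lspan L (s *: v)) -> locally_finite S M.
Proof.
move=> H v; have [L HL] := H v; exists (size L), (fun i => L`_i) => s /HL.
exact: lspan_coef.
Qed.

Lemma locally_finiteE (S : uea g -> Prop) v : locally_finite S M ->
  exists L, forall s, S s -> lspan L (s *: v).
Proof.
move=> /(_ v)[n [b H]]; exists [seq b i | i <- enum 'I_n] => s /H[c ->].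
by apply: fspan_sum => i _; apply/fspanZ/fspan_gen/map_f; rewrite mem_enum.
Qed.

Lemma usub_stable (A : {vspace g}) (P : M -> Prop) :
  (forall v w, P v -> P w -> P (v + w)) -> (forall (c : F) v, P v -> P (c%:A *: v)) ->
  (forall x v, x \in A -> P v -> P (ugen x *: v)) ->
  forall y v, usub A y -> P v -> P (y *: v).
Proof.
move=> PD PZ PG y v Ay; elim: Ay v => [x xA|v|s t _ IHs _ IHt v|c s _ IH v|s t _ IHs _ IHt v] Pv.
- exact: PG.
- by rewrite scale1r.
- by rewrite scalerDl; apply: PD; [apply: IHs|apply: IHt].
- by rewrite algZ; apply/PZ/IH.
- by rewrite -scalerA; apply/IHs/IHt.
Qed.

End FiniteSpans.

Section LieStraightening.
Variables (F : numFieldType) (g : lieSuper F) (n : nat) (fam : 'I_n -> g) (par : 'I_n -> bool).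
Hypothesis famp : forall i, fam i \in lpart g (par i).
Hypothesis famc : forall i j, exists c : 'I_n -> F, [lie fam i, fam j] = \sum_k c k *: fam k.

(** The spanning half of Poincare-Birkhoff-Witt for the subalgebra spanned by [fam], obtained from
    [straighten] with all weights 0. *)
Lemma lie_straighten (M : lmodType (uea g)) (v : M) l :
  fspan (fun y => exists a : {ffun 'I_n -> nat}, [/\ forall i, par i -> (a i <= 1)%N,
    (\sum_i a i <= size l)%N & y = smono (fun i => ugen (fam i)) a *: v])
   (lword (fun i => ugen (fam i)) l *: v).
Proof.
pose br i j := projT1 (cid (famc i j)).
have brE i j : [lie fam i, fam j] = \sum_k br i j k *: fam k by rewrite /br; case: cid.
have swap i j : ugen (fam i) * ugen (fam j) =
    Koszul (par i) (par j) *: (ugen (fam j) * ugen (fam i)) + \sum_k br i j k *: ugen (fam k).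
  rewrite (ugenC (famp i) (famp j)) brE linear_sum; congr (_ + _).
  by apply: eq_bigr => k _; rewrite linearZ.
have sq i : par i -> exists c : F,
  ugen (fam i) * ugen (fam i) = c *: (\sum_k br i i k *: ugen (fam k)).
  move=> pi; exists (2%:R^-1); have := swap i i.
  rewrite /Koszul pi /= expr1 scaleN1r => /(congr1 (+%R (ugen (fam i) * ugen (fam i)))).
  rewrite addrA subrr add0r => <-.
  by rewrite -mulr2n -scaler_nat scalerA mulVf ?pnatr_eq0 // scale1r.
apply: fspan_mono (straighten (om := fun=> 0%N) swap sq _ v l) => [|//] y [a [a1 _ a3 ->]].
by exists a.
Qed.

End LieStraightening.

(** * Restriction of the two families to the even part *)

Section EvenRestriction.
Variables (F : numFieldType) (g : lieSuper F) (h : g) (zeta : {scalar g}).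
Variables (r' r : nat) (u x : 'I_r -> g) (d : 'I_r -> nat).
Hypothesis df : dual_families h zeta fullv r' u x d.
Hypothesis r'r : (r' <= r)%N.
Local Notation m := (neg_part h).
Local Notation wd := (widen_ord r'r).

Lemma even_odd0 (y : g) : y \in even_part g -> y \in odd_part g -> y = 0.
Proof.
move=> y0 y1; have : y \in (even_part g :&: odd_part g)%VS by rewrite memv_cap y0.
by rewrite lpart_direct memv0 => /eqP.
Qed.

Lemma even_coords y : y \in (m :&: even_part g)%VS ->
  exists c : 'I_r' -> F, y = \sum_i c i *: u (wd i).
Proof.
rewrite memv_cap => /andP[ym y0].
have ym' : y \in (m :&: fullv)%VS by rewrite capvf.
have [c E] := codom_coords (df_basis df) ym'.
exists (fun i => c (wd i)).
have E1 : y = \sum_(i < r | (i < r')%N) c i *: u i + \sum_(i < r | ~~ (i < r')%N) c i *: u i.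
  by rewrite {1}E (bigID (fun i : 'I_r => (i < r')%N)).
have e0 : \sum_(i < r | (i < r')%N) c i *: u i \in even_part g.
  apply: memv_suml => i ir; apply: memvZ.
  by have := df_upar df i; rewrite leqNgt ir.
have o0 : \sum_(i < r | ~~ (i < r')%N) c i *: u i \in odd_part g.
  apply: memv_suml => i; rewrite -leqNgt => ir; apply: memvZ.
  by have := df_upar df i; rewrite ir.
rewrite E1 (_ : \sum_(i < r | ~~ _) _ = 0); last first.
  apply: even_odd0 o0; rewrite -[X in X \in _](addKr (\sum_(i < r | (i < r')%N) c i *: u i)).
  by rewrite -E1; apply: memvD => //; rewrite memvN.
by rewrite addr0 (big_ord_narrow r'r).
Qed.

Lemma df_restrict : dual_families h zeta (even_part g) r'
  (fun i => u (wd i)) (fun i => x (wd i)) (fun i => d (wd i)).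
Proof.
have sub y : y \in (m :&: even_part g)%VS -> y \in (m :&: fullv)%VS.
  by rewrite capvf memv_cap => /andP[].
have lt (i : 'I_r') : (r' <= wd i)%N = false by rewrite leqNgt /= ltn_ord.
have u0 i : u (wd i) \in even_part g by have := df_upar df (wd i); rewrite lt.
split.
- exact: df_even df.
- by move=> y z y0 z0; have := lbr_part y0 z0.
(* y + gsig y is twice the even component, so [P] carries the homogeneous generators of [g] over to
   generators of the even part. *)
- pose P (y : g) := y + gsig g y \in spanof (fun y : g => [/\ y \in even_part g,
    exists i, y \in lpart g i & exists k : int, y \in grade h (2 * k)]).
  apply/eqP; rewrite eqEsubv; apply/andP; split; last first.
    by apply: spanof_sub => y [].
  apply/subvP => y y0.
  suff /(memvZ (2%:R^-1)) : P y.
    rewrite (gsig_part y0) /= -mulr2n -scaler_nat scalerA mulVf ?pnatr_eq0 //.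
    by rewrite scale1r.
  have : y \in fullv by exact: memvf.
  rewrite (df_span df); move: {y0} y.
  apply: (spanof_ind (P := P)) => [|c y z Py Pz|y [_ [[] yi] yk]]; rewrite /P.
  + by rewrite linear0 addr0 mem0v.
  + rewrite linearP addrACA -scalerDr; apply: memvD => //; exact: memvZ.
  + by rewrite (gsig_part yi) subrr mem0v.
  + rewrite (gsig_part yi) /=; apply: memvD; apply: mem_spanof; split=> //; by exists false.
- by move=> y z /sub ym /sub zm; apply: df_zlie df _ _ ym zm.
- by move=> y /sub; apply: (df_zodd df).
- by move=> y k /sub; apply: (df_zlow df).
- exact: u0.
- by move=> s; have := df_xpar df (wd s); rewrite lt.
- by move=> s; rewrite leqNgt ltn_ord; apply: u0.
- by move=> s; have := df_xpar df (wd s); rewrite lt.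
- by move=> s; apply: df_d df _.
- by move=> s; apply: df_ugr df _.
- by move=> s; apply: df_xgr df _.
- rewrite basisEfree; apply/and3P; split.
  + rewrite (codom_mktuple (fun i : 'I_r' => u (wd i))); apply/freeP => c E i.
    pose c' (j : 'I_r) := if insub (val j) is Some k then c k else 0.
    have c'E k : c' (wd k) = c k by rewrite /c' /= valK.
    rewrite -c'E; apply: (codom_free (df_basis df) (c := c')).
    rewrite (bigID (fun i : 'I_r => (i < r')%N)) /= [X in _ + X]big1 ?addr0; last first.
      by move=> j jr; rewrite /c' insubN // scale0r.
    rewrite (big_ord_narrow r'r) /= -[RHS]E.
    apply: eq_bigr => k _.
    by rewrite c'E (nth_map k) ?size_enum_ord // nth_ord_enum.
  + apply/span_subvP => _ /codomP[i ->]; rewrite memv_cap u0 andbT.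
    by have := u_mK df (wd i); rewrite capvf.
  + rewrite size_codom card_ord.
    suff : ((m :&: even_part g) <= <<codom (fun i : 'I_r' => u (wd i))>>)%VS.
      move/dimvS => H; apply: leq_trans H _; apply: leq_trans (dim_span _) _.
      by rewrite size_codom card_ord.
    apply/subvP => y /even_coords[c ->]; apply: memv_suml => i _; apply/memvZ/memv_span.
    exact: codom_f.
- by move=> i; apply: df_eq df _.
- by move=> i j ij; apply: (df_ne df); apply: contra_neq ij => /(congr1 val)/= E; apply: val_inj.
Qed.

End EvenRestriction.

Section EvenWhittaker.
Variables (F : numFieldType) (g : lieSuper F) (h : g) (zeta : {scalar g}).
Variables (r' r : nat) (u x : 'I_r -> g) (d : 'I_r -> nat).
Hypothesis df : dual_families h zeta fullv r' u x d.
Hypothesis r'r : (r' <= r)%N.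
Local Notation m := (neg_part h).
Local Notation m0 := (neg_part h :&: even_part g)%VS.
Local Notation S := (ushift zeta).
Local Notation wd := (widen_ord r'r).
Local Notation df0 := (df_restrict df r'r).
Local Notation Kwhe := (Kwh h zeta (even_part g)).
Variable M : lmodType (uea g).

(** For an odd [u i] the square of [S (u i)] is a multiple of [S [lie u i, u i]], whose argument
    lies in m_0. Nilpotency of the basis elements gives expansions in Whittaker vectors, and these
    give nilpotency for all of m. *)
Lemma even_nil_Wmod : loc_nilpotent zeta m0 M -> in_Wmod m zeta M.
Proof.
move=> nil.
have nilu i (w : M) : exists k, S (u i) ^+ k *: w = 0.
  have um := u_mK df i; rewrite capvf in um; have up := df_upar df i.
  case: (leqP r' i) up => [ri up|ri up]; last by apply: nil; rewrite memv_cap um.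
  have zm : [lie u i, u i] \in m0.
    rewrite memv_cap (lbr_part up up) andbT.
    apply: (grade_neg _ (grade_lbr (df_even df) (df_ugr df i) (df_ugr df i))).
    by move: (df_d df i); clear; lia.
  have [k Hk] := nil _ zm w; exists (2 * k)%N.
  have [c E] : exists c : F, S (u i) * S (u i) = c *: S [lie u i, u i].
    have [c E] := u_square df ri; exists c; rewrite E; congr (c *: _);
      rewrite [in RHS](ubrE df) linear_sum.
    by apply: eq_bigr => j _; rewrite linearZ.
  by rewrite exprM expr2 E exprZn algZ Hk scaler0.
apply: (gen_Wmod df) => P PD PG v.
have [va [vK [s [_ _ _ ->]]]] := xexp_ex df v nilu.
elim/big_ind: _ => //.
- by rewrite -(scale0r 0); apply: PG; exact: Kwh0.
- by move=> a _; apply: PG.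
Qed.

Hypothesis MW : in_Wmod m zeta M.
Variable B : seq M.
Hypothesis BP : forall v : M, Kwh h zeta fullv v -> lspan B v.

(** One more than the weight of the product of all odd [u i], the heaviest word in odd letters
    without repetition. *)
Let k0 := (\sum_(i < r | (r' <= i)%N) d i).+1.

(** Letters may be permuted up to a scalar and shorter words of the same weight: an even letter
    moved to the right end kills [w], a repeated odd letter shortens the word, and distinct odd
    letters are too light. *)
Lemma Kwh0_word (w : M) l : Kwhe w -> (k0 <= lom d l)%N ->
  lword (fun i => S (u i)) l *: w = 0.
Proof.
move=> wK; have [p] := ubnP (size l); elim: p l => // p IH l; rewrite ltnS => lp kl.
have sh q y : (q <= p)%N -> shorter (fun i => S (u i)) d w q (lom d l) y -> y = 0.
  move=> qp; apply: fspan_false => _ [l' [l'q l'w ->]]; apply: IH; last by rewrite l'w.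
  exact: leq_trans l'q qp.
have move_eq l' : perm_eq l l' -> lword (fun i => S (u i)) l' *: w = 0 ->
    lword (fun i => S (u i)) l *: w = 0.
  move=> ll' E; have [e] := lequiv_perm (u_swap df) (@ubr_d _ _ _ _ _ _ _ _ _ _ df) w ll'.
  by rewrite E scaler0 subr0; apply: sh.
case: (boolP (has (fun i : 'I_r => (i < r')%N) l)) => [/hasP[i il ir]|/hasPn odd].
  apply: (move_eq (rem i l ++ [:: i])); first by rewrite perm_sym perm_catC perm_sym perm_to_rem.
  rewrite lword_cat -scalerA /lword big_seq1 wK ?scaler0 //.
  have um := u_mK df i; rewrite capvf in um; rewrite memv_cap um /=.
  by have := df_upar df i; rewrite leqNgt ir.
case: (pselect (forall i, (count_mem i l <= 1)%N)) => [ok|/existsNP[i /negP]].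
  exfalso; move: kl; rewrite /k0 ltnNge => /negP; apply.
  have := expand_perm l; rewrite perm_sym => /(lom_perm d) ->; rewrite lom_expand.
  rewrite [X in (_ <= X)%N]big_mkcond /=; apply: leq_sum => i _; rewrite ffunE.
  case: ifP => ir; first by rewrite -{2}[d i]muln1 leq_mul2l ok orbT.
  rewrite leqn0 muln_eq0; apply/orP; right; rewrite -leqn0 leqNgt -has_count has_pred1.
  by apply/negP => /odd; rewrite ltnNge ir.
rewrite -ltnNge => i2.
have il : i \in l by rewrite -has_pred1 has_count (ltn_trans _ i2).
have pl := perm_to_rem il; have il' : i \in rem i l.
  move/permP: (pl) => /(_ (pred1 i)) /= e.
  by rewrite -has_pred1 has_count; move: i2; rewrite e eqxx.
have pl' : perm_eq l [:: i, i & rem i (rem i l)].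
  by apply: (perm_trans pl); rewrite perm_cons perm_to_rem.
apply: (move_eq _ pl').
have ri : (r' <= i)%N by rewrite leqNgt; apply: odd.
have [c E] := u_square df ri.
rewrite !lword_cons mulrA E -scalerAl algZ -scalerA.
have := shorter_br (fun i => S (u i)) (@ubr_d _ _ _ _ _ _ _ _ _ _ df) w i i (rem i (rem i l)).
rewrite -2!lom_cons -(lom_perm d pl') -[(size _).+2]/(size [:: i,
  i & rem i (rem i l)]) -(perm_size pl').
by move/(sh _ _ lp) => ->; rewrite scaler0.
Qed.

(** For the largest [b] in the expansion of [w], u^b w is a nonzero multiple of the coefficient, so
    [Kwh0_word] bounds the weight of [b] and with it all exponents. The coefficients themselves lie
    in the span of [B]. *)
Lemma Kwh0_fin : exists B0 : seq M, forall w, Kwhe w -> lspan B0 w.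
Proof.
pose idx := {ffun 'I_r -> nat}.
pose emb (f : {ffun 'I_r -> 'I_k0}) : idx := [ffun i => val (f i)].
exists [seq xmon' x a *: b | a <- map emb (enum {ffun 'I_r -> 'I_k0}), b <- B] => w wK.
have [va [vK [s [us sX s0 E]]]] := Wmod_xexp df w MW.
have low a : a \in s -> va a != 0 -> (wt d a < k0)%N.
  move=> as' va0.
  have [|b] := seq_argmax (s := [seq a <- s | va a != 0]) (key d).
    by apply/negP => /eqP E'; have : a \in [::] by rewrite -E' mem_filter va0.
  rewrite mem_filter => /andP[vb0 bs] bmax.
  have [|c c0] := xmon_free_key df us sX vK bs vb0.
    by move=> t ts t0; apply: bmax; rewrite mem_filter t0.
  rewrite -E => Eb.
  have wb : (wt d b < k0)%N.
    rewrite ltnNge; apply/negP => kb; case/eqP: vb0; apply: (alg_eq0 c0); rewrite -Eb.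
    by rewrite /umon' -lword_expand; apply: Kwh0_word => //; rewrite lom_expand.
  have := bmax a; rewrite mem_filter va0 as' => /(_ isT) kab.
  move: kab wb (deg_le_wt df a) (deg_le_wt df b); rewrite /key; clear; nia.
rewrite E big_seq; apply: fspan_sum => a as'.
case: (eqVneq (va a) 0) => [->|va0]; first by rewrite scaler0; apply: fspan0.
apply: fspan_map (BP (vK a)) => b bB; apply/fspan_gen/allpairs_f => //.
apply/mapP; exists [ffun i => inord (a i)]; first by rewrite mem_enum.
apply/ffunP => i; rewrite !ffunE /= inordK //.
exact: leq_ltn_trans (wt_ge df a i) (low _ as' va0).
Qed.

(** A central z commutes with the x^a in even letters and maps vectors that are Whittaker for m_0 to
    such vectors, which span a finite-dimensional space. *)
Lemma Wmod_center_lf : locally_finite (@ucenter_even F g) M.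
Proof.
have [B0 HB0] := Kwh0_fin; apply: locally_finiteI => v.
have nil0 i (w : M) : exists k, S (u (wd i)) ^+ k *: w = 0 by exact: (Wmod_nil df MW (wd i) w).
have [va [vK [s [us sX s0 E]]]] := xexp_ex df0 v nil0.
exists [seq xmon' (fun i => x (wd i)) a *: b | a <- s, b <- B0] => z [z0 zc].
rewrite E scaler_sumr big_seq; apply: fspan_sum => a as'.
have xa : usub (even_part g) (xmon' (fun i => x (wd i)) a).
  rewrite /xmon' /smono; elim/big_ind: _ => [|y1 y2|i _]; [exact: usub1|exact: usubM|].
  elim: (a i) => [|k IH]; first by rewrite expr0; apply: usub1.
  by rewrite exprS; apply: usubM => //; apply: usub_gen; apply: df_xK df0 i.
have zw : Kwhe (z *: va a).
  move=> y ym; have y0 : y \in even_part g by move: ym; rewrite memv_cap => /andP[].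
  rewrite scalerA -zc; first by rewrite -scalerA vK // scaler0.
  rewrite /ushift -scaleNr; apply: usubD; first exact: usub_gen.
  by apply: usubZ; apply: usub1.
rewrite scalerA (zc _ xa) -scalerA.
by apply: fspan_map (HB0 _ zw) => b bB; apply/fspan_gen/allpairs_f.
Qed.

(** U(m_0) v is spanned by the ordered monomials u^a v, and local nilpotency leaves finitely many
    nonzero ones. *)
Lemma m0_stable_span (v : M) : exists E : seq M, lspan E v /\
  forall y w, y \in m0 -> lspan E w -> lspan E (ugen y *: w).
Proof.
have nil0 i (w : M) : exists k, S (u (wd i)) ^+ k *: w = 0 by exact: (Wmod_nil df MW (wd i) w).
have [N HN] := nilp_box v nil0.
pose idx := {ffun 'I_r' -> nat}.
pose um (a : idx) := umon' zeta (fun i => u (wd i)) a.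
pose emb (f : {ffun 'I_r' -> 'I_N.+1}) : idx := [ffun i => val (f i)].
exists [seq um a *: v | a <- map emb (enum {ffun 'I_r' -> 'I_N.+1})].
have inE a : lspan [seq um a *: v | a <- map emb (enum {ffun 'I_r' -> 'I_N.+1})] (um a *: v).
  case: (eqVneq (um a *: v) 0) => [->|/HN aN]; first exact: fspan0.
  apply/fspan_gen/map_f/mapP; exists [ffun i => inord (a i)]; first by rewrite mem_enum.
  by apply/ffunP => i; rewrite !ffunE /= inordK // ltnW // ltnS; apply: aN.
split=> [|y w ym].
  have := inE [ffun=> 0%N]; rewrite /um /umon' /smono big1 ?scale1r // => i _.
  by rewrite ffunE expr0.
apply: fspan_map => _ /mapP[a _ ->].
have -> : ugen y = S y + (zeta y)%:A by rewrite /ushift subrK.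
rewrite scalerDl; apply: fspanD; last exact/fspanZ/inE.
have [c ->] := even_coords df r'r ym.
rewrite linear_sum scaler_suml; apply: fspan_sum => i _; rewrite linearZ /= algZ; apply: fspanZ.
have Ea : um a = lword (fun i => S (u (wd i))) (lexpand a) by rewrite lword_expand.
rewrite [um a *: v]/(_ *: _) Ea scalerA -(lword_cons (fun i => S (u (wd i)))).
by apply: fspan_sub (u_straighten df0 v _) => y' [b [_ _ _ ->]]; apply: inE.
Qed.

(* [U(n) = U(n_1) U(m_0)], with sorted monomials in a basis of [n_1] on the left. *)
Lemma Wmod_n_lf (n : {vspace g}) : (forall y z, y \in n -> z \in n -> [lie y, z] \in n) ->
  (n <= (n :&: even_part g) + (n :&: odd_part g))%VS -> (n :&: even_part g)%VS = m0 ->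
  locally_finite (usub n) M.
Proof.
move=> nlie ndec n0; apply: locally_finiteI => v.
have [E [Ev Est]] := m0_stable_span v.
pose p := \dim (n :&: odd_part g); pose y := vbasis (n :&: odd_part g).
pose fam (i : 'I_(p + r')) := match split i with inl j => y`_j | inr k => u (wd k) end.
pose par (i : 'I_(p + r')) := (i < p)%N.
have yj (j : 'I_p) : y`_j \in (n :&: odd_part g)%VS by apply/vbasis_mem/mem_nth; rewrite size_tuple.
have u0 k : u (wd k) \in m0 by apply: u_mK df0 k.
have famp i : fam i \in lpart g (par i).
  rewrite /fam /par; case: splitP => j _.
    by have := yj j; rewrite memv_cap => /andP[].
  by have := u0 j; rewrite memv_cap => /andP[].
have famn i : fam i \in n.
  rewrite /fam; case: splitP => j _.
    by have := yj j; rewrite memv_cap => /andP[].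
  by have := u0 j; rewrite -n0 memv_cap => /andP[].
have coords z : z \in n -> exists c : 'I_(p + r') -> F, z = \sum_k c k *: fam k.
  move/(subvP ndec); rewrite n0 => /memv_addP[z0 z0m [z1 z1m ->]].
  have [c0 ->] := even_coords df r'r z0m.
  have E1 := coord_vbasis z1m.
  exists (fun i => match split i with inl j => coord y j z1 | inr k => c0 k end).
  rewrite big_split_ord /= [LHS]addrC {1}E1; congr (_ + _); apply: eq_bigr => i _.
    by rewrite /fam -[lshift r' i]/(unsplit (inl i)) unsplitK.
  by rewrite /fam -[rshift p i]/(unsplit (inr i)) unsplitK.
have famc i j : exists c : 'I_(p + r') -> F, [lie fam i, fam j] = \sum_k c k *: fam k.
  by apply: coords; apply: nlie.
pose sl (f : {ffun 'I_p -> bool}) : uea g := \prod_(j < p) ugen (y`_j) ^+ nat_of_bool (f j).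
pose B' := [seq sl f *: e | f <- enum {ffun 'I_p -> bool}, e <- E].
exists B' => s sn.
suff H z w : z \in n -> lspan B' w -> lspan B' (ugen z *: w).
  apply: (usub_stable _ _ H sn) => [||]; [exact: fspanD|by move=> c w; apply: fspanZ|].
  apply: fspan_sub Ev => e eE; apply: fspan_gen.
  rewrite -[e]scale1r (_ : 1 = sl [ffun=> false]).
    by apply/allpairs_f => //; rewrite mem_enum.
  by rewrite /sl big1 // => i _; rewrite ffunE expr0.
move=> /coords[c ->]; apply: fspan_map => _ /allpairsP[[f e] /= [_ eE ->]].
rewrite linear_sum scaler_suml; apply: fspan_sum => i _; rewrite linearZ /= algZ; apply: fspanZ.
pose a : {ffun 'I_(p + r') -> nat} := [ffun i => match split i with inl j =>
  nat_of_bool (f j) | inr _ => 0%N end].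
have -> : sl f = lword (fun i => ugen (fam i)) (lexpand a).
  rewrite lword_expand /smono big_split_ord /= [X in _ * X]big1 ?mulr1.
    by apply: eq_bigr => j _; rewrite ffunE /fam -[lshift r' j]/(unsplit (inl j)) unsplitK.
  by move=> j _; rewrite ffunE -[rshift p j]/(unsplit (inr j)) unsplitK expr0.
rewrite scalerA -(lword_cons (fun i => ugen (fam i))).
apply: fspan_sub (lie_straighten famp famc e _) => _ [b [b1 _ ->]].
rewrite /smono big_split_ord /= -scalerA.
have wE : lspan E ((\prod_(k < r') ugen (fam (rshift p k)) ^+ b (rshift p k)) *: e).
  suff : forall w, lspan E w -> lspan E ((\prod_(k < r') ugen (fam (rshift p k)) ^+ b (rshift p
    k)) *: w).
    by apply; apply: fspan_gen.
  elim/big_ind: _ => [t|s1 s2 IH1 IH2 t|k _ t] tE; first by rewrite scale1r.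
    by rewrite -scalerA; apply/IH1/IH2.
  elim: (b _) => [|q IH]; first by rewrite expr0 scale1r.
  rewrite exprS -scalerA; apply: Est IH.
  by rewrite /fam -[rshift p k]/(unsplit (inr k)) unsplitK.
apply: fspan_map wE => e' e'E; apply: fspan_gen.
rewrite (_ : \prod_i _ = sl [ffun j => b (lshift r' j) == 1%N]).
  by apply/allpairs_f => //; rewrite mem_enum.
apply: eq_bigr => j _; rewrite ffunE /fam -[lshift r' j]/(unsplit (inl j)) unsplitK /=.
congr (_ ^+ _); have := b1 (lshift r' j); rewrite /par /= ltn_ord => /(_ isT).
by case: (b _) => [|[]].
Qed.

End EvenWhittaker.

Section TensorFinite.
Variables (F : numFieldType) (g : lieSuper F) (h : g) (zeta : {scalar g}).
Variables (r' r : nat) (u x : 'I_r -> g) (d : 'I_r -> nat).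
Hypothesis df : dual_families h zeta fullv r' u x d.
Hypothesis r'r : (r' <= r)%N.
Local Notation m := (neg_part h).
Local Notation U := (uea g).
Local Notation Q := (Qz m zeta).
Local Notation W := (Wz m zeta).
Local Notation q1 := (one_z m zeta).

(** By [whunit_bij] every Whittaker vector of Q (x) V is some 1_zeta (x) v, so finite dimension of V
    yields local finiteness over the center. *)
Lemma tensor_in_N (n : {vspace g}) (V : lmodType W) :
  (forall y z, y \in n -> z \in n -> [lie y, z] \in n) ->
  (n <= (n :&: even_part g) + (n :&: odd_part g))%VS ->
  (n :&: even_part g)%VS = (m :&: even_part g)%VS ->
  W_fdmod m zeta V -> in_N m zeta n (@tensor U Q V).
Proof.
move=> nlie ndec n0 [p [b Hb]].
have tc c q (v : V) : tens q (endscal Q c *: v) = c%:A *: tens q v :> @tensor U Q V.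
  by rewrite -tens_bal tensZ.
have TW : in_Wmod m zeta (@tensor U Q V) by apply: (tensor_Wmod df).
split.
- exists p, (fun j => tens q1 (b j)); apply: tens_ind => [q v|t t' [a ->] [a' ->]].
    have [c ->] := Hb v; exists (fun j => (c j)%:A * qrep q).
    rewrite tens_sumr; apply: eq_bigr => j _.
    by rewrite tc tensE scalerA.
  exists (fun j => a j + a' j); rewrite -big_split; apply: eq_bigr => j _.
  by rewrite /= scalerDl.
- apply: (Wmod_center_lf df r'r TW (B := [seq tens q1 (b j) | j <- enum 'I_p])) => v vK.
  have [v' E] := (whunit_bij df V).2 (mkwh vK).
  have -> : v = tens q1 v' by rewrite -[v]/(val (mkwh vK)) -E.
  have [c ->] := Hb v'; rewrite tens_sumr; apply: fspan_sum => j _.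
  by rewrite tc; apply/fspanZ/fspan_gen/map_f; rewrite mem_enum.
- exact: (Wmod_n_lf df r'r TW nlie ndec n0).
- by move=> y; rewrite memv_cap => /andP[ym _]; apply: TW.
Qed.

End TensorFinite.

Section Borel.
Variables (F : numClosedFieldType) (g : lieSuper F) (b hh n : {vspace g}).
Hypothesis bn : is_borel b hh n.

Lemma borel_lie y z : y \in n -> z \in n -> [lie y, z] \in n.
Proof.
have [A [H [[A0 _ _ _] HA _ _ [nE _]]]] := bn; rewrite nE => yn zn.
move: yn; pose P y := [lie y, z] \in spanof (fun x => exists2 al : {scalar g},
              weight_vector A al x & 0 < 'Re (al H)).
apply: (spanof_ind (P := P)) => [|c y1 y2 P1 P2|{}y [al ya ya0]]; rewrite /P.
- by rewrite lbr0l mem0v.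
- by rewrite lbrDl lbrZl; apply: memvD => //; apply: memvZ.
move: zn; pose P' z := [lie y, z] \in spanof (fun x => exists2 al : {scalar g},
              weight_vector A al x & 0 < 'Re (al H)).
apply: (spanof_ind (P := P')) => [|c y1 y2 P1 P2|z' [be zb zb0]]; rewrite /P'.
- by rewrite lbr0r mem0v.
- by rewrite lbrDr lbrZr; apply: memvD => //; apply: memvZ.
apply: mem_spanof; exists (al \+ be : {scalar g}).
  move=> a aA; rewrite lbr_evenJ ?(subvP A0) // (ya a aA) (zb a aA) lbrZl lbrZr -scalerDl.
  by [].
by rewrite /= raddfD /= addr_gt0.
Qed.

Lemma weight_part A (al : {scalar g}) x0 x1 : (A <= even_part g)%VS ->
  x0 \in even_part g -> x1 \in odd_part g -> weight_vector A al (x0 + x1) ->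
  weight_vector A al x0 /\ weight_vector A al x1.
Proof.
move=> A0 p0 p1 wx.
have H y : y \in A -> [lie y, x0] = al y *: x0 /\ [lie y, x1] = al y *: x1.
  move=> yA; have y0 := subvP A0 y yA; have := wx y yA.
  rewrite lbrDr scalerDr => /eqP; rewrite -subr_eq0 opprD addrACA => /eqP E.
  have e0 : [lie y, x0] - al y *: x0 \in even_part g.
    by apply: memvB; [have := lbr_part y0 p0|apply: memvZ].
  have e1 : [lie y, x1] - al y *: x1 \in odd_part g.
    by apply: memvB; [have := lbr_part y0 p1|apply: memvZ].
  have z0 : [lie y, x0] - al y *: x0 = 0.
    apply: even_odd0 => //; rewrite -[X in X \in _](addrK ([lie y, x1] - al y *: x1)) E sub0r.
    by rewrite memvN.
  split; apply/eqP; rewrite -subr_eq0; first by rewrite z0.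
  by rewrite z0 add0r in E; rewrite E.
by split=> y /H[].
Qed.

Lemma borel_dec : (n <= (n :&: even_part g) + (n :&: odd_part g))%VS.
Proof.
have [A [H [[A0 _ _ _] HA _ _ [nE _]]]] := bn; rewrite nE.
apply: spanof_sub => x [al xa xa0]; have [x0 [x1 [p0 p1 E]]] := part_decomp x.
rewrite E in xa *; have [w0 w1] := weight_part A0 p0 p1 xa.
by apply: memv_add; rewrite memv_cap ?p0 ?p1 andbT; apply: mem_spanof; exists al.
Qed.

End Borel.

(** * Weights of a nilpotent subalgebra *)

Section LieWeights.
Variables (F : numClosedFieldType) (g : lieSuper F) (A : {vspace g}).
Hypothesis A0 : (A <= even_part g)%VS.
Hypothesis Alie : ad_stable A A.
Variable n0 : nat.
Hypothesis Anil : lower_central A n0 = 0%VS.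
Implicit Types (V W : {vspace g}) (a b x y : g) (c : F).

Definition lieD a c x := [lie a, x] - c *: x.

Lemma lieD_lin a c k x y : lieD a c (k *: x + y) = k *: lieD a c x + lieD a c y.
Proof.
rewrite /lieD lbrDr lbrZr scalerBr scalerDr (scalerA c k) mulrC -(scalerA k c) opprD.
by rewrite addrACA.
Qed.

Lemma lieD0 a c : lieD a c 0 = 0.
Proof. by rewrite /lieD lbr0r scaler0 subr0. Qed.

Lemma iter_lieD_lin N a c k x y :
  iter N (lieD a c) (k *: x + y) = k *: iter N (lieD a c) x + iter N (lieD a c) y.
Proof. by elim: N => //= N ->; rewrite lieD_lin. Qed.

Lemma iter_lieD0 N a c : iter N (lieD a c) 0 = 0.
Proof. by elim: N => //= N ->; rewrite lieD0. Qed.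

Lemma lieDD a c x y : lieD a c (x + y) = lieD a c x + lieD a c y.
Proof. by have := lieD_lin a c 1 x y; rewrite !scale1r. Qed.

Lemma iter_lieDD N a c x y :
  iter N (lieD a c) (x + y) = iter N (lieD a c) x + iter N (lieD a c) y.
Proof. by have := iter_lieD_lin N a c 1 x y; rewrite !scale1r. Qed.

Lemma iter_lieDZ N a c k x : iter N (lieD a c) (k *: x) = k *: iter N (lieD a c) x.
Proof. by have := iter_lieD_lin N a c k x 0; rewrite iter_lieD0 !addr0. Qed.

Lemma lieD_br a c b x : a \in A ->
  lieD a c [lie b, x] = [lie [lie a, b], x] + [lie b, lieD a c x].
Proof.
by move=> aA; rewrite /lieD lbr_evenJ ?(subvP A0) // lbrBr lbrZr addrA.
Qed.

Lemma lieD_stable a c W x : a \in A -> ad_stable A W -> x \in W -> lieD a c x \in W.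
Proof. by move=> aA sW xW; apply: memvB; [apply: sW|apply: memvZ]. Qed.

Lemma iter_lieD_stable N a c W x : a \in A -> ad_stable A W -> x \in W ->
  iter N (lieD a c) x \in W.
Proof. by move=> aA sW xW; elim: N => //= N; apply: lieD_stable. Qed.

Lemma lower_central_sub k : (lower_central A k <= A)%VS.
Proof.
case: k => [|k] /=; first exact: subvv.
elim: k => [|k IH] /=; apply: spanof_sub => _ [a [b [aA bA ->]]]; apply: Alie => //.
exact: subvP IH b bA.
Qed.

Lemma iter_lower_central k a b : a \in A -> b \in A -> iter k (lbr a) b \in lower_central A k.
Proof.
move=> aA bA; elim: k => //= k IH; apply: mem_spanof.
by exists a, (iter k (lbr a) b).
Qed.

Lemma iter_ad0 a b : a \in A -> b \in A -> iter n0 (lbr a) b = 0.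
Proof. by move=> aA bA; have := iter_lower_central n0 aA bA; rewrite Anil memv0 => /eqP. Qed.

(** By the Leibniz rule (ad a - c)^N [b, x] combines the [(ad a)^i b, (ad a - c)^j x] with i + j =
    N, and for large N one argument is killed or lies in [W]. Induction on i + j avoids the binomial
    coefficients. *)
Lemma lieD_gen W a c b x i j : ad_stable A W -> a \in A -> b \in A ->
  iter i (lbr a) b = 0 -> iter j (lieD a c) x \in W ->
  exists N, iter N (lieD a c) [lie b, x] \in W.
Proof.
move=> sW aA; have [k] := ubnP (i + j); elim: k i j b x => // k IH i j b x + bA.
rewrite ltnS => ijk ib jx.
case: j ijk jx => [|j] ijk jx; first by exists 0%N; apply: sW.
case: i ijk ib => [|i] ijk ib; first by rewrite /= in ib; exists 0%N; rewrite ib /= lbr0l mem0v.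
have jx' : iter j (lieD a c) (lieD a c x) \in W by rewrite -iterSr.
have ib' : iter i (lbr a) [lie a, b] = 0 by rewrite -iterSr.
have lt1 : (i + j.+1 < k)%N by rewrite -ltnS -addSn.
have lt2 : (i.+1 + j < k)%N by rewrite addSnnS.
have [N1 H1] := IH i j.+1 [lie a, b] x lt1 (Alie aA bA) ib' jx.
have [N2 H2] := IH i.+1 j b (lieD a c x) lt2 bA ib jx'.
exists (N1 + N2).+1; rewrite iterSr lieD_br // iter_lieDD; apply: memvD.
  by rewrite addnC iterD; apply: iter_lieD_stable.
by rewrite iterD; apply: iter_lieD_stable.
Qed.

Lemma sep_functional (W : {vspace g}) x : x \notin W ->
  exists phi : {scalar g}, phi x = 1 /\ forall w, w \in W -> phi w = 0.
Proof.
move=> xW; pose X := [tuple of x :: vbasis W].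
have Xf : free X by rewrite free_cons (span_basis (vbasisP W)) xW (basis_free (vbasisP W)).
pose f y := coord X ord0 y.
have lf : linear_for *%R f by move=> c y z; rewrite /f linearP.
exists (HB.pack_for {scalar g} f (GRing.isLinear.Build F g F *%R f lf)).
split=> [|w wW] /=; first by rewrite /f (coord_free ord0 ord0 Xf).
rewrite /f (coord_vbasis wW) linear_sum big1 // => i _; rewrite linearZ /=.
have -> : (vbasis W)`_i = X`_(lift ord0 i) by [].
by rewrite (coord_free (lift ord0 i) ord0 Xf) /= mulr0.
Qed.

Lemma stable_minimal V' V : ad_stable A V' -> ad_stable A V -> (V' <= V)%VS -> V' != V ->
  exists W, [/\ ad_stable A W, (V' <= W)%VS, (W <= V)%VS, V' != W &
    forall W', ad_stable A W' -> (V' <= W')%VS -> (W' <= W)%VS -> V' != W' -> W' = W].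
Proof.
move=> sV' sV V'V ne.
pose P k := `[< exists W, [/\ ad_stable A W, (V' <= W)%VS, (W <= V)%VS, V' != W & \dim W = k] >].
have exP : exists k, P k by exists (\dim V); apply/asboolP; exists V.
case: (ex_minnP exP) => k /asboolP[W [sW V'W WV neW dW]] min.
exists W; split=> // W' sW' V'W' W'W ne'; apply/eqP; rewrite eqEdim W'W dW /=.
by apply: min; apply/asboolP; exists W'; split=> //; apply: subv_trans WV.
Qed.

(** Take a nonzero polynomial p of least degree with p(ad a) x in [V']; dividing out a root c leaves
    a cofactor whose value on x is an eigenvector modulo [V']. *)
Lemma eigen_mod (V' V : {vspace g}) a : (forall x, x \in V -> [lie a, x] \in V) ->
  (forall x, x \in V' -> [lie a, x] \in V') -> (V' <= V)%VS -> V' != V ->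
  exists c x, [/\ x \in V, x \notin V' & lieD a c x \in V'].
Proof.
move=> aV aV' V'V ne.
have [x xV xV'] : exists2 x, x \in V & x \notin V'.
  apply: contrapT => /forall2NP H; case/eqP: ne; apply/eqP; rewrite eqEsubv V'V.
  by apply/subvP => x xV; case: (H x) => // /negP; rewrite negbK.
pose ev (p : {poly F}) : g := \sum_(i < size p) p`_i *: iter i (lbr a) x.
have evE (p : {poly F}) N : (size p <= N)%N -> ev p = \sum_(i < N) p`_i *: iter i (lbr a) x.
  move=> pN; rewrite /ev [LHS](big_ord_widen N (fun i =>
    p`_i *: iter i (lbr a) x)) // [LHS]big_mkcond.
  apply: eq_bigr => i _; case: ltnP => // ?; by rewrite nth_default // scale0r.
have itV i : iter i (lbr a) x \in V by elim: i => //= i; apply: aV.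
pose N := (\dim {:g}).+1.
have [p p0 pV'] : exists2 p : {poly F}, p != 0 & ev p \in V'.
  pose X := [tuple iter i (lbr a) x | i < N].
  have Xf : ~~ free X.
    apply/negP => /eqP; rewrite size_tuple /N => e.
    by have := dimvS (subvf <<X>>%VS); rewrite e ltnn.
  case: (pselect (forall k : 'I_N -> F, \sum_(i < N) k i *: X`_i = 0 -> forall i, k i = 0)).
    by move/freeP => Xf'; rewrite Xf' in Xf.
  case/existsNP=> k /not_implyP[kE /existsNP[i ki]].
  exists (\poly_(i < N) k (inord i)).
    apply/eqP => /polyP/(_ i); rewrite coef_poly coef0 ltn_ord => E; apply: ki.
    by rewrite -E /N inord_val.
  rewrite (evE _ N) ?size_poly // (_ : \sum_(i < N) _ = 0) ?mem0v // -[RHS]kE.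
  apply: eq_bigr => j _; rewrite coef_poly ltn_ord inord_val; congr (_ *: _).
  by rewrite (nth_map j) ?size_enum_ord // nth_ord_enum.
pose P k := `[< exists p : {poly F}, [/\ p != 0, ev p \in V' & size p = k] >].
have exP : exists k, P k by exists (size p); apply/asboolP; exists p.
case: (ex_minnP exP) => k /asboolP[q [q0 qV' sq]] min.
have : size q != 1%N.
  apply/eqP => /eqP/size_poly1P[c c0 Eq]; case/negP: xV'.
  move: qV'; rewrite Eq (evE _ 1%N) ?size_polyC ?c0 // big_ord1 coefC eqxx /= => H.
  by rewrite -[x]scale1r -(mulVf c0) -scalerA memvZ.
case/closed_rootP=> c /factor_theorem[q' Eq].
have q'0 : q' != 0 by apply: contra_neq q0 => E; rewrite Eq E mul0r.
have sq' : size q = (size q').+1 by rewrite Eq size_Mmonic ?monicXsubC // size_XsubC addn2.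
exists c, (ev q'); split.
- by apply: memv_suml => i _; apply/memvZ/itV.
- apply/negP => H; have : P (size q') by apply/asboolP; exists q'.
  by move/min; rewrite -sq sq' ltnn.
suff <- : ev q = lieD a c (ev q') by [].
rewrite (evE q (size q').+1) ?sq' // /lieD /ev lbr_sumr scaler_sumr.
have Ec i : q`_i = (if i == 0 then 0 else q'`_i.-1) - q'`_i * c.
  by rewrite Eq mulrBr coefB coefMX coefMC.
transitivity (\sum_(i < (size q').+1) ((if i == 0%N :> nat then 0 else q'`_i.-1) *: iter i (lbr a) x
    - (q'`_i * c) *: iter i (lbr a) x)).
  by apply: eq_bigr => i _; rewrite Ec scalerBl.
rewrite sumrB big_ord_recl /= scale0r add0r; congr (_ - _).
  by apply: eq_bigr => i _; rewrite lbrZr.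
rewrite big_ord_recr /= nth_default // mul0r scale0r addr0.
by apply: eq_bigr => i _; rewrite mulrC scalerA.
Qed.

(* Any subspace between [V'] and a minimal [V] is [V'] or [V], so elements
   central modulo the scalars act on [V/V'] by scalars. *)
Lemma lie_weight (V' V : {vspace g}) : ad_stable A V' -> ad_stable A V -> (V' <= V)%VS ->
  V' != V -> exists (al : {scalar g}) x,
  [/\ x \in V, x \notin V' & forall a, a \in A -> [lie a, x] - al a *: x \in V'].
Proof.
move=> sV' sV0 V'V0 ne0.
have [W [sW V'W WV neW min]] := stable_minimal sV' sV0 V'V0 ne0.
(* Minimality of [W]: a stable linear property that holds on [V'] and somewhere else in [W] holds on
   all of [W]. *)
have sub (P : g -> Prop) : (forall x, x \in V' -> P x) ->
    (forall k x y, P x -> P y -> P (k *: x + y)) ->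
    (forall a x, a \in A -> P x -> P [lie a, x]) ->
    (exists2 x, x \in W & x \notin V' /\ P x) -> forall x, x \in W -> P x.
  move=> P' PL PA [x0 x0W [x0V' Px0]].
  have [||X XP] := @vspace_of_pred _ _ (fun x => P x /\ x \in W).
  - by split; [apply: P'; apply: mem0v|apply: mem0v].
  - by move=> k x y [Px xW] [Py yW]; split; [apply: PL|apply: memvD => //; apply: memvZ].
  have XW : X = W.
    apply: min.
    - by move=> a x aA /XP[Px xW]; apply/XP; split; [apply: PA|apply: sW].
    - by apply/subvP => x xV'; apply/XP; split; [apply: P'|apply: (subvP V'W)].
    - by apply/subvP => x /XP[].
    - by apply: contraNneq x0V' => ->; apply/XP.
  by move=> x; rewrite -XW => /XP[].
(* Descending induction along the lower central series: from step [n0] on its elements are zero, and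
   [a, b] lies one step deeper than [a]. *)
have scal k a : a \in lower_central A k -> exists c, forall x, x \in W -> lieD a c x \in V'.
  have [m] := ubnP (n0 - k); elim: m k a => // m IH k a km ak.
  case: (leqP n0 k) => nk.
    exists 0 => x xW; suff -> : a = 0 by rewrite /lieD lbr0l scale0r subrr mem0v.
    move: (subnK nk) ak => <-; rewrite addnC; elim: (k - n0)%N a => [|j IHj] a.
      by rewrite addn0 Anil memv0 => /eqP.
    rewrite addnS /= => aL; apply/eqP; rewrite -memv0; move: aL; apply/subvP.
    apply: spanof_sub => _ [b [b' [_ b'A ->]]].
    by rewrite (IHj _ b'A) lbr0r mem0v.
  have aA := subvP (lower_central_sub k) a ak.
  have [c [x0 [x0W x0V' x0c]]] := eigen_mod (a := a) (sW a ^~ aA) (sV' a ^~ aA) V'W neW.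
  exists c.
  have gen x : x \in W -> exists N, iter N (lieD a c) x \in V'.
    move: x; apply: sub => [x xV'|t x y [N1 H1] [N2 H2]|b x bA [N HN]|].
    - by exists 0%N.
    - exists (N1 + N2)%N; rewrite iter_lieD_lin; apply: memvD; last first.
        by rewrite iterD; apply: iter_lieD_stable.
      by apply: memvZ; rewrite addnC iterD; apply: iter_lieD_stable.
    - exact: lieD_gen sV' aA bA (iter_ad0 aA bA) HN.
    - by exists x0 => //; split=> //; exists 1%N.
  have [N HN] : exists N, forall x, x \in W -> iter N (lieD a c) x \in V'.
    pose f i := projT1 (cid (gen _ (vbasis_mem (mem_tnth i (vbasis W))))).
    have fP i : iter (f i) (lieD a c) (tnth (vbasis W) i) \in V' by rewrite /f; case: cid.
    have [N fN] : exists N, forall i, (f i <= N)%N.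
      by exists (\max_i f i) => i; apply: leq_bigmax.
    exists N => x xW; rewrite (coord_vbasis xW).
    elim/big_ind: _ => [|y z Hy Hz|i _]; first by rewrite iter_lieD0 mem0v.
      by rewrite iter_lieDD memvD.
    rewrite iter_lieDZ -tnth_nth; apply: memvZ.
    by rewrite -(subnK (fN i)) iterD; apply: iter_lieD_stable.
  have comm b : b \in A -> forall x, x \in W -> [lie [lie a, b], x] \in V'.
    move=> bA.
    have ab : [lie a, b] \in lower_central A k.+1.
      by rewrite lbr_evenC ?(subvP A0) // memvN; apply: mem_spanof; exists b, a.
    have km' : (n0 - k.+1 < m)%N by move: km nk; clear; lia.
    have [mu Hmu] := IH _ _ km' ab.
    case: (eqVneq mu 0) => [mu0|mu0].
      by move=> x /Hmu; rewrite /lieD mu0 scale0r subr0.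
    exfalso.
    (* With D = ad a - c and [a, b] acting by mu modulo [V'], moving b past D^(M+1) yields (M+1) mu
       D^M. If mu were nonzero, this would contradict the choice of the least power of D that maps
       [W] into [V']. *)
    have id M x : exists2 w, w \in V' & x \in W -> iter M.+1 (lieD a c) [lie b, x] =
        [lie b, iter M.+1 (lieD a c) x] + ((M.+1%:R * mu) *: iter M (lieD a c) x + w).
      case: (boolP (x \in W)) => xW; last by exists 0; rewrite ?mem0v.
      elim: M => [|M [w wV' /(_ isT) E]].
        exists (lieD [lie a, b] mu x); first exact: Hmu.
        by move=> _; rewrite /= lieD_br // mul1r [lieD [lie a,
          b] mu x]/lieD [mu *: x + _]addrC subrK addrC.
      set y := iter M.+1 (lieD a c) x in E *.
      have yW : y \in W by apply: iter_lieD_stable.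
      exists (lieD [lie a, b] mu y + lieD a c w).
        by apply: memvD; [apply: Hmu|apply: lieD_stable].
      move=> _; rewrite iterS E lieDD lieD_br // lieD_lin -!iterS -/y.
      rewrite -[M.+2]addn1 natrD mulrDl mul1r.
      rewrite [lieD [lie a, b] mu y]/lieD scalerDl.
      move: ((M.+1%:R * mu) *: y) (mu *: y) [lie [lie a, b], y] => s t p.
      rewrite -(addrA s) (addrA t) [t + _]addrC subrK (addrCA s).
      by rewrite [RHS]addrCA [RHS]addrA.
    pose PN N := `[< forall x, x \in W -> iter N (lieD a c) x \in V' >].
    have exN : exists N, PN N by exists N; apply/asboolP.
    case: (ex_minnP exN) => -[|M] /asboolP HM minM.
      by case/negP: x0V'; apply: (HM x0).
    have : PN M.
      apply/asboolP => x xW; have [w wV' /(_ xW) E] := id M x.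
      have : (M.+1%:R * mu) *: iter M (lieD a c) x \in V'.
        rewrite (_ : _ *: _ = iter M.+1 (lieD a c) [lie b, x] - [lie b,
          iter M.+1 (lieD a c) x] - w).
          apply: memvB => //; apply: memvB; first exact/HM/sW.
          exact/sV'/HM.
        by rewrite E [_ - [lie b, _]]addrC addKr addrK.
      have n0' : M.+1%:R * mu != 0 by rewrite mulf_neq0 // pnatr_eq0.
      by move/(memvZ (M.+1%:R * mu)^-1); rewrite scalerA mulVf // scale1r.
    by move/minM; rewrite ltnn.
  suff H x : x \in W -> x \in W /\ lieD a c x \in V' by move=> x /H[].
  move: x; apply: sub => [x xV'|t x y [xW Hx] [yW Hy]|b x bA [xW Hx]|].
  - by split; [apply: (subvP V'W)|apply: lieD_stable].
  - by split; [apply: memvD => //; apply: memvZ|rewrite lieD_lin memvD // memvZ].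
  - split; first exact: sW.
    by rewrite lieD_br // memvD ?comm // sV'.
  - by exists x0 => //; split=> //; split.
have [x xW xV'] : exists2 x, x \in W & x \notin V'.
  apply: contrapT => /forall2NP H; case/eqP: neW; apply/eqP; rewrite eqEsubv V'W.
  by apply/subvP => x xW; case: (H x) => // /negP; rewrite negbK.
(* A functional that is 1 at [x] and 0 on [V'] reads off the scalar, which makes it linear in
   [a]. *)
have [phi [phix phi0]] := sep_functional xV'.
pose f y := phi [lie y, x].
have lf : linear_for *%R f by move=> c y z; rewrite /f lbrDl lbrZl linearP.
exists (HB.pack_for {scalar g} f (GRing.isLinear.Build F g F *%R f lf)), x.
split=> //; first exact: subvP WV x xW.
move=> a aA /=; have [c Hc] := scal 0%N a aA; have := Hc x xW; rewrite /lieD => Hx.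
by have := phi0 _ Hx; rewrite linearB linearZ /= phix mulr1 => /eqP; rewrite subr_eq0 /f => /eqP ->.
Qed.

Lemma weight_iter (al : {scalar g}) a c x N : a \in A -> weight_vector A al x ->
  iter N (lieD a c) x = (al a - c) ^+ N *: x.
Proof.
move=> aA wx; elim: N => [|N IH]; first by rewrite expr0 scale1r.
by rewrite iterS IH /lieD lbrZr wx // exprS !scalerA -scalerBl mulrBl [_ * al a]mulrC.
Qed.

(* The generalized eigenspaces of an element of [A] are [A]-stable. *)
Lemma weight_of_eigen W a c y : ad_stable A W -> a \in A -> y \in W -> y != 0 ->
  [lie a, y] = c *: y ->
  exists (al : {scalar g}) z, [/\ z \in W, z != 0, weight_vector A al z & al a = c].
Proof.
move=> sW aA yW y0 yc.
have [||X XP] := @vspace_of_pred _ _ (fun x => x \in W /\ exists N, iter N (lieD a c) x = 0).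
- by split; [apply: mem0v|exists 0%N].
- move=> k x1 x2 [x1W [N1 H1]] [x2W [N2 H2]]; split; first by rewrite memvD // memvZ.
  exists (N1 + N2)%N; rewrite iter_lieD_lin {1}addnC !iterD H1 H2 !iter_lieD0.
  by rewrite scaler0 addr0.
have s0 : ad_stable A (0%VS : {vspace g}).
  by move=> b x _; rewrite !memv0 => /eqP ->; rewrite lbr0r.
have sX : ad_stable A X.
  move=> b x bA /XP[xW [N HN]]; apply/XP; split; first exact: sW.
  have [|N' HN'] := lieD_gen (W := 0%VS) (c := c) (x := x) (j := N) s0 aA bA (iter_ad0 aA bA).
    by rewrite HN mem0v.
  by exists N'; apply/eqP; rewrite -memv0.
have yX : y \in X by apply/XP; split=> //; exists 1%N; rewrite /= /lieD yc subrr.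
have [||al [z [zX z0 zw]]] := lie_weight s0 sX.
- exact: sub0v.
- by apply: contraNneq y0 => E; rewrite -memv0 E.
rewrite memv0 in z0; have /XP[zW [N HN]] := zX.
have wz : weight_vector A al z.
  by move=> b bA; apply/eqP; rewrite -subr_eq0 -memv0; apply: zw.
exists al, z; split=> //.
move/eqP: HN; rewrite (weight_iter c N aA wz) scaler_eq0 (negPf z0) orbF expf_eq0 subr_eq0.
by case/andP=> _ /eqP.
Qed.

End LieWeights.

(** * Cartan subalgebra and root vectors of the even part *)

Section Center.
Variables (F : fieldType) (g : lieSuper F).
Hypothesis red : reductive_even g.

Definition even_center (z : g) : Prop :=
  z \in even_part g /\ forall y, y \in even_part g -> [lie y, z] = 0.

(** Each simple summand S of g_0 is central or inside the derived algebra, as [g_0, S] is a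
    submodule of S and so is 0 or S. *)
Lemma reductive_center_derived x : x \in even_part g -> exists z w,
  [/\ even_center z, w \in lbrv (even_part g) (even_part g) & x = z + w].
Proof.
have [n [S [Ssim _ SE]]] := red.
rewrite -[in x \in _]SE => /memv_sumP[v vS ->] {x}.
have H i : exists z w, [/\ even_center z, w \in lbrv (even_part g) (even_part g) & v i = z + w].
  have viS : v i \in S i by apply: vS.
  have Si0 : (S i <= even_part g)%VS by rewrite -SE (sumv_sup i).
  have [_ Sst Smin] := Ssim i.
  have sub : (lbrv (even_part g) (S i) <= S i)%VS.
    by apply: spanof_sub => _ [a [b [a0 bS ->]]]; apply: Sst.
  case: (Smin _ sub) => [a w a0 wS|E|E].
  - by apply: mem_spanof; exists a, w; split=> //; apply: subvP sub w wS.
  - exists (v i), 0; split; [split; first exact: subvP Si0 _ viS|exact: mem0v|by rewrite addr0].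
    move=> y y0; apply/eqP; rewrite -memv0 -E; apply: mem_spanof.
    by exists y, (v i).
  exists 0, (v i); split; last by rewrite add0r.
    by split; [exact: mem0v|move=> y _; rewrite lbr0r].
  move: viS; rewrite -E; move: (v i).
  apply: (spanof_ind (P := fun x => x \in lbrv (even_part g) (even_part g))) =>
    [|c a b Ha Hb|_ [a [b [a0 bS ->]]]].
  - exact: mem0v.
  - by apply: memvD => //; apply: memvZ.
  - by apply: mem_spanof; exists a, b; split=> //; apply: subvP Si0 b bS.
elim/big_ind: _ => [|x y [z [w [zc wd ->]]] [z' [w' [zc' wd' ->]]]|i _]; last exact: H.
  exists 0, 0; split; [by split; [exact: mem0v|move=> y _;
    rewrite lbr0r]|exact: mem0v|by rewrite addr0].
exists (z + z'), (w + w'); split; [|exact: memvD|by rewrite addrACA].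
split; first by apply: memvD; [case: zc|case: zc'].
by move=> y' y0; rewrite lbrDr zc.2 // zc'.2 // addr0.
Qed.

End Center.

(** * Dual vectors for an invariant form *)

Section FormDual.
Variables (F : fieldType) (g : lieSuper F) (B : g -> g -> F).
Hypothesis Bform : invariant_form B.
Local Notation g0 := (even_part g).

Lemma formDl x y z : x \in g0 -> y \in g0 -> z \in g0 -> B (x + y) z = B x z + B y z.
Proof. by move=> x0 y0 z0; case: Bform => H _ _ _; have := H 1 x y z x0 y0 z0;
  rewrite scale1r mul1r. Qed.
Lemma form0l z : z \in g0 -> B 0 z = 0.
Proof.
move=> z0; have := formDl (mem0v _) (mem0v _) z0; rewrite addr0 => /eqP.
by rewrite -[X in X == _]addr0 (inj_eq (addrI _)) eq_sym => /eqP.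
Qed.
Lemma formZl c x z : x \in g0 -> z \in g0 -> B (c *: x) z = c * B x z.
Proof. by move=> x0 z0; case: Bform => H _ _ _; have := H c x 0 z x0 (mem0v _) z0;
  rewrite form0l // !addr0. Qed.
Lemma formC x y : x \in g0 -> y \in g0 -> B x y = B y x.
Proof. by case: Bform => _ H _ _; apply: H. Qed.
Lemma formDr x y z : x \in g0 -> y \in g0 -> z \in g0 -> B x (y + z) = B x y + B x z.
Proof. by move=> x0 y0 z0; rewrite formC ?memvD // formDl // (formC y0 x0) (formC z0 x0). Qed.
Lemma form0r z : z \in g0 -> B z 0 = 0.
Proof. by move=> z0; rewrite formC ?mem0v // form0l. Qed.
Lemma formZr c x z : x \in g0 -> z \in g0 -> B z (c *: x) = c * B z x.
Proof. by move=> x0 z0; rewrite formC ?memvZ // formZl // formC. Qed.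
Lemma formA x y z : x \in g0 -> y \in g0 -> z \in g0 -> B [lie x, y] z = B x [lie y, z].
Proof. by case: Bform => _ _ H _; apply: H. Qed.
Lemma form_nondeg x : x \in g0 -> (forall y, y \in g0 -> B x y = 0) -> x = 0.
Proof. by case: Bform => _ _ _ H; apply: H. Qed.
Lemma formNl x z : x \in g0 -> z \in g0 -> B (- x) z = - B x z.
Proof. by move=> x0 z0; rewrite -scaleN1r formZl // mulN1r. Qed.
Lemma form_skew a x y : a \in g0 -> x \in g0 -> y \in g0 -> B [lie a, x] y = - B x [lie a, y].
Proof.
move=> a0 x0 y0; rewrite lbr_evenC // formNl ?formA //.
by have := lbr_part x0 a0.
Qed.
Lemma form_suml (I : Type) (s : seq I) (P : pred I) (f : I -> g) y : (forall i,
  P i -> f i \in g0) ->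
  y \in g0 -> B (\sum_(i <- s | P i) f i) y = \sum_(i <- s | P i) B (f i) y.
Proof.
move=> f0 y0; suff [] : B (\sum_(i <- s | P i) f i) y = \sum_(i <- s | P i) B (f i) y
  /\ \sum_(i <- s | P i) f i \in g0 by [].
elim/big_rec2: _ => [|i u v Pi [<- v0]]; first by rewrite form0l ?mem0v.
by rewrite formDl ?memvD ?f0.
Qed.
Lemma form_sumr (I : Type) (s : seq I) (P : pred I) (f : I -> g) y : (forall i,
  P i -> f i \in g0) ->
  y \in g0 -> B y (\sum_(i <- s | P i) f i) = \sum_(i <- s | P i) B y (f i).
Proof.
move=> f0 y0; rewrite formC ?memv_suml // form_suml //.
by apply: eq_bigr => i Pi; rewrite formC ?f0.
Qed.
Lemma form_spanof0 S y : (forall x, S x -> x \in g0 /\ B x y = 0) -> y \in g0 ->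
  forall x, x \in spanof S -> B x y = 0.
Proof.
move=> SB y0 x xS; suff [] : x \in g0 /\ B x y = 0 by [].
move: x xS; apply: spanof_ind => [|c u v [u0 Bu] [v0 Bv]|x /SB//].
  by rewrite form0l ?mem0v.
by rewrite memvD ?memvZ // formDl ?memvZ // formZl // Bu Bv mulr0 addr0.
Qed.

(** The Gram matrix between a basis of [W] and the [x j] has independent columns, hence a left
    inverse, whose rows are the coordinates of the [z i]. *)
Lemma form_dual (W : {vspace g}) p (x : 'I_p -> g) : (W <= g0)%VS ->
  (forall i, x i \in g0) ->
  (forall c : 'I_p -> F, (forall w, w \in W -> B w (\sum_j c j *: x j) = 0) -> forall j, c j = 0) ->
  exists z : 'I_p -> g, (forall i, z i \in W) /\ forall i j, B (z i) (x j) = (i == j)%:R.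
Proof.
move=> W0 x0 inj; pose w (i : 'I_(\dim W)) := (vbasis W)`_i.
have wW i : w i \in W by apply/vbasis_mem/mem_nth; rewrite size_tuple.
have w0 i : w i \in g0 by apply: subvP W0 _ (wW i).
pose G := \matrix_(i < \dim W, j < p) B (w i) (x j).
have /row_fullP[L LG] : row_full G.
  suff : row_free G^T by rewrite /row_free /row_full mxrank_tr.
  rewrite -kermx_eq0.
  apply/eqP/row_matrixP => k; rewrite row0; set c := row k (kermx G^T).
  apply/rowP => j; rewrite [RHS]mxE; move: j.
  have cG : c *m G^T = 0 by apply/sub_kermxP/row_sub.
  apply: (inj (fun j => c 0 j)) => v vW; rewrite (coord_vbasis vW).
  rewrite form_suml => [||]; last 2 first.
  - by move=> i _; apply/memvZ/w0.
  - by apply: memv_suml => i _; apply/memvZ.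
  rewrite big1 // => i _; rewrite formZl ?w0 //; last by apply: memv_suml => l _; apply/memvZ.
  rewrite form_sumr ?w0 // => [|l _]; last exact: memvZ.
  have /rowP/(_ i) := cG; rewrite !mxE => E; rewrite (_ : \sum_l _ = 0) ?mulr0 // -[RHS]E.
  by apply: eq_bigr => l _; rewrite !mxE formZr ?w0.
exists (fun i => \sum_k L i k *: w k); split=> [i|i j].
  by apply: memv_suml => k _; apply/memvZ/wW.
have /matrixP/(_ i j) := LG; rewrite !mxE => <-.
rewrite form_suml // => [|k _]; last exact/memvZ/w0.
by apply: eq_bigr => k _; rewrite formZl ?w0 // mxE.
Qed.

End FormDual.

(* [lt c d] stands for Re lam_c(H) < Re lam_d(H) on the weights lam_c of the
   basis [b], with [b'] its dual basis for [B]. *)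
Record root_data (F : fieldType) (g : lieSuper F) (B : g -> g -> F) (m0 A : {vspace g})
    (p : nat) (I : finType) (b b' : I -> g) (ys : 'I_p -> g) (lt : rel I) : Prop := RootData {
  rd_b : forall c, b c \in even_part g;
  rd_b' : forall c, b' c \in even_part g;
  rd_exp : forall y, y \in even_part g -> y = \sum_c B y (b' c) *: b c;
  rd_exp' : forall y, y \in even_part g -> y = \sum_c B y (b c) *: b' c;
  rd_lt : transitive lt;
  rd_irr : irreflexive lt;
  rd_low : forall c d, c != d -> ~~ lt c d -> [lie b c, b' d] \in m0;
  rd_A : forall a, a \in A -> a \in even_part g;
  rd_ab : forall a a', a \in A -> a' \in A -> [lie a, a'] = 0;
  rd_t : forall c, [lie b c, b' c] \in A;
  rd_span : forall a, a \in A -> exists (k : I -> F) z,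
    even_center z /\ a = \sum_c k c *: [lie b c, b' c] + z;
  rd_ys : forall i, ys i \in even_part g;
  rd_dec : forall y, y \in even_part g -> exists (k : 'I_p -> F) a x,
    [/\ a \in A, x \in m0 & y = \sum_i k i *: ys i + a + x]
}.

(** * The Cartan subalgebra inside the nonpositive part of the grading *)

Section Torus.
Variables (F : numClosedFieldType) (g : lieSuper F) (h : g) (B : g -> g -> F).
Local Notation g0 := (even_part g).
Local Notation m0 := (neg_part h :&: even_part g)%VS.
Hypothesis h0 : h \in g0.
Hypothesis gspan : g0 = spanof (fun y => [/\ y \in g0, exists i, y \in lpart g i &
                                 exists k : int, y \in grade h (2 * k)]).
Variables (p : nat) (u : 'I_p -> g) (d : 'I_p -> nat).
Hypothesis u_basis : basis_of m0 (codom u).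
Hypothesis ugr : forall i, u i \in grade h (- (d i)%:Z).
Hypothesis d_gt0 : forall i, (0 < d i)%N.
Hypothesis Bform : invariant_form B.
Hypothesis red : reductive_even g.
Variables (A : {vspace g}) (H : g) (n : {vspace g}).
Hypothesis Acart : cartan_even A.
Hypothesis HA : H \in A.
Hypothesis Hreg : forall (al : {scalar g}) x, x != 0 -> weight_vector A al x ->
  (exists2 y, y \in A & al y != 0) -> 'Re (al H) != 0.
Hypothesis nE : n = spanof (fun x =>
  exists2 al : {scalar g}, weight_vector A al x & 0 < 'Re (al H)).
Hypothesis n0 : (n :&: g0)%VS = m0.

Lemma A_sub : (A <= g0)%VS. Proof. by case: Acart. Qed.
Lemma A_lie : ad_stable A A. Proof. by case: Acart. Qed.
Lemma A_even a : a \in A -> a \in g0. Proof. by move/(subvP A_sub). Qed.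
Lemma H_even : H \in g0. Proof. exact: A_even. Qed.
Lemma m0_even y : y \in m0 -> y \in g0. Proof. by rewrite memv_cap => /andP[]. Qed.
Lemma lie_even x y : x \in g0 -> y \in g0 -> [lie x, y] \in g0.
Proof. by move=> x0 y0; have := lbr_part x0 y0. Qed.

(** The grading is even, so degrees are halved: [low 0] is the nonpositive part of g_0 and [low 1]
    turns out to be m_0. *)
Definition low (j : int) := spanof (fun y =>
  y \in g0 /\ exists2 k : int, k <= - j & y \in grade h (2 * k)).
Definition high := spanof (fun y => y \in g0 /\ exists2 k : int, 0 < k & y \in grade h (2 * k)).

Definition high0 := spanof (fun y => y \in g0 /\ exists2 k : int, 0 <= k & y \in grade h (2 * k)).

Lemma low_sub j y : y \in low j -> y \in g0.
Proof. by move: y; apply/subvP/spanof_sub => y []. Qed.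
Lemma high_sub y : y \in high -> y \in g0.
Proof. by move: y; apply/subvP/spanof_sub => y []. Qed.

Lemma B_grade i j y z : y \in g0 -> z \in g0 -> y \in grade h i -> z \in grade h j ->
  i + j != 0 -> B y z = 0.
Proof.
move=> y0 z0 /gradeP yi /gradeP zj ij; have := form_skew Bform h0 y0 z0.
rewrite yi zj formZl // formZr // => /eqP; rewrite -subr_eq0 opprK -mulrDl -intrD mulf_eq0 intr_eq0.
by rewrite (negPf ij) => /eqP.
Qed.

Lemma B_homog y : y \in g0 -> (forall z k, z \in g0 -> z \in grade h (2 * k) -> B y z = 0) -> y = 0.
Proof.
move=> y0 yB; apply: (form_nondeg Bform y0) => z; rewrite gspan => z0;
  rewrite (formC Bform) -?gspan //.
  move: z z0; apply: (form_spanof0 Bform) => // z [z0 _ [k zk]]; split=> //.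
  by rewrite (formC Bform) // (yB z k).
by rewrite gspan.
Qed.

Lemma g0_dec y : y \in g0 -> exists y1 y2, [/\ y1 \in low 0, y2 \in high & y = y1 + y2].
Proof.
rewrite gspan; move: y.
apply: spanof_ind => [|c y z [y1 [y2 [Y1 Y2 ->]]] [z1 [z2 [Z1 Z2 ->]]]|y [y0 _ [k yk]]].
- by exists 0, 0; rewrite !mem0v addr0.
- exists (c *: y1 + z1), (c *: y2 + z2); split; try by apply: memvD => //; apply: memvZ.
  by rewrite scalerDr addrACA.
case: (lerP k 0) => k0.
  by exists y, 0; rewrite mem0v addr0; split=> //; apply: mem_spanof; split=> //;
    exists k => //; rewrite oppr0.
by exists 0, y; rewrite mem0v add0r; split=> //; apply: mem_spanof; split=> //; exists k.
Qed.

Lemma B_low_grade (j k : int) y z : y \in low j -> z \in g0 -> z \in grade h (2 * k) -> k < j ->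
  B y z = 0.
Proof.
move=> yj z0 zk kj; move: y yj; apply: (form_spanof0 Bform) => // y [y0 [i ij yi]]; split=> //.
by apply: (B_grade y0 z0 yi zk); move: ij kj; clear; lia.
Qed.

Lemma g0_dec1 z : z \in g0 -> exists z1 z2, [/\ z1 \in low 1,
    z2 \in high0 & z = z1 + z2].
Proof.
rewrite gspan; move: z.
apply: spanof_ind => [|c z w [z1 [z2 [Z1 Z2 ->]]] [w1 [w2 [W1 W2 ->]]]|z [z0 _ [k zk]]].
- by exists 0, 0; rewrite !mem0v addr0.
- exists (c *: z1 + w1), (c *: z2 + w2); split; try by apply: memvD => //; apply: memvZ.
  by rewrite scalerDr addrACA.
case: (lerP 0 k) => k0.
  by exists 0, z; rewrite mem0v add0r; split=> //; apply: mem_spanof; split=> //; exists k.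
by exists z, 0; rewrite mem0v addr0; split=> //; apply: mem_spanof; split=> //; exists k.
Qed.

(** A component of nonnegative degree that lies in m_0 is orthogonal to every homogeneous element:
    to those of positive degree by its own degree, to the others by the negative degrees of the
    [u i]. *)
Lemma low1 : low 1 = m0.
Proof.
have low_m : (low 1 <= m0)%VS.
  apply: spanof_sub => y [y0 [k k1 yk]]; rewrite memv_cap y0 andbT.
  by apply: (grade_neg _ yk); move: k1; clear; lia.
apply/eqP; rewrite eqEsubv low_m /=; apply/subvP => y ym.
have y0 := m0_even ym; have [y1 [y2 [Y1 Y2 E]]] := g0_dec1 y0.
have y2m : y2 \in m0.
  by rewrite -[y2](addKr y1) -E memvD // memvN; apply: subvP low_m _ Y1.
rewrite E (_ : y2 = 0) ?addr0 //; apply: B_homog => [|z k z0 zk]; first exact: m0_even.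
case: (ltrP 0 k) => k0.
  move: y2 Y2 {E y2m}; apply: (form_spanof0 Bform) => // y2 [y20 [i i0 yi]]; split=> //.
  by apply: (B_grade y20 z0 yi zk); move: i0 k0; clear; lia.
have [c ->] := codom_coords u_basis y2m.
rewrite (form_suml Bform) // => [|i _]; last by apply/memvZ/m0_even/(codom_mem u_basis).
have ui0 i : u i \in g0 by apply/m0_even/(codom_mem u_basis).
rewrite big1 // => i _; rewrite (formZl Bform) // (B_grade (ui0 i) z0 (ugr i) zk) ?mulr0 //.
by move: (d_gt0 i) k0; clear; lia.
Qed.

Definition perp_m0 y := y \in g0 /\ forall x, x \in m0 -> B y x = 0.

(** The component of positive degree is orthogonal to m_0, because [y] and its nonpositive component
    are, and to all nonnegative degrees; nondegeneracy removes it. *)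
Lemma perp_low y : perp_m0 y -> y \in low 0.
Proof.
move=> [y0 yB]; have [y1 [y2 [Y1 Y2 E]]] := g0_dec y0.
rewrite E (_ : y2 = 0) ?addr0 //; apply: B_homog => [|z k z0 zk]; first exact: high_sub.
case: (ltrP k 0) => k0.
  have zm : z \in m0.
    by rewrite -low1; apply: mem_spanof; split=> //; exists k.
  have -> : y2 = y - y1 by rewrite E addrC addKr.
  rewrite (formDl Bform) ?memvN ?(low_sub Y1) // (formNl Bform) ?(low_sub Y1) // yB // sub0r.
  by rewrite (B_low_grade Y1 z0 zk) ?oppr0.
move: y2 Y2 {E}; apply: (form_spanof0 Bform) => // y2 [y20 [i i0 yi]]; split=> //.
by apply: (B_grade y20 z0 yi zk); move: i0 k0; clear; lia.
Qed.

Lemma low_perp y : y \in low 0 -> perp_m0 y.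
Proof.
move=> yl; split; first exact: low_sub yl.
move=> x; rewrite -low1 => xm; rewrite (formC Bform) ?(low_sub yl) ?(low_sub xm) //.
have x0 := low_sub xm.
move: x xm x0 => x xm x0; rewrite (formC Bform) // ?(low_sub yl) //.
move: y yl; apply: (form_spanof0 Bform) => // y [y0 [k k0 yk]]; split=> //.
rewrite (formC Bform) //; apply: (B_low_grade xm y0 yk).
by move: k0; clear; lia.
Qed.

Lemma low_lie (i j : int) x y : x \in low i -> y \in low j -> [lie x, y] \in low (i + j).
Proof.
move=> xi yj; move: x xi.
pose Px x := [lie x, y] \in low (i + j).
apply: (spanof_ind (P := Px)) => [|c x1 x2 H1 H2|x [x0 [k ki xk]]]; rewrite /Px.
- by rewrite lbr0l mem0v.
- by rewrite lbrDl lbrZl memvD // memvZ.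
move: y yj {Px}; pose Py y := [lie x, y] \in low (i + j).
apply: (spanof_ind (P := Py)) => [|c y1 y2 H1 H2|y [y0 [l lj yl]]]; rewrite /Py.
- by rewrite lbr0r mem0v.
- by rewrite lbrDr lbrZr memvD // memvZ.
apply: mem_spanof; split; first exact: lie_even.
exists (k + l); first by move: ki lj; clear; lia.
by rewrite mulrDr; apply: grade_lbr.
Qed.

Lemma low_h (j : int) x : x \in low j -> [lie h, x] + (2 * j)%:~R *: x \in low (j + 1).
Proof.
move: x; pose Px x := [lie h, x] + (2 * j)%:~R *: x \in low (j + 1).
apply: (spanof_ind (P := Px)) => [|c x1 x2 H1 H2|x [x0 [k kj xk]]]; rewrite /Px.
- by rewrite lbr0r scaler0 addr0 mem0v.
- rewrite lbrDr lbrZr scalerDr addrACA scalerA mulrC -scalerA -scalerDr.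
  by rewrite memvD // memvZ.
have /gradeP -> := xk; rewrite -scalerDl -intrD.
case: (eqVneq k (- j)) => [->|kj'].
  by rewrite (_ : _ + _ = 0) ?scale0r ?mem0v //; clear; lia.
apply: memvZ; apply: mem_spanof; split=> //; exists k => //.
by move: kj kj'; clear; lia.
Qed.

(* On [low j] modulo [low (j + 1)] the operator is multiplication by [- 2 j]. *)
Lemma shifted_h_inj w x : w \in m0 -> x \in m0 -> [lie h + w, x] = 0 -> x = 0.
Proof.
move=> wm xm E.
have xl k : x \in low (k.+1)%:Z.
  elim: k => [|k IH]; first by rewrite low1.
  have := low_h IH; rewrite -low1 in wm; have := low_lie wm IH.
  rewrite addrC => Hw Hh; have := memvD Hh Hw.
  rewrite addrAC -lbrDl E add0r => /(memvZ ((2 * (k.+1)%:Z)%:~R)^-1).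
  rewrite scalerA mulVf ?intr_eq0 // scale1r.
  by rewrite (_ : (k.+1)%:Z + 1 = (k.+2)%:Z) //; clear; lia.
apply: B_homog => [|z k z0 zk]; first exact: m0_even.
apply: (B_low_grade (xl `|k|%N) z0 zk); clear; lia.
Qed.

Lemma weight_vector_m0 (al : {scalar g}) z : z \in g0 -> weight_vector A al z -> 0 < 'Re (al H) ->
  z \in m0.
Proof. by move=> z0 zw zH; rewrite -n0 memv_cap z0 andbT nE; apply: mem_spanof; exists al. Qed.

(** [n] may contain odd vectors, so the induction over [n] runs on even components, which keep the
    weights. *)
Lemma m0_ind (P : g -> Prop) : P 0 -> (forall c x y, P x -> P y -> P (c *: x + y)) ->
  (forall (al : {scalar g}) x, x \in m0 -> weight_vector A al x -> 0 < 'Re (al H) -> P x) ->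
  forall x, x \in m0 -> P x.
Proof.
move=> P0 PL PW x; rewrite -n0 memv_cap => /andP[xn x0].
suff : forall y, y \in n -> forall y0 y1, y0 \in g0 -> y1 \in odd_part g -> y = y0 + y1 -> P y0.
  by move/(_ x xn x 0 x0 (mem0v _)); rewrite addr0; apply.
move=> {x xn x0} y; rewrite nE; move: y.
have uniq_part (y0 y1 z0 z1 : g) : y0 \in g0 -> y1 \in odd_part g -> z0 \in g0 -> z1 \in
  odd_part g ->
    y0 + y1 = z0 + z1 -> y0 = z0.
  move=> Y0 Y1 Z0 Z1 E; apply/eqP; rewrite -subr_eq0; apply/eqP.
  apply: even_odd0; first by rewrite memvB.
  have -> : y0 - z0 = z1 - y1 by apply/eqP; rewrite subr_eq addrAC eq_sym subr_eq addrC E.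
  by rewrite memvB.
apply: spanof_ind => [y0 y1 p0 p1 E|c y z IHy IHz t0 t1 p0 p1 E|y [al yw yH] y0 y1 p0 p1 E].
- by rewrite (uniq_part y0 y1 0 0) ?mem0v // -E addr0.
- have [y0 [y1 [q0 q1 Ey]]] := part_decomp y; have [z0 [z1 [s0 s1 Ez]]] := part_decomp z.
  rewrite (uniq_part t0 t1 (c *: y0 + z0) (c *: y1 + z1)) //; try by rewrite memvD // memvZ.
    by apply: PL; [apply: (IHy y0 y1)|apply: (IHz z0 z1)].
  by rewrite -E Ey Ez scalerDr addrACA.
rewrite E in yw; have [w0 _] := weight_part A_sub p0 p1 yw.
exact: PW (weight_vector_m0 p0 w0 yH) w0 yH.
Qed.


Lemma perp_low_m0 y : y \in g0 -> (forall z, z \in low 0 -> B y z = 0) -> y \in m0.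
Proof.
move=> y0 yB; have [y1 [y2 [Y1 Y2 E]]] := g0_dec1 y0.
have y20 : y2 \in g0.
  by move: y2 Y2 {E}; apply/subvP/spanof_sub => z [].
rewrite -low1 E (_ : y2 = 0) ?addr0 //; apply: B_homog => // z k z0 zk.
case: (ltrP 0 k) => k0.
  move: y2 Y2 {E y20}; apply: (form_spanof0 Bform) => // y2 [y20 [i i0 yi]]; split=> //.
  by apply: (B_grade y20 z0 yi zk); move: i0 k0; clear; lia.
have -> : y2 = y - y1 by rewrite E addrC addKr.
rewrite (formDl Bform) ?memvN ?(low_sub Y1) // (formNl Bform) ?(low_sub Y1) //.
rewrite yB ?sub0r; last by apply: mem_spanof; split=> //; exists k => //; rewrite oppr0.
by rewrite (B_low_grade Y1 z0 zk) ?oppr0 //; move: k0; clear; lia.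
Qed.

Lemma lieD00 (a x : g) N : iter N (lieD a 0) x = iter N (lbr a) x.
Proof. by apply: eq_iter => y; rewrite /lieD scale0r subr0. Qed.

Lemma A_nil : exists k, forall a b, a \in A -> b \in A -> iter k (lbr a) b = 0.
Proof. by have [_ _ [k Ak] _] := Acart; exists k => a b; apply: (iter_ad0 (F := F) Ak). Qed.

(** The generalized null space [K] of ad H is A-stable and contains [A]. A weight of K/A that is 0
    has a vector normalizing [A], hence in [A]; a nonzero one leads to a nonzero weight that
    vanishes at [H], which regularity excludes. *)
Lemma gen0_A x N : x \in g0 -> iter N (lbr H) x = 0 -> x \in A.
Proof.
have [_ _ [k Ak] Anorm] := Acart.
move=> x0 xN.
have [||K KP] := @vspace_of_pred _ _ (fun x => x \in g0 /\ exists N, iter N (lieD H 0) x = 0).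
- by split; [apply: mem0v|exists 0%N].
- move=> c x1 x2 [x1W [N1 H1]] [x2W [N2 H2]]; split; first by rewrite memvD // memvZ.
  exists (N1 + N2)%N; rewrite iter_lieD_lin {1}addnC !iterD H1 H2 !iter_lieD0.
  by rewrite scaler0 addr0.
have s0 : ad_stable A (0%VS : {vspace g}).
  by move=> b y _; rewrite !memv0 => /eqP ->; rewrite lbr0r.
have sK : ad_stable A K.
  move=> b y bA /KP[y0 [M HM]]; apply/KP; split; first exact: lie_even (A_even bA) y0.
  have [|M' HM'] := lieD_gen A_sub A_lie (W := 0%VS) (c := 0) (x := y) (j := M) s0 HA bA
    (iter_ad0 (F := F) Ak HA bA).
    by rewrite HM mem0v.
  by exists M'; apply/eqP; rewrite -memv0.
have AK : (A <= K)%VS.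
  by apply/subvP => a aA; apply/KP; split; [exact: A_even|exists k;
    rewrite lieD00 (iter_ad0 (F := F) Ak)].
have xK : x \in K by apply/KP; split=> //; exists N; rewrite lieD00.
suff -> : A = K by [].
apply/eqP; apply: contraT => neAK.
have [al [y [yK yA yw]]] := lie_weight A_sub A_lie Ak A_lie sK AK neAK.
have /KP[y0 _] := yK.
case: (pselect (exists2 a, a \in A & al a != 0)) => [[a aA ala]|al0]; last first.
  case/negP: yA; apply: Anorm => // a aA.
  rewrite lbr_evenC // memvN; have := yw a aA; suff -> : al a = 0 by rewrite scale0r subr0.
  by apply/eqP; apply: contra_notT al0 => ala; exists a.
(* [ad a] is nilpotent on [A], so a power of it turns [y] into an eigenvector. *)
pose z := iter k (lbr a) y.
have za : [lie a, z] = al a *: z.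
  have : iter k (lbr a) ([lie a, y] - al a *: y) = 0 by apply: (iter_ad0 (F := F) Ak aA (yw a aA)).
  rewrite -lieD00 -[X in iter k _ (_ + X)]scaleN1r addrC iter_lieD_lin iter_lieDZ scaleN1r addrC
    !lieD00.
  by rewrite -iterSr iterS => /eqP; rewrite subr_eq0 => /eqP.
have zK : z \in K.
  by rewrite /z; elim: (k) => //= j IH; apply: sK.
have z0 : z != 0.
  apply: contraNneq (yA) => z0.
  have : forall j, iter j (lbr a) y = 0 -> y \in A; last by apply; apply: z0.
  elim=> [|j IH] /= E; first by rewrite E mem0v.
  (* Modulo [A] the j-th power of ad a multiplies [y] by al(a)^j, so its vanishing would put [y]
     into [A]. *)
  apply: IH; have yj : forall j, exists2 b, b \in A & iter j (lbr a) y = al a ^+ j *: y + b.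
    elim=> [|i [b bA Eb]]; first by exists 0; rewrite ?mem0v // expr0 scale1r addr0.
    exists (al a ^+ i *: ([lie a, y] - al a *: y) + [lie a, b]).
      by rewrite memvD ?memvZ ?yw ?A_lie.
    rewrite /= Eb lbrDr lbrZr scalerBr scalerA -exprSr addrA; congr (_ + _).
    by rewrite addrCA subrr addr0.
  exfalso; have [b bA Eb] := yj j.+1; rewrite /= E in Eb.
  case/negP: yA; rewrite -[y]scale1r -(mulVf (expf_neq0 j.+1 ala)) -scalerA memvZ //.
  by have := esym Eb; move/eqP; rewrite addr_eq0 => /eqP ->; rewrite memvN.
have [be [w [wK w0 wb bea]]] := weight_of_eigen A_sub A_lie Ak sK aA zK z0 za.
have /KP[_ [M HM]] := wK.
have beH : be H = 0.
  move/eqP: HM; rewrite (weight_iter 0 M HA wb) scaler_eq0 (negPf w0) orbF expf_eq0 subr0.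
  by case/andP=> _ /eqP.
have := Hreg w0 wb; rewrite beH raddf0 eqxx; apply.
by exists a => //; rewrite bea.
Qed.

Lemma free_gen_basis (S : g -> Prop) : exists s : seq g,
  (forall x, x \in s -> S x) /\ basis_of (spanof S) s.
Proof.
pose P k := `[< exists s : seq g, [/\ forall x, x \in s -> S x, free s & size s = k] >].
have exP : exists k, P k by exists 0%N; apply/asboolP; exists [::]; rewrite nil_free.
have ubP k : P k -> (k <= \dim {:g})%N.
  by case/asboolP=> s [_ /eqP <- <-]; apply/dimvS/subvf.
case: (ex_maxnP exP ubP) => k /asboolP[s [sS sf sk]] max.
exists s; split=> //; rewrite basisEfree sf /=; apply/andP; split.
  by apply/span_subvP => x /sS; apply: mem_spanof.
rewrite -(eqP (_ : \dim <<s>> == size s)) //; apply/dimvS/spanof_sub => x Sx.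
apply: contraT => xs; have /max : P k.+1.
  apply/asboolP; exists (x :: s); split=> [y||/=]; last by rewrite sk.
    by rewrite inE => /predU1P[->|/sS].
  by rewrite free_cons xs.
by rewrite ltnn.
Qed.

Lemma weight_basis : exists (xs : 'I_p -> g) (lam : 'I_p -> {scalar g}),
  [/\ basis_of m0 (codom xs), forall i, weight_vector A (lam i) (xs i) & forall i,
    0 < 'Re (lam i H)].
Proof.
pose S x := x \in m0 /\ exists2 al : {scalar g}, weight_vector A al x & 0 < 'Re (al H).
have E : spanof S = m0.
  apply/eqP; rewrite eqEsubv; apply/andP; split; first by apply: spanof_sub => x [].
  apply/subvP; apply: m0_ind => [|c x y xS yS|al x xm xw xH]; first exact: mem0v.
    by rewrite memvD // memvZ.
  by apply: mem_spanof; split=> //; exists al.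
have [s [sS sb]] := free_gen_basis S; rewrite E in sb.
have ss : size s = p.
  have := basis_free sb; have := basis_free u_basis.
  by rewrite /free (span_basis sb) (span_basis u_basis) size_codom card_ord => /eqP -> /eqP.
have si (i : 'I_p) : s`_i \in s by rewrite mem_nth ?ss.
exists (fun i => s`_i), (fun i => s2val (cid2 (sS _ (si i)).2)); split=> [|i|i].
- suff -> : codom (fun i : 'I_p => s`_i) = s by [].
  apply: (@eq_from_nth _ 0); first by rewrite size_codom card_ord ss.
  move=> i; rewrite size_codom card_ord => ip.
  by rewrite codomE (nth_map (Ordinal ip)) ?size_enum_ord // nth_enum_ord.
- exact: s2valP (cid2 (sS _ (si i)).2).
- exact: s2valP' (cid2 (sS _ (si i)).2).
Qed.


Section WeightBasis.
Variables (xs : 'I_p -> g) (lam : 'I_p -> {scalar g}).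
Hypothesis xsb : basis_of m0 (codom xs).
Hypothesis xsw : forall i, weight_vector A (lam i) (xs i).
Hypothesis lamp : forall i, 0 < 'Re (lam i H).

Lemma xs_m i : xs i \in m0. Proof. exact: (codom_mem xsb). Qed.
Lemma xs_even i : xs i \in g0. Proof. exact/m0_even/xs_m. Qed.
Lemma xs_neq0 i : xs i != 0.
Proof.
apply/eqP => E; have := @codom_free _ _ _ _ _ xsb (fun j => (j == i)%:R).
rewrite (bigD1 i) //= eqxx E scaler0 add0r big1 => [|j /negPf ->]; last by rewrite scale0r.
by move/(_ erefl i)/eqP; rewrite eqxx oner_eq0.
Qed.
Lemma Re_neq0 (c : F) : 0 < 'Re c -> c != 0.
Proof. by apply: contraTneq => ->; rewrite raddf0 ltxx. Qed.

Lemma lie_xs a (c : 'I_p -> F) : a \in A -> [lie a,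
  \sum_i c i *: xs i] = \sum_i (c i * lam i a) *: xs i.
Proof. by move=> aA; rewrite lbr_sumr; apply: eq_bigr => i _; rewrite lbrZr xsw // scalerA. Qed.

Lemma m0_solve a q : a \in A -> (forall i, lam i a != 0) -> q \in m0 ->
  exists2 w, w \in m0 & [lie a, w] = q.
Proof.
move=> aA a0 /(codom_coords xsb)[c ->]; exists (\sum_i (c i / lam i a) *: xs i).
  by apply: memv_suml => i _; apply/memvZ/xs_m.
by rewrite lie_xs //; apply: eq_bigr => i _; rewrite divfK.
Qed.

Lemma m0_lieA a x : a \in A -> x \in m0 -> [lie a, x] \in m0.
Proof.
move=> aA /(codom_coords xsb)[c ->]; rewrite lie_xs //.
by apply: memv_suml => i _; apply/memvZ/xs_m.
Qed.

Lemma m0_H_inj x : x \in m0 -> [lie H, x] = 0 -> x = 0.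
Proof.
move=> /(codom_coords xsb)[c ->]; rewrite lie_xs // => /(codom_free xsb) E.
rewrite big1 // => i _; have /eqP := E i.
by rewrite mulf_eq0 (negPf (Re_neq0 (lamp i))) orbF => /eqP ->; rewrite scale0r.
Qed.

(** ad H is nilpotent on [A] and injective on m_0, where its eigenvalues have positive real part. *)
Lemma A_m0 x : x \in A -> x \in m0 -> x = 0.
Proof.
move=> xA xm; have [k /(_ H x HA xA)] := A_nil.
elim: k => // k IH; rewrite iterS => /m0_H_inj E; apply/IH/E.
by elim: (k) => //= j; apply: m0_lieA.
Qed.

Lemma B_iter a N y i : a \in A -> y \in g0 ->
  B (iter N (lbr a) y) (xs i) = (- lam i a) ^+ N * B y (xs i).
Proof.
move=> aA y0; elim: N y y0 => [|N IH] y y0; first by rewrite mul1r.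
rewrite iterSr IH; last exact: lie_even (A_even aA) y0.
by rewrite (form_skew Bform (A_even aA) y0 (xs_even i)) xsw // (formZr Bform) ?xs_even // exprSr
  -mulrA mulNr.
Qed.

(** A power of ad H kills [a], whereas moving it onto [xs i] multiplies the pairing by a nonzero
    power of -lam_i(H); so [A] is orthogonal to m_0. *)
Lemma A_low a : a \in A -> a \in low 0.
Proof.
move=> aA; apply: perp_low; split=> [|x /(codom_coords xsb)[c ->]]; first exact: A_even.
rewrite (form_sumr Bform) ?A_even // => [|i _]; last exact/memvZ/xs_even.
rewrite big1 // => i _; rewrite (formZr Bform) ?xs_even ?A_even //.
have [k Ak] := A_nil; have := B_iter k i HA (A_even aA).
rewrite (Ak H a HA aA) (form0l Bform) ?xs_even // => /esym/eqP; rewrite mulf_eq0 expf_eq0 oppr_eq0.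
by rewrite (negPf (Re_neq0 (lamp i))) andbF => /eqP ->; rewrite mulr0.
Qed.

Lemma m0_low x : x \in m0 -> x \in low 0.
Proof.
rewrite -low1; move: x; apply/subvP/spanof_sub => y [y0 [k k1 yk]].
by apply: mem_spanof; split=> //; exists k => //; move: k1; clear; lia.
Qed.

Lemma low_m0 x y : x \in low 0 -> y \in m0 -> [lie x, y] \in m0.
Proof. by rewrite -low1 => x0 y1; have := low_lie x0 y1; rewrite add0r. Qed.

(** [H] has nonpositive degree, so [h, H] lies in m_0 and equals [H, w] for some w in m_0; then h +
    w commutes with [H]. *)
Lemma ht_ex : exists w, w \in m0 /\ h + w \in A.
Proof.
have hH : [lie h, H] \in m0.
  have := low_h (A_low HA); rewrite mulr0 scale0r addr0 add0r low1.
  exact.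
have [w wm E] := m0_solve HA (fun i => Re_neq0 (lamp i)) hH.
exists w; split=> //; apply: (@gen0_A _ 1); first by rewrite memvD ?h0 ?m0_even.
by rewrite /= lbrDr E lbr_evenC ?H_even // addNr.
Qed.

(* The element of [A] congruent to [h] centralizes a complement of [m0] in the
   sum [low 0] of the nonpositive degrees, and this complement is [A]. *)
Lemma low_dec y : y \in low 0 -> exists a x, [/\ a \in A, x \in m0 & y = a + x].
Proof.
have [w [wm htA]] := ht_ex; set ht := h + w in htA.
have [k Ak] := A_nil.
have ht0 := A_even htA.
have low_ht p0 : p0 \in low 0 -> [lie ht, p0] \in m0.
  move=> pl; rewrite lbrDl memvD //; last by rewrite lbr_evenC ?(m0_even wm) // memvN low_m0.
  by have := low_h pl; rewrite mulr0 scale0r addr0 add0r low1.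
have ht_inj x : x \in m0 -> [lie ht, x] = 0 -> x = 0 by apply: shifted_h_inj.
have lam_ht i : lam i ht != 0.
  apply: contraNneq (xs_neq0 i) => E; apply/eqP/ht_inj; first exact: xs_m.
  by rewrite xsw // E scale0r.
(* This is the complement: ad ht maps [low 0] into m_0 and is invertible on m_0. *)
pose L := (low 0 :&: lker (ad ht))%VS.
have LP l : l \in L <-> l \in low 0 /\ [lie ht, l] = 0.
  rewrite memv_cap memv_ker /ad lfunE /=.
  by split=> [/andP[-> /eqP]|[-> ->]]; rewrite ?eqxx.
have Lm x : x \in L -> x \in m0 -> x = 0 by move=> /LP[_ xh] /ht_inj ->.
have AL : (A <= L)%VS.
  apply/subvP => a aA; apply/LP; split; first exact: A_low.
  apply: A_m0; first exact: A_lie.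
  by apply: low_ht; apply: A_low.
have sL : ad_stable A L.
  move=> a l aA /LP[ll lh]; apply/LP; split.
    by have := low_lie (A_low aA) ll; rewrite addr0.
  have /LP[_ ha] := subvP AL _ aA.
  by rewrite lbr_evenJ // ha lbr0l add0r lh lbr0r.
have [_ _ [n1 An1] _] := Acart.
(* A weight vector of [L] with positive real part at [H] would lie in m_0, so nonzero eigenvalues of
   ad H on [L] have negative real part. *)
have noeig c y0 : y0 \in L -> y0 != 0 -> [lie H, y0] = c *: y0 -> c != 0 -> 'Re c < 0.
  move=> yL yn yc c0.
  have [al [z [zL z0 zw alc]]] := weight_of_eigen A_sub A_lie An1 sL HA yL yn yc.
  have Rc : 'Re c != 0.
    by rewrite -alc; apply: (Hreg z0 zw); exists H => //; rewrite alc.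
  have : 'Re c < 0 \/ 0 < 'Re c.
    have := Creal_Re c; rewrite realE => /orP[]; rewrite le_eqVlt => /orP[/eqP E|]; auto.
      by rewrite -E eqxx in Rc.
    by rewrite E eqxx in Rc.
  case=> // Rp; have /LP[zl _] := zL.
  have zm : z \in m0 by apply: (weight_vector_m0 (low_sub zl) zw); rewrite alc.
  by rewrite (Lm z zL zm) eqxx in z0.
have LA : A = L.
  apply/eqP; apply: contraT => neAL.
  (* If [A] were smaller than [L], ad H would have a nonzero eigenvalue c on [L]; invariance of the
     form then produces the eigenvalue -c, and both would have negative real part. *)
  have [c [l [lL lA lc]]] := eigen_mod (a := H) (fun x => sL H x HA) (fun x => A_lie HA) AL neAL.
  have l0 : l \in g0 by have /LP[/low_sub] := lL.
  have c0 : c != 0.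
    apply: contraNneq lA => c0; apply: (@gen0_A _ k.+1) => //.
    by rewrite iterSr; apply: Ak => //; move: lc; rewrite c0 /lieD scale0r subr0.
  pose y0 := iter k (lbr H) l.
  have yc : [lie H, y0] = c *: y0.
    have : iter k (lbr H) ([lie H, l] - c *: l) = 0 by apply: Ak.
    rewrite -lieD00 -[X in iter k _ (_ + X)]scaleN1r addrC iter_lieD_lin iter_lieDZ scaleN1r
      addrC !lieD00.
    by rewrite -iterSr iterS => /eqP; rewrite subr_eq0 => /eqP.
  have yn : y0 != 0 by apply: contraNneq lA => E; apply: (@gen0_A _ k).
  have yL : y0 \in L by rewrite /y0; elim: (k) => //= j; apply: sL.
  have Rc := noeig c y0 yL yn yc c0.
  have yg : y0 \in g0 by have /LP[/low_sub] := yL.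
  pose T : 'End(g) := (ad H + c *: \1%VF)%R.
  have TE z : T z = [lie H, z] + c *: z by rewrite /T add_lfunE scale_lfunE id_lfunE lfunE.
  have TL : (T @: L <= L)%VS.
    by apply/subvP => _ /memv_imgP[z zL ->]; rewrite TE memvD ?memvZ ?sL.
  have : (L :&: lker T)%VS != 0%VS.
    (* If ad H + c were injective on [L], it would be onto; by invariance [y0] would be orthogonal
       to L and to m_0, hence to [low 0], and so lie in m_0. *)
    apply/eqP => /limg_dim_eq dT.
    have TLL : (T @: L)%VS = L by apply/eqP; rewrite eqEdim TL dT leqnn.
    have yB l1 : l1 \in L -> B y0 l1 = 0.
      rewrite -TLL => /memv_imgP[z zL ->]; have z0 : z \in g0 by have /LP[/low_sub] := zL.
      rewrite TE (formDr Bform) ?memvZ //; last exact: lie_even H_even z0.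
      have := form_skew Bform H_even yg z0; rewrite yc (formZl Bform) // (formZr Bform) // => E.
      by rewrite E subrr.
    have [_ ym] := low_perp (m0_low (x := 0) (mem0v _)).
    have yl : y0 \in low 0 by have /LP[] := yL.
    have [_ yx] := low_perp yl.
    suff ym0 : y0 \in m0 by rewrite (Lm _ yL ym0) eqxx in yn.
    apply: perp_low_m0 => // z zl.
    have [x xm xE] := m0_solve htA lam_ht (low_ht z zl).
    have zL : z - x \in L.
      apply/LP; split; first by apply: memvB => //; apply: m0_low.
      by rewrite lbrBr xE subrr.
    have zx0 : z - x \in g0 by have /LP[/low_sub] := zL.
    by rewrite -(subrK x z) (formDr Bform) ?(m0_even xm) // yB // yx // addr0.
  rewrite -subv0 => /subvPn[z zLT]; rewrite memv0 => z0.
  move: zLT; rewrite memv_cap memv_ker TE addr_eq0 -scaleNr => /andP[zL /eqP zc].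
  have := noeig (- c) z zL z0 zc; rewrite oppr_eq0 c0 raddfN /= oppr_lt0 => /(_ isT).
  by move=> /(lt_trans Rc); rewrite ltxx.
move=> yl; have [x xm xE] := m0_solve htA lam_ht (low_ht y yl).
exists (y - x), x; split=> //; last by rewrite subrK.
rewrite LA; apply/LP; split; first by apply: memvB => //; apply: m0_low.
by rewrite lbrBr xE subrr.
Qed.

(** An element of [A] orthogonal to [A] is orthogonal to low 0 = A + m_0, hence lies in m_0, which
    meets [A] in 0. *)
Lemma A_nondeg a : a \in A -> (forall a', a' \in A -> B a a' = 0) -> a = 0.
Proof.
move=> aA aB; apply: A_m0 => //; apply: perp_low_m0 => [|z /low_dec[a' [x [aA' xm ->]]]].
  exact: A_even.
have [_ ap] := low_perp (A_low aA).
by rewrite (formDr Bform (A_even aA) (A_even aA') (m0_even xm)) (aB _ aA') (ap _ xm) addr0.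
Qed.


Definition Pil (s : seq F) (z : g) : g := foldr (lieD H) z s.

Lemma Pil_lin s c x y : Pil s (c *: x + y) = c *: Pil s x + Pil s y.
Proof. by elim: s => //= k s ->; rewrite lieD_lin. Qed.

Lemma Pil0 s : Pil s 0 = 0.
Proof. by elim: s => //= k s ->; rewrite lieD0. Qed.

Lemma PilD s x y : Pil s (x + y) = Pil s x + Pil s y.
Proof. by have := Pil_lin s 1 x y; rewrite !scale1r. Qed.

Lemma PilZ s c x : Pil s (c *: x) = c *: Pil s x.
Proof. by have := Pil_lin s c x 0; rewrite Pil0 !addr0. Qed.

Lemma Pil_g0 s z : z \in g0 -> Pil s z \in g0.
Proof.
move=> z0; elim: s => //= c s IH; apply: memvB; last exact: memvZ.
exact: lie_even H_even IH.
Qed.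

Lemma Pil_A s a : a \in A -> Pil s a \in A.
Proof. by move=> aA; elim: s => //= c s IH; apply: memvB; [apply: A_lie|apply: memvZ]. Qed.

Lemma Pil_eigen s mu x : [lie H, x] = mu *: x -> Pil s x = (\prod_(c <- s) (mu - c)) *: x.
Proof.
move=> E; elim: s => [|c s IH] /=; first by rewrite big_nil scale1r.
by rewrite IH /lieD lbrZr E big_cons !scalerA -scalerBl mulrBl [mu * _]mulrC.
Qed.

Lemma Pil_B s z j : z \in g0 ->
  B (Pil s z) (xs j) = (\prod_(c <- s) (- lam j H - c)) * B z (xs j).
Proof.
move=> z0; elim: s => [|c s IH] /=; first by rewrite big_nil mul1r.
have sz := Pil_g0 s z0; have Hz : [lie H, Pil s z] \in g0 by apply: lie_even H_even sz.
rewrite /lieD (formDl Bform) ?memvN ?memvZ ?xs_even // (formNl Bform) ?memvZ ?xs_even //.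
rewrite (form_skew Bform H_even sz (xs_even j)) xsw // (formZr Bform) ?xs_even // (formZl Bform)
  ?xs_even // IH.
by rewrite big_cons -mulrA mulrBl mulNr.
Qed.

Lemma Pil_comm s a z : [lie H, a] = 0 -> [lie a, Pil s z] = Pil s [lie a, z].
Proof.
move=> Ha; elim: s => //= c s <-; rewrite /lieD lbrBr lbrZr; congr (_ - _).
by rewrite (lbr_evenJ _ _ H_even) Ha lbr0l add0r.
Qed.

(** Roots of a polynomial in ad H that annihilates low 0 = A + m_0: 0 with a multiplicity that kills
    [A], and the eigenvalues on m_0. No -lam_j(H) is among them, so [Pi] singles out the opposite
    side. *)
Let kA := projT1 (cid A_nil).
Let Sroots := nseq kA (0 : F) ++ [seq lam i H | i <- enum 'I_p].
Let Pi := Pil Sroots.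

Lemma Pi_low y : y \in low 0 -> Pi y = 0.
Proof.
move=> /low_dec[a [x [aA xm ->]]]; rewrite /Pi PilD.
have -> : Pil Sroots a = 0.
  rewrite /Sroots /Pil foldr_cat -/(Pil _ a); move: (Pil_A [seq lam i H | i <- enum 'I_p] aA).
  move: (Pil _ a) => b bA; have := projT2 (cid A_nil) H b HA bA.
  rewrite -/kA -lieD00 => E; rewrite -[RHS]E.
  by elim: (kA) => //= k ->.
rewrite add0r; have [c ->] := codom_coords xsb xm.
elim/big_ind: _ => [|y1 y2 E1 E2|i _]; first exact: Pil0.
  by rewrite PilD E1 E2 addr0.
rewrite PilZ (@Pil_eigen _ (lam i H)) ?xsw //.
rewrite (_ : \prod_(c <- _) _ = 0) ?scale0r ?scaler0 //.
apply/eqP; rewrite prodf_seq_eq0; apply/hasP; exists (lam i H); last by rewrite /= subrr.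
by rewrite mem_cat; apply/orP; right; apply/mapP; exists i; rewrite ?mem_enum.
Qed.

Lemma kappa_neq0 j : \prod_(c <- Sroots) (- lam j H - c) != 0.
Proof.
rewrite prodf_seq_neq0; apply/allP => c; rewrite mem_cat => /orP[].
  by rewrite mem_nseq => /andP[_ /eqP ->] /=; rewrite subr0 oppr_eq0 Re_neq0.
case/mapP=> i _ -> /=; rewrite -opprD oppr_eq0; apply: Re_neq0.
by rewrite raddfD /= addr_gt0.
Qed.

Lemma perp_xs y : y \in g0 -> (forall j, B y (xs j) = 0) -> y \in low 0.
Proof.
move=> y0 yB; apply: perp_low; split=> // x /(codom_coords xsb)[c ->].
rewrite (form_sumr Bform) // => [|i _]; last exact/memvZ/xs_even.
by rewrite big1 // => i _; rewrite (formZr Bform) ?xs_even // yB mulr0.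
Qed.

(** [Pi] multiplies the pairings with the [xs j] by nonzero factors; so if [Pi v] is orthogonal to
    m_0, then so is [v], which lies in [low 0] and is killed. *)
Lemma Pi_low0 v : v \in g0 -> Pi v \in low 0 -> Pi v = 0.
Proof.
move=> v0 vl; apply/Pi_low/perp_xs => // j; have [_ /(_ (xs j) (xs_m j))] := low_perp vl.
by rewrite Pil_B // => /eqP; rewrite mulf_eq0 (negPf (kappa_neq0 j)) => /eqP.
Qed.

(** Vectors dual to the [xs] are determined only modulo [low 0]; applying [Pi], which kills [low 0],
    removes the ambiguity and will make them weight vectors. *)
Lemma ys_ex : exists v : 'I_p -> g, (forall i, v i \in g0) /\
  forall i j, B (Pi (v i)) (xs j) = (i == j)%:R.
Proof.
have [c cE|z [z0 zB]] := form_dual Bform (W := g0) (x := xs) (subvv _) xs_even.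
  apply: (codom_free xsb); apply: (form_nondeg Bform) => [|y y0].
    by apply: memv_suml => i _; apply/memvZ/xs_even.
  by rewrite (formC Bform) ?cE //; apply: memv_suml => i _; apply/memvZ/xs_even.
exists (fun i => (\prod_(c <- Sroots) (- lam i H - c))^-1 *: z i); split=> [i|i j].
  exact/memvZ/z0.
rewrite Pil_B ?memvZ // (formZl Bform) ?xs_even // zB.
case: (eqVneq i j) => [->|ij]; last by rewrite !mulr0.
by rewrite mulr1 mulfV ?kappa_neq0.
Qed.

Section OppositeBasis.
Variable v : 'I_p -> g.
Hypothesis v0 : forall i, v i \in g0.
Hypothesis vB : forall i j, B (Pi (v i)) (xs j) = (i == j)%:R.
Let ys i := Pi (v i).

Lemma ys_even i : ys i \in g0. Proof. exact/Pil_g0/v0. Qed.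

Lemma g0_ys y : y \in g0 -> exists2 y', y' \in low 0 & y = \sum_i B y (xs i) *: ys i + y'.
Proof.
move=> y0; have s0 : \sum_i B y (xs i) *: ys i \in g0.
  by apply: memv_suml => i _; apply/memvZ/ys_even.
exists (y - \sum_i B y (xs i) *: ys i); last by rewrite addrC subrK.
apply: perp_xs => [|j]; first exact: memvB.
rewrite (formDl Bform) ?memvN ?xs_even // (formNl Bform) ?xs_even // (form_suml Bform) ?xs_even
  // => [|i _]; last first.
  exact/memvZ/ys_even.
rewrite (bigD1 j) //= (formZl Bform) ?ys_even ?xs_even // vB eqxx mulr1 big1 ?addr0 ?subrr // =>
  i ij.
by rewrite (formZl Bform) ?ys_even ?xs_even // vB (negPf ij) mulr0.
Qed.

Lemma weight_derived (al : {scalar g}) z c : weight_vector A al z -> c \in lbrv A A ->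
  [lie c, z] = 0.
Proof.
move=> zw; move: c.
apply: (spanof_ind (P := fun c => [lie c, z] = 0)) => [|c x y Ex Ey|_ [a [b [aA bA ->]]]].
- by rewrite lbr0l.
- by rewrite lbrDl lbrZl Ex Ey scaler0 addr0.
have := lbr_evenJ b z (A_even aA); rewrite (zw a aA) (zw b bA) !lbrZr (zw a aA) (zw b bA).
by rewrite !scalerA mulrC => /eqP; rewrite -[X in X == _]add0r (inj_eq (addIr _)) eq_sym => /eqP.
Qed.

(** Invariance makes the center orthogonal to the derived algebra, and together they span g_0. *)
Lemma central_derived_eq0 c : even_center c -> c \in lbrv g0 g0 -> c = 0.
Proof.
move=> [c0 cc] cd; apply: (form_nondeg Bform) => // y y0.
have [z [w [[z0 zc] wd ->]]] := reductive_center_derived red y0.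
have w0 : w \in g0.
  by move: w wd; apply/subvP/spanof_sub => _ [a [b [a0 b0 ->]]]; apply: lie_even.
rewrite (formDr Bform) //.
have Bd (t s : g) : even_center t -> s \in lbrv g0 g0 -> B s t = 0.
  move=> [t0 tc]; move: s; apply: (form_spanof0 Bform) => // _ [a [b [a0 b0 ->]]].
  by split; [exact: lie_even|rewrite (formA Bform) // tc // (form0r Bform)].
rewrite (Bd z c) // add0r (formC Bform) //; apply: Bd => //.
Qed.

(* The last nonzero term of the lower central series of [A] would be central
   in [g0] and contained in the derived algebra. *)
Lemma A_abelian a a' : a \in A -> a' \in A -> [lie a, a'] = 0.
Proof.
have [_ _ Anil _] := Acart; move: a a'.
pose PA k := lower_central A k == 0%VS.
have exA : exists k, PA k by case: Anil => k Ak; exists k; apply/eqP.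
case: (ex_minnP exA) => -[|[|k]] /eqP Ek min a a' aA aA'.
- by move: aA; rewrite [A]Ek memv0 => /eqP ->; rewrite lbr0l.
- apply/eqP; rewrite -memv0 -Ek; apply: mem_spanof.
  by exists a, a'.
(* An element [c] of this last nonzero term commutes with [A] and, being in [A, A], is killed by
   every weight; so it acts trivially on [low 0]. *)
have : lower_central A k.+1 != 0%VS.
  by apply/negP => /min; rewrite ltnn.
rewrite -subv0 => /subvPn[c ck]; rewrite memv0 => /eqP c0; exfalso; apply: c0.
have cAA : c \in lbrv A A.
  move: c ck; apply/subvP/spanof_sub => _ [x [y [xA yk ->]]]; apply: mem_spanof.
  exists x, y; split=> //; exact: subvP (lower_central_sub A_lie k) _ yk.
have cA : c \in A by exact: subvP (lower_central_sub A_lie k.+1) _ ck.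
have cc x : x \in A -> [lie x, c] = 0.
  move=> xA; apply/eqP; rewrite -memv0 -Ek; apply: mem_spanof.
  by exists x, c.
have cH : [lie H, c] = 0 by apply: cc.
have clow y : y \in low 0 -> [lie c, y] = 0.
  move=> /low_dec[x [z [xA zm ->]]]; rewrite lbrDr [X in _ + X](_ : _ = 0) ?addr0.
    by rewrite lbr_evenC ?A_even // cc // oppr0.
  have [e ->] := codom_coords xsb zm; rewrite lbr_sumr big1 // => i _.
  by rewrite lbrZr (weight_derived (xsw i) cAA) scaler0.
(* Consequently ad c kills each ys_i = Pi(v_i): it commutes with [Pi], and [Pi] kills [low 0]. *)
have cg y : y \in g0 -> [lie c, y] \in low 0.
  move=> y0; apply: perp_xs => [|j]; first exact: lie_even (A_even cA) y0.
  rewrite (form_skew Bform (A_even cA) y0 (xs_even j)) (weight_derived (xsw j) cAA) (form0r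
    Bform) ?oppr0 //.
apply: central_derived_eq0.
  split=> [|y /g0_ys[y' yl ->]]; first exact: A_even.
  rewrite -[LHS]opprK -lbr_evenC ?A_even // lbrDr (clow _ yl) addr0 lbr_sumr big1 ?oppr0 // => i _.
  by rewrite lbrZr /ys Pil_comm // -/Pi Pi_low ?scaler0 // cg.
move: c cAA {ck cA cc cH clow cg}; apply/subvP/spanof_sub => _ [x [y [xA yA ->]]].
by apply: mem_spanof; exists x, y; split=> //; apply: A_even.
Qed.

(** [Pi t] is the defect of the weight equation; it is orthogonal to m_0, hence in [low 0], hence
    zero by [Pi_low0]. *)
Lemma ysw i a : a \in A -> [lie a, ys i] = - lam i a *: ys i.
Proof.
move=> aA; have Ha := A_abelian HA aA.
pose t := [lie a, v i] + lam i a *: v i.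
have t0 : t \in g0 by apply: memvD; [exact: lie_even (A_even aA) (v0 i)|exact: memvZ].
have Et : Pi t = [lie a, ys i] + lam i a *: ys i by rewrite /Pi PilD PilZ -Pil_comm.
apply/eqP; rewrite scaleNr -addr_eq0 -Et; apply/eqP/Pi_low0 => //.
have a0 := A_even aA; have y0 := ys_even i.
rewrite Et; apply: perp_xs => [|j]; first by apply: memvD; [exact: lie_even|exact: memvZ].
rewrite (formDl Bform) ?memvZ ?xs_even ?lie_even // (form_skew Bform a0 y0 (xs_even j)) xsw //.
rewrite (formZr Bform) ?xs_even // (formZl Bform) ?xs_even // vB.
by case: eqP => [->|_]; rewrite ?mulr1 ?addNr // !mulr0 oppr0 addr0.
Qed.

Lemma B_eig (k l : F) y z : y \in g0 -> z \in g0 ->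
  [lie H, y] = k *: y -> [lie H, z] = l *: z -> k + l != 0 -> B y z = 0.
Proof.
move=> y0 z0 yw zw ne; have := form_skew Bform H_even y0 z0.
rewrite yw zw (formZl Bform) // (formZr Bform) // => /eqP;
  rewrite -addr_eq0 -mulrDl mulf_eq0 (negPf ne).
by move/eqP.
Qed.

Let q := \dim A.
Let aa (j : 'I_q) := (vbasis A)`_j.

Lemma aaA j : aa j \in A.
Proof. by apply/vbasis_mem/mem_nth; rewrite size_tuple. Qed.

Lemma aa_coords a : a \in A -> exists k : 'I_q -> F, a = \sum_j k j *: aa j.
Proof. by move=> aA; exists (fun j => coord (vbasis A) j a); apply: coord_vbasis. Qed.

Lemma aa_dual_ex : exists aa' : 'I_q -> g, (forall i, aa' i \in A) /\
  forall i j, B (aa' i) (aa j) = (i == j)%:R.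
Proof.
apply: (form_dual Bform A_sub) => [j|c cB]; first exact/A_even/aaA.
have sA : \sum_j c j *: aa j \in A by apply: memv_suml => j _; apply/memvZ/aaA.
have /freeP := basis_free (vbasisP A); apply.
by apply: A_nondeg => // a aA; rewrite (formC Bform) ?A_even // cB.
Qed.

Section RootData.
Variable aa' : 'I_q -> g.
Hypothesis aa'A : forall i, aa' i \in A.
Hypothesis aaB : forall i j, B (aa' i) (aa j) = (i == j)%:R.
Local Notation I := ('I_p + ('I_q + 'I_p))%type.

Definition rb (c : I) : g :=
  match c with inl i => ys i | inr (inl j) => aa j | inr (inr i) => xs i end.
Definition rb' (c : I) : g :=
  match c with inl i => xs i | inr (inl j) => aa' j | inr (inr i) => ys i end.
Definition rwt (c : I) : {scalar g} :=
  match c with inl i => \- lam i | inr (inl j) => \0 | inr (inr i) => lam i end.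
Definition rlt : rel I := fun c c' => 'Re (rwt c H) < 'Re (rwt c' H).

Lemma rb_even c : rb c \in g0.
Proof. by case: c => [i|[j|i]] /=; [exact: ys_even|exact/A_even/aaA|exact: xs_even]. Qed.
Lemma rb'_even c : rb' c \in g0.
Proof. by case: c => [i|[j|i]] /=; [exact: xs_even|exact/A_even/aa'A|exact: ys_even]. Qed.
Lemma rb_wt c : weight_vector A (rwt c) (rb c).
Proof.
case: c => [i|[j|i]] a aA /=; [exact: ysw| |exact: xsw].
by rewrite A_abelian ?aaA // scale0r.
Qed.
Lemma rb'_wt c a : a \in A -> [lie a, rb' c] = - rwt c a *: rb' c.
Proof.
case: c => [i|[j|i]] aA /=; [by rewrite opprK xsw| |exact: ysw].
by rewrite A_abelian ?aa'A // oppr0 scale0r.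
Qed.

Lemma rb_dual c c' : B (rb c) (rb' c') = (c == c')%:R.
Proof.
have lam0 i := Re_neq0 (lamp i).
have lamS i j : lam i H + lam j H != 0 by apply: Re_neq0; rewrite raddfD /= addr_gt0.
have E k l : [lie H, rb k] = rwt k H *: rb k /\ [lie H, rb' l] = - rwt l H *: rb' l.
  by split; [exact: rb_wt|exact: rb'_wt].
have Z : rwt c H - rwt c' H != 0 -> B (rb c) (rb' c') = 0.
  by case: (E c c') => E1 E2; apply: B_eig E1 E2; [exact: rb_even|exact: rb'_even].
case: c c' {E} Z => [i|[j|i]] [i'|[j'|i']] /= Z.
- by rewrite vB.
- by rewrite Z // subr0 oppr_eq0.
- by rewrite Z // -opprD oppr_eq0.
- by rewrite Z // opprK add0r.
- by rewrite (formC Bform) ?aaB ?(A_even (aaA _)) ?(A_even (aa'A _)) // eq_sym.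
- by rewrite Z // sub0r oppr_eq0.
- by rewrite Z // opprK.
- by rewrite Z // subr0.
- by rewrite (formC Bform) ?vB ?xs_even ?ys_even // eq_sym.
Qed.

Lemma rb_exp y : y \in g0 -> y = \sum_c B y (rb' c) *: rb c.
Proof.
move=> y0; suff [k E] : exists k : I -> F, y = \sum_c k c *: rb c.
  rewrite {1}E; apply: eq_bigr => c _; congr (_ *: _).
  rewrite E (form_suml Bform) ?rb'_even // => [|c' _]; last exact/memvZ/rb_even.
  rewrite (bigD1 c) //= (formZl Bform) ?rb_even ?rb'_even // rb_dual eqxx mulr1 big1 ?addr0 //
    => c' ne.
  by rewrite (formZl Bform) ?rb_even ?rb'_even // rb_dual (negPf ne) mulr0.
have [y' yl ->] := g0_ys y0; have [a [x [aA xm ->]]] := low_dec yl.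
have [ka ->] := aa_coords aA; have [kx ->] := codom_coords xsb xm.
exists (fun c => match c with inl i => B y (xs i) | inr (inl j) => ka j | inr (inr i) => kx i end).
by rewrite !big_sumType.
Qed.

Lemma rb_exp' y : y \in g0 -> y = \sum_c B y (rb c) *: rb' c.
Proof.
move=> y0; have s0 : \sum_c B y (rb c) *: rb' c \in g0.
  by apply: memv_suml => c _; apply/memvZ/rb'_even.
apply/eqP; rewrite -subr_eq0; apply/eqP; apply: (form_nondeg Bform) => [|z z0]; first exact: memvB.
rewrite (rb_exp z0) (form_sumr Bform) ?memvB // => [|c _]; last exact/memvZ/rb_even.
rewrite big1 // => c _; rewrite (formZr Bform) ?rb_even ?memvB // (formDl Bform) ?memvN ?rb_even //.
rewrite (formNl Bform) ?rb_even // (form_suml Bform) ?rb_even // => [|c' _];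
  last exact/memvZ/rb'_even.
rewrite (bigD1 c) //= (formZl Bform) ?rb_even ?rb'_even // (formC Bform (rb'_even c) (rb_even
  c)) rb_dual eqxx mulr1.
rewrite big1 ?addr0 ?subrr ?mulr0 // => c' ne.
by rewrite (formZl Bform) ?rb_even ?rb'_even // (formC Bform (rb'_even c') (rb_even c)) rb_dual
  eq_sym (negPf ne) mulr0.
Qed.

Lemma rb_lie c c' a : a \in A ->
  [lie a, [lie rb c, rb' c']] = (rwt c a - rwt c' a) *: [lie rb c, rb' c'].
Proof.
move=> aA; rewrite lbr_evenJ ?A_even // (@rb_wt c a aA) (@rb'_wt c' a aA) lbrZl lbrZr -scalerDl.
by [].
Qed.

Lemma rb_tA c : [lie rb c, rb' c] \in A.
Proof.
apply: (@gen0_A _ 1); first by apply: lie_even; [exact: rb_even|exact: rb'_even].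
by rewrite /= rb_lie // subrr scale0r.
Qed.

(** For equal indices this says that [b_c, b'_c] is the element of [A] representing the weight of
    b_c under the form. *)
Lemma B_lie_A c c' a : a \in A -> B [lie rb c, rb' c'] a = rwt c' a * (c == c')%:R.
Proof.
move=> aA; rewrite (formA Bform) ?rb_even ?rb'_even ?A_even // lbr_evenC ?rb'_even // rb'_wt //
  scaleNr opprK.
by rewrite (formZr Bform) ?rb'_even ?rb_even // rb_dual.
Qed.

(** A weight difference with positive real part at [H] puts the bracket into m_0. With real part 0
    and a nonzero bracket, the difference vanishes on [A] by regularity; then the bracket lies in
    [A] and, the indices being distinct, is orthogonal to [A]. *)
Lemma rb_low c c' : c != c' -> ~~ rlt c c' -> [lie rb c, rb' c'] \in m0.
Proof.
move=> ne; rewrite /rlt; set z := [lie rb c, rb' c'] => nlt.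
have z0 : z \in g0 by apply: lie_even; [exact: rb_even|exact: rb'_even].
have zw : weight_vector A (rwt c \- rwt c') z by move=> a aA; rewrite /z rb_lie.
have ge : 'Re (rwt c' H) <= 'Re (rwt c H) by rewrite real_leNgt ?Creal_Re.
case: (eqVneq z 0) => [->|zn]; first exact: mem0v.
move: ge; rewrite le_eqVlt => /orP[/eqP e|gt]; last first.
  by apply: (weight_vector_m0 z0 zw); rewrite /= raddfB /= subr_gt0.
have mu0 a : a \in A -> rwt c a - rwt c' a = 0.
  move=> aA; apply/eqP; apply: contraT => mu.
  have := Hreg zn zw (ex_intro2 _ _ a aA mu).
  by rewrite /= raddfB /= e subrr eqxx.
suff -> : z = 0 by exact: mem0v.
apply: A_nondeg => [|a aA]; last by rewrite B_lie_A // (negPf ne) mulr0.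
by apply: (@gen0_A _ 1) => //=; rewrite rb_lie // mu0 // scale0r.
Qed.

Lemma center_A z : even_center z -> z \in A.
Proof. by case=> z0 zc; apply: (@gen0_A _ 1) => //=; apply: zc H_even. Qed.

(** Otherwise a functional that is nonzero at [a] vanishes on all such sums. The element of [A]
    representing it is killed by every weight, so it is central, and it is orthogonal to the center
    and to the derived algebra, hence 0. *)
Lemma rb_span a : a \in A -> exists (k : I -> F) z,
  even_center z /\ a = \sum_c k c *: [lie rb c, rb' c] + z.
Proof.
have [||X XP] := @vspace_of_pred _ _ (fun a => exists (k : I -> F) z,
  even_center z /\ a = \sum_c k c *: [lie rb c, rb' c] + z).
- exists (fun=> 0), 0; split; first by split=> [|y _]; rewrite ?mem0v ?lbr0r.
  by rewrite big1 ?addr0 // => c _; rewrite scale0r.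
- move=> e x y [k [z [[z0 zc] ->]]] [k' [z' [[z'0 z'c] ->]]].
  exists (fun c => e * k c + k' c), (e *: z + z'); split.
    split=> [|t t0]; first by rewrite memvD ?memvZ.
    by rewrite lbrDr lbrZr zc // z'c // scaler0 addr0.
  rewrite scalerDr addrACA scaler_sumr -big_split; congr (_ + _).
  by apply: eq_bigr => c _; rewrite /= scalerA scalerDl.
move=> aA; apply/XP; apply: contraT => aX.
have [phi [phia phiX]] := sep_functional aX.
pose t := \sum_j phi (aa j) *: aa' j.
have tA : t \in A by apply: memv_suml => j _; apply/memvZ/aa'A.
have tB b : b \in A -> B t b = phi b.
  move=> /aa_coords[k ->]; rewrite (form_sumr Bform) ?(A_even tA) // => [|j _];
    last exact/memvZ/A_even/aaA.
  rewrite linear_sum; apply: eq_bigr => j _;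
    rewrite linearZ /= (formZr Bform) ?(A_even tA) ?(A_even (aaA j)) //.
  congr (_ * _); rewrite /t (form_suml Bform) ?(A_even (aaA j)) // => [|i _];
    last exact/memvZ/A_even/aa'A.
  rewrite (bigD1 j) //= (formZl Bform) ?(A_even (aaA j)) ?(A_even (aa'A j)) // aaB eqxx mulr1.
  rewrite big1 ?addr0 // => i ij.
  by rewrite (formZl Bform) ?(A_even (aaA j)) ?(A_even (aa'A i)) // aaB (negPf ij) mulr0.
have tc c : [lie t, rb c] = 0.
  rewrite rb_wt //; suff -> : rwt c t = 0 by rewrite scale0r.
  have := B_lie_A c c tA; rewrite eqxx mulr1 => <-.
  have tX : [lie rb c, rb' c] \in X.
    apply/XP; exists (fun c' => (c' == c)%:R), 0; split.
      by split=> [|y _]; rewrite ?mem0v ?lbr0r.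
    rewrite (bigD1 c) //= eqxx scale1r big1 ?addr0 // => c' /negPf ->.
    by rewrite scale0r.
  by rewrite (formC Bform) ?(A_even tA) ?(A_even (rb_tA c)) // tB ?rb_tA // phiX.
have tcent : even_center t.
  split=> [|y y0]; first exact: A_even.
  rewrite -[LHS]opprK -lbr_evenC ?A_even // (rb_exp y0) lbr_sumr big1 ?oppr0 // => c _.
  by rewrite lbrZr tc scaler0.
have t0 : t = 0.
  apply: (form_nondeg Bform) => [|y y0]; first exact: A_even.
  have [z [w [zc wd ->]]] := reductive_center_derived red y0.
  have w0 : w \in g0.
    by move: w wd; apply/subvP/spanof_sub => _ [x [b [x0 b0 ->]]]; apply: lie_even.
  have z0 := zc.1.
  rewrite (formDr Bform (A_even tA) z0 w0) (tB _ (center_A zc)) phiX ?add0r; last first.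
    apply/XP; exists (fun=> 0), z; split=> //.
    by rewrite big1 ?add0r // => c _; rewrite scale0r.
  rewrite (formC Bform (A_even tA) w0); move: w wd {w0}; apply: (form_spanof0 Bform);
    last exact: A_even.
  move=> _ [x [b [x0 b0 ->]]]; split; first exact: lie_even.
  by rewrite (formA Bform x0 b0 (A_even tA)) (tcent.2 _ b0) (form0r Bform x0).
by have := tB a aA; rewrite t0 (form0l Bform) ?A_even // phia => /esym/eqP; rewrite oner_eq0.
Qed.

Lemma rb_root_data : root_data B m0 A rb rb' ys rlt.
Proof.
split.
- exact: rb_even.
- exact: rb'_even.
- exact: rb_exp.
- exact: rb_exp'.
- by move=> c1 c2 c3; apply: lt_trans.
- by move=> c; apply: ltxx.
- exact: rb_low.
- exact: A_even.
- exact: A_abelian.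
- exact: rb_tA.
- exact: rb_span.
- exact: ys_even.
move=> y /g0_ys[y' /low_dec[a [x [aA xm ->]]] ->].
by exists (fun i => B y (xs i)), a, x; rewrite addrA.
Qed.

End RootData.
End OppositeBasis.
End WeightBasis.

Theorem torus_root_data : exists (I : finType) (b b' : I -> g) (ys : 'I_p -> g) (lt : rel I),
  root_data B m0 A b b' ys lt.
Proof.
have [xs [lam [xsb xsw lamp]]] := weight_basis.
have [v [v0 vB]] := ys_ex xsb xsw lamp.
have [aa' [aa'A aaB]] := aa_dual_ex xsb xsw lamp.
exact: (ex_intro _ _ (ex_intro _ _ (ex_intro _ _ (ex_intro _ _ (ex_intro _ _
  (rb_root_data xsb xsw lamp v0 vB aa'A aaB)))))).
Qed.

End Torus.

(** * Central elements and growth *)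

(* Elementary symmetric functions with signs, the coefficients of
   prod_(t in l) (1 - t X), of a list of commuting elements. *)
Section Newton.
Variables (F : numFieldType) (U : algType F).
Implicit Types (l : seq U) (t x : U).

Fixpoint EP l (k : nat) : U :=
  if l is t :: l' then EP l' k - (if k is k'.+1 then t * EP l' k' else 0) else (k == 0)%:R.

Definition PS l (i : nat) : U := \sum_(t <- l) t ^+ i.

Lemma EP_comm x l k : (forall t, t \in l -> GRing.comm x t) -> GRing.comm x (EP l k).
Proof.
elim: l k => [|t l IH] k H /=; first exact: commr_nat.
have H' s : s \in l -> GRing.comm x s by move=> sl; apply: H; rewrite inE sl orbT.
apply: commrB; first exact: IH.
by case: k => [|k]; [exact: commr0|apply: commrM; [apply/H/mem_head|apply: IH]].
Qed.

Lemma commr_bigsum (I : Type) (s : seq I) (P : pred I) (f : I -> U) x :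
  (forall i, P i -> GRing.comm x (f i)) -> GRing.comm x (\sum_(i <- s | P i) f i).
Proof. by move=> H; elim/big_ind: _ => //; [exact: commr0|exact: commrD]. Qed.

Lemma commr4 (a b c d : U) : GRing.comm a c -> GRing.comm a d ->
  GRing.comm b c -> GRing.comm b d -> GRing.comm (a * b) (c * d).
Proof.
by move=> ac ad bc bd; apply: commrM; apply/commr_sym/commrM; apply/commr_sym.
Qed.

Lemma PS_comm x l i : (forall t, t \in l -> GRing.comm x t) -> GRing.comm x (PS l i).
Proof.
move=> H; rewrite /PS big_seq; apply: commr_bigsum => t tl.
exact/commrX/H.
Qed.

Lemma EP_big l k : (size l < k)%N -> EP l k = 0.
Proof.
elim: l k => [|t l IH] k /=; first by case: k.
by case: k => // k lk; rewrite !IH ?mulr0 ?subrr // ltnW.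
Qed.

(** In generating series g = (1 - tX) f, and the geometric series in tX recovers t f from g. *)
Lemma telescope_geom t (f g : nat -> U) k : g 0%N = f 0%N ->
  (forall j, g j.+1 = f j.+1 - t * f j) ->
  \sum_(i < k.+1) t ^+ i.+1 * g (k - i)%N = t * f k.
Proof.
move=> g0 gS; elim: k => [|k IH]; first by rewrite big_ord1 g0.
rewrite big_ord_recl subn0 gS expr1.
under eq_bigr => i _ do rewrite /= subSS exprS -mulrA.
by rewrite -mulr_sumr IH mulrBr subrK.
Qed.

Lemma EPS t l j : EP (t :: l) j.+1 = EP l j.+1 - t * EP l j. Proof. by []. Qed.
Lemma EP0 t l : EP (t :: l) 0 = EP l 0. Proof. exact: subr0. Qed.
Lemma EPnil k : EP [::] k = (k == 0)%:R. Proof. by []. Qed.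
Arguments EP : simpl never.

(** Adding t to the list multiplies the generating series by 1 - tX, and [telescope_geom] accounts
    for the powers of t in the power sums. *)
Lemma newton l k : (forall s t, s \in l -> t \in l -> GRing.comm s t) ->
  k%:R *: EP l k = - \sum_(i < k) PS l i.+1 * EP l (k.-1 - i).
Proof.
elim: l k => [|t l IH] k H.
  rewrite EPnil big1 => [|i _]; last by rewrite /PS big_nil mul0r.
  by rewrite oppr0; case: k => [|k]; rewrite ?scale0r ?scaler0.
have H' s s' : s \in l -> s' \in l -> GRing.comm s s'.
  by move=> sl sl'; apply: H; rewrite inE ?sl ?sl' orbT.
have tc s : s \in l -> GRing.comm t s by move=> sl; apply: H; rewrite inE ?sl ?eqxx ?orbT.
case: k => [|k]; first by rewrite scale0r big_ord0 oppr0.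
have T1 := @telescope_geom t (EP l) (EP (t :: l)) k (EP0 t l) (EPS t l).
have T2 : \sum_(i < k.+1) PS l i.+1 * EP (t :: l) (k - i) =
    \sum_(i < k.+1) PS l i.+1 * EP l (k - i) - t * \sum_(i < k) PS l i.+1 * EP l (k.-1 - i).
  rewrite big_ord_recr [in RHS]big_ord_recr /= subnn EP0.
  rewrite addrAC; congr (_ + _); rewrite mulr_sumr -sumrB; apply: eq_bigr => i _.
  have Ek : (k - i = (k.-1 - i).+1)%N by move: (ltn_ord i); clear; lia.
  rewrite Ek EPS mulrBr; congr (_ - _); rewrite !mulrA; congr (_ * _).
  exact/esym/PS_comm.
transitivity (- (\sum_(i < k.+1) t ^+ i.+1 * EP (t :: l) (k - i) +
    \sum_(i < k.+1) PS l i.+1 * EP (t :: l) (k - i))); last first.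
  by rewrite -big_split; congr (- _); apply: eq_bigr => i _; rewrite /PS big_cons mulrDl.
rewrite T1 T2 EPS scalerBr (IH k.+1 H') /= -natr1 scalerDl scale1r scalerAr (IH k H') mulrN.
by rewrite !opprD !opprK addrA [RHS]addrC.
Qed.

(** The sum is the value at t of the product of the X - s over the list, built factor by factor. *)
Lemma EP_root l t : (forall s t, s \in l -> t \in l -> GRing.comm s t) -> t \in l ->
  \sum_(k < (size l).+1) EP l k * t ^+ (size l - k) = 0.
Proof.
elim: l => // t0 l IH H; have H' s s' : s \in l -> s' \in l -> GRing.comm s s'.
  by move=> sl sl'; apply: H; rewrite inE ?sl ?sl' orbT.
have tc s : s \in l -> GRing.comm t0 s by move=> sl; apply: H; rewrite inE ?sl ?eqxx ?orbT.
move=> tl; pose S := \sum_(k < (size l).+1) EP l k * t ^+ (size l - k).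
have -> : \sum_(k < (size (t0 :: l)).+1) EP (t0 :: l) k * t ^+ (size (t0 :: l) - k) = S * t - t0
  * S.
  rewrite /= big_ord_recl EP0 subn0.
  under eq_bigr => k _ do rewrite /= subSS EPS mulrBl -[t0 * _ * _]mulrA.
  rewrite sumrB addrA -mulr_sumr; congr (_ - _).
  rewrite mulr_suml [RHS]big_ord_recl big_ord_recr /= subnn subn0 -!mulrA -!exprSr.
  congr (_ + _); rewrite EP_big // mul0r addr0; apply: eq_bigr => k _.
  by rewrite /= -mulrA -exprSr subnSK.
move: tl; rewrite inE => /predU1P[tt0|/(IH H')]; last by rewrite -/S => ->;
  rewrite mul0r mulr0 subr0.
subst t0; apply/eqP; rewrite subr_eq0 eq_sym; apply/eqP.
by apply: commr_bigsum => k _; apply: commrM; [exact: EP_comm|exact/commrX/commr_refl].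
Qed.

End Newton.

(** * Degrees and symbols on the filtered module U_n(g_0) E *)

Section Filtration.
Variables (F : numFieldType) (g : lieSuper F) (m0 : {vspace g}) (M : lmodType (uea g)).
Local Notation g0 := (even_part g).
Local Notation U := (uea g).
Variable E : seq M.
Hypothesis m00 : forall y, y \in m0 -> y \in g0.
Hypothesis Est : forall y w, y \in m0 -> lspan E w -> lspan E (ugen y *: w).

Definition gact (l : seq g) (w : M) : M := foldr (fun y w => ugen y *: w) w l.

Definition Fil (n : nat) : M -> Prop := fspan (fun w => exists l e,
  [/\ forall y, y \in l -> y \in g0, (size l <= n)%N, e \in E & w = gact l e]).

Lemma Fil_mono n n' w : (n <= n')%N -> Fil n w -> Fil n' w.
Proof.
by move=> nn'; apply: fspan_mono => _ [l [e [l0 ln eE ->]]]; exists l, e; split=> //;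
  apply: leq_trans nn'.
Qed.

Lemma Fil_E w : lspan E w -> Fil 0 w.
Proof. by apply: fspan_mono => e eE; exists [::], e. Qed.

Lemma Fil_gen n y w : y \in g0 -> Fil n w -> Fil n.+1 (ugen y *: w).
Proof.
move=> y0; apply: fspan_map => _ [l [e [l0 ln eE ->]]]; apply: fspan_gen.
by exists (y :: l), e; split=> // z; rewrite inE => /predU1P[->|/l0].
Qed.

Lemma even_ugenC y z : y \in g0 -> z \in g0 -> ugen y * ugen z = ugen z * ugen y + ugen [lie y,
  z] :> U.
Proof. by move=> y0 z0; rewrite (ugenC y0 z0) KoszulF scale1r. Qed.

(** [dg k] means degree at most k, and [lo k] that the symbol in degree k is zero. The predecessor
    truncates at 0, whence the positivity conditions below. *)
Definition dg k (a : U) := forall n w, Fil n w -> Fil (n + k) (a *: w).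
Definition lo k (a : U) := forall n w, Fil n w -> Fil (n + k).-1 (a *: w).

(** Moving y to the right produces commutators, each of which replaces two letters by one; at the
    right end y is absorbed by the stable span of [E]. *)
Lemma lo_m0 y : y \in m0 -> lo 1 (ugen y).
Proof.
move=> ym n w; rewrite addn1 /=; apply: fspan_map => _ [l [e [l0 ln eE ->]]].
elim: l n l0 ln => [|z l IH] n l0 ln /=.
  by apply: (Fil_mono (leq0n n)); apply/Fil_E/Est/fspan_gen.
have z0 : z \in g0 by apply/l0/mem_head.
have l0' t : t \in l -> t \in g0 by move=> tl; apply: l0; rewrite inE tl orbT.
case: n ln => // n ln.
rewrite scalerA (even_ugenC (m00 ym) z0) scalerDl -scalerA; apply: fspanD.
  by apply: Fil_gen z0 (IH n l0' ln).
apply: Fil_gen; first by have := lbr_part (m00 ym) z0.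
by apply: fspan_gen; exists l, e.
Qed.

Lemma dg_gen y : y \in g0 -> dg 1 (ugen y).
Proof. by move=> y0 n w; rewrite addn1; apply: Fil_gen. Qed.

Lemma dg1 : dg 0 1. Proof. by move=> n w; rewrite addn0 scale1r. Qed.
Lemma dg0 k : dg k 0. Proof. by move=> n w _; rewrite scale0r; apply: fspan0. Qed.
Lemma lo0 k : lo k 0. Proof. by move=> n w _; rewrite scale0r; apply: fspan0. Qed.
Lemma dgD k a b : dg k a -> dg k b -> dg k (a + b).
Proof. by move=> ka kb n w wn; rewrite scalerDl; apply: fspanD; [apply: ka|apply: kb]. Qed.
Lemma loD k a b : lo k a -> lo k b -> lo k (a + b).
Proof. by move=> ka kb n w wn; rewrite scalerDl; apply: fspanD; [apply: ka|apply: kb]. Qed.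
Lemma dgZ k c a : dg k a -> dg k (c *: a).
Proof. by move=> ka n w wn; rewrite algZ; apply/fspanZ/ka. Qed.
Lemma loZ k c a : lo k a -> lo k (c *: a).
Proof. by move=> ka n w wn; rewrite algZ; apply/fspanZ/ka. Qed.
Lemma dgN k a : dg k a -> dg k (- a).
Proof. by rewrite -scaleN1r; apply: dgZ. Qed.
Lemma loN k a : lo k a -> lo k (- a).
Proof. by rewrite -scaleN1r; apply: loZ. Qed.
Lemma dg_sum k (I : Type) (s : seq I) (P : pred I) (f : I -> U) :
  (forall i, P i -> dg k (f i)) -> dg k (\sum_(i <- s | P i) f i).
Proof. by move=> H; elim/big_ind: _ => //; [exact: dg0|exact: dgD]. Qed.
Lemma lo_sum k (I : Type) (s : seq I) (P : pred I) (f : I -> U) :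
  (forall i, P i -> lo k (f i)) -> lo k (\sum_(i <- s | P i) f i).
Proof. by move=> H; elim/big_ind: _ => //; [exact: lo0|exact: loD]. Qed.
Lemma lo_dg k a : lo k a -> dg k a.
Proof. by move=> ka n w /ka; apply: Fil_mono; apply: leq_pred. Qed.
Lemma dgM k l a b : dg k a -> dg l b -> dg (k + l) (a * b).
Proof. by move=> ka lb n w wn; rewrite -scalerA addnC -addnA addnC [(l + n)%N]addnC;
  apply/ka/lb. Qed.
Lemma loMl k l a b : lo k a -> dg l b -> lo (k + l) (a * b).
Proof. by move=> ka lb n w wn; rewrite -scalerA addnC -addnA addnC [(l + n)%N]addnC;
  apply/ka/lb. Qed.
Lemma loMr k l a b : (0 < l)%N -> dg k a -> lo l b -> lo (k + l) (a * b).
Proof.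
move=> l0 ka lb n w wn; rewrite -scalerA; apply: Fil_mono (ka _ _ (lb _ _ wn)).
by move: l0; clear; lia.
Qed.
Lemma dgX k a i : dg k a -> dg (k * i) (a ^+ i).
Proof.
move=> ka; elim: i => [|i IH]; first by rewrite muln0; apply: dg1.
by rewrite exprS mulnS; apply: dgM.
Qed.

Lemma lo_expB k a b i : (0 < k)%N -> dg k a -> dg k b -> lo k (a - b) -> lo (k * i) (a ^+ i - b
  ^+ i).
Proof.
move=> k0 ka kb ab; elim: i => [|i IH]; first by rewrite !expr0 subrr; apply: lo0.
have -> : a ^+ i.+1 - b ^+ i.+1 = (a ^+ i - b ^+ i) * a + b ^+ i * (a - b).
  by rewrite mulrBl mulrBr -!exprSr addrA subrK.
rewrite mulnS addnC; apply: loD; first exact: loMl.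
by apply: loMr => //; apply: dgX.
Qed.

(* The symbol of [a] in degree [k] is nilpotent on the associated graded. *)
Definition gnil k a := dg k a /\ exists2 K, (0 < K)%N & lo (k * K) (a ^+ K).

Lemma gnil_lo k a b : (0 < k)%N -> gnil k a -> lo k (a - b) -> gnil k b.
Proof.
move=> k0 [ka [K K0 HK]] ab.
have kb : dg k b by rewrite -[b](subKr a); apply/dgD/dgN/lo_dg.
split=> //; exists K => //; rewrite -[b ^+ K](subKr (a ^+ K)).
exact/loD/loN/lo_expB.
Qed.

Lemma gnil0 k : gnil k 0.
Proof. by split; [exact: dg0|exists 1%N => //; rewrite expr1; apply: lo0]. Qed.

Lemma gnilM k l a b : gnil k a -> dg l b -> GRing.comm a b -> gnil (k + l) (a * b).
Proof.
move=> [ka [K K0 HK]] lb ab; split; first exact: dgM.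
exists K => //; rewrite exprMn_comm // mulnDl; apply: loMl => //; exact: dgX.
Qed.

Lemma gnilZ k c a : gnil k a -> gnil k (c *: a).
Proof.
move=> [ka [K K0 HK]]; split; first exact: dgZ.
by exists K => //; rewrite exprZn; apply: loZ.
Qed.

Lemma gnilD k a b : (0 < k)%N -> gnil k a -> gnil k b -> GRing.comm a b -> gnil k (a + b).
Proof.
move=> k0 [ka [K K0 HK]] [kb [L L0 HL]] ab; split; first exact: dgD.
exists (K + L)%N; first by rewrite addn_gt0 K0.
rewrite exprDn_comm //; apply: lo_sum => i _.
suff H : lo (k * (K + L)) (a ^+ (K + L - i) * b ^+ i).
  by rewrite -scaler_nat; apply: loZ.
have iKL : (i <= K + L)%N by rewrite -ltnS.
rewrite -[in X in lo X _](subnK iKL) mulnDr.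
case: (leqP L i) => iL.
  apply: loMr; [by rewrite muln_gt0 k0 (leq_trans L0)|exact: dgX|].
  rewrite -(subnK iL) mulnDr exprD; apply: loMr => //; last exact: dgX.
  by rewrite muln_gt0 k0.
apply: loMl; last exact: dgX.
have Ki : (K <= K + L - i)%N by move: iL; clear; lia.
rewrite -(subnK Ki) mulnDr exprD; apply: loMr => //; last exact: dgX.
by rewrite muln_gt0 k0.
Qed.

Lemma gnil_sum k (I : eqType) (s : seq I) (f : I -> U) : (0 < k)%N ->
  (forall i, i \in s -> gnil k (f i)) ->
  (forall i j, i \in s -> j \in s -> GRing.comm (f i) (f j)) -> gnil k (\sum_(i <- s) f i).
Proof.
move=> k0; elim: s => [|i s IH] H C; first by rewrite big_nil; apply: gnil0.
rewrite big_cons; apply: gnilD => //; first exact/H/mem_head.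
  apply: IH => [j js|j j' js j's]; first by apply: H; rewrite inE js orbT.
  by apply: C; rewrite inE ?js ?j's orbT.
rewrite big_seq; apply: commr_bigsum => j js; apply: C; first exact: mem_head.
by rewrite inE js orbT.
Qed.

Lemma gnilX k a i : (0 < i)%N -> dg k a -> gnil (k * i) (a ^+ i) -> gnil k a.
Proof.
move=> i0 ka [_ [K K0 HK]]; split=> //; exists (i * K)%N; first by rewrite muln_gt0 i0.
by rewrite mulnA exprM.
Qed.

(** Newton's identities divide by k, so in characteristic 0 nilpotent power sums give nilpotent
    elementary functions; [EP_root] then writes a power of t as a sum of nilpotent terms. *)
Lemma gnil_PS (l : seq U) : (forall s t, s \in l -> t \in l -> GRing.comm s t) ->
  (forall t, t \in l -> dg 1 t) -> (forall i, (0 < i)%N -> gnil i (PS l i)) ->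
  forall t, t \in l -> gnil 1 t.
Proof.
move=> C D H t tl.
have CE s j : s \in l -> GRing.comm s (EP l j) by move=> sl; apply: EP_comm => r; apply: C.
have CEP i j : GRing.comm (PS l i) (EP l j).
  by apply/commr_sym/PS_comm => r rl; apply/commr_sym/CE.
have CPP i j : GRing.comm (PS l i) (PS l j).
  by apply: PS_comm => r rl; apply/commr_sym/PS_comm => s sl; apply: C.
have CEE i j : GRing.comm (EP l i) (EP l j) by apply: EP_comm => r rl; apply/commr_sym/CE.
have DE k : dg k (EP l k).
  elim: (l) D k => [|s l' IH] D k.
    by rewrite EPnil; case: k => [|k]; [exact: dg1|exact: dg0].
  have D' r : r \in l' -> dg 1 r by move=> rl; apply: D; rewrite inE rl orbT.
  case: k => [|k]; first by rewrite EP0; apply: IH.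
  rewrite EPS; apply: dgD; first exact: IH.
  by apply: dgN; rewrite -add1n; apply: dgM; [apply/D/mem_head|apply: IH].
have GE k : (0 < k)%N -> gnil k (EP l k).
  case: k => // k _; have kn : (k.+1)%:R != 0 :> F by rewrite pnatr_eq0.
  rewrite -[EP l _](scalerK kn) newton //; apply: gnilZ; rewrite -scaleN1r; apply: gnilZ.
  rewrite (_ : \sum_(i < k.+1) _ = \sum_(i <- index_enum 'I_k.+1) PS l i.+1 * EP l (k - i)) //.
  apply: gnil_sum => // [i _|i j _ _].
    have e : k.+1 = (i.+1 + (k - i))%N by rewrite addSn subnKC // -ltnS.
    rewrite [X in gnil X]e; apply: gnilM => //; exact: H.
  by apply: commr4 => //; apply/commr_sym.
have := EP_root C tl; rewrite big_ord_recl /= subn0.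
have -> : EP l 0 = 1 by elim: (l) => [|s l' IH]; rewrite ?EPnil ?EP0.
rewrite mul1r => /eqP; rewrite addr_eq0 => /eqP Et.
have n0 : (0 < size l)%N by case: (l) tl.
apply: (gnilX n0 (D _ tl)); rewrite mul1n Et -scaleN1r; apply: gnilZ.
apply: gnil_sum => // [i _|i j _ _].
  rewrite [bump _ _]add1n; have e : size l = (i.+1 + (size l - i.+1))%N by rewrite subnKC.
  rewrite [X in gnil X]e; apply: gnilM; [exact: GE|rewrite -[X in dg X]mul1n; exact/dgX/D|].
  exact/commrX/commr_sym/CE.
have CX i' j' : GRing.comm (EP l i') (t ^+ j') by apply/commrX/commr_sym/CE.
by apply: commr4 => //; [apply/commr_sym/CX|apply/commrX/commr_sym/commrX].
Qed.

End Filtration.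

(** * Central traces and nilpotent symbols *)

Section TraceInvariants.
Variables (F : numFieldType) (g : lieSuper F) (B : g -> g -> F) (m0 A : {vspace g}).
Variables (p : nat) (I : finType) (b b' : I -> g) (ys : 'I_p -> g) (lt : rel I).
Hypothesis Bform : invariant_form B.
Hypothesis rd : root_data B m0 A b b' ys lt.
Local Notation g0 := (even_part g).
Local Notation U := (uea g).

(* The commutator of [y] with this matrix is its matrix commutator with ad y, so the
   traces of its powers are central. *)
Definition Xmx (c d : I) : U := ugen [lie b c, b' d].
Fixpoint Xpow k (c d : I) : U :=
  if k is k'.+1 then \sum_e Xpow k' c e * Xmx e d else (c == d)%:R.

Definition Xtr k : U := \sum_c Xpow k c c.

Lemma Xmx_even c d : [lie b c, b' d] \in g0.
Proof. exact: (lbr_part (rd_b rd c) (rd_b' rd d)). Qed.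

Section Commutator.
Variable y : g.
Hypothesis y0 : y \in g0.
Let M c e := B [lie y, b c] (b' e).
Let der a := ugen y * a - a * ugen y.

Lemma der_mul (a a' : U) : der (a * a') = der a * a' + a * der a'.
Proof. by rewrite /der mulrBl mulrBr !mulrA addrA subrK. Qed.

Lemma der_sum (f : I -> U) : der (\sum_e f e) = \sum_e der (f e).
Proof. by rewrite /der mulr_sumr mulr_suml -sumrB. Qed.

Lemma der_Xmx c d : der (Xmx c d) = \sum_e (M c e *: Xmx e d - M e d *: Xmx c e).
Proof.
have yb e : [lie y, b e] \in g0 by apply: (lbr_part y0 (rd_b rd e)).
have yb' e : [lie y, b' e] \in g0 by apply: (lbr_part y0 (rd_b' rd e)).
rewrite /der /Xmx (even_ugenC y0 (Xmx_even c d)) addrC addKr.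
rewrite lbr_evenJ // linearD sumrB; congr (_ + _).
  rewrite {1}(rd_exp rd (yb c)) lbr_suml linear_sum; apply: eq_bigr => e _.
  by rewrite lbrZl linearZ.
rewrite (rd_exp' rd (yb' d)) lbr_sumr linear_sum -sumrN; apply: eq_bigr => e _.
rewrite lbrZr linearZ -scaleNr; congr (_ *: _).
by rewrite (form_skew Bform y0 (rd_b' rd d) (rd_b rd e)) (formC Bform (rd_b' rd d) (yb e)).
Qed.

(** The commutator with y is a derivation and acts on the matrix as a matrix commutator, so it does
    the same on its powers: the middle terms cancel. *)
Lemma der_Xpow k c d : der (Xpow k c d) = \sum_e (M c e *: Xpow k e d - M e d *: Xpow k c e).
Proof.
elim: k c d => [|k IH] c d /=.
  rewrite sumrB (bigD1 d) //= [X in _ = _ - X](bigD1 c) //= !eqxx.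
  rewrite [X in _ = _ + X - _]big1 => [|e /negPf ->]; last by rewrite scaler0.
  rewrite [X in _ = _ - (_ + X)]big1 => [|e]; last by rewrite eq_sym => /negPf ->; rewrite scaler0.
  rewrite !addr0 subrr /der.
  by rewrite (commr_nat (ugen y) (c == d)) subrr.
rewrite der_sum.
transitivity (\sum_e ((\sum_f (M c f *: Xpow k f e * Xmx e d) - \sum_f (M f e *: Xpow k c f *
  Xmx e d))
   + (\sum_f (Xpow k c e * (M e f *: Xmx f d)) - \sum_f (Xpow k c e * (M f d *: Xmx e f))))).
  by apply: eq_bigr => e _; rewrite der_mul IH der_Xmx !sumrB mulrBl mulrBr !mulr_suml !mulr_sumr.
rewrite big_split !sumrB /=.
have -> : \sum_e \sum_f (M f e *: Xpow k c f * Xmx e d) = \sum_e \sum_f Xpow k c e * (M e f *: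
  Xmx f d).
  rewrite exchange_big; apply: eq_bigr => e _; apply: eq_bigr => f _.
  by rewrite -scalerAl scalerAr.
rewrite addrA subrK; congr (_ - _); rewrite exchange_big; apply: eq_bigr => e _.
  by rewrite scaler_sumr; apply: eq_bigr => f _; rewrite scalerAl.
by rewrite scaler_sumr; apply: eq_bigr => f _; rewrite scalerAr.
Qed.

Lemma Xtr_comm k : GRing.comm (Xtr k) (ugen y).
Proof.
apply/esym/eqP; rewrite -subr_eq0 -/(der _) /Xtr der_sum.
under eq_bigr => c _ do rewrite der_Xpow sumrB.
by rewrite sumrB [X in X - _]exchange_big subrr.
Qed.

End Commutator.

Lemma usub_sum (V : {vspace g}) (f : I -> U) : (forall c, usub V (f c)) -> usub V (\sum_c f c).
Proof.
move=> H; elim/big_ind: _ => // [|s t]; last exact: usubD.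
by rewrite -[0](scale0r 1); apply/usubZ/usub1.
Qed.

Lemma ucenter_gen (z : U) : usub g0 z ->
  (forall y, y \in g0 -> GRing.comm z (ugen y)) -> ucenter_even z.
Proof.
move=> zU zC; split=> // y; elim=> [t /zC //||s t _ Hs _ Ht|c s _ Hs|s t _ Hs _ Ht].
- by rewrite mulr1 mul1r.
- exact: commrD.
- by rewrite -scalerAr Hs scalerAl.
- exact: commrM.
Qed.

Lemma Xtr_center k : ucenter_even (Xtr k).
Proof.
apply: ucenter_gen; last by move=> y y0; apply: Xtr_comm.
suff H c d : usub g0 (Xpow k c d) by apply: usub_sum.
elim: k c d => [|k IH] c d /=.
  by rewrite -scaler_nat; apply/usubZ/usub1.
by apply: usub_sum => e; apply: usubM => //; apply/usub_gen/Xmx_even.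
Qed.

Section Graded.
Variables (M : lmodType U) (E : seq M).
Hypothesis m00 : forall y, y \in m0 -> y \in g0.
Hypothesis Est : forall y w, y \in m0 -> lspan E w -> lspan E (ugen y *: w).
Local Notation dg := (@dg F g M E).
Local Notation lo := (@lo F g M E).
Local Notation gnil := (@gnil F g M E).
Local Notation Fil := (@Fil F g M E).

Lemma dg_Xmx c d : dg 1 (Xmx c d).
Proof. exact/dg_gen/Xmx_even. Qed.

Lemma lo_Xmx c d : c != d -> ~~ lt c d -> lo 1 (Xmx c d).
Proof. by move=> cd ncd; apply: (lo_m0 m00 Est); apply: (rd_low rd). Qed.

Lemma dg_Xpow k c d : dg k (Xpow k c d).
Proof.
elim: k c d => [|k IH] c d /=.
  by rewrite -scaler_nat; apply/dgZ/dg1.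
by apply: dg_sum => e _; rewrite -addn1; apply: dgM => //; apply: dg_Xmx.
Qed.

(* As [m0] preserves the span of [E], the matrix is triangular up to lower degree. *)
Lemma lo_Xpow k c d : c != d -> ~~ lt c d -> lo k (Xpow k c d).
Proof.
elim: k c d => [|k IH] c d cd ncd /=; first by rewrite (negPf cd); apply: lo0.
apply: lo_sum => e _; rewrite -addn1.
case: (eqVneq e d) => [->|ed]; first by apply: loMl; [exact: IH|exact: dg_Xmx].
case: (boolP (lt e d)) => led; last by apply: loMr => //; [exact: dg_Xpow|exact: lo_Xmx].
apply: loMl; last exact: dg_Xmx.
apply: IH; first by apply: contraNneq ncd => ->.
by apply: contra ncd => lce; apply: (rd_lt rd) led.
Qed.

(** For each intermediate index e distinct from c one of the two factors has zero symbol, since [lt]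
    cannot hold in both directions between c and e. *)
Lemma lo_Xpow_diag k c : lo k (Xpow k c c - Xmx c c ^+ k).
Proof.
elim: k => [|k IH] /=; first by rewrite eqxx subrr; apply: lo0.
rewrite (bigD1 c) //= exprSr addrAC -mulrBl -addn1; apply: loD.
  by apply: loMl => //; apply: dg_Xmx.
apply: lo_sum => e ec.
case: (boolP (lt e c)) => lec; last by apply: loMr => //; [exact: dg_Xpow|exact: lo_Xmx].
apply: loMl; last exact: dg_Xmx.
apply: lo_Xpow; first by rewrite eq_sym.
by apply/negP => lce; have := rd_lt rd lec lce; rewrite (rd_irr rd).
Qed.

Hypothesis lf : locally_finite (@ucenter_even F g) M.

Lemma ucenterX (z : U) j : ucenter_even z -> ucenter_even (z ^+ j).
Proof.
move=> [zU zC]; split.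
  by elim: j => [|j IH]; [exact: usub1|rewrite exprS; apply: usubM].
by move=> y /zC zy; apply/commr_sym/commrX.
Qed.

Lemma center_comm_gact (z : U) l (w : M) : ucenter_even z -> (forall y, y \in l -> y \in g0) ->
  z *: gact l w = gact l (z *: w).
Proof.
move=> [_ zC]; elim: l => //= y l IH H; rewrite -IH; last by move=> t tl; apply: H;
  rewrite inE tl orbT.
by rewrite !scalerA zC //; apply/usub_gen/H/mem_head.
Qed.

Lemma Fil_gact n l (w : M) : (forall y,
  y \in l -> y \in g0) -> Fil n w -> Fil (n + size l) (gact l w).
Proof.
move=> H wn; elim: l H => /= [|y l IH] H; first by rewrite addn0.
rewrite addnS; apply: Fil_gen; first exact/H/mem_head.
by apply: IH => t tl; apply: H; rewrite inE tl orbT.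
Qed.

(** Local finiteness makes the powers z^j e dependent; solving for the largest exponent J expresses
    z^J e through lower powers, so z^K e loses at least one power of z once K exceeds J. *)
Lemma center_low_vec (z : U) k e : ucenter_even z -> dg k z -> (0 < k)%N -> e \in E ->
  exists J, forall K, (J < K)%N -> Fil (k * K).-1 (z ^+ K *: e).
Proof.
move=> zc zk k0 eE; have [L LP] := locally_finiteE e lf.
have Fj j : Fil (k * j) (z ^+ j *: e).
  by have := dgX j zk; rewrite /dg => /(_ 0%N e); rewrite add0n; apply; apply/Fil_E/fspan_gen.
have [c [i0 ci0] cE] := @fspan_dep _ _ _ (size L).+1 _ (fun j => z ^+ j *: e) L
  (fun j => LP _ (ucenterX j zc)) erefl (ltnSn _).
have [J cJ Jmax] : exists2 J : 'I_(size L).+1, c J != 0 & forall j : 'I_(size L).+1,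
  (J < j)%N -> c j = 0.
  have [|J] := seq_argmax (fun j : 'I_(size L).+1 =>
    j : nat) (s := [seq j <- enum 'I_(size L).+1 | c j != 0]).
    by apply/negP => /eqP e0; have : i0 \in [::] by rewrite -e0 mem_filter ci0 mem_enum.
  rewrite mem_filter => /andP[cJ _] Jm; exists J => // j Jj; apply/eqP/negPn/negP => cj.
  by have := Jm j; rewrite mem_filter cj mem_enum leqNgt Jj => /(_ isT).
have zJ : z ^+ J *: e = \sum_(j | j != J) (- (c J)^-1 * c j)%:A *: (z ^+ j *: e).
  apply: (@etrans _ _ ((c J)^-1%:A *: ((c J)%:A *: (z ^+ J *: e)))); first by rewrite algK.
  move: cE; rewrite (bigD1 J) //= => /eqP; rewrite addr_eq0 => /eqP ->.
  rewrite scalerN -scaleNr -[- _%:A]scaleNr scaler_sumr; apply: eq_bigr => j _.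
  by rewrite algA.
exists J => K JK; rewrite -(subnK (ltnW JK)) exprD -scalerA.
rewrite zJ scaler_sumr; apply: fspan_sum => j jJ.
case: (ltngtP j J) => [lt_jJ|Jj|/val_inj e0]; last by rewrite e0 eqxx in jJ.
  rewrite algAC; apply: fspanZ; rewrite scalerA -exprD.
  apply: Fil_mono (Fj _); rewrite (subnK (ltnW JK)) -ltnS prednK ?muln_gt0 ?k0 ?(leq_ltn_trans _
    JK) //.
  by rewrite ltn_mul2l k0 /=; move: lt_jJ JK; clear; lia.
by rewrite (Jmax j Jj) mulr0 alg0 scaler0; apply: fspan0.
Qed.

(** [E] is finite, so one exponent serves all its elements, and central powers pass through the
    letters of a word to act on [E] directly. *)
Lemma gnil_center (z : U) k : ucenter_even z -> dg k z -> (0 < k)%N -> gnil k z.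
Proof.
move=> zc zk k0; split=> //.
have [K K0 HK] : exists2 K, (0 < K)%N & forall e, e \in E -> Fil (k * K).-1 (z ^+ K *: e).
  have H : forall s : seq M, {subset s <= E} ->
      exists J, forall e, e \in s -> forall K, (J < K)%N -> Fil (k * K).-1 (z ^+ K *: e).
    elim=> [|e s IH] sE; first by exists 0%N.
    have [|J HJ] := IH; first by move=> t ts; apply: sE; rewrite inE ts orbT.
    have [J' HJ'] := center_low_vec zc zk k0 (sE _ (mem_head _ _)).
    exists (J + J')%N => t; rewrite inE => /predU1P[->|ts] K JK.
      by apply: HJ'; apply: leq_ltn_trans (leq_addl _ _) JK.
    by apply: HJ => //; apply: leq_ltn_trans (leq_addr _ _) JK.
  by have [J HJ] := H E (fun _ h => h); exists J.+1 => // e eE; apply: HJ.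
exists K => // n w; apply: fspan_map => _ [l [e [l0 ln eE ->]]].
rewrite center_comm_gact //; last exact: ucenterX.
apply: Fil_mono (Fil_gact l0 (HK e eE)).
have kK : (0 < k * K)%N by rewrite muln_gt0 k0.
by move: ln kK; clear; lia.
Qed.

(** The power sums of the diagonal entries agree with the central traces up to lower degree, so
    [gnil_PS] applies to the diagonal. *)
Lemma gnil_root c : gnil 1 (ugen [lie b c, b' c]).
Proof.
apply: (@gnil_PS _ _ M E [seq Xmx c c | c <- enum I]).
- move=> _ _ /mapP[i _ ->] /mapP[j _ ->]; rewrite /GRing.comm /Xmx even_ugenC ?Xmx_even //.
  by rewrite (rd_ab rd (rd_t rd i) (rd_t rd j)) linear0 addr0.
- by move=> _ /mapP[i _ ->]; apply: dg_Xmx.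
- move=> i i0; apply: (gnil_lo i0 (gnil_center (Xtr_center i) _ i0)).
    by apply: dg_sum => d _; apply: dg_Xpow.
  rewrite /PS big_map big_enum /= /Xtr -sumrB; apply: lo_sum => d _; apply: lo_Xpow_diag.
- by apply: map_f; rewrite mem_enum.
Qed.

Lemma gnil_even_center z : even_center z -> gnil 1 (ugen z).
Proof.
move=> [z0 zC]; apply: gnil_center => //; last exact: dg_gen.
apply: ucenter_gen => [|y y0]; first exact: usub_gen.
by apply/esym; rewrite /GRing.comm even_ugenC // zC // linear0 addr0.
Qed.

End Graded.
End TraceInvariants.

(** * Growth of the filtration *)

Section Growth.
Variables (F : numFieldType) (g : lieSuper F) (m0 : {vspace g}) (M : lmodType (uea g)).
Variable E : seq M.
Local Notation g0 := (even_part g).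
Local Notation U := (uea g).
Hypothesis m00 : forall y, y \in m0 -> y \in g0.
Hypothesis Est : forall y w, y \in m0 -> lspan E w -> lspan E (ugen y *: w).
Variables (p q s : nat) (ys : 'I_p -> g) (ss : 'I_q -> g) (us : 'I_s -> g).
Hypothesis ys0 : forall i, ys i \in g0.
Hypothesis ss0 : forall i, ss i \in g0.
Hypothesis ssC : forall i j, [lie ss i, ss j] = 0.
Hypothesis ssN : forall i, gnil E 1 (ugen (ss i)).
Hypothesis usm : forall i, us i \in m0.
Hypothesis g0dec : forall y, y \in g0 -> exists k k' k'',
  y = \sum_i k i *: ys i + (\sum_i k' i *: ss i + \sum_i k'' i *: us i).
Local Notation Fil := (@Fil F g M E).
Local Notation Ym := (smono (fun i => ugen (ys i) : U)).
Local Notation Sm := (smono (fun i => ugen (ss i) : U)).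

(** The letters of m_0 come last, so that in an ordered monomial they act first and are absorbed by
    the stable span of [E]. *)
Definition tri_fam (i : 'I_(p + (q + s))) : g :=
  match split i with
  | inl j => ys j
  | inr j => match split j with inl k => ss k | inr k => us k end
  end.

Lemma tri_l i : tri_fam (lshift _ i) = ys i.
Proof. by rewrite /tri_fam (unsplitK (inl i)). Qed.
Lemma tri_m i : tri_fam (rshift _ (lshift _ i)) = ss i.
Proof. by rewrite /tri_fam (unsplitK (inr _)) (unsplitK (inl i)). Qed.
Lemma tri_r i : tri_fam (rshift _ (rshift _ i)) = us i.
Proof. by rewrite /tri_fam (unsplitK (inr _)) (unsplitK (inr i)). Qed.

Lemma tri_even i : tri_fam i \in g0.
Proof.
rewrite /tri_fam; case: split => // j; case: split => // k.
exact/m00.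
Qed.

Lemma tri_coords y : y \in g0 -> exists c, y = \sum_i c i *: tri_fam i.
Proof.
move=> /g0dec[k [k' [k'' ->]]].
exists (fun i => match split i with inl j => k j
  | inr j => match split j with inl j' => k' j' | inr j' => k'' j' end end).
rewrite !big_split_ord /=; congr (_ + (_ + _)); apply: eq_bigr => i _.
- by rewrite tri_l (unsplitK (inl i)).
- by rewrite tri_m (unsplitK (inr _)) (unsplitK (inl i)).
- by rewrite tri_r (unsplitK (inr _)) (unsplitK (inr i)).
Qed.

Lemma gact_words l (e : M) : (forall y, y \in l -> y \in g0) ->
  fspan (fun w => exists2 l', size l' = size l & w = lword (fun i => ugen (tri_fam i) : U) l' *: e)
    (gact l e).
Proof.
elim: l => [|y l IH] H /=.
  by apply: fspan_gen; exists [::]; rewrite // /lword big_nil scale1r.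
have [c ->] := tri_coords (H _ (mem_head _ _)).
rewrite linear_sum scaler_suml; apply: fspan_sum => i _; rewrite linearZ /= algZ; apply: fspanZ.
apply: fspan_map (IH _) => [_ [l' sl' ->]|t tl]; last by apply: H; rewrite inE tl orbT.
by apply: fspan_gen; exists (i :: l'); rewrite /= ?sl' // scalerA -lword_cons.
Qed.

Definition tri_span (Q : {ffun 'I_p -> nat} -> {ffun 'I_q -> nat} -> Prop) : M -> Prop :=
  fspan (fun w => exists al be e, [/\ Q al be, e \in E & w = Ym al *: (Sm be *: e)]).

Lemma Fil_tri n w : Fil n w -> tri_span (fun al be => (\sum_i al i + \sum_i be i <= n)%N) w.
Proof.
apply: fspan_sub => _ [l [e [l0 ln eE ->]]].
apply: fspan_sub (gact_words e l0) => _ [l' sl' ->].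
have famc i j : exists c, [lie tri_fam i, tri_fam j] = \sum_k c k *: tri_fam k.
  by apply: tri_coords; apply: (lbr_part (tri_even i) (tri_even j)).
apply: fspan_sub (lie_straighten (par := fun=> false) tri_even famc e l') => _ [a [_ al' ->]].
rewrite /smono big_split_ord big_split_ord /=.
under eq_bigr => i _ do rewrite tri_l.
under [X in _ * (X * _)]eq_bigr => i _ do rewrite tri_m.
under [X in _ * (_ * X)]eq_bigr => i _ do rewrite tri_r.
set T := \prod_(i < s) _.
have TE : lspan E (T *: e).
  rewrite /T; elim/big_rec: _ => [|i t _ IH]; first by rewrite scale1r; apply: fspan_gen.
  rewrite -scalerA; elim: (a _) => [|k IHk]; first by rewrite expr0 scale1r.
  by rewrite exprS -scalerA; apply: Est.
rewrite mulrA -scalerA; apply: fspan_map TE => e' e'E; apply: fspan_gen.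
exists [ffun i => a (lshift _ i)], [ffun i => a (rshift _ (lshift _ i))], e'; split=> //.
  apply: leq_trans ln; rewrite -sl'; apply: leq_trans al'; rewrite !big_split_ord /=.
  apply: leq_add; first by apply/eq_leq/eq_bigr => i _; rewrite ffunE.
  by apply: leq_trans (leq_addr _ _); apply/eq_leq/eq_bigr => i _; rewrite ffunE.
rewrite scalerA; congr (_ * _ *: _); apply: eq_bigr => i _; rewrite ffunE //.
Qed.

Lemma ss_comm i j : GRing.comm (ugen (ss i) : U) (ugen (ss j)).
Proof. by rewrite /GRing.comm even_ugenC // ssC linear0 addr0. Qed.

Lemma dg_prod (n : nat) (f : 'I_n -> g) (a : {ffun 'I_n -> nat}) : (forall i, f i \in g0) ->
  dg E (\sum_i a i)%N (smono (fun i => ugen (f i) : U) a).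
Proof.
move=> f0; rewrite /smono; elim/big_rec2: _ => [|i k t _ IH]; first exact: dg1.
by apply: dgM IH; rewrite -[X in dg E X]mul1n; apply/dgX/dg_gen.
Qed.

Lemma Sm_split K j (be : {ffun 'I_q -> nat}) : (K <= be j)%N ->
  Sm be = ugen (ss j) ^+ K * Sm [ffun i => if i == j then (be i - K)%N else be i].
Proof.
move=> Kj; rewrite /smono.
have H : forall r : seq 'I_q, uniq r -> \prod_(i <- r) ugen (ss i) ^+ be i =
    (if j \in r then ugen (ss j) ^+ K else 1) *
    \prod_(i <- r) ugen (ss i) ^+ [ffun i => if i == j then (be i - K)%N else be i] i :> U.
  elim=> [|i r IH] /=; first by rewrite !big_nil mulr1.
  case/andP=> ir /IH E1; rewrite !big_cons E1 ffunE in_cons eq_sym.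
  case: (eqVneq i j) ir => [->|ij] ir.
    by rewrite (negPf ir) mul1r mulrA -exprD subnKC.
  case: ifP => _; last by rewrite !mul1r.
  rewrite !mulrA; congr (_ * _); apply/esym; apply: commrX; apply/commr_sym/commrX.
  exact: ss_comm.
by rewrite H ?index_enum_uniq // mem_index_enum.
Qed.

(** The [ss i] commute, so a factor [ss j] to the power K can be pulled out; it lowers the degree,
    and the monomial already lies in the step before [n], where induction applies. *)
Lemma Fil_tri_bounded : exists K, forall n w, Fil n w ->
  tri_span (fun al be => (\sum_i al i + \sum_i be i <= n)%N /\ forall i, (be i < K)%N) w.
Proof.
have [K K0 HK] : exists2 K, (0 < K)%N & forall i, lo E K (ugen (ss i) ^+ K).
  have H (r : seq 'I_q) : exists2 K, (0 < K)%N & forall i, i \in r -> lo E K (ugen (ss i) ^+ K).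
    elim: r => [|i r [K K0 IH]]; first by exists 1%N.
    have [_ [L L0]] := ssN i; rewrite mul1n => HL.
    have dX k j : dg E k (ugen (ss j) ^+ k) by rewrite -[X in dg E X]mul1n; apply/dgX/dg_gen.
    exists (K + L)%N => [|j]; first by rewrite addn_gt0 K0.
    rewrite exprD inE => /predU1P[->|/IH jr].
      exact: loMr.
    exact: loMl.
  by have [K K0 HK] := H (enum 'I_q); exists K => // i; apply: HK; rewrite mem_enum.
exists K; elim/ltn_ind => n IH w wn.
apply: fspan_sub (Fil_tri wn) => _ [al [be [e [abn eE ->]]]].
case: (boolP [forall i, (be i < K)%N]) => [/forallP bK|].
  by apply: fspan_gen; exists al, be, e.
rewrite negb_forall => /existsP[j]; rewrite -leqNgt => Kj.
have n0 : (0 < n)%N.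
  by apply: leq_trans abn; rewrite (bigD1 j) //= addnCA ltn_addr // (leq_trans K0).
suff : Fil n.-1 (Ym al *: (Sm be *: e)).
  move/(IH _); rewrite prednK // leqnn => /(_ isT);
    apply: fspan_mono => _ [a' [b' [e' [[ab' bK] e'E ->]]]].
  by exists a', b', e'; split=> //; split=> //; apply: leq_trans ab' (leq_pred _).
rewrite (Sm_split Kj) -scalerA.
have := dg_prod [ffun i => if i == j then (be i - K)%N else be i] ss0 (Fil_E (fspan_gen eE)).
rewrite add0n => /(HK j) /(dg_prod al ys0); apply: Fil_mono.
have Eb : (\sum_i be i = K + \sum_i [ffun i => if i == j then (be i - K)%N else be i] i)%N.
  rewrite (bigD1 j) //= [in RHS](bigD1 j) //= ffunE eqxx addnA subnKC //; congr (_ + _)%N.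
  by apply: eq_bigr => i /negPf ij; rewrite ffunE ij.
by move: abn K0; rewrite Eb; set X := (\sum_i al i)%N; set Y := (\sum_i [ffun _ => _] i)%N;
  move: X Y; clear; lia.
Qed.

(* High powers of the [ss i] drop the degree, so only the exponents of the [ys i] are
   unbounded. *)
Theorem Fil_growth : exists D, forall n, exists L : seq M, size L = (D * n.+1 ^ p)%N /\
  forall w, Fil n w -> lspan L w.
Proof.
have [K HK] := Fil_tri_bounded; exists (K ^ q * size E)%N => n.
pose em (a : {ffun 'I_p -> 'I_n.+1}) : {ffun 'I_p -> nat} := [ffun i => val (a i)].
pose em' (a : {ffun 'I_q -> 'I_K}) : {ffun 'I_q -> nat} := [ffun i => val (a i)].
exists [seq Ym (em a) *: w | a <- enum {ffun 'I_p -> 'I_n.+1},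
  w <- [seq Sm (em' b) *: e | b <- enum {ffun 'I_q -> 'I_K}, e <- E]]; split.
  by rewrite !size_allpairs -!cardE !card_ffun !card_ord mulnC.
move=> w /HK; apply: fspan_mono => _ [al [be [e [[abn bK] eE ->]]]].
have an i : (al i < n.+1)%N.
  by rewrite ltnS; apply: leq_trans abn; rewrite (bigD1 i) //= -addnA leq_addr.
have -> : al = em [ffun i => Ordinal (an i)] by apply/ffunP => i; rewrite !ffunE.
have -> : be = em' [ffun i => Ordinal (bK i)] by apply/ffunP => i; rewrite !ffunE.
by apply: allpairs_f; rewrite ?mem_enum //; apply: allpairs_f; rewrite ?mem_enum.
Qed.

End Growth.

(** The nilpotent family consists of the brackets [b_c, b'_c] and a basis of the center; it may be
    dependent, as only spanning matters for an upper bound. *)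
Lemma root_data_growth (F : numFieldType) (g : lieSuper F) (B : g -> g -> F) (m0 A : {vspace g})
  (p : nat) (I : finType) (b b' : I -> g) (ys : 'I_p -> g) (lt : rel I) (M : lmodType (uea g))
    (E : seq M) :
  invariant_form B -> root_data B m0 A b b' ys lt ->
  (forall y, y \in m0 -> y \in even_part g) ->
  (forall y w, y \in m0 -> lspan E w -> lspan E (ugen y *: w)) ->
  locally_finite (@ucenter_even F g) M ->
  exists D, forall n, exists L : seq M, size L = (D * n.+1 ^ p)%N /\
    forall w, Fil E n w -> lspan L w.
Proof.
move=> Bform rd m00 Est lf.
have [C HC] : exists C : {vspace g}, forall z, z \in C <-> even_center z.
  apply: vspace_of_pred => [|c z z' [z0 zc] [z'0 z'c]].
    by split=> [|y _]; [exact: mem0v|exact: lbr0r].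
  split=> [|y y0]; first by rewrite memvD ?memvZ.
  by rewrite lbrDr lbrZr zc // z'c // scaler0 addr0.
pose L := [seq [lie b c, b' c] | c <- enum I] ++ vbasis C.
have LP y : y \in L -> (exists c, y = [lie b c, b' c]) \/ even_center y.
  rewrite mem_cat => /orP[/mapP[c _ ->]|/vbasis_mem /HC]; last by right.
  by left; exists c.
pose ss (i : 'I_(size L)) := L`_i.
have ssL i : ss i \in L by apply: mem_nth.
apply: (@Fil_growth _ _ m0 M E m00 Est p (size L) (\dim m0) ys ss (fun i => (vbasis m0)`_i)).
- exact: (rd_ys rd).
- by move=> i; case: (LP _ (ssL i)) => [[c ->]|[]//]; apply: (Xmx_even rd).
- move=> i j; case: (LP _ (ssL j)) => [[c' Ej]|[j0 jc]]; last first.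
    by apply: jc; case: (LP _ (ssL i)) => [[c ->]|[]//]; apply: (Xmx_even rd).
  case: (LP _ (ssL i)) => [[c Ei]|[i0 ic]].
    by rewrite Ei Ej (rd_ab rd) ?(rd_t rd).
  by rewrite lbr_evenC // ic ?oppr0 // Ej; apply: (Xmx_even rd).
- move=> i; case: (LP _ (ssL i)) => [[c ->]|].
    exact: (gnil_root Bform rd m00 Est lf).
  exact: gnil_even_center.
- by move=> i; apply/vbasis_mem/mem_nth; rewrite size_tuple.
move=> y y0; have [k [a [x [aA xm ->]]]] := rd_dec rd y0.
have [t [z [zc Ea]]] := rd_span rd aA.
have aL : a \in <<in_tuple L>>%VS.
  rewrite /= /L span_cat Ea memv_add //; last by rewrite (span_basis (vbasisP C)); apply/HC.
  by apply: memv_suml => c _; apply/memvZ/memv_span/mapP; exists c; rewrite ?mem_enum.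
exists k, (fun i => coord (in_tuple L) i a), (fun i => coord (vbasis m0) i x).
by rewrite -addrA -(coord_vbasis xm) -(coord_span aL).
Qed.

Section Exhaustion.
Variables (F : numFieldType) (g : lieSuper F) (m0 : {vspace g}) (M : lmodType (uea g)).
Local Notation g0 := (even_part g).
Local Notation U := (uea g).
Hypothesis stable_span : forall v : M, exists E : seq M, lspan E v /\
  forall y w, y \in m0 -> lspan E w -> lspan E (ugen y *: w).

Lemma stable_span_list (E0 : seq M) : exists E : seq M, (forall v, v \in E0 -> lspan E v) /\
  forall y w, y \in m0 -> lspan E w -> lspan E (ugen y *: w).
Proof.
elim: E0 => [|v E0 [E1 [H1 S1]]].
  by exists [::]; split=> // y w _ /(fspan_false (fun _ => _)) ->; rewrite ?scaler0 //;
    apply: fspan0.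
have [E2 [H2 S2]] := stable_span v; exists (E2 ++ E1).
have L2 w : lspan E2 w -> lspan (E2 ++ E1) w.
  by apply: fspan_mono => t tE; rewrite mem_cat tE.
have L1 w : lspan E1 w -> lspan (E2 ++ E1) w.
  by apply: fspan_mono => t tE; rewrite mem_cat tE orbT.
split=> [t|y w ym]; first by rewrite inE => /predU1P[->|/H1/L1//]; apply: L2.
apply: fspan_map => t; rewrite mem_cat => /orP[tE|tE]; [apply: L2; apply: S2|apply: L1;
  apply: S1] => //.
  exact: fspan_gen.
exact: fspan_gen.
Qed.

(** Straightening puts the odd letters next to the generators with exponents at most 1; so finitely
    many odd monomials applied to the generators suffice for U(g_0) to reach everything. *)
Lemma Fil_exhaust : fin_gen M -> exists E : seq M,
  (forall y w, y \in m0 -> lspan E w -> lspan E (ugen y *: w)) /\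
  forall v, exists n, Fil E n v.
Proof.
move=> [N [b Hb]].
pose p := \dim g0; pose q := \dim (odd_part g).
pose ev (i : 'I_p) := (vbasis g0)`_i; pose od (i : 'I_q) := (vbasis (odd_part g))`_i.
have ev0 i : ev i \in g0 by apply/vbasis_mem/mem_nth; rewrite size_tuple.
have od1 i : od i \in odd_part g by apply/vbasis_mem/mem_nth; rewrite size_tuple.
pose fam (i : 'I_(p + q)) := match split i with inl j => ev j | inr j => od j end.
pose par (i : 'I_(p + q)) := if split i is inl _ then false else true.
have faml i : fam (lshift _ i) = ev i by rewrite /fam (unsplitK (inl i)).
have famr i : fam (rshift _ i) = od i by rewrite /fam (unsplitK (inr i)).
have famp i : fam i \in lpart g (par i) by rewrite /fam /par; case: split => j.
have coords y : exists c, y = \sum_i c i *: fam i.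
  have [y0 [y1 [y00 y11 ->]]] := part_decomp y.
  exists (fun i => match split i with inl j => coord (vbasis g0) j y0
                                 | inr j => coord (vbasis (odd_part g)) j y1 end).
  rewrite big_split_ord /= {1}(coord_vbasis y00) {1}(coord_vbasis y11); congr (_ + _).
    by apply: eq_bigr => i _; rewrite faml (unsplitK (inl i)).
  by apply: eq_bigr => i _; rewrite famr (unsplitK (inr i)).
pose Od (f : {ffun 'I_q -> bool}) : U := \prod_i ugen (od i) ^+ (f i : nat).
pose E0 := [seq Od f *: b j | f <- enum {ffun 'I_q -> bool}, j <- enum 'I_N].
have [E [HE Est]] := stable_span_list E0; exists E; split=> // v.
have sumF (I : finType) (f : I -> M) : (forall i, exists n, Fil E n (f i)) -> exists n,
  Fil E n (\sum_i f i).
  move=> H; elim/big_ind: _ => //; first by exists 0%N; apply: fspan0.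
  move=> s t [n Hn] [n' Hn']; exists (n + n')%N; apply: fspanD.
    exact: Fil_mono (leq_addr _ _) Hn.
  exact: Fil_mono (leq_addl _ _) Hn'.
have [a ->] := Hb v; apply: sumF => j.
suff : fspan (fun w => exists l, w = lword (fun i => ugen (fam i) : U) l *: b j) (a j *: b j).
  move: (a j *: b j); apply: fspan_ind2 => [|s t [n Hn] [n' Hn']|c s [n Hn]|s [l ->]].
  - by exists 0%N; apply: fspan0.
  - exists (n + n')%N; apply: fspanD; first exact: Fil_mono (leq_addr _ _) Hn.
    exact: Fil_mono (leq_addl _ _) Hn'.
  - by exists n; apply: fspanZ.
  have famc i k : exists c, [lie fam i, fam k] = \sum_t c t *: fam t by apply: coords.
  exists (size l); apply: fspan_sub (lie_straighten famp famc (b j) l) => _ [f [f1 fl ->]].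
  rewrite /smono big_split_ord /= -scalerA.
  under eq_bigr => i _ do rewrite faml.
  under [X in _ *: (X *: _)]eq_bigr => i _ do rewrite famr.
  have oE : Fil E 0 (\prod_(i < q) ugen (od i) ^+ f (rshift p i) *: b j).
    apply/Fil_E/HE; apply/allpairsP; exists ([ffun i => 0 < f (rshift p i)]%N, j).
    split; rewrite ?mem_enum //; congr (_ *: _); apply: eq_bigr => i _; rewrite ffunE.
    have := f1 (rshift p i); rewrite /par (unsplitK (inr i)) => /(_ isT).
    by case: (f _) => [|[]].
  have := dg_prod [ffun i => f (lshift q i)] ev0 oE; rewrite /smono add0n.
  under eq_bigr => i _ do rewrite ffunE.
  under [X in _ (X *: _)]eq_bigr => i _ do rewrite ffunE.
  apply: Fil_mono; apply: leq_trans fl; rewrite big_split_ord /=; exact: leq_addr.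
apply: (uea_act (P := fspan (fun w => exists l, w = lword (fun i => ugen (fam i) : U) l *: b j))).
- by move=> *; apply: fspanD.
- by move=> *; apply: fspanZ.
- move=> y w; apply: fspan_map => _ [l ->]; have [c ->] := coords y.
  rewrite linear_sum scaler_suml; apply: fspan_sum => i _; rewrite linearZ /= algZ.
  by apply/fspanZ/fspan_gen; exists (i :: l); rewrite scalerA -lword_cons.
- by apply: fspan_gen; exists [::]; rewrite /lword big_nil scale1r.
Qed.

End Exhaustion.

(** * Finite dimension of the Whittaker vectors *)

Section WhittakerFinite.
Variables (F : numFieldType) (g : lieSuper F) (h : g) (zeta : {scalar g}).
Variables (r' r : nat) (u x : 'I_r -> g) (d : 'I_r -> nat).
Hypothesis df : dual_families h zeta fullv r' u x d.
Hypothesis r'r : (r' <= r)%N.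
Local Notation m := (neg_part h).
Local Notation m0 := (neg_part h :&: even_part g)%VS.
Local Notation U := (uea g).
Local Notation wd := (widen_ord r'r).
Local Notation df0 := (df_restrict df r'r).
Local Notation Kwhe := (Kwh h zeta (even_part g)).
Variable M : lmodType U.
Hypothesis MW : in_Wmod m zeta M.
Hypothesis Mfg : fin_gen M.
Hypothesis growth : forall E : seq M,
  (forall y w, y \in m0 -> lspan E w -> lspan E (ugen y *: w)) ->
  exists D, forall n, exists L : seq M, size L = (D * n.+1 ^ r')%N /\
    forall w, Fil E n w -> lspan L w.

Definition findep N (ws : 'I_N -> M) :=
  forall c : 'I_N -> F, \sum_i (c i)%:A *: ws i = 0 -> forall i, c i = 0.

(* For [a] in a box of side n the vectors x^a w are independent and lie in the step
   r' n + O(1) of the filtration. *)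
Lemma findep_bound : exists K, forall N (ws : 'I_N -> M),
  (forall i, Kwhe (ws i)) -> findep ws -> (N <= K)%N.
Proof.
have [E [Est Eex]] := Fil_exhaust (m0_stable_span df r'r MW) Mfg.
(* The box will have side n0 + 1, where step n0 contains all [ws]. Its vectors lie in step r' n0 +
   n0, and r' n0 + n0 + 1 is at most (r' + 1)(n0 + 1); the powers of n0 + 1 then cancel and leave
   this bound. *)
have [D HD] := growth Est; exists (D * r'.+1 ^ r')%N => N ws wK wi.
have [n0 Hn0] : exists n0, forall i, Fil E n0 (ws i).
  pose n i := projT1 (cid (Eex (ws i))).
  exists (\sum_i n i)%N => i; apply: Fil_mono (projT2 (cid (Eex (ws i)))).
  by rewrite (bigD1 i) //= leq_addr.
pose T := ({ffun 'I_r' -> 'I_n0.+1} * 'I_N)%type.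
pose em (a : {ffun 'I_r' -> 'I_n0.+1}) : {ffun 'I_r' -> nat} := [ffun i => val (a i)].
have em_inj : injective em.
  by move=> a a' /ffunP E1; apply/ffunP => i; apply: val_inj; have := E1 i; rewrite !ffunE.
pose X (t : T) : M := xmon' (fun i => x (wd i)) (em t.1) *: ws t.2.
have [L [sL LP]] := HD (r' * n0 + n0)%N.
have XL t : lspan L (X t).
  apply: LP; have x0 i : x (wd i) \in even_part g by apply: (df_xK df0).
  apply: Fil_mono (dg_prod (em t.1) x0 (Hn0 t.2)); rewrite addnC leq_add2r.
  rewrite -[r' in leqRHS]card_ord -sum_nat_const; apply: leq_sum => i _.
  by rewrite ffunE -ltnS ltn_ord.
rewrite leqNgt; apply/negP => DN.
have cT : #|{: T}| = (n0.+1 ^ r' * N)%N by rewrite card_prod card_ffun !card_ord.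
have sT : (size L < #|{: T}|)%N.
  have le : ((r' * n0 + n0).+1 <= r'.+1 * n0.+1)%N by clear; lia.
  rewrite sL cT; apply: (@leq_ltn_trans (D * (r'.+1 * n0.+1) ^ r')%N).
    by case: (posnP r') => [->|rp]; rewrite ?expn0 // leq_mul2l leq_exp2r // le orbT.
  by rewrite expnMn mulnA mulnC ltn_mul2l expn_gt0.
have [c [i0 ci0] cE] := fspan_dep (fun i : 'I_#|{: T}| => XL (enum_val i)) erefl sT.
pose cc (t : T) := c (enum_rank t).
have ccE : \sum_(t : T) (cc t)%:A *: X t = 0.
  rewrite -[RHS]cE [RHS](reindex (@enum_rank T)) /=; last exact/onW_bij/enum_rank_bij.
  by apply: eq_bigr => t _; rewrite enum_rankK.
(* Collecting the relation by exponents makes each coefficient Whittaker for m_0, so freeness of the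
   x^a applies. *)
pose va (a : {ffun 'I_r' -> nat}) : M :=
  \sum_(t : T | em t.1 == a) (cc t)%:A *: ws t.2.
have vaK a : Kwhe (va a).
  by rewrite /va; elim/big_ind: _ => [|v w|t _]; [exact: Kwh0|exact: KwhD|exact/KwhZ].
have vaE a : va (em a) = \sum_i (cc (a, i))%:A *: ws i.
  rewrite /va (eq_big (fun t : T => pred1 a t.1 && xpredT t.2)
    (fun t : T => (cc (t.1, t.2))%:A *: ws t.2)); last 2 first.
  - by move=> t; rewrite andbT (inj_eq em_inj).
  - by case.
  rewrite -(pair_big (pred1 a) xpredT (fun a' i => (cc (a', i))%:A *: ws i)) /=.
  by rewrite big_pred1_eq.
have va0 a : va (em a) = 0.
  have us : uniq (map em (enum {ffun 'I_r' -> 'I_n0.+1})) by rewrite map_inj_uniq ?enum_uniq.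
  apply: (xmon_free df0 us _ vaK) => [t _||]; last by rewrite map_f ?mem_enum.
    by apply/forallP => i; rewrite leqNgt ltn_ord.
  rewrite big_map big_enum /= -[RHS]ccE.
  rewrite (eq_bigr (fun t : T => (cc (t.1, t.2))%:A *: X (t.1, t.2))); last by case.
  rewrite -(pair_bigA _ (fun a' i => (cc (a', i))%:A *: X (a', i))) /=.
  apply: eq_bigr => a' _; rewrite vaE scaler_sumr; apply: eq_bigr => i _.
  by rewrite /X algAC.
have := wi _ (etrans (esym (vaE (enum_val i0).1)) (va0 _)) (enum_val i0).2.
by rewrite -surjective_pairing /cc enum_valK => E0; rewrite E0 eqxx in ci0.
Qed.

(** A maximal independent family spans: adding [v] creates a relation, in which the coefficient of
    [v] cannot vanish. *)
Lemma wh_fdmod : W_fdmod m zeta (wh m zeta M).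
Proof.
have [K HK] := findep_bound.
pose P N := `[< exists ws : 'I_N -> M, (forall i, Kwh h zeta fullv (ws i)) /\ findep ws >].
have exP : exists N, P N.
  by exists 0%N; apply/asboolP; exists (fun=> 0); split=> [[]//|c _ []].
have ubP N : P N -> (N <= K)%N.
  move=> /asboolP[ws [wK wi]]; apply: HK wi => i y; rewrite memv_cap => /andP[ym _].
  by apply: wK; rewrite capvf.
case: (ex_maxnP exP ubP) => N /asboolP[ws [wK wi]] Nmax.
exists N, (fun i => mkwh (wK i)) => v.
pose ws' (i : 'I_N.+1) := oapp ws (val v) (unlift ord0 i).
have [c [i ci] cE] : exists2 c : 'I_N.+1 -> F, exists i, c i != 0 & \sum_i (c i)%:A *: ws' i = 0.
  apply: contrapT => nc; suff /Nmax : P N.+1 by rewrite ltnn.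
  apply/asboolP; exists ws'; split=> [i|c cE i].
    by rewrite /ws'; case: unlift => [j|] /=; [exact: wK|exact: wh_Kwh].
  by apply/eqP/negPn/negP => ci; apply: nc; exists c => //; exists i.
move: cE; rewrite big_ord_recl /ws' unlift_none /=.
under eq_bigr => j _ do rewrite liftK /=.
case: (eqVneq (c ord0) 0) => [c0|c0].
  rewrite c0 alg0 add0r => /wi cj; move: ci.
  by case: (unliftP ord0 i) => [j ->|->]; rewrite ?c0 ?cj eqxx.
move/eqP; rewrite addr_eq0 => /eqP E; exists (fun j => - (c ord0)^-1 * c (lift ord0 j)).
apply: val_inj; rewrite raddf_sum /= -[LHS](algK _ c0) E scalerN -scaleNr -[- _%:A]scaleNr
  scaler_sumr.
by apply: eq_bigr => j _; rewrite algA wh_homZ wh_hom1.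
Qed.

End WhittakerFinite.

(** * From the hypotheses of the theorem to dual families *)

Section Situation.
Variables (F : numFieldType) (g : lieSuper F) (e h f : g).
Variables (form : g -> g -> F) (zeta : {scalar g}).
Variables (r' r : nat) (u x : 'I_r -> g) (d : 'I_r -> nat).
Local Notation m := (neg_part h).
Hypothesis e0 : e \in even_part g.
Hypothesis h0 : h \in even_part g.
Hypothesis sl2 : sl2_triple e h f.
Hypothesis hev : even_grading h.
Hypothesis Bform : invariant_form form.
Hypothesis zch : character m zeta.
Hypothesis zform : forall y, y \in (m :&: even_part g)%VS -> zeta y = form y e.

Lemma grade_parts k y0 y1 : y0 \in even_part g -> y1 \in odd_part g ->
  y0 + y1 \in grade h k -> y0 \in grade h k /\ y1 \in grade h k.
Proof.
move=> y00 y11 /gradeP; rewrite lbrDr scalerDr => E.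
have H0 := lbr_part h0 y00; have H1 := lbr_part h0 y11.
have E' : [lie h, y0] - k%:~R *: y0 = k%:~R *: y1 - [lie h, y1].
  by apply/eqP; rewrite subr_eq addrAC [X in X - _]addrC -E addrK.
have Z : [lie h, y0] - k%:~R *: y0 = 0.
  apply: even_odd0; first by apply: memvB => //; apply: memvZ.
  by rewrite E'; apply: memvB => //; apply: memvZ.
split; apply/gradeP; first by apply/eqP; rewrite -subr_eq0 Z.
by apply/esym/eqP; rewrite -subr_eq0 -E' Z.
Qed.

(** On even elements of m, zeta is the pairing with [e], and invariance under [h] lets degree k pair
    nontrivially with [e], of degree 2, only for k = -2. *)
Lemma zeta_low y k : y \in m -> y \in grade h k -> k < -2 -> zeta y = 0.
Proof.
move=> ym yk k2; have [y0 [y1 [y00 y11 Ey]]] := part_decomp y.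
move: yk; rewrite Ey => /(grade_parts y00 y11)[yk0 yk1].
have km : forall t, t \in grade h k -> t \in m by move=> t; apply: grade_neg; exact: ltW.
have z1 : zeta y1 = 0 by apply: zch.2; rewrite memv_cap km.
rewrite linearD /= z1 addr0 zform ?memv_cap ?km //.
have [_ he _ _] := sl2.
have := formA Bform y00 h0 e0; rewrite he formZr // (lbr_evenC _ y00).
move/gradeP: yk0 => ->; rewrite -scaleNr formZl // => /eqP.
rewrite -subr_eq0 -mulrBl mulf_eq0 => /orP[|/eqP//].
rewrite subr_eq0 => /eqP E; move: k2; suff -> : k = -2 by rewrite ltxx.
have /eqP : ((- k)%:~R : F) = (2%:Z)%:~R by rewrite rmorphN.
by rewrite eqr_int => /eqP; clear; lia.
Qed.

Hypothesis upar : forall s : 'I_r, (s < r')%N -> u s \in even_part g /\ x s \in even_part g.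
Hypothesis upar1 : forall s : 'I_r, (r' <= s)%N -> u s \in odd_part g /\ x s \in odd_part g.
Hypothesis ugr : forall s, exists k : int, u s \in grade h k.
Hypothesis d_gt0 : forall s, (0 < d s)%N.
Hypothesis xgr : forall s, x s \in grade h (- 2 + (d s)%:Z).
Hypothesis ub : basis_of m (codom u).
Hypothesis ux : forall i, [lie u i, x i] \in (grade h (- 2) :&: even_part g)%VS /\
  zeta [lie u i, x i] = 1.
Hypothesis uxne : forall i j, i != j -> [lie u i, x j] \in grade h (- 2) ->
  zeta [lie u i, x j] = 0.

Lemma situation_families : dual_families h zeta fullv r' u x d.
Proof.
split=> //.
- by move=> *; apply: memvf.
- apply/eqP; rewrite eqEsubv subvf andbT -[X in (X <= _)%VS]hev; apply: spanof_sub => y [k yk].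
  have [y0 [y1 [y00 y11 Ey]]] := part_decomp y.
  move: yk; rewrite Ey => /(grade_parts y00 y11)[yk0 yk1].
  by apply: memvD; apply: mem_spanof; split; rewrite ?memvf //;
    [by exists false|by exists k|by exists true|by exists k].
- by move=> y z; rewrite capvf; apply: zch.1.
- by move=> y; rewrite capvf => ym y1; apply: zch.2; rewrite memv_cap ym.
- by move=> y k; rewrite capvf; apply: zeta_low.
- by move=> s; apply: memvf.
- by move=> s; apply: memvf.
- by move=> s; case: (leqP r' s) => [/upar1|/upar] [].
- by move=> s; case: (leqP r' s) => [/upar1|/upar] [].
(* zeta([u_s, x_s]) = 1 makes this bracket nonzero, so the degrees of u_s and x_s add up to -2,
   which fixes the degree of u_s. *)
- move=> s; have [k uk] := ugr s; have [] := ux s; rewrite memv_cap => /andP[/gradeP ux2 _] ux1.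
  have /gradeP := grade_lbr h0 uk (xgr s); rewrite ux2 => /eqP; rewrite -subr_eq0 -scalerBl.
  rewrite scaler_eq0 subr_eq0 eqr_int => /orP[/eqP E|/eqP E]; last first.
    by move: ux1; rewrite E linear0 => /esym/eqP; rewrite oner_eq0.
  by apply: grade_eq uk; move: E; clear; lia.
- by rewrite capvf.
- by move=> i; have [+ ->] := ux i; rewrite memv_cap => /andP[].
Qed.

End Situation.

Section Final.
Variables (F : numClosedFieldType) (g : lieSuper F) (h : g).
Variables (form : g -> g -> F) (zeta : {scalar g}).
Variables (r' r : nat) (u x : 'I_r -> g) (d : 'I_r -> nat).
Hypothesis df : dual_families h zeta fullv r' u x d.
Hypothesis r'r : (r' <= r)%N.
Hypothesis Bform : invariant_form form.
Hypothesis qr : quasi_reductive g.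
Local Notation m := (neg_part h).
Local Notation df0 := (df_restrict df r'r).

Lemma in_N_Wmod n M : in_N m zeta n M -> in_Wmod m zeta M.
Proof. by case=> _ _ _; apply: (even_nil_Wmod df). Qed.

Lemma in_N_fdmod b hh n M : is_borel b hh n ->
  (n :&: even_part g)%VS = (m :&: even_part g)%VS ->
  in_N m zeta n M -> W_fdmod m zeta (wh m zeta M).
Proof.
move=> [A [H [Acart HA Hreg _ [nE _]]]] n0 MN.
have [Mfg Mlf _ _] := MN.
apply: (wh_fdmod df r'r (in_N_Wmod MN) Mfg) => E Est.
have [I [B [B' [ys [lt rd]]]]] := torus_root_data (df_even df) (df_span df0) (df_basis df0)
  (df_ugr df0) (df_d df0) Bform qr.1 Acart HA Hreg nE n0.
apply: (root_data_growth Bform rd) => // y.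
by rewrite memv_cap => /andP[].
Qed.

Lemma umonE (a : multi_index r' r) : umon zeta u a = umon' zeta u (val a).
Proof.
apply: eq_bigr => s _; case: ltnP => // rs.
by rewrite /ushift (um_odd0 df rs) scale0r subr0.
Qed.

(** If the criterion of [umon_xmon_eq0] failed, every compatible order would put [a] before [b]. *)
Lemma umon_xmon_lt (lt : rel (multi_index r' r)) (M : lmodType (uea g)) (v : M) a b :
  strict_linear_order lt -> wt_compatible d lt -> is_wh m zeta v -> lt b a ->
  umon zeta u a *: (xmon x b *: v) = 0.
Proof.
move=> [irr tr _] ltw /is_whP vK ba; rewrite umonE.
apply: (umon_xmon_eq0 df vK (svalP b)).
  by apply: contraTneq ba => /val_inj ->; rewrite irr.
apply/negPn/negP => nab; suff /(tr _ _ _ ba) : lt a b by rewrite irr.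
apply: ltw; move: nab; rewrite -![wt d _]/(mi_wt d _) -![deg _]/(mi_abs _).
by move: (mi_wt d a) (mi_wt d b) (mi_abs a) (mi_abs b); clear; lia.
Qed.

End Final.

Theorem theorem22 (R : realType) (g : lieSuper R[i]) (e h f : g)
  (form : g -> g -> R[i]) (zeta : {scalar g})
  (r' r : nat) (u x : 'I_r -> g) (d : 'I_r -> nat)
  (lt : rel (multi_index r' r)) :
  let m := neg_part h in
  quasi_reductive g ->
  [/\ e \in even_part g, h \in even_part g & f \in even_part g] ->
  sl2_triple e h f ->
  principal_nilpotent e ->
  even_grading h ->
  invariant_form form ->
  character m zeta ->
  (forall y, y \in (m :&: even_part g)%VS -> zeta y = form y e) ->
  (r' <= r)%N ->
  (forall s : 'I_r, (s < r')%N -> u s \in even_part g /\ x s \in even_part g) ->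
  (forall s : 'I_r, (r' <= s)%N -> u s \in odd_part g /\ x s \in odd_part g) ->
  (forall s, exists k : int, u s \in grade h k) ->
  (forall s, (0 < d s)%N) ->
  (forall s, x s \in grade h (- 2 + (d s)%:Z)) ->
  basis_of m (codom u) ->
  (forall i, [lie u i, x i] \in (grade h (- 2) :&: even_part g)%VS /\
             zeta [lie u i, x i] = 1) ->
  (forall i j, i != j -> [lie u i, x j] \in grade h (- 2) ->
               zeta [lie u i, x j] = 0) ->
  strict_linear_order lt ->
  wt_compatible d lt ->
  [/\ (forall (M : lmodType (uea g)) (v : M) (a b : multi_index r' r),
         fin_gen M -> is_wh m zeta v ->
         (exists2 c : R[i], c != 0 &
            umon zeta u a *: (xmon x a *: v) = (c%:A : uea g) *: v) /\
         (lt b a -> umon zeta u a *: (xmon x b *: v) = 0)),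
      right_basis (fun a : multi_index r' r => xmon x a *: one_z m zeta),
      Wh_equivalence m zeta (in_Wmod m zeta) (fun _ => True) /\
      sWh_equivalence m zeta (in_Wmod m zeta) (fun _ => True) &
      forall b hh n : {vspace g}, is_borel b hh n ->
        (n :&: even_part g)%VS = (m :&: even_part g)%VS ->
        [/\ (forall M, in_N m zeta n M -> in_Wmod m zeta M),
            Wh_equivalence m zeta (in_N m zeta n) (W_fdmod m zeta) &
            sWh_equivalence m zeta (in_N m zeta n) (W_fdmod m zeta)]].
Proof.
move=> m qr [e0 h0 _] sl2 _ hev Bform zch zform r'r up up1 ugr d0 xgr ub ux uxne slt wlt.
have df := situation_families e0 h0 sl2 hev Bform zch zform up up1 ugr d0 xgr ub ux uxne.
split.
- move=> M v a b _ vw; split; last exact: (umon_xmon_lt df slt wlt vw).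
  by rewrite (umonE df); apply: (umon_xmon_eq df) (svalP a); apply/is_whP.
- exact: (right_basis_xmon df).
- split; [apply: (Wh_equiv df) => //|apply: (sWh_equiv df) => //]; move=> V _; exact: tensor_Wmod df V.
move=> b hh n bn n0; have NW M : in_N m zeta n M -> in_Wmod m zeta M by apply: (in_N_Wmod df).
have HWh M : in_N m zeta n M -> W_fdmod m zeta (wh m zeta M) by apply: (in_N_fdmod df r'r Bform qr bn n0).
have HQ V : W_fdmod m zeta V -> in_N m zeta n (tensor V).
  by apply: (tensor_in_N df r'r _ _ n0); [exact: borel_lie bn|exact: borel_dec bn].
by split; [exact: NW|exact: (Wh_equiv df HWh HQ NW)|exact: (sWh_equiv df HWh HQ NW)].
Qed.
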